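(* Let the solution $u$ satisfy the decomposition assumption stated in the context with all derivative bounds holding for $0\le i+j\le 3$. Let $u^N\in V^N$ be the SDFEM solution and let $\tilde u^N=\mathcal P u^N$ be the numerical solution generated by postprocessing $u^N$ with the macrotriangle quadratic interpolation operator $\mathcal P$. Then there is a constant $C$ independent of $\varepsilon$ and $N$ such that $$\Vert u-\tilde u^{N}\Vert_{\varepsilon} \le C\,(\varepsilon^{1/2} N^{-1}+N^{-3/2})\ln^{3/2}N.$$
   Context: Problem: $\Omega=(0,1)^2$; $u$ is the solution of $-\varepsilon\Delta u+\boldsymbol{b}\cdot\nabla u+cu=f$ in $\Omega$, $u=0$ on $\partial\Omega$, where $\varepsilon>0$ is a small parameter, and $\boldsymbol b=(b_1,b_2)^T$, $c\ge0$, $f$ are sufficiently smooth functions on $\bar\Omega$ with $b_1\ge\beta_1>0$, $b_2\ge\beta_2>0$, $c-\tfrac12\nabla\cdot\boldsymbol b\ge\mu_0>0$ on $\bar\Omega$ for constants $\beta_1,\beta_2,\mu_0$. The constant $C$ (here and in the assumption below) denotes a generic constant independent of $\varepsilon$ and $N$. Decomposition assumption for $0\le i+j\le3$: $u=S+E_1+E_2+E_{12}$ on $\bar\Omega$, with sufficiently smooth functions satisfying, at all $(x,y)\in\bar\Omega$ and for $0\le i+j\le 3$: $|\partial_x^i\partial_y^jS|\le C$, $|\partial_x^i\partial_y^jE_1|\le C\varepsilon^{-i}e^{-\beta_1(1-x)/\varepsilon}$, $|\partial_x^i\partial_y^jE_2|\le C\varepsilon^{-j}e^{-\beta_2(1-y)/\varepsilon}$,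 $|\partial_x^i\partial_y^jE_{12}|\le C\varepsilon^{-(i+j)}e^{-(\beta_1(1-x)+\beta_2(1-y))/\varepsilon}$. Shishkin mesh: $N\ge4$ is an integer with $N/2$ even; standing assumptions $\varepsilon\le N^{-1}$ and $\lambda_x=\rho\varepsilon\beta_1^{-1}\ln N\le\frac12$, $\lambda_y=\rho\varepsilon\beta_2^{-1}\ln N\le\frac12$, with $\rho=2.5$. Points $0=x_0<\dots<x_N=1$ divide each of $[0,1-\lambda_x]$, $[1-\lambda_x,1]$ into $N/2$ equal intervals; points $0=y_0<\dots<y_N=1$ divide each of $[0,1-\lambda_y]$, $[1-\lambda_y,1]$ into $N/2$ equal intervals. Each rectangle $[x_i,x_{i+1}]\times[y_j,y_{j+1}]$ is split into the triangle $K^1_{i,j}$ with vertices $(x_i,y_j),(x_{i+1},y_j),(x_i,y_{j+1})$ and the triangle $K^2_{i,j}$ with vertices $(x_i,y_{j+1}),(x_{i+1},y_j),(x_{i+1},y_{j+1})$; $\mathcal T_N$ is the resulting triangulation. $\Omega_s=[0,1-\lambda_x]\times[0,1-\lambda_y]$, $\Omega_x=[1-\lambda_x,1]\times[0,1-\lambda_y]$, $\Omega_y=[0,1-\lambda_x]\times[1-\lambda_y,1]$, $\Omega_{xy}=[1-\lambda_x,1]\times[1-\lambda_y,1]$. $V^N\subset H^1_0(\Omega)$ is the space of continuous functions, linear on each triangle of $\mathcal T_N$, vanishing on $\partial\Omega$. SDFEM: $(\cdot,\cdot)_D$, $\Vert\cdot\Vert_D$ are the $L^2(D)$ inner product and norm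 ($D=\Omega$ when omitted), $|\cdot|_1$ is the $H^1(\Omega)$ seminorm. Let $\delta_K=C^*N^{-1}$ if $K\subset\Omega_s$ and $\delta_K=0$ otherwise, and $$a_{Gal}(w,v)=\varepsilon(\nabla w,\nabla v)+(\boldsymbol b\cdot\nabla w+cw,v),\qquad a_{stab}(w,v)=\sum_{K\in\mathcal T_N}(-\varepsilon\Delta w+\boldsymbol b\cdot\nabla w+cw,\ \delta_K\boldsymbol b\cdot\nabla v)_K,$$ $a_{SD}=a_{Gal}+a_{stab}$. The SDFEM solution $u^N\in V^N$ is defined by $a_{SD}(u^N,v^N)=(f,v^N)+\sum_{K}(f,\delta_K\boldsymbol b\cdot\nabla v^N)_K$ for all $v^N\in V^N$. Norms: $\Vert v\Vert_\varepsilon^2=\varepsilon|v|_1^2+\mu_0\Vert v\Vert^2$ and $\Vert v\Vert_{SD}^2=\Vert v\Vert_\varepsilon^2+\sum_{K\in\mathcal T_N}\delta_K\Vert\boldsymbol b\cdot\nabla v\Vert_K^2$. $C^*>0$ is a constant (independent of $\varepsilon,N$) chosen such that $a_{SD}(v^N,v^N)\ge\frac12\Vert v^N\Vert_{SD}^2$ for all $v^N\in V^N$. Postprocessing: the macromesh $\tilde{\mathcal T}_{N/2}$ consists of disjoint (non-overlapping) macrotriangles $M$, each the union of four triangles of $\mathcal T_N$ and each contained in exactly one of $\Omega_s,\Omega_x,\Omega_y,\Omega_{xy}$; explicitly, each macrorectangle $[x_{2k},x_{2k+2}]\times[y_{2l},y_{2l+2}]$ ($0\le k,l\le N/2-1$)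 is split by the diagonal joining $(x_{2k},y_{2l+2})$ and $(x_{2k+2},y_{2l})$ into two macrotriangles. $\mathcal P_M:C(M)\to P_2(M)$ is standard quadratic Lagrange interpolation at the three vertices and three edge midpoints of $M$ ($P_2(M)$: polynomials of degree at most 2 in two variables). The global operator $\mathcal P$ maps $C(\bar\Omega)$ to the continuous piecewise quadratic functions on $\tilde{\mathcal T}_{N/2}$ via $(\mathcal Pv)|_M=\mathcal P_M(v|_M)$ for all $M$. *)

(* Defs.v *)
From HB Require Import structures.
From mathcomp Require Import all_boot all_order all_algebra.
From mathcomp Require Import all_classical all_reals all_analysis.

Set Implicit Arguments.
Unset Strict Implicit.
Unset Printing Implicit Defensive.

Import Order.TTheory GRing.Theory Num.Theory.
Import numFieldNormedType.Exports.

Local Open Scope classical_set_scope.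
Local Open Scope ring_scope.

Definition Omega (R : realType) : set (R * R) :=
  [set p | 0 < p.1 < 1 /\ 0 < p.2 < 1].
Definition Omega_bar (R : realType) : set (R * R) :=
  [set p | 0 <= p.1 <= 1 /\ 0 <= p.2 <= 1].
Definition bOmega (R : realType) : set (R * R) :=
  @Omega_bar R `\` @Omega R.
Arguments Omega {R}.
Arguments Omega_bar {R}.
Arguments bOmega {R}.

(* [jet k v D]: v is of class C^k on the closed square, and [D i j] is the
   derivative of order i in x and j in y, extended continuously from the open
   to the closed square; this determines [D i j] there for i + j <= k. *)
Definition jet (R : realType) (k : nat) (v : R * R -> R)
    (D : nat -> nat -> R * R -> R) : Prop :=
  [/\ forall p, Omega_bar p -> D 0%N 0%N p = v p,
      forall i j, (i + j <= k)%N -> {within Omega_bar, continuous (D i j)},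
      forall i j p, (i + j < k)%N -> Omega p ->
        is_derive p.1 1 (fun t => D i j (t, p.2)) (D i.+1 j p)
    & forall i j p, (i + j < k)%N -> Omega p ->
        is_derive p.2 1 (fun t => D i j (p.1, t)) (D i j.+1 p)].

(* Pointwise partial derivatives. They are applied to continuous functions on
   the closed square that are C^2 inside each triangle of a mesh; the values on
   the (null) mesh skeleton do not affect any integral below, and the gradient
   is the weak gradient of such a function. *)
Definition dx (R : realType) (v : R * R -> R) (p : R * R) : R :=
  derive1 (fun t => v (t, p.2)) p.1.
Definition dy (R : realType) (v : R * R -> R) (p : R * R) : R :=
  derive1 (fun t => v (p.1, t)) p.2.
Definition lap (R : realType) (v : R * R -> R) (p : R * R) : R :=
  dx (dx v) p + dy (dy v) p.

Definition ip (R : realType) (D : set (R * R)) (v w : R * R -> R) : R :=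
  \int[(@lebesgue_measure R \x @lebesgue_measure R)%E]_(p in D) (v p * w p).
Definition L2norm (R : realType) (D : set (R * R)) (v : R * R -> R) : R :=
  Num.sqrt (ip D v v).
Definition H1seminorm (R : realType) (v : R * R -> R) : R :=
  Num.sqrt (L2norm Omega (dx v) ^+ 2 + L2norm Omega (dy v) ^+ 2).

Record problem (R : realType) := Problem {
  b1 : R * R -> R;
  b2 : R * R -> R;
  creac : R * R -> R;
  fsrc : R * R -> R;
  beta1 : R;
  beta2 : R;
  mu0 : R }.

Definition admissible (R : realType) (P : problem R) : Prop :=
  [/\ [/\ 0 < beta1 P, 0 < beta2 P & 0 < mu0 P],
      {within Omega_bar, continuous (creac P)} /\
        {within Omega_bar, continuous (fsrc P)},
      forall p, Omega_bar p ->
        [/\ beta1 P <= b1 P p, beta2 P <= b2 P p & 0 <= creac P p]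
    & exists D1 D2, [/\ jet 1 (b1 P) D1, jet 1 (b2 P) D2
        & forall p, Omega_bar p ->
            mu0 P <= creac P p - 2^-1 * (D1 1%N 0%N p + D2 0%N 1%N p)]].

Definition bgrad (R : realType) (P : problem R) (v : R * R -> R)
    (p : R * R) : R :=
  b1 P p * dx v p + b2 P p * dy v p.

Definition Lop (R : realType) (P : problem R) (eps : R) (v : R * R -> R)
    (p : R * R) : R :=
  - eps * lap v p + bgrad P v p + creac P p * v p.

Definition solution (R : realType) (P : problem R) (eps : R)
    (u : R * R -> R) : Prop :=
  [/\ exists D, jet 2 u D,
      forall p, Omega p -> Lop P eps u p = fsrc P p
    & forall p, bOmega p -> u p = 0].

Definition C3_bounded (R : realType) (v : R * R -> R)
    (B : nat -> nat -> R * R -> R) : Prop :=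
  exists2 D, jet 3 v D &
    forall i j p, (i + j <= 3)%N -> Omega_bar p -> `|D i j p| <= B i j p.

Definition decomposition (R : realType) (P : problem R) (C eps : R)
    (u : R * R -> R) : Prop :=
  exists S E1 E2 E12 : R * R -> R,
  [/\ forall p, Omega_bar p -> u p = S p + E1 p + E2 p + E12 p,
      C3_bounded S (fun _ _ _ => C),
      C3_bounded E1 (fun i _ p =>
        C * eps ^- i * expR (- (beta1 P * (1 - p.1) / eps))),
      C3_bounded E2 (fun _ j p =>
        C * eps ^- j * expR (- (beta2 P * (1 - p.2) / eps)))
    & C3_bounded E12 (fun i j p =>
        C * eps ^- (i + j) *
        expR (- ((beta1 P * (1 - p.1) + beta2 P * (1 - p.2)) / eps)))].

Definition rho (R : realType) : R := 5 / 2.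
Definition lamx (R : realType) (P : problem R) (eps : R) (N : nat) : R :=
  rho R * eps * (beta1 P)^-1 * ln N%:R.
Definition lamy (R : realType) (P : problem R) (eps : R) (N : nat) : R :=
  rho R * eps * (beta2 P)^-1 * ln N%:R.

Definition mesh_parameters (R : realType) (P : problem R) (eps : R) (N : nat)
    : Prop :=
  [/\ 0 < eps, eps <= N%:R^-1,
      [/\ (4 <= N)%N, ~~ odd N & ~~ odd N./2],
      lamx P eps N <= 2^-1 & lamy P eps N <= 2^-1].

Definition mesh_point (R : realType) (lam : R) (N i : nat) : R :=
  if (i <= N./2)%N then (1 - lam) * i%:R / N./2%:R
  else (1 - lam) + lam * (i - N./2)%:R / N./2%:R.
Definition xpt (R : realType) (P : problem R) (eps : R) (N i : nat) : R :=
  mesh_point (lamx P eps N) N i.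
Definition ypt (R : realType) (P : problem R) (eps : R) (N j : nat) : R :=
  mesh_point (lamy P eps N) N j.

Record triangle (R : realType) := Triangle {
  vert0 : R * R; vert1 : R * R; vert2 : R * R }.

Definition hull (R : realType) (K : triangle R) : set (R * R) :=
  [set p | exists t0 t1 t2 : R,
    [/\ [/\ 0 <= t0, 0 <= t1 & 0 <= t2], t0 + t1 + t2 = 1,
        p.1 = t0 * (vert0 K).1 + t1 * (vert1 K).1 + t2 * (vert2 K).1
      & p.2 = t0 * (vert0 K).2 + t1 * (vert1 K).2 + t2 * (vert2 K).2]].

(* The halves of [x0, x1] x [y0, y1] cut by the diagonal from (x0, y1) to
   (x1, y0): [false] is the lower left one, [true] the upper right one. *)
Definition half_rect (R : realType) (x0 x1 y0 y1 : R) (s : bool) : triangle R :=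
  if s then Triangle (x0, y1) (x1, y0) (x1, y1)
  else Triangle (x0, y0) (x1, y0) (x0, y1).

Definition elt (R : realType) (P : problem R) (eps : R) (N i j : nat)
    (s : bool) : triangle R :=
  half_rect (xpt P eps N i) (xpt P eps N i.+1)
            (ypt P eps N j) (ypt P eps N j.+1) s.

Definition macro_elt (R : realType) (P : problem R) (eps : R) (N k l : nat)
    (s : bool) : triangle R :=
  half_rect (xpt P eps N k.*2) (xpt P eps N k.*2.+2)
            (ypt P eps N l.*2) (ypt P eps N l.*2.+2) s.

Definition Omega_s (R : realType) (P : problem R) (eps : R) (N : nat)
    : set (R * R) :=
  [set p | 0 <= p.1 <= 1 - lamx P eps N /\ 0 <= p.2 <= 1 - lamy P eps N].

Definition VN (R : realType) (P : problem R) (eps : R) (N : nat)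
    : set (R * R -> R) :=
  [set v | [/\ {within Omega_bar, continuous v},
      forall (i j : 'I_N) (s : bool), exists a0 a1 a2 : R,
        forall p, hull (elt P eps N i j s) p ->
          v p = a0 + a1 * p.1 + a2 * p.2
    & forall p, bOmega p -> v p = 0]].

Definition delta (R : realType) (P : problem R) (Cs eps : R) (N : nat)
    (K : triangle R) : R :=
  if `[< hull K `<=` Omega_s P eps N >] then Cs * N%:R^-1 else 0.

Definition sum_elts (R : realType) (P : problem R) (eps : R) (N : nat)
    (F : triangle R -> R) : R :=
  \sum_(i < N) \sum_(j < N) \sum_(s : bool) F (elt P eps N i j s).

Definition aGal (R : realType) (P : problem R) (eps : R) (w v : R * R -> R)
    : R :=
  eps * (ip Omega (dx w) (dx v) + ip Omega (dy w) (dy v)) +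
  ip Omega (fun p => bgrad P w p + creac P p * w p) v.

Definition astab (R : realType) (P : problem R) (Cs eps : R) (N : nat)
    (w v : R * R -> R) : R :=
  sum_elts P eps N (fun K =>
    ip (hull K) (Lop P eps w) (fun p => delta P Cs eps N K * bgrad P v p)).

Definition aSD (R : realType) (P : problem R) (Cs eps : R) (N : nat)
    (w v : R * R -> R) : R :=
  aGal P eps w v + astab P Cs eps N w v.

Definition SDFEM_solution (R : realType) (P : problem R) (Cs eps : R) (N : nat)
    (uN : R * R -> R) : Prop :=
  VN P eps N uN /\
  forall v, VN P eps N v ->
    aSD P Cs eps N uN v =
    ip Omega (fsrc P) v +
    sum_elts P eps N (fun K =>
      ip (hull K) (fsrc P) (fun p => delta P Cs eps N K * bgrad P v p)).

Definition norm_eps (R : realType) (P : problem R) (eps : R) (v : R * R -> R)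
    : R :=
  Num.sqrt (eps * H1seminorm v ^+ 2 + mu0 P * L2norm Omega v ^+ 2).

Definition norm_SD (R : realType) (P : problem R) (Cs eps : R) (N : nat)
    (v : R * R -> R) : R :=
  Num.sqrt (norm_eps P eps v ^+ 2 +
    sum_elts P eps N (fun K =>
      delta P Cs eps N K * L2norm (hull K) (bgrad P v) ^+ 2)).

Definition coercivity_constant (R : realType) (P : problem R) (Cs : R) : Prop :=
  0 < Cs /\
  forall (eps : R) (N : nat), mesh_parameters P eps N ->
  forall v, VN P eps N v ->
    2^-1 * norm_SD P Cs eps N v ^+ 2 <= aSD P Cs eps N v v.

Definition midpoint (R : realType) (p q : R * R) : R * R :=
  ((p.1 + q.1) / 2, (p.2 + q.2) / 2).

Definition interp_nodes (R : realType) (M : triangle R) : seq (R * R) :=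
  [:: vert0 M; vert1 M; vert2 M; midpoint (vert0 M) (vert1 M);
      midpoint (vert1 M) (vert2 M); midpoint (vert2 M) (vert0 M)].

Definition P2 (R : realType) : set (R * R -> R) :=
  [set q | exists a0 a1 a2 a3 a4 a5 : R, forall p, q p =
    a0 + a1 * p.1 + a2 * p.2 +
    a3 * p.1 ^+ 2 + a4 * (p.1 * p.2) + a5 * p.2 ^+ 2].

Definition quadratic_interpolant (R : realType) (M : triangle R)
    (v q : R * R -> R) : Prop :=
  P2 q /\ forall a, a \in interp_nodes M -> q a = v a.

(* The graph of the postprocessing operator; on the closed square, w is
   determined by v because quadratic interpolation is unisolvent. *)
Definition postprocessing (R : realType) (P : problem R) (eps : R) (N : nat)
    (v w : R * R -> R) : Prop :=
  {within Omega_bar, continuous w} /\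
  forall (k l : 'I_(N./2)) (s : bool),
    exists2 q, quadratic_interpolant (macro_elt P eps N k l s) v q &
      forall p, hull (macro_elt P eps N k l s) p -> w p = q p.

(* Main.v *)
(* Let chi be the difference between the nodal interpolant I u and the SDFEM
   solution. By coercivity and Galerkin orthogonality half of the squared SD norm
   of chi is at most the residual of I u - u tested with chi, and it suffices to
   gain the full rate there. In the diffusion term the gradient of chi is constant,
   in the x direction, on the two triangles sharing a horizontal edge, so that only
   the sum of the two interpolation errors matters; it is of higher order because
   the first order terms integrate to zero over the parallelogram. The convection
   term is integrated by parts, which leaves the pointwise error u - I u. In the
   stabilization term the layers are integrated exactly, so that the factor 1 / eps
   disappears, and chi is controlled by an inverse estimate.
   Finally quadratic interpolation on the macrotriangles is stable on finite
   element functions and reproduces the nodal values of u, so the error is the sum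
   of the interpolation error of u, which is of the same order, and of chi. *)
Require Import Defs.
From mathcomp Require Import all_boot all_order all_algebra.
From mathcomp Require Import all_classical all_reals all_analysis.
From mathcomp Require Import measurable_realfun.
From mathcomp Require Import ring lra.

Set Implicit Arguments.
Unset Strict Implicit.
Unset Printing Implicit Defensive.

Import Order.TTheory GRing.Theory Num.Theory.
Import numFieldNormedType.Exports.

Local Open Scope classical_set_scope.
Local Open Scope ring_scope.

(** * Integration over triangles *)

(** The mesh is uniform only on either side of the transition lines, so the pairing of triangles
    across a common edge fails for the one row of edges on the line [Y n]. There only a first order
    bound of size [M / eps] is left, but it concerns a strip of height O(1/N) inside a layer of
    width [lam]. Cauchy-Schwarz on that strip yields eps^(1/2) (M / eps) lam^(1/2) N^(-1/2), which
    is of order N^(-3/2) ln^(3/2) N: this row determines the power of the logarithm. Components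
    without a layer in the direction of differentiation are estimated to first order only; the
    factor eps of the diffusion turns [M] into eps^(1/2) [M], whence the term eps^(1/2) / N. The
    number 5/2 in the transition points comes from the stabilization: the integrated exponentials
    have size N^(-5/2) outside of the layers, the inverse estimate costs N^2, and the parameter
    delta gives back a single factor 1/N. Estimates in y are never proved separately: all hypotheses
    are symmetric under the exchange of the variables, and so are the triangles. *)

Section PlaneIntegration.
Variable R : realType.
Notation mu := (@lebesgue_measure R).
Notation mu2 := (@lebesgue_measure R \x @lebesgue_measure R)%E.

(** The sigma-algebra on [R * R] is the product one, so open sets are not measurable by definition:
    an open set is the countable union of the boxes with rational centre and side 2/(n+1) that it
    contains. *)
Lemma open_measurable2 (U : set (R * R)) : open U -> measurable U.
Proof.
move=> oU.
pose B (a b : rat) (n : nat) : set (R * R) :=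
  [set p | `|p.1 - ratr a| < n.+1%:R^-1 /\ `|p.2 - ratr b| < n.+1%:R^-1].
have mB a b n : measurable (B a b n).
  have -> : B a b n = ball (ratr a : R) n.+1%:R^-1 `*` ball (ratr b : R) n.+1%:R^-1.
    apply/seteqP; split => -[x y]; rewrite /B /ball /= => -[].
      by move=> h1 h2; split; rewrite distrC.
    by move=> h1 h2; split; rewrite distrC.
  by apply: measurableX; apply: open_measurable; exact: ball_open.
pose C a b n : set (R * R) := if `[< B a b n `<=` U >] then B a b n else set0.
have -> : U = \bigcup_a \bigcup_b \bigcup_n C a b n.
  apply/seteqP; split => [p Up|p [a _ [b _ [n _]]]]; last first.
    by rewrite /C; case: asboolP => // h; apply: h.
  have /nbhs_ballP[e /= e0 he] : nbhs p U by rewrite nbhsE; exists U.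
  have [n hn] : exists n : nat, n.+1%:R^-1 < e / 2.
    have [n _ h] := @near_infty_natSinv_lt R (PosNum (divr_gt0 e0 (ltr0n _ 2))).
    by exists n; apply: (h n) => /=.
  have n0 : (0 : R) < n.+1%:R^-1 by rewrite invr_gt0 ltr0n.
  have rat_near (x : R) : exists a : rat, `|x - ratr a| < n.+1%:R^-1.
    move: (n.+1%:R^-1 : R) n0 => d d0.
    have hx : x - d < x + d by lra.
    have [a] := rat_in_itvoo hx.
    by rewrite in_itv /= => /andP[h1 h2]; exists a; rewrite ltr_norml; apply/andP; split; lra.
  have [a ha] := rat_near p.1; have [b hb] := rat_near p.2.
  exists a => //; exists b => //; exists n => //.
  have close (x y z : R) : `|x - z| < n.+1%:R^-1 -> `|y - z| < n.+1%:R^-1 ->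
      `|x - y| < e.
    move: (n.+1%:R^-1 : R) hn => d hd.
    by rewrite !ltr_norml => /andP[? ?] /andP[? ?]; apply/andP; split; lra.
  rewrite /C; case: asboolP => //; case => q [q1 q2]; apply: he; split => /=.
    exact: close ha q1.
  exact: close hb q2.
apply: bigcupT_measurable_rat => a; apply: bigcupT_measurable_rat => b.
apply: bigcupT_measurable => n; rewrite /C; case: asboolP => _; first exact: mB.
exact: measurable0.
Qed.

Lemma continuous_measurable2 (G : R * R -> R) :
  continuous G -> measurable_fun setT G.
Proof.
move=> cG; apply: (measurability _ (RGenOpens.measurableE R)).
move=> _ [_ [a [b ->]] <-]; rewrite setTI; apply: open_measurable2.
by apply: open_comp; [move=> x _; exact: cG|exact: interval_open].
Qed.

Lemma continuous_bounded_box (G : R * R -> R) (a b c d : R) : continuous G ->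
  exists M, forall p, a <= p.1 <= b -> c <= p.2 <= d -> `|G p| <= M.
Proof.
move=> cG.
have cK : compact (`[a, b] `*` `[c, d] : set (R * R)).
  by apply: compact_setX; exact: segment_compact.
have /compact_bounded [M [_ hM]] : compact (G @` (`[a, b] `*` `[c, d])).
  apply: continuous_compact => //; exact: continuous_subspaceT.
exists (M + 1) => p p1 p2; apply: (hM (M + 1)); first by rewrite ltrDl.
by exists p => //; split; rewrite /= in_itv.
Qed.

Import HBNNSimple.

(** No measurability of [f] is assumed: the integral is a supremum over simple functions below [f],
    and cutting such a function off on [Z] does not change its integral. This is what allows junk
    values of derivatives on the mesh skeleton. *)
Lemma ge0_integral_off_null d (T : measurableType d)
    (m : {measure set T -> \bar R}) (Z : set T) (f : T -> \bar R) :
  measurable Z -> m Z = 0%E -> (forall x, 0 <= f x)%E ->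
  (\int[m]_x f x = \int[m]_(x in ~` Z) f x)%E.
Proof.
move=> mZ mZ0 f0; rewrite ge0_integralTE// ge0_integralE//.
have mC := measurableC mZ.
apply/eqP; rewrite eq_le; apply/andP; split.
  apply: ge_ereal_sup => _ [h hf <-].
  have -> : sintegral m h = (\int[m]_(x in ~` Z) (h x)%:E)%E.
    have -> : sintegral m h = (\int[m]_(x in setT) (h x)%:E)%E.
      by rewrite integral_nnsfun// patch_setT.
    rewrite (ge0_negligible_integral mZ)// ?setTD//.
    - by apply/measurable_EFinP; exact: measurable_funP.
    - by move=> x _; rewrite lee_fin.
  rewrite integral_nnsfun//; apply: ereal_sup_ubound.
  exists (proj_nnsfun h mC) => [x|].
    rewrite -mrestrict /patch; case: ifPn => // _.
  by rewrite mrestrict.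
apply: ge_ereal_sup => _ [h hf <-]; apply: ereal_sup_ubound; exists h => // x.
by apply: le_trans (hf x) _; rewrite /patch; case: ifPn.
Qed.

Lemma Rintegral_off_null d (T : measurableType d)
    (m : {measure set T -> \bar R}) (D Z : set T) (F : T -> R) :
  measurable Z -> m Z = 0%E ->
  \int[m]_(p in D) F p = \int[m]_(p in D `\` Z) F p.
Proof.
move=> mZ mZ0; rewrite /Rintegral; congr fine.
have key (f : T -> \bar R) : (forall x, 0 <= f x)%E ->
    (\int[m]_(x in D) f x = \int[m]_(x in D `\` Z) f x)%E.
  move=> f0; rewrite integral_mkcond (ge0_integral_off_null mZ)//; last first.
    by move=> x; rewrite /patch; case: ifP.
  by rewrite [RHS]integral_mkcond setDE setIC patch_setI -integral_mkcond.
by rewrite integralE [RHS]integralE !key.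
Qed.

(** The open counterpart of [hull (half_rect x0 x1 y0 y1 s)]; the side of the diagonal is expressed
    without divisions. *)
Definition tri (x0 x1 y0 y1 : R) (s : bool) : set (R * R) :=
  [set p | [/\ x0 < p.1 < x1, y0 < p.2 < y1 &
    if s then (x1 - x0) * (y1 - y0) < (p.1 - x0) * (y1 - y0) + (p.2 - y0) * (x1 - x0)
    else (p.1 - x0) * (y1 - y0) + (p.2 - y0) * (x1 - x0) < (x1 - x0) * (y1 - y0)]].

Definition J x0 x1 y0 y1 s (G : R * R -> R) : R :=
  \int[mu2]_(p in tri x0 x1 y0 y1 s) G p.

Lemma continuous_fst' : continuous (fun p : R * R => p.1).
Proof. by move=> p; exact: cvg_fst. Qed.
Lemma continuous_snd' : continuous (fun p : R * R => p.2).
Proof. by move=> p; exact: cvg_snd. Qed.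

Lemma open_pos (g : R * R -> R) : continuous g -> open [set p | 0 < g p].
Proof. by move=> cg; apply: (@open_comp _ _ g [set x | 0 < x]) => [x _|]; [exact: cg|exact: open_gt]. Qed.

End PlaneIntegration.

Section ContinuousAlgebra.
Variables (R : realType) (T : topologicalType).
Implicit Types f g : T -> R.
Lemma continuous_add f g : continuous f -> continuous g -> continuous (fun p => f p + g p).
Proof. by move=> cf cg p; apply: cvgD; [exact: cf|exact: cg]. Qed.
Lemma continuous_mul f g : continuous f -> continuous g -> continuous (fun p => f p * g p).
Proof. by move=> cf cg p; apply: cvgM; [exact: cf|exact: cg]. Qed.
Lemma continuous_opp f : continuous f -> continuous (fun p => - f p).
Proof. by move=> cf p; apply: cvgN; exact: cf. Qed.
Lemma continuous_exp f n : continuous f -> continuous (fun p => f p ^+ n).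
Proof.
move=> cf; elim: n => [|n ih]; first by move=> p; exact: cvg_cst.
have -> : (fun p => f p ^+ n.+1) = (fun p => f p * f p ^+ n).
  by apply/funext => q; rewrite exprS.
exact: continuous_mul.
Qed.
Lemma continuous_norm f : continuous f -> continuous (fun p => `|f p|).
Proof. by move=> cf p; apply: cvg_norm; exact: cf. Qed.
Lemma continuous_const (c : R) : continuous (fun _ : T => c).
Proof. by move=> p; exact: cvg_cst. Qed.
End ContinuousAlgebra.

Lemma continuous_idfun (R : realType) : continuous (fun x : R => x).
Proof. by move=> x; exact: cvg_id. Qed.

(** Continuity by recursion on the syntax of the function. Minima and projections are written with
    absolute values below so that they fall within its reach. *)
Ltac cont := lazymatch goal with
  | |- continuous (fun _ => ?c) => exact: continuous_const
  | |- continuous (fun p => p.1) => exact: continuous_fst'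
  | |- continuous (fun p => p.2) => exact: continuous_snd'
  | |- continuous (fun p => p) => exact: continuous_idfun
  | |- continuous (fun p => @?f p + @?g p) =>
      apply: (@continuous_add _ _ f g); cont
  | |- continuous (fun p => - @?f p) => apply: (@continuous_opp _ _ f); cont
  | |- continuous (fun p => @?f p * @?g p) =>
      apply: (@continuous_mul _ _ f g); cont
  | |- continuous (fun p => @?f p ^+ ?n) => apply: (@continuous_exp _ _ f n); cont
  | |- continuous (fun p => `|@?f p|) => apply: (@continuous_norm _ _ f); cont
  | |- continuous _ => first [assumption | exact: continuous_fst'
      | exact: continuous_snd' | exact: continuous_idfun | idtac]
  | |- _ => idtac
  end.

(** * Fubini's theorem and the fundamental theorem of calculus on a triangle *)

Section PlaneIntegration2.
Variable R : realType.
Notation mu := (@lebesgue_measure R).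
Notation mu2 := (@lebesgue_measure R \x @lebesgue_measure R)%E.

Lemma continuous_comp2 (T : topologicalType) (G : R * R -> R) (a b : T -> R) :
  continuous G -> continuous a -> continuous b -> continuous (fun t => G (a t, b t)).
Proof.
move=> cG ca cb t.
have h : (fun x => (a x, b x)) @ t --> (a t, b t).
  exact: (@cvg_pair _ _ _ (nbhs t) (nbhs (a t)) (nbhs (b t)) _ _ _ _ _ (ca t) (cb t)).
exact: (cvg_comp _ _ h (cG _)).
Qed.

Lemma continuous_swap (G : R * R -> R) : continuous G -> continuous (fun p => G (p.2, p.1)).
Proof. by move=> cG; apply: continuous_comp2 => //; cont. Qed.

Lemma open_tri x0 x1 y0 y1 s : open (tri x0 x1 y0 y1 s : set (R * R)).
Proof.
have -> : tri x0 x1 y0 y1 s =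
  [set p : R * R | 0 < p.1 - x0] `&` [set p | 0 < x1 - p.1] `&`
  ([set p | 0 < p.2 - y0] `&` [set p | 0 < y1 - p.2]) `&`
  [set p | 0 < (if s then 1 else -1) *
     ((p.1 - x0) * (y1 - y0) + (p.2 - y0) * (x1 - x0) - (x1 - x0) * (y1 - y0))].
  rewrite /tri; apply/seteqP; split => p /=; rewrite !subr_gt0.
    case=> /andP[h1 h2] /andP[h3 h4] h5; do !split => //.
    by case: s h5; rewrite ?mul1r ?mulN1r ?oppr_gt0 ?subr_gt0 ?subr_lt0.
  case=> -[[h1 h2] [h3 h4]] h5; split; rewrite ?h1 ?h3 //.
  by case: s h5; rewrite ?mul1r ?mulN1r ?oppr_gt0 ?subr_gt0 ?subr_lt0.
by do 2?[apply: openI]; do ?[apply: openI]; apply: open_pos; cont.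
Qed.

Lemma measurable_tri x0 x1 y0 y1 s : measurable (tri x0 x1 y0 y1 s : set (R * R)).
Proof. by apply: open_measurable2; exact: open_tri. Qed.

Lemma integrable_box (G : R * R -> R) (D : set (R * R)) (a b c d : R) :
  continuous G -> measurable D ->
  (forall p, D p -> a <= p.1 <= b /\ c <= p.2 <= d) ->
  mu2.-integrable D (EFin \o G).
Proof.
move=> cG mD hD.
have mB : (mu2 D < +oo)%E.
  have : (mu2 (`[a, b] `*` `[c, d]) < +oo)%E.
    rewrite product_measure1E //= lte_mul_pinfty//.
      by rewrite ge0_fin_numE // lebesgue_measure_itv; case: ifP => _ //=; rewrite ltry.
    by rewrite lebesgue_measure_itv; case: ifP => _ //=; rewrite ltry.
  apply: le_lt_trans; apply: le_measure; [by rewrite inE| |].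
    by rewrite inE; apply: measurableX.
  by move=> p /hD [h1 h2]; split; rewrite /= in_itv.
apply: measurable_bounded_integrable => //.
  by apply: measurable_funTS; exact: continuous_measurable2.
have [M hM] := continuous_bounded_box a b c d cG.
exists M; split; first exact: num_real.
move=> t Mt p /hD [h1 h2]; exact: le_trans (hM p h1 h2) (ltW Mt).
Qed.

Lemma integrable_tri (G : R * R -> R) x0 x1 y0 y1 s : continuous G ->
  mu2.-integrable (tri x0 x1 y0 y1 s) (EFin \o G).
Proof.
move=> cG; apply: (@integrable_box _ _ x0 x1 y0 y1) => //; first exact: measurable_tri.
by move=> p [/andP[/ltW -> /ltW ->] /andP[/ltW -> /ltW ->] _].
Qed.

(** The exchange of the coordinates maps each half to the half with the same [s], because the
    diagonal runs from the upper left to the lower right corner. Every estimate in y is deduced from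
    the one in x through this symmetry. *)
Lemma J_swap (G : R * R -> R) x0 x1 y0 y1 s : continuous G ->
  J x0 x1 y0 y1 s G = J y0 y1 x0 x1 s (fun p => G (p.2, p.1)).
Proof.
move=> cG; rewrite /J /Rintegral; congr fine.
rewrite integral_mkcond [RHS]integral_mkcond.
rewrite -integral12_prod_meas1; last first.
  by apply/(integrable_mkcond _ _).1; [exact: measurable_tri|exact: integrable_tri].
rewrite -integral21_prod_meas1; last first.
  apply/(integrable_mkcond _ _).1; first exact: measurable_tri.
  by apply: integrable_tri; exact: continuous_swap.
apply: eq_integral => x _; rewrite /fubini_F /fubini_G; apply: eq_integral => y _.
rewrite /patch; congr (if _ then _ else _).
apply/idP/idP; rewrite !inE /tri /= => -[h1 h2 h3]; split => //.
  by case: s h3 => h3; lra.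
by case: s h3 => h3; lra.
Qed.

(** The abscissa of the diagonal at height [y]; the horizontal section of the half [s] is the
    interval between [lo] and [hi]. *)
Definition diag x0 x1 y0 y1 (y : R) : R := x1 - (x1 - x0) * ((y - y0) / (y1 - y0)).
Definition lo x0 x1 y0 y1 (s : bool) (y : R) := if s then diag x0 x1 y0 y1 y else x0.
Definition hi x0 x1 y0 y1 (s : bool) (y : R) := if s then x1 else diag x0 x1 y0 y1 y.

Lemma tri_lo_hi x0 x1 y0 y1 s (p : R * R) : x0 < x1 -> y0 < y1 ->
  tri x0 x1 y0 y1 s p <->
  y0 < p.2 < y1 /\ lo x0 x1 y0 y1 s p.2 < p.1 < hi x0 x1 y0 y1 s p.2.
Proof.
move=> hx hy; rewrite /tri /lo /hi /diag /=; set d := (p.2 - y0) / (y1 - y0).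
have hd : p.2 - y0 = d * (y1 - y0) by rewrite /d divfK //; lra.
split.
  case=> /andP[h1 h2] /andP[h3 h4] h5; split; first by rewrite h3.
  have d0 : 0 < d by apply: divr_gt0; lra.
  have d1 : d < 1 by rewrite ltr_pdivrMr; lra.
  case: s h5; rewrite hd => h5; apply/andP; split; nra.
case=> /andP[h3 h4].
have d0 : 0 < d by apply: divr_gt0; lra.
have d1 : d < 1 by rewrite ltr_pdivrMr; lra.
case: s => /andP[h1 h2]; split; rewrite ?h3 ?h4 ?hd //; try (apply/andP; split); nra.
Qed.

Lemma lo_hi_le (x0 x1 y0 y1 : R) s (y : R) : x0 < x1 -> y0 <= y <= y1 -> y0 < y1 ->
  [/\ x0 <= lo x0 x1 y0 y1 s y, lo x0 x1 y0 y1 s y <= hi x0 x1 y0 y1 s y &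
    hi x0 x1 y0 y1 s y <= x1].
Proof.
move=> hx /andP[ya yb] hy; rewrite /lo /hi /diag.
have d0 : 0 <= (y - y0) / (y1 - y0) by apply: divr_ge0; lra.
have d1 : (y - y0) / (y1 - y0) <= 1 by rewrite ler_pdivrMr; lra.
by case: s; split; nra.
Qed.

Lemma lo_hi_lt (x0 x1 y0 y1 : R) s (y : R) : x0 < x1 -> y0 < y < y1 ->
  lo x0 x1 y0 y1 s y < hi x0 x1 y0 y1 s y.
Proof.
move=> hx /andP[ya yb]; rewrite /lo /hi /diag.
have d0 : 0 < (y - y0) / (y1 - y0) by apply: divr_gt0; lra.
have d1 : (y - y0) / (y1 - y0) < 1 by rewrite ltr_pdivrMr; lra.
by case: s; nra.
Qed.

Lemma continuous_diag (x0 x1 y0 y1 : R) : continuous (diag x0 x1 y0 y1).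
Proof. by rewrite /diag; cont. Qed.

Lemma continuous_lo (x0 x1 y0 y1 : R) s : continuous (lo x0 x1 y0 y1 s).
Proof. by rewrite /lo; case: s; [exact: continuous_diag|cont]. Qed.
Lemma continuous_hi (x0 x1 y0 y1 : R) s : continuous (hi x0 x1 y0 y1 s).
Proof. by rewrite /hi; case: s; [cont|exact: continuous_diag]. Qed.

Lemma FTC (F G : R -> R) (a b : R) : a < b -> continuous F -> continuous G ->
  (forall x, a < x < b -> is_derive x 1 F (G x)) ->
  \int[mu]_(x in `[a, b]) G x = F b - F a.
Proof.
move=> ab cF cG hd; rewrite /Rintegral (@continuous_FTC2 _ G F a b ab) //.
- exact: continuous_subspaceT.
- split => [x|//|//]; last 2 first.
  + exact: cvg_at_right_filter (cF a).
  + exact: cvg_at_left_filter (cF b).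
  by rewrite in_itv /= => /hd h; apply: ex_derive.
- by move=> x; rewrite in_itv /= => /hd h; rewrite derive1E derive_val.
Qed.

Lemma integrable_segment (G : R -> R) (a b : R) : continuous G ->
  mu.-integrable `[a, b] (EFin \o G).
Proof.
move=> cG; apply: continuous_compact_integrable; first exact: segment_compact.
exact: continuous_subspaceT.
Qed.

Lemma Rintegral_itv_oo_cc (G : R -> R) (a b : R) : continuous G ->
  \int[mu]_(x in `]a, b[) G x = \int[mu]_(x in `[a, b]) G x.
Proof.
move=> cG; have iG := integrable_segment a b cG.
rewrite Rintegral_itv_bndo_bndc ?Rintegral_itv_obnd_cbnd //.
  by apply: integrableS iG => //; exact: subset_itv_oc_cc.
by apply: integrableS iG => //; exact: subset_itv_oo_cc.
Qed.

(** The divergence theorem on one triangle for a field in the x direction: Fubini, then the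
    fundamental theorem on each horizontal section. The derivative is only asked for in the open
    triangle, since the integrands used later are smooth inside the elements and merely continuous
    across their sides. *)
Lemma J_FTC_x (F G : R * R -> R) (x0 x1 y0 y1 : R) s : x0 < x1 -> y0 < y1 ->
  continuous F -> continuous G ->
  (forall p, tri x0 x1 y0 y1 s p -> is_derive p.1 1 (fun t => F (t, p.2)) (G p)) ->
  J x0 x1 y0 y1 s G =
  \int[mu]_(y in `[y0, y1])
    (F (hi x0 x1 y0 y1 s y, y) - F (lo x0 x1 y0 y1 s y, y)).
Proof.
move=> hx hy cF cG hd; rewrite -Rintegral_itv_oo_cc; last first.
  move=> y; apply: cvgB.
    by apply: (continuous_comp2 cF); [exact: continuous_hi|cont].
  by apply: (continuous_comp2 cF); [exact: continuous_lo|cont].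
rewrite /J /Rintegral; congr fine.
rewrite integral_mkcond [RHS]integral_mkcond.
rewrite -integral21_prod_meas1; last first.
  by apply/(integrable_mkcond _ _).1; [exact: measurable_tri|exact: integrable_tri].
apply: eq_integral => y _; rewrite /fubini_G /patch.
case: ifPn => [|hyn]; last first.
  apply: integral0_eq => x _; case: ifPn => //.
  by rewrite inE tri_lo_hi // => -[h _]; move: hyn; rewrite notin_setE /= in_itv.
rewrite inE /= in_itv /= => hyy.
set a := lo _ _ _ _ _ _; set b := hi _ _ _ _ _ _.
have ab : a < b by exact: lo_hi_lt.
have cGy : continuous (fun x => G (x, y)) by apply: (continuous_comp2 cG); cont.
have -> : F (b, y) - F (a, y) = \int[mu]_(x in `]a, b[) G (x, y).
  rewrite Rintegral_itv_oo_cc //; apply/esym/(@FTC (fun x => F (x, y))) => //.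
    by apply: (continuous_comp2 cF); cont.
  by move=> x xab; apply: (hd (x, y)); apply/tri_lo_hi.
have iG : mu.-integrable `]a, b[ (EFin \o (fun x => G (x, y))).
  apply: integrableS (integrable_segment a b cGy) => //; exact: subset_itv_oo_cc.
rewrite /Rintegral fineK; last exact: integrable_fin_num.
rewrite [RHS]integral_mkcond; apply: eq_integral => x _; rewrite /patch.
suff -> : ((x, y) \in tri x0 x1 y0 y1 s) = (x \in `]a, b[%classic) by [].
apply/idP/idP; rewrite !inE /= => h.
  by have /(tri_lo_hi _ _ hx hy) [_ /=] := h; rewrite in_itv.
by apply/tri_lo_hi => //; split => //; move: h; rewrite in_itv.
Qed.

End PlaneIntegration2.

(** * Algebra and exact quadrature of integrals over a triangle *)

Section TriangleIntegral.
Variable R : realType.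
Notation mu := (@lebesgue_measure R).

Section Algebra.
Variables (x0 x1 y0 y1 : R) (s : bool).
Notation J := (J x0 x1 y0 y1 s).
Implicit Types F G : R * R -> R.

Lemma J_eq F G : (forall p, tri x0 x1 y0 y1 s p -> F p = G p) -> J F = J G.
Proof. by move=> h; apply: eq_Rintegral => p; rewrite inE => /h. Qed.

Lemma J_add F G : continuous F -> continuous G ->
  J (fun p => F p + G p) = J F + J G.
Proof.
by move=> cF cG; apply: RintegralD; [exact: measurable_tri|exact: integrable_tri..].
Qed.

Lemma J_sub F G : continuous F -> continuous G ->
  J (fun p => F p - G p) = J F - J G.
Proof.
by move=> cF cG; apply: RintegralB; [exact: measurable_tri|exact: integrable_tri..].
Qed.

Lemma J_scale a F : continuous F -> J (fun p => a * F p) = a * J F.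
Proof.
by move=> cF; apply: RintegralZl; [exact: measurable_tri|exact: integrable_tri].
Qed.

Lemma J_le F G : continuous F -> continuous G ->
  (forall p, tri x0 x1 y0 y1 s p -> F p <= G p) -> J F <= J G.
Proof.
by move=> cF cG h; apply: le_Rintegral => //; [exact: measurable_tri|exact: integrable_tri..].
Qed.

Lemma J_ge0 F : (forall p, tri x0 x1 y0 y1 s p -> 0 <= F p) -> 0 <= J F.
Proof. by move=> h; apply: Rintegral_ge0. Qed.

Lemma J_abs F G : continuous F -> continuous G ->
  (forall p, tri x0 x1 y0 y1 s p -> `|F p| <= G p) -> `|J F| <= J G.
Proof.
move=> cF cG h; rewrite ler_norml; apply/andP; split.
  rewrite -mulN1r -J_scale //; apply: J_le => // [|p /h]; first by cont.
  by rewrite ler_norml => /andP[]; lra.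
by apply: J_le => // p /h; rewrite ler_norml => /andP[].
Qed.

End Algebra.

Lemma simpson (c0 c1 c2 c3 a b : R) (g : R -> R) : a < b ->
  (forall y, g y = c0 + c1 * y + c2 * y ^+ 2 + c3 * y ^+ 3) ->
  \int[mu]_(y in `[a, b]) g y = (b - a) / 6 * (g a + 4 * g ((a + b) / 2) + g b).
Proof.
move=> ab hg; pose F (y : R) := c0 * y + c1 / 2 * y ^+ 2 + c2 / 3 * y ^+ 3 + c3 / 4 * y ^+ 4.
have dF (y : R) : is_derive y 1 F (g y).
  by rewrite /F; apply: is_derive_eq; rewrite hg /GRing.scale /=; field.
have cF : continuous F by move=> y; apply: differentiable_continuous; apply/derivable1_diffP; exact: (@ex_derive _ _ _ _ _ _ _ (dF y)).
have cg : continuous g.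
  by rewrite (funext hg); cont.
have -> := FTC ab cF cg (fun y _ => dF y).
by rewrite !hg /F; field.
Qed.

(** The edge midpoint rule on a triangle, exact in degree two; [(xm, ym)] is the midpoint of the
    diagonal. Integrating an explicit primitive in x leaves a cubic in y, for which Simpson's rule
    is exact. *)
Lemma J_quadratic (x0 x1 y0 y1 : R) s (q : R * R -> R) (a0 a1 a2 a3 a4 a5 : R) :
  x0 < x1 -> y0 < y1 ->
  (forall p, q p = a0 + a1 * p.1 + a2 * p.2 + a3 * p.1 ^+ 2 + a4 * (p.1 * p.2) + a5 * p.2 ^+ 2) ->
  let xm := (x0 + x1) / 2 in let ym := (y0 + y1) / 2 in
  J x0 x1 y0 y1 s q = (x1 - x0) * (y1 - y0) / 6 *
    (q (xm, ym) + (if s then q (x1, ym) + q (xm, y1) else q (x0, ym) + q (xm, y0))).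
Proof.
move=> hx hy hq xm ym.
pose F (p : R * R) := a0 * p.1 + a1 / 2 * (p.1 * p.1) + a2 * (p.1 * p.2) +
  a3 / 3 * (p.1 * (p.1 * p.1)) + a4 / 2 * (p.1 * p.1 * p.2) + a5 * (p.1 * (p.2 * p.2)).
have cF : continuous F by rewrite /F; cont.
have cq : continuous q.
  have -> : q = (fun p => a0 + a1 * p.1 + a2 * p.2 + a3 * (p.1 * p.1) + a4 * (p.1 * p.2) + a5 * (p.2 * p.2)).
    by apply/funext => p; rewrite hq; ring.
  by cont.
have dF p : tri x0 x1 y0 y1 s p -> is_derive p.1 1 (fun t => F (t, p.2)) (q p).
  move=> _; rewrite /F /=; apply: is_derive_eq.
  by rewrite hq /GRing.scale /=; field.
rewrite (J_FTC_x hx hy cF cq dF).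
(* [al + be * y] is the abscissa of the diagonal and [k] that of the vertical leg; the sign [e]
   treats both halves at once. *)
pose be := - ((x1 - x0) / (y1 - y0)); pose al := x1 + (x1 - x0) * y0 / (y1 - y0).
have hd y : diag x0 x1 y0 y1 y = al + be * y.
  by rewrite /diag /al /be; field; lra.
pose k := if s then x1 else x0.
pose e := if s then -1 else 1 : R.
have Fd y : F (hi x0 x1 y0 y1 s y, y) - F (lo x0 x1 y0 y1 s y, y) = 
   e * (F (al + be * y, y) - F (k, y)).
  by rewrite /hi /lo hd /e /k; case: (s); ring.
under eq_Rintegral => y _ do rewrite Fd.
rewrite (@simpson 
  (e * (a0 * (al - k) + a1 / 2 * (al ^+ 2 - k ^+ 2) + a3 / 3 * (al ^+ 3 - k ^+ 3)))
  (e * (a0 * be + a1 * al * be + a2 * (al - k) + a3 * al ^+ 2 * be + a4 / 2 * (al ^+ 2 - k ^+ 2)))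
  (e * (a1 / 2 * be ^+ 2 + a2 * be + a3 * al * be ^+ 2 + a4 * al * be + a5 * (al - k)))
  (e * (a3 / 3 * be ^+ 3 + a4 / 2 * be ^+ 2 + a5 * be))) //; last first.
  by move=> y; rewrite /F /=; field.
rewrite -!hd /diag /e /k !hq /F /xm /ym /=; case: (s); field; lra.
Qed.

Lemma J_cst (x0 x1 y0 y1 : R) s c : x0 < x1 -> y0 < y1 ->
  J x0 x1 y0 y1 s (fun=> c) = (x1 - x0) * (y1 - y0) / 2 * c.
Proof.
move=> hx hy; rewrite (@J_quadratic x0 x1 y0 y1 s _ c 0 0 0 0 0) //.
  by case: s; field.
by move=> p; ring.
Qed.

Lemma J_abs_cst (x0 x1 y0 y1 : R) s F M : x0 < x1 -> y0 < y1 -> continuous F ->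
  (forall p, tri x0 x1 y0 y1 s p -> `|F p| <= M) ->
  `|J x0 x1 y0 y1 s F| <= (x1 - x0) * (y1 - y0) / 2 * M.
Proof. by move=> hx hy cF h; rewrite -(J_cst s) //; apply: J_abs => //; cont. Qed.

End TriangleIntegral.

(** * Smooth functions on the closed square *)

Section Smooth.
Variable R : realType.

(** The projection of the line onto the unit interval. *)
Definition clamp (x : R) : R := (1 + `|x| - `|x - 1|) / 2.

Lemma clamp_id x : 0 <= x <= 1 -> clamp x = x.
Proof.
by move=> /andP[x0 x1]; rewrite /clamp ger0_norm // ler0_norm; [field|lra].
Qed.

Lemma clamp_itv x : 0 <= clamp x <= 1.
Proof.
rewrite /clamp; have [a|a] := ger0P x; have [b|b] := ger0P (x - 1);
  by apply/andP; split; lra.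
Qed.

(* Composing with the projection onto the closed square makes the integrands
   continuous on the whole plane without changing them on the square. *)
Definition ext (f : R * R -> R) (p : R * R) : R := f (clamp p.1, clamp p.2).

Lemma extE f p : Omega_bar p -> ext f p = f p.
Proof. by case: p => x y [/= hx hy]; rewrite /ext /= !clamp_id. Qed.

Lemma Omega_bar_clamp (p : R * R) : Omega_bar (clamp p.1, clamp p.2).
Proof. by split; exact: clamp_itv. Qed.

Lemma continuous_ext f : {within Omega_bar, continuous f} -> continuous (ext f).
Proof.
move=> /subspace_continuousP cf p.
have h : (fun q : R * R => (clamp q.1, clamp q.2)) @ p --> within Omega_bar (nbhs (clamp p.1, clamp p.2)).
  have h1 : continuous (fun q : R * R => clamp q.1) by rewrite /clamp; cont.
  have h2 : continuous (fun q : R * R => clamp q.2) by rewrite /clamp; cont.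
  have h : (fun q : R * R => (clamp q.1, clamp q.2)) @ p --> (clamp p.1, clamp p.2).
    exact: (@cvg_pair _ _ _ (nbhs p) (nbhs (clamp p.1)) (nbhs (clamp p.2)) _ _ _ _ _ (h1 p) (h2 p)).
  move=> A /h; rewrite !nbhs_simpl /= => hA.
  by apply: filterS hA => q; apply; exact: Omega_bar_clamp.
exact: (cvg_comp _ _ h (cf _ (Omega_bar_clamp p))).
Qed.

Lemma is_derive_eps (f : R -> R) (a df : R) :
  (forall e, 0 < e -> exists2 d, 0 < d &
     forall h, `|h| < d -> `|f (a + h) - f a - h * df| <= e * `|h|) ->
  is_derive a 1 f df.
Proof.
move=> H.
have hl : h^-1 *: (f (h *: (1 : R) + a) - f a) @[h --> (0 : R)^'] --> df.
  apply/cvgrPdist_le => e e0; have [d d0 hd] := H _ e0.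
  near=> h.
  have h0 : h != 0 by near: h; exact: nbhs_dnbhs_neq.
  have hh : `|h| < d by near: h; apply: dnbhs0_lt.
  have := hd h hh; rewrite -ler_pdivrMr ?normr_gt0 //.
  apply: le_trans; rewrite -normf_div -normrN /GRing.scale /= mulr1 addrC le_eqVlt.
  apply/orP; left; apply/eqP; congr (`| _ |); rewrite [a + h]addrC; field; exact: h0.
apply: DeriveDef; first by apply/cvg_ex; exists df.
exact: cvg_lim.
Unshelve. all: by end_near. Qed.

Lemma mvt_bound (f df : R -> R) (l r a b M : R) : continuous f ->
  (forall x, l < x < r -> is_derive x 1 f (df x)) ->
  (forall x, l <= x <= r -> `|df x| <= M) ->
  l <= a <= r -> l <= b <= r -> `|f b - f a| <= M * `|b - a|.
Proof.
move=> cf hd hM; wlog ab : a b / a < b.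
  move=> wl ha hb; have [e|e|->] := ltgtP a b; first exact: wl.
    by rewrite distrC (distrC b); exact: wl.
  by rewrite !subrr normr0 mulr0.
move=> /andP[a1 a2] /andP[b1 b2].
have [x|c] := @MVT R f df a b ab _ (continuous_subspaceT cf).
  by rewrite in_itv /= => /andP[h1 h2]; apply: hd; apply/andP; split; lra.
rewrite in_itv /= => /andP[h1 h2] ->; rewrite normrM ler_wpM2r //.
by apply: hM; apply/andP; split; lra.
Qed.

(** The mean value bound is applied twice: to [df], and to [f] minus its tangent at [a]. This loses
    the factor 1/2 of the sharp remainder, but allows [b] on either side of [a]. *)
Lemma taylor1_bound (f df ddf : R -> R) (l r a b M : R) : continuous f -> continuous df ->
  (forall x, l < x < r -> is_derive x 1 f (df x)) ->
  (forall x, l < x < r -> is_derive x 1 df (ddf x)) ->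
  (forall x, l <= x <= r -> `|ddf x| <= M) ->
  l <= a <= r -> l <= b <= r ->
  `|f b - f a - (b - a) * df a| <= M * `|b - a| ^+ 2.
Proof.
move=> cf cdf hd hdd hM ha hb.
pose g x := f x - (x - a) * df a.
have cg : continuous g by rewrite /g; cont.
have := @mvt_bound g (fun x => df x - df a) (Num.min a b) (Num.max a b) a b
   (M * `|b - a|) cg.
rewrite (_ : g b - g a = f b - f a - (b - a) * df a); last by rewrite /g; ring.
rewrite -mulrA -expr2; apply.
- move=> x hx.
  have hf : is_derive x 1 f (df x).
    apply: hd; move: hx ha hb; rewrite gt_min lt_max => /andP[/orP h1 /orP h2] /andP[? ?] /andP[? ?].
    by apply/andP; case: h1 => ?; case: h2 => ?; split; lra.
  by rewrite /g; apply: is_derive_eq; rewrite /GRing.scale /=; ring.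
- move=> x hx.
  have hx' : l <= x <= r /\ `|x - a| <= `|b - a|.
    move: hx ha hb; rewrite ge_min le_max => /andP[/orP h1 /orP h2] /andP[? ?] /andP[? ?].
    split; first by apply/andP; case: h1 => ?; case: h2 => ?; split; lra.
    have [k1|k1] := ger0P (x - a); have [k2|k2] := ger0P (b - a);
       case: h1 => ?; case: h2 => ?; lra.
  apply: le_trans (mvt_bound cdf hdd hM ha hx'.1) _.
  by apply: ler_wpM2l hx'.2; apply: le_trans (hM _ ha).
- by rewrite ge_min le_max !lexx.
- by rewrite ge_min le_max !lexx !orbT.
Qed.

(** Second order accuracy of the centred difference quotient: the quadratic Taylor term at the
    midpoint takes the same value at [a] and [b] and drops out, so that the remainder of order three
    is divided by one step. *)
Lemma midpoint_bound (f df ddf d3f : R -> R) (a b M : R) :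
  continuous f -> continuous df -> continuous ddf -> a < b ->
  (forall x, a < x < b -> is_derive x 1 f (df x)) ->
  (forall x, a < x < b -> is_derive x 1 df (ddf x)) ->
  (forall x, a < x < b -> is_derive x 1 ddf (d3f x)) ->
  (forall x, a <= x <= b -> `|d3f x| <= M) ->
  `|(f b - f a) / (b - a) - df ((a + b) / 2)| <= M * (b - a) ^+ 2.
Proof.
move=> cf cdf cddf ab hd hdd h3 hM.
pose m := (a + b) / 2; pose h := (b - a) / 2.
have M0 : 0 <= M by apply: le_trans (hM a _) => //; apply/andP; split; lra.
pose g x := f x - (x - m) * df m - (x - m) ^+ 2 / 2 * ddf m.
have cg : continuous g by rewrite /g; cont.
have hm : a <= m <= b by rewrite /m; apply/andP; split; lra.
have hg : forall x, a < x < b -> is_derive x 1 g (df x - df m - (x - m) * ddf m).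
  by move=> x /hd hx; rewrite /g; apply: is_derive_eq; rewrite /GRing.scale /=; field.
have hB : forall x, a <= x <= b -> `|df x - df m - (x - m) * ddf m| <= M * h ^+ 2.
  move=> x hx; apply: le_trans (taylor1_bound cdf cddf hdd h3 hM hm hx) _.
  apply: ler_wpM2l => //; rewrite ler_sqr ?nnegrE /h //; last by lra.
  by move: hx => /andP[? ?]; rewrite ler_norml /m; apply/andP; split; lra.
have ha : a <= a <= b by rewrite lexx ltW.
have hb : a <= b <= b by rewrite lexx ltW.
have := mvt_bound cg hg hB hm hb.
have := mvt_bound cg hg hB hm ha.
have -> : `|a - m| = h by rewrite ler0_norm /m /h; [field|lra].
have -> : `|b - m| = h by rewrite ger0_norm /m /h; [field|lra].
move=> e1 e2.
have e3 : `|g b - g a| <= 2 * (M * h ^+ 2 * h).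
  have -> : g b - g a = (g b - g m) - (g a - g m) by ring.
  by apply: le_trans (ler_normB _ _) _; lra.
have -> : (f b - f a) / (b - a) - df m = (g b - g a) / (b - a).
  by rewrite /g /m; field; lra.
rewrite normf_div (gtr0_norm (_ : 0 < b - a)) ?subr_gt0 // ler_pdivrMr ?subr_gt0 //.
apply: le_trans e3 _; rewrite /h.
have : 0 <= M * (b - a) ^+ 2 * (b - a) by apply: mulr_ge0; [apply: mulr_ge0 => //; exact: sqr_ge0|lra].
lra.
Qed.

End Smooth.

(** * Derivatives up to the boundary of the square *)

Section Jets.
Variable R : realType.
Implicit Types (f g : R * R -> R) (D : nat -> nat -> R * R -> R).

(** [jet] gives derivatives in the open square only, but difference quotients along the sides y = 0
    and y = 1 are needed too. At heights [v] inside (0, 1) the mean value theorem gives a bound that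
    is uniform in [v], and it passes to the limit. *)
Lemma is_derive_boundary f g : continuous f -> continuous g ->
  (forall x y : R, 0 < x < 1 -> 0 < y < 1 -> is_derive x 1 (fun t => f (t, y)) (g (x, y))) ->
  forall x y : R, 0 < x < 1 -> 0 <= y <= 1 -> is_derive x 1 (fun t => f (t, y)) (g (x, y)).
Proof.
move=> cf cg H x y /andP[hx0 hx1] /andP[hy0 hy1].
apply: is_derive_eps => e e0.
have /cvgrPdist_le /(_ e e0) /nbhs_ballP [d /= d0 hd] := cg (x, y).
have {}hd u v : `|u - x| < d -> `|v - y| < d -> `|g (u, v) - g (x, y)| <= e.
  move=> hu hv; rewrite distrC; apply: (hd (u, v)); split; rewrite /ball /= distrC //.
pose r := Num.min d (Num.min x (1 - x)).
have r0 : 0 < r by rewrite !lt_min d0 hx0 subr_gt0 hx1.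
have [rd [rx r1]] : r <= d /\ r <= x /\ r <= 1 - x.
  by rewrite /r !ge_min !lexx ?orbT.
exists r => // h hr.
pose p v := `|f (x + h, v) - f (x, v) - h * g (x, y)|.
have cp : continuous p.
  rewrite /p; cont; apply: (continuous_comp2 cf); cont.
(* A strict violation of the bound at height [y] would persist at all nearby heights. *)
rewrite leNgt; apply/negP => hp.
have [d' d'0 hd'] : exists2 d', 0 < d' & forall v, `|v - y| < d' -> e * `|h| < p v.
  have : nbhs y [set v | 0 < p v - e * `|h|].
    have oP : open [set v | 0 < p v - e * `|h|].
      apply: (@open_comp _ _ (fun v => p v - e * `|h|) [set u | 0 < u]) => [z _|].
        by have : continuous (fun v => p v - e * `|h|) by cont.
      exact: open_gt.
    by rewrite nbhsE; exists [set v | 0 < p v - e * `|h|] => //; split => //=; rewrite subr_gt0.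
  move=> /nbhs_ballP [d' /= d'0 k]; exists d' => // v hv.
  have := k v; rewrite /ball /= subr_gt0; apply; by rewrite distrC.
pose t := Num.min (Num.min d d') 1 : R.
have t0 : 0 < t by rewrite !lt_min d0 d'0 ltr01.
have [td [td' t1]] : t <= d /\ t <= d' /\ t <= 1.
  by rewrite /t !ge_min !lexx ?orbT.
(* Moving [y] slightly towards 1/2 gives a height strictly between 0 and 1, also when [y] is 0 or
   1. *)
pose v := y + t * (1 / 2 - y).
have hv : 0 < v < 1 by rewrite /v; apply/andP; split; nra.
have hvy : `|v - y| < t.
  by rewrite /v ltr_norml; apply/andP; split; nra.
have := hd' v (lt_le_trans hvy td').
apply/negP; rewrite -leNgt /p.
pose q u := f (u, v) - (u - x) * g (x, y).
have cq : continuous q by rewrite /q; cont; apply: (continuous_comp2 cf); cont.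
have hr' : - r < h < r by rewrite -ltr_norml.
move: hr' => /andP[hr1 hr2].
have := @mvt_bound _ q (fun u => g (u, v) - g (x, y)) (x - `|h|) (x + `|h|) x (x + h) e cq.
have -> : q (x + h) - q x = f (x + h, v) - f (x, v) - h * g (x, y) by rewrite /q; ring.
have -> : x + h - x = h by ring.
apply.
- move=> u /andP[u1 u2].
  have hu : is_derive u 1 (fun t => f (t, v)) (g (u, v)).
    by apply: H => //; apply/andP; split; move: hr rx r1 u1 u2; lra.
  by rewrite /q; apply: is_derive_eq; rewrite /GRing.scale /=; ring.
- move=> u /andP[u1 u2]; apply: hd; last exact: lt_le_trans hvy td.
  by apply: (@le_lt_trans _ _ `|h|); [rewrite ler_norml; apply/andP; split; lra|lra].
- by apply/andP; split; have := normr_ge0 h; lra.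
- by have := ler_norm h; have := ler_norm (- h); rewrite normrN => *; apply/andP; split; lra.
Qed.

(** What [jet] becomes after extension by [ext]: continuity on the whole plane, and derivatives in x
    at every height, also on and beyond the horizontal sides, where the extension is constant in
    y. *)
Definition sm (k : nat) D : Prop :=
  [/\ forall i j, (i + j <= k)%N -> continuous (D i j),
      forall i j (p : R * R), (i + j < k)%N -> 0 < p.1 < 1 ->
        is_derive p.1 1 (fun t => D i j (t, p.2)) (D i.+1 j p)
    & forall i j (p : R * R), (i + j < k)%N -> 0 < p.2 < 1 ->
        is_derive p.2 1 (fun t => D i j (p.1, t)) (D i j.+1 p)].

Lemma ext_is_derive f g : {within Omega_bar, continuous f} -> {within Omega_bar, continuous g} ->
  (forall p, Omega p -> is_derive p.1 1 (fun t => f (t, p.2)) (g p)) ->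
  forall p : R * R, 0 < p.1 < 1 -> is_derive p.1 1 (fun t => ext f (t, p.2)) (ext g p).
Proof.
move=> cf cg H [x y] /= hx.
have -> : (fun t => ext f (t, y)) = (fun t => ext f (t, clamp y)).
  by apply/funext => t; rewrite /ext /= (clamp_id (clamp_itv y)).
have -> : ext g (x, y) = ext g (x, clamp y) by rewrite /ext /= (clamp_id (clamp_itv y)).
apply: (is_derive_boundary (continuous_ext cf) (continuous_ext cg)) => //; last exact: clamp_itv.
move=> {hx y} x {}y hx hy.
have h := H (x, y) (conj hx hy).
rewrite extE; last first.
  by case/andP: hx => *; case/andP: hy => *; split; rewrite /= !ltW.
apply: near_eq_is_derive h => /=.
have hn : \forall t \near x, t \in `](0 : R), 1[ by apply: near_in_itvoo; rewrite in_itv.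
apply: filterS hn => t; rewrite in_itv /= => /andP[h1 h2]; rewrite extE //.
by case/andP: hy => *; split; rewrite /= !ltW.
Qed.

Lemma within_swap f : {within Omega_bar, continuous f} ->
  {within Omega_bar, continuous (fun p => f (p.2, p.1))}.
Proof.
move=> cf; have c := continuous_swap (continuous_ext cf).
have /subspace_continuousP h : {within Omega_bar, continuous (fun p => ext f (p.2, p.1))}.
  exact: continuous_subspaceT.
apply/subspace_continuousP => -[x y] hp.
have sw (q : R * R) : Omega_bar q -> Omega_bar (q.2, q.1) by case.
have e : ext f (y, x) = f (y, x) by rewrite extE //; exact: (sw (x, y)).
have hxy : (fun p => ext f (p.2, p.1)) q @[q --> within Omega_bar (nbhs (x, y))] --> f (y, x).
  by rewrite -e; exact: h.
apply: cvg_trans hxy; apply: near_eq_cvg.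
by rewrite /prop_near1 /within /=; apply: nearW => q /sw hq; rewrite extE.
Qed.

Lemma jet_sm k v D : jet k v D -> sm k (fun i j => ext (D i j)).
Proof.
case=> _ cD dx dy; split.
- by move=> i j h; apply: continuous_ext; exact: cD.
- move=> i j p h hp; apply: ext_is_derive => //.
  + by apply: cD; exact: ltnW.
  + exact: cD.
  + by move=> q hq; exact: dx.
- move=> i j p h hp.
  have := @ext_is_derive (fun q => D i j (q.2, q.1)) (fun q => D i j.+1 (q.2, q.1)) _ _ _ (p.2, p.1) hp.
  rewrite /ext /=; apply.
  + by apply: within_swap; apply: cD; exact: ltnW.
  + by apply: within_swap; apply: cD; rewrite addnS.
  + by move=> [x y] [/= h1 h2]; have := dy i j (y, x) h (conj h2 h1).
Qed.

Lemma sm_swap k D : sm k D -> sm k (fun i j p => D j i (p.2, p.1)).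
Proof.
case=> cD dx dy; split.
- by move=> i j h; apply: continuous_swap; apply: cD; rewrite addnC.
- by move=> i j [x y] h hp; have := dy j i (y, x); rewrite addnC; apply.
- by move=> i j [x y] h hp; have := dx j i (y, x); rewrite addnC; apply.
Qed.

Lemma sm_add k D D' : sm k D -> sm k D' -> sm k (fun i j p => D i j p + D' i j p).
Proof.
case=> cD dx dy [cD' dx' dy']; split.
- by move=> i j h; have := cD i j h; have := cD' i j h => h1 h2 /=; cont.
- move=> i j p h hp; have h1 := dx i j p h hp; have h2 := dx' i j p h hp.
  by apply: is_derive_eq.
- move=> i j p h hp; have h1 := dy i j p h hp; have h2 := dy' i j p h hp.
  by apply: is_derive_eq.
Qed.

End Jets.

(** * Local interpolation errors *)

Section ElementEstimates.
Variable R : realType.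
Notation mu := (@lebesgue_measure R).
Implicit Types (f : R * R -> R) (D : nat -> nat -> R * R -> R).

Definition bounded_on (x0 x1 y0 y1 : R) f (M : R) : Prop :=
  forall p, x0 <= p.1 <= x1 -> y0 <= p.2 <= y1 -> `|f p| <= M.

Lemma bounded_on_sub x0 x1 y0 y1 x0' x1' y0' y1' f M :
  x0 <= x0' -> x1' <= x1 -> y0 <= y0' -> y1' <= y1 ->
  bounded_on x0 x1 y0 y1 f M -> bounded_on x0' x1' y0' y1' f M.
Proof.
move=> h1 h2 h3 h4 h p /andP[a b] /andP[c d]; apply: h.
  by rewrite (le_trans h1 a) (le_trans b h2).
by rewrite (le_trans h3 c) (le_trans d h4).
Qed.

Lemma bounded_on_swap x0 x1 y0 y1 f M : bounded_on x0 x1 y0 y1 f M ->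
  bounded_on y0 y1 x0 x1 (fun p => f (p.2, p.1)) M.
Proof. by move=> h p hx hy; apply: h. Qed.

Lemma bounded_on_ge0 x0 x1 y0 y1 f M : x0 <= x1 -> y0 <= y1 ->
  bounded_on x0 x1 y0 y1 f M -> 0 <= M.
Proof.
move=> hx hy h; apply: le_trans (normr_ge0 (f (x0, y0))) _.
by apply: h => /=; rewrite lexx.
Qed.

Lemma sm_continuous k D i j : sm k D -> (i + j <= k)%N -> continuous (D i j).
Proof. by case=> h _ _; exact: h. Qed.

Section Cell.
Variables (k : nat) (D : nat -> nat -> R * R -> R) (x0 x1 y0 y1 : R).
Hypotheses (hD : sm k D) (hx : x0 < x1) (hy : y0 < y1).
Hypotheses (hx0 : 0 <= x0) (hx1 : x1 <= 1) (hy0 : 0 <= y0) (hy1 : y1 <= 1).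
Notation bd := (bounded_on x0 x1 y0 y1).

Lemma sm_continuous_x i j y : (i + j <= k)%N -> continuous (fun x => D i j (x, y)).
Proof. by move=> h; apply: (continuous_comp2 (sm_continuous hD h)); cont. Qed.
Lemma sm_continuous_y i j x : (i + j <= k)%N -> continuous (fun y => D i j (x, y)).
Proof. by move=> h; apply: (continuous_comp2 (sm_continuous hD h)); cont. Qed.

Lemma sm_dx i j (x y : R) : (i + j < k)%N -> x0 < x < x1 ->
  is_derive x 1 (fun t => D i j (t, y)) (D i.+1 j (x, y)).
Proof.
case: hD => _ h _ ij /andP[a b]; apply: (h i j (x, y)) => //=.
by move: (hx0) (hx1) => *; apply/andP; split; lra.
Qed.
Lemma sm_dy i j (x y : R) : (i + j < k)%N -> y0 < y < y1 ->
  is_derive y 1 (fun t => D i j (x, t)) (D i j.+1 (x, y)).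
Proof.
case: hD => _ _ h ij /andP[a b]; apply: (h i j (x, y)) => //=.
by move: (hy0) (hy1) => *; apply/andP; split; lra.
Qed.

Lemma lip_x i j (a b y M : R) : (i + j < k)%N -> bd (D i.+1 j) M ->
  x0 <= a <= x1 -> x0 <= b <= x1 -> y0 <= y <= y1 ->
  `|D i j (b, y) - D i j (a, y)| <= M * `|b - a|.
Proof.
move=> ij hM ha hb h.
apply: (@mvt_bound _ (fun x => D i j (x, y)) (fun x => D i.+1 j (x, y)) x0 x1) => //.
- by apply: sm_continuous_x; exact: ltnW.
- by move=> x; exact: sm_dx.
- by move=> x hxx; exact: hM.
Qed.

Lemma lip_y i j (a b x M : R) : (i + j < k)%N -> bd (D i j.+1) M ->
  y0 <= a <= y1 -> y0 <= b <= y1 -> x0 <= x <= x1 ->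
  `|D i j (x, b) - D i j (x, a)| <= M * `|b - a|.
Proof.
move=> ij hM ha hb h.
apply: (@mvt_bound _ (fun y => D i j (x, y)) (fun y => D i j.+1 (x, y)) y0 y1) => //.
- by apply: sm_continuous_y; exact: ltnW.
- by move=> y; exact: sm_dy.
- by move=> y hyy; exact: hM.
Qed.

Lemma abs_sub_le (a b c d : R) : a <= c <= b -> a <= d <= b -> `|d - c| <= b - a.
Proof. by move=> /andP[? ?] /andP[? ?]; rewrite ler_norml; apply/andP; split; lra. Qed.

Lemma lip_xy i j (p q : R * R) (Mx My : R) : (i + j < k)%N ->
  bd (D i.+1 j) Mx -> bd (D i j.+1) My ->
  x0 <= p.1 <= x1 -> y0 <= p.2 <= y1 -> x0 <= q.1 <= x1 -> y0 <= q.2 <= y1 ->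
  `|D i j q - D i j p| <= (x1 - x0) * Mx + (y1 - y0) * My.
Proof.
case: p q => [a b] [c d] ij hMx hMy /= ha hb hc hd.
have e1 := lip_x ij hMx ha hc hd; have e2 := lip_y ij hMy hb hd ha.
have Mx0 := bounded_on_ge0 (ltW hx) (ltW hy) hMx.
have My0 := bounded_on_ge0 (ltW hx) (ltW hy) hMy.
have -> : D i j (c, d) - D i j (a, b) =
  (D i j (c, d) - D i j (a, d)) + (D i j (a, d) - D i j (a, b)) by ring.
apply: le_trans (ler_normD _ _) _; apply: lerD.
  by apply: le_trans e1 _; rewrite mulrC ler_wpM2r //; exact: abs_sub_le.
by apply: le_trans e2 _; rewrite mulrC ler_wpM2r //; exact: abs_sub_le.
Qed.

Lemma taylor_x i j (a b y M : R) : ((i + j).+1 < k)%N -> bd (D i.+2 j) M ->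
  x0 <= a <= x1 -> x0 <= b <= x1 -> y0 <= y <= y1 ->
  `|D i j (b, y) - D i j (a, y) - (b - a) * D i.+1 j (a, y)| <= M * `|b - a| ^+ 2.
Proof.
move=> ij hM ha hb h.
apply: (@taylor1_bound _ (fun x => D i j (x, y)) (fun x => D i.+1 j (x, y)) (fun x => D i.+2 j (x, y)) x0 x1) => //.
- by apply: sm_continuous_x; rewrite ltnW // ltnW.
- by apply: sm_continuous_x; rewrite ltnW.
- by move=> x; apply: sm_dx; rewrite ltnW.
- by move=> x; apply: sm_dx.
- by move=> x hxx; exact: hM.
Qed.

Lemma taylor_y i j (a b x M : R) : ((i + j).+1 < k)%N -> bd (D i j.+2) M ->
  y0 <= a <= y1 -> y0 <= b <= y1 -> x0 <= x <= x1 ->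
  `|D i j (x, b) - D i j (x, a) - (b - a) * D i j.+1 (x, a)| <= M * `|b - a| ^+ 2.
Proof.
move=> ij hM ha hb h.
apply: (@taylor1_bound _ (fun y => D i j (x, y)) (fun y => D i j.+1 (x, y)) (fun y => D i j.+2 (x, y)) y0 y1) => //.
- by apply: sm_continuous_y; rewrite ltnW // ltnW.
- by apply: sm_continuous_y; rewrite addnS ltnW.
- by move=> y; apply: sm_dy; rewrite ltnW.
- by move=> y; apply: sm_dy; rewrite addnS.
- by move=> y hyy; exact: hM.
Qed.

Lemma taylor_xy i j (p q : R * R) (Mxx Mxy Myy : R) : ((i + j).+1 < k)%N ->
  bd (D i.+2 j) Mxx -> bd (D i.+1 j.+1) Mxy -> bd (D i j.+2) Myy ->
  x0 <= p.1 <= x1 -> y0 <= p.2 <= y1 -> x0 <= q.1 <= x1 -> y0 <= q.2 <= y1 ->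
  `|D i j q - D i j p - (q.1 - p.1) * D i.+1 j p - (q.2 - p.2) * D i j.+1 p| <=
  (x1 - x0) ^+ 2 * Mxx + (x1 - x0) * (y1 - y0) * Mxy + (y1 - y0) ^+ 2 * Myy.
Proof.
case: p q => [a b] [c d] ij hMxx hMxy hMyy /= ha hb hc hd.
have Mxx0 := bounded_on_ge0 (ltW hx) (ltW hy) hMxx.
have Mxy0 := bounded_on_ge0 (ltW hx) (ltW hy) hMxy.
have Myy0 := bounded_on_ge0 (ltW hx) (ltW hy) hMyy.
have e1 := taylor_x ij hMxx ha hc hd.
have e2 := taylor_y ij hMyy hb hd ha.
have e3 : `|D i.+1 j (a, d) - D i.+1 j (a, b)| <= Mxy * `|d - b|.
  by apply: lip_y.
have -> : D i j (c, d) - D i j (a, b) - (c - a) * D i.+1 j (a, b) - (d - b) * D i j.+1 (a, b) =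
  (D i j (c, d) - D i j (a, d) - (c - a) * D i.+1 j (a, d)) +
  (c - a) * (D i.+1 j (a, d) - D i.+1 j (a, b)) +
  (D i j (a, d) - D i j (a, b) - (d - b) * D i j.+1 (a, b)) by ring.
move: (hx) (hy) => hx' hy'; have k1 := abs_sub_le ha hc; have k2 := abs_sub_le hb hd.
apply: le_trans (ler_normD _ _) _; apply: lerD.
  apply: le_trans (ler_normD _ _) _; apply: lerD.
    apply: le_trans e1 _; rewrite mulrC ler_wpM2r // ler_sqr ?nnegrE //; lra.
  rewrite normrM -mulrA; apply: ler_pM => //.
  by apply: le_trans e3 _; rewrite mulrC ler_wpM2r.
apply: le_trans e2 _; rewrite mulrC ler_wpM2r // ler_sqr ?nnegrE //; lra.
Qed.

Definition slope_x f (y : R) := (f (x1, y) - f (x0, y)) / (x1 - x0).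
Definition slope_y f (x : R) := (f (x, y1) - f (x, y0)) / (y1 - y0).

Lemma slope_x_err i j (p : R * R) y Mx My : ((i + j).+1 < k)%N ->
  bd (D i.+2 j) Mx -> bd (D i.+1 j.+1) My ->
  x0 <= p.1 <= x1 -> y0 <= p.2 <= y1 -> y0 <= y <= y1 ->
  `|slope_x (D i j) y - D i.+1 j p| <= (x1 - x0) * Mx + (y1 - y0) * My.
Proof.
move=> ij hMx hMy hp1 hp2 hyy; rewrite /slope_x.
pose c := D i.+1 j p.
have -> : (D i j (x1, y) - D i j (x0, y)) / (x1 - x0) - c =
  (D i j (x1, y) - x1 * c - (D i j (x0, y) - x0 * c)) / (x1 - x0).
  by move: (hx) => hx'; field; lra.
rewrite normf_div (gtr0_norm (_ : 0 < x1 - x0)) ?subr_gt0 // ler_pdivrMr ?subr_gt0 //.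
have hx01 : x0 <= x0 <= x1 by rewrite lexx ltW.
have hx11 : x0 <= x1 <= x1 by rewrite lexx ltW.
have hn : `|x1 - x0| = x1 - x0 by rewrite gtr0_norm ?subr_gt0.
have : forall u v : R, u <= v * `|x1 - x0| -> u <= v * (x1 - x0) by rewrite hn.
apply.
apply: (@mvt_bound _ (fun x => D i j (x, y) - x * c) (fun x => D i.+1 j (x, y) - c) x0 x1) => //.
- have cc : continuous (fun x => D i j (x, y)) by apply: sm_continuous_x; rewrite ltnW // ltnW.
  by cont.
- move=> x hxx; have h := @sm_dx i j x y (ltnW ij) hxx.
  by apply: is_derive_eq; rewrite /GRing.scale /=; ring.
- by move=> x hxx; apply: (@lip_xy i.+1 j p (x, y)).
Qed.

Lemma slope_x_le i j y M : (i + j < k)%N -> bd (D i.+1 j) M -> y0 <= y <= y1 ->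
  `|slope_x (D i j) y| <= M.
Proof.
move=> ij hM hyy; rewrite /slope_x normf_div (gtr0_norm (_ : 0 < x1 - x0)) ?subr_gt0 //.
have hn : `|x1 - x0| = x1 - x0 by rewrite gtr0_norm ?subr_gt0.
rewrite ler_pdivrMr ?subr_gt0 // -[in leRHS]hn.
by apply: lip_x => //; rewrite lexx ltW.
Qed.

Lemma slope_x_mid i j y M : ((i + j).+2 < k)%N -> bd (D i.+3 j) M -> y0 <= y <= y1 ->
  `|slope_x (D i j) y - D i.+1 j ((x0 + x1) / 2, y)| <= M * (x1 - x0) ^+ 2.
Proof.
move=> ij hM hyy.
apply: (@midpoint_bound _ (fun x => D i j (x, y)) (fun x => D i.+1 j (x, y))
  (fun x => D i.+2 j (x, y)) (fun x => D i.+3 j (x, y))) => //.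
- by apply: sm_continuous_x; do 3?rewrite ltnW //.
- by apply: sm_continuous_x; do 2?rewrite ltnW //.
- by apply: sm_continuous_x; rewrite ltnW //.
- by move=> x; apply: sm_dx; do 2?rewrite ltnW //.
- by move=> x; apply: sm_dx; rewrite ltnW //.
- by move=> x; apply: sm_dx.
- by move=> x hxx; apply: hM.
Qed.

End Cell.
End ElementEstimates.

(** * Gradient and value errors of the linear interpolant on one element *)

Section ElementErrors.
Variable R : realType.
Notation mu := (@lebesgue_measure R).
Implicit Types (f : R * R -> R) (D : nat -> nat -> R * R -> R).

Definition cell (x0 x1 y0 y1 : R) : Prop :=
  [/\ x0 < x1, y0 < y1, 0 <= x0 /\ x1 <= 1 & 0 <= y0 /\ y1 <= 1].

Lemma Rintegral_segment_bound (g : R -> R) (a b M : R) : a <= b -> continuous g ->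
  (forall x, a <= x <= b -> `|g x| <= M) ->
  `|\int[mu]_(x in `[a, b]) g x| <= M * (b - a).
Proof.
move=> ab cg hM.
have ic : mu.-integrable `[a, b] (EFin \o (fun=> M)).
  by apply: integrable_segment => x; exact: cvg_cst.
have ic' : mu.-integrable `[a, b] (EFin \o (fun x => `|g x|)).
  by apply: integrable_segment; cont.
apply: le_trans (le_normr_Rintegral _ (integrable_segment a b cg)) _ => //.
apply: (@le_trans _ _ (\int[mu]_(x in `[a, b]) M)).
  by apply: le_Rintegral => // x /=; rewrite in_itv /=; exact: hM.
rewrite Rintegral_cst //= lebesgue_measure_itv /= lte_fin.
by case: ltP => h; rewrite /= -?EFinB //=; have -> : b - a = 0 by lra.
Qed.

(** Used in both coordinates, it gives the right-angled corner of the half [s]. The x derivative of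
    the linear interpolant is the slope along the horizontal leg, hence at this height. *)
Definition edge (y0 y1 : R) (s : bool) : R := if s then y1 else y0.

Lemma edge_itv (y0 y1 : R) s : y0 <= y1 -> y0 <= edge y0 y1 s <= y1.
Proof. by move=> h; rewrite /edge; case: s; rewrite ?lexx ?h. Qed.

(** The integral over the triangle of the x derivative of the linear interpolation error. The
    diffusion term sees nothing else, since the gradient of a finite element function is constant on
    the triangle. *)
Definition Xerr (x0 x1 y0 y1 : R) s D : R :=
  J x0 x1 y0 y1 s (D 1%N 0%N) -
  (x1 - x0) * (y1 - y0) / 2 * slope_x x0 x1 (D 0%N 0%N) (edge y0 y1 s).

Lemma tri_box (x0 x1 y0 y1 : R) s p : tri x0 x1 y0 y1 s p ->
  x0 <= p.1 <= x1 /\ y0 <= p.2 <= y1.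
Proof. by case=> /andP[/ltW -> /ltW ->] /andP[/ltW -> /ltW ->] _. Qed.

Lemma XerrE (x0 x1 y0 y1 : R) s D : cell x0 x1 y0 y1 -> sm 3 D ->
  Xerr x0 x1 y0 y1 s D =
  J x0 x1 y0 y1 s (fun p => D 1%N 0%N p - slope_x x0 x1 (D 0%N 0%N) (edge y0 y1 s)).
Proof.
case=> hx hy _ _ hD; rewrite J_sub; [|exact: (sm_continuous hD)|by cont].
by rewrite J_cst.
Qed.

Lemma Xerr_le0 (x0 x1 y0 y1 : R) s D M : cell x0 x1 y0 y1 -> sm 3 D ->
  bounded_on x0 x1 y0 y1 (D 1%N 0%N) M ->
  `|Xerr x0 x1 y0 y1 s D| <= (x1 - x0) * (y1 - y0) / 2 * (2 * M).
Proof.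
move=> hc hD hM; rewrite XerrE //; case: hc => hx hy [hx0 hx1] [hy0 hy1].
have cD := sm_continuous hD (isT : (1 + 0 <= 3)%N).
apply: J_abs_cst => //; first by cont.
move=> p /tri_box [hp1 hp2]; apply: le_trans (ler_normB _ _) _.
have := slope_x_le hD hx hx0 hx1 (isT : (0 + 0 < 3)%N) hM (edge_itv s (ltW hy)).
by have := hM p hp1 hp2; lra.
Qed.

Lemma Xerr_le1 (x0 x1 y0 y1 : R) s D Mx My : cell x0 x1 y0 y1 -> sm 3 D ->
  bounded_on x0 x1 y0 y1 (D 2 0%N) Mx -> bounded_on x0 x1 y0 y1 (D 1%N 1%N) My ->
  `|Xerr x0 x1 y0 y1 s D| <=
  (x1 - x0) * (y1 - y0) / 2 * ((x1 - x0) * Mx + (y1 - y0) * My).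
Proof.
move=> hc hD hMx hMy; rewrite XerrE //; case: hc => hx hy [hx0 hx1] [hy0 hy1].
have cD := sm_continuous hD (isT : (1 + 0 <= 3)%N).
apply: J_abs_cst => //; first by cont.
move=> p /tri_box [hp1 hp2]; rewrite distrC.
apply: (slope_x_err hD hx hy hx0 hx1 hy0 hy1) => //.
exact: edge_itv (ltW hy).
Qed.

(* Fubini turns the integral of a derivative into boundary values, so no
   derivative of the function enters. *)
Lemma Xerr_le2 (x0 x1 y0 y1 : R) s D M : cell x0 x1 y0 y1 -> sm 3 D ->
  bounded_on x0 x1 y0 y1 (D 0%N 0%N) M ->
  `|Xerr x0 x1 y0 y1 s D| <= (x1 - x0) * (y1 - y0) / 2 * (6 * M / (x1 - x0)).
Proof.
move=> [hx hy [hx0 hx1] [hy0 hy1]] hD hM.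
have c0 := sm_continuous hD (isT : (0 + 0 <= 3)%N).
have c1 := sm_continuous hD (isT : (1 + 0 <= 3)%N).
have hd p : tri x0 x1 y0 y1 s p ->
    is_derive p.1 1 (fun t => D 0%N 0%N (t, p.2)) (D 1%N 0%N p).
  by case: p => u v [/= h _ _]; apply: (sm_dx hD hx0 hx1).
have e1 : `|J x0 x1 y0 y1 s (D 1%N 0%N)| <= 2 * M * (y1 - y0).
  rewrite (J_FTC_x hx hy c0 c1 hd); apply: Rintegral_segment_bound.
  - exact: ltW.
  - have cl := continuous_lo (x0:=x0) (x1:=x1) (y0:=y0) (y1:=y1) (s:=s).
    have ch := continuous_hi (x0:=x0) (x1:=x1) (y0:=y0) (y1:=y1) (s:=s).
    have k1 := continuous_comp2 c0 ch (@continuous_idfun R).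
    have k2 := continuous_comp2 c0 cl (@continuous_idfun R).
    by cont.
  - move=> y hyy; have [h1 h2 h3] := lo_hi_le s hx hyy hy.
    apply: le_trans (ler_normB _ _) _; rewrite mulr_natl mulr2n; apply: lerD; apply: hM => //=.
      by rewrite h3 (le_trans h1 h2).
    by rewrite h1 (le_trans h2 h3).
have e2 : `|slope_x x0 x1 (D 0%N 0%N) (edge y0 y1 s)| <= 2 * M / (x1 - x0).
  rewrite /slope_x normf_div (gtr0_norm (_ : 0 < x1 - x0)) ?subr_gt0 //.
  rewrite ler_pM2r ?invr_gt0 ?subr_gt0 //.
  apply: le_trans (ler_normB _ _) _; rewrite mulr_natl mulr2n.
  have he := edge_itv s (ltW hy).
  by apply: lerD; apply: hM; rewrite //= lexx ltW.
rewrite /Xerr; apply: le_trans (ler_normB _ _) _.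
rewrite normrM (gtr0_norm (_ : 0 < (x1 - x0) * (y1 - y0) / 2)); last first.
  by apply: divr_gt0 => //; apply: mulr_gt0; rewrite subr_gt0.
have e3 : (x1 - x0) * (y1 - y0) / 2 * `|slope_x x0 x1 (D 0%N 0%N) (edge y0 y1 s)| <= 
    (x1 - x0) * (y1 - y0) / 2 * (2 * M / (x1 - x0)).
  apply: ler_wpM2l => //; apply: divr_ge0 => //; apply: mulr_ge0; lra.
have -> : (x1 - x0) * (y1 - y0) / 2 * (6 * M / (x1 - x0)) = 3 * M * (y1 - y0).
  by field; lra.
have e4 : (x1 - x0) * (y1 - y0) / 2 * (2 * M / (x1 - x0)) = M * (y1 - y0).
  by field; lra.
by move: e3; rewrite e4; lra.
Qed.

(* The linear part of [D 1 0] around the midpoint of the common edge integrates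
   to zero over the parallelogram formed by the two triangles. *)
Lemma Xerr_pair (x0 x1 y0 y1 y2 : R) D M30 M21 M12 : cell x0 x1 y0 y2 ->
  y1 - y0 = y2 - y1 -> sm 3 D ->
  bounded_on x0 x1 y0 y2 (D 3 0%N) M30 -> bounded_on x0 x1 y0 y2 (D 2 1%N) M21 ->
  bounded_on x0 x1 y0 y2 (D 1%N 2) M12 ->
  `|Xerr x0 x1 y0 y1 true D + Xerr x0 x1 y1 y2 false D| <=
  (x1 - x0) * (y1 - y0) *
  (2 * (x1 - x0) ^+ 2 * M30 + 2 * ((x1 - x0) * (y1 - y0)) * M21 + 4 * (y1 - y0) ^+ 2 * M12).
Proof.
move=> [hx hy [hx0 hx1] [hy0 hy1]] hh hD h30 h21 h12.
have h01 : y0 < y1 by lra.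
have h12' : y1 < y2 by lra.
have c1 := sm_continuous hD (isT : (1 + 0 <= 3)%N).
pose m : R * R := ((x0 + x1) / 2, y1).
pose q (p : R * R) : R := D 1%N 0%N m + (p.1 - m.1) * D 2 0%N m + (p.2 - m.2) * D 1%N 1%N m.
have cq : continuous q by rewrite /q; cont.
have hq p : q p = (D 1%N 0%N m - m.1 * D 2 0%N m - m.2 * D 1%N 1%N m) + D 2 0%N m * p.1 +
   D 1%N 1%N m * p.2 + 0 * p.1 ^+ 2 + 0 * (p.1 * p.2) + 0 * p.2 ^+ 2.
  by rewrite /q; ring.
set rho := (x1 - x0) ^+ 2 * M30 + (x1 - x0) * (y2 - y0) * M21 + (y2 - y0) ^+ 2 * M12.
have hrho p : x0 <= p.1 <= x1 -> y0 <= p.2 <= y2 -> `|D 1%N 0%N p - q p| <= rho.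
  move=> hp1 hp2; have -> : D 1%N 0%N p - q p = D 1%N 0%N p - D 1%N 0%N m -
     (p.1 - m.1) * D 2 0%N m - (p.2 - m.2) * D 1%N 1%N m by rewrite /q; ring.
  apply: (taylor_xy hD hx hy hx0 hx1 hy0 hy1 (isT : ((1 + 0).+1 < 3)%N)) => //=.
    by apply/andP; split; lra.
  by apply/andP; split; lra.
have e1 : `|J x0 x1 y0 y1 true (D 1%N 0%N) - J x0 x1 y0 y1 true q| <= (x1 - x0) * (y1 - y0) / 2 * rho.
  rewrite -J_sub //; apply: J_abs_cst => //; first by cont.
  move=> p /tri_box [hp1 /andP[? ?]]; apply: hrho => //; apply/andP; split; lra.
have e2 : `|J x0 x1 y1 y2 false (D 1%N 0%N) - J x0 x1 y1 y2 false q| <= (x1 - x0) * (y2 - y1) / 2 * rho.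
  rewrite -J_sub //; apply: J_abs_cst => //; first by cont.
  move=> p /tri_box [hp1 /andP[? ?]]; apply: hrho => //; apply/andP; split; lra.
have e3 : `|slope_x x0 x1 (D 0%N 0%N) y1 - D 1%N 0%N m| <= M30 * (x1 - x0) ^+ 2.
  apply: (slope_x_mid hD hx hx0 hx1 (isT : ((0 + 0).+2 < 3)%N) h30).
  by apply/andP; split; lra.
have q1 := J_quadratic true hx h01 hq; have q2 := J_quadratic false hx h12' hq.
rewrite /Xerr /edge.
set s := slope_x _ _ _ _ in e3 *.
set A := J _ _ _ _ _ _ in e1 *; set B := J _ _ _ _ _ q in e1 q1.
set A' := J _ _ _ _ _ _ in e2 *; set B' := J _ _ _ _ _ q in e2 q2.
have eB : B + B' = (x1 - x0) * (y1 - y0) * D 1%N 0%N m.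
  rewrite q1 q2 -hh /q /m /=; have -> : y2 = y1 + (y1 - y0) by lra.
  by field.
have -> : A - (x1 - x0) * (y1 - y0) / 2 * s + (A' - (x1 - x0) * (y2 - y1) / 2 * s) =
  (A - B) + (A' - B') - (x1 - x0) * (y1 - y0) * (s - D 1%N 0%N m).
  have -> : (x1 - x0) * (y1 - y0) * (s - D 1%N 0%N m) = (x1 - x0) * (y1 - y0) * s - (B + B').
    by rewrite eB; ring.
  by rewrite -hh; field.
apply: le_trans (ler_normB _ _) _.
have K0 : 0 <= (x1 - x0) * (y1 - y0) by apply: mulr_ge0; lra.
rewrite normrM (ger0_norm K0).
have e4 := ler_normD (A - B) (A' - B').
have e5 := ler_wpM2l K0 e3.
rewrite -hh in e2.
have -> : 2 * (x1 - x0) ^+ 2 * M30 + 2 * ((x1 - x0) * (y1 - y0)) * M21 + 4 * (y1 - y0) ^+ 2 * M12 = rho + M30 * (x1 - x0) ^+ 2.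
  have hy2 : y2 - y0 = 2 * (y1 - y0) by lra.
  by rewrite /rho hy2; ring.
rewrite mulrDr; lra.
Qed.

(** The nodal linear interpolant, expanded at the right-angled corner. *)
Definition lin (x0 x1 y0 y1 : R) (s : bool) f (p : R * R) : R :=
  let c := (edge x0 x1 s, edge y0 y1 s) in
  f c + (p.1 - c.1) * slope_x x0 x1 f c.2 + (p.2 - c.2) * slope_y y0 y1 f c.1.

(** Both functions are compared with the Taylor polynomial at the right-angled corner, where each
    slope differs from the partial derivative by at most one step times the pure second
    derivative. *)
Lemma lin_err (x0 x1 y0 y1 : R) s D p Mxx Mxy Myy : cell x0 x1 y0 y1 -> sm 3 D ->
  bounded_on x0 x1 y0 y1 (D 2 0%N) Mxx -> bounded_on x0 x1 y0 y1 (D 1%N 1%N) Mxy ->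
  bounded_on x0 x1 y0 y1 (D 0%N 2) Myy ->
  x0 <= p.1 <= x1 -> y0 <= p.2 <= y1 ->
  `|D 0%N 0%N p - lin x0 x1 y0 y1 s (D 0%N 0%N) p| <=
  2 * ((x1 - x0) ^+ 2 * Mxx + (x1 - x0) * (y1 - y0) * Mxy + (y1 - y0) ^+ 2 * Myy).
Proof.
move=> [hx hy [hx0 hx1] [hy0 hy1]] hD hMxx hMxy hMyy hp1 hp2.
pose c := (edge x0 x1 s, edge y0 y1 s).
have hc1 : x0 <= c.1 <= x1 := edge_itv s (ltW hx).
have hc2 : y0 <= c.2 <= y1 := edge_itv s (ltW hy).
have e1 := taylor_xy hD hx hy hx0 hx1 hy0 hy1 (isT : ((0 + 0).+1 < 3)%N) hMxx hMxy hMyy hc1 hc2 hp1 hp2.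
have M0x := bounded_on_ge0 (ltW hx) (ltW hy) hMxx.
have M0y := bounded_on_ge0 (ltW hx) (ltW hy) hMyy.
have M0xy := bounded_on_ge0 (ltW hx) (ltW hy) hMxy.
have slope_one D' a0 a1 b0 b1 c1 c2 M : a0 < a1 -> b0 < b1 -> 0 <= a0 -> a1 <= 1 -> sm 3 D' ->
    bounded_on a0 a1 b0 b1 (D' 2 0%N) M -> c1 = a0 \/ c1 = a1 -> b0 <= c2 <= b1 ->
    `|slope_x a0 a1 (D' 0%N 0%N) c2 - D' 1%N 0%N (c1, c2)| <= (a1 - a0) * M.
  move=> ha hb ha0 ha1 hD' hM hc hc2'.
  have k0 : a0 <= a0 <= a1 by rewrite lexx ltW.
  have k1 : a0 <= a1 <= a1 by rewrite lexx ltW.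
  have P0 : 0 < a1 - a0 by lra.
  have hn : `|a1 - a0| = a1 - a0 by rewrite gtr0_norm.
  have hn' : `|a0 - a1| = a1 - a0 by rewrite distrC.
  rewrite -(ler_pM2l P0) -{1}hn -normrM.
  case: hc => ->.
    have h := taylor_x hD' ha0 ha1 (isT : ((0 + 0).+1 < 3)%N) hM k0 k1 hc2'.
    rewrite hn in h; have -> : (a1 - a0) * (slope_x a0 a1 (D' 0%N 0%N) c2 - D' 1%N 0%N (a0, c2)) =
      D' 0%N 0%N (a1, c2) - D' 0%N 0%N (a0, c2) - (a1 - a0) * D' 1%N 0%N (a0, c2).
      by rewrite /slope_x; field; lra.
    by apply: le_trans h _; lra.
  have h := taylor_x hD' ha0 ha1 (isT : ((0 + 0).+1 < 3)%N) hM k1 k0 hc2'.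
  rewrite hn' -normrN in h; have -> : (a1 - a0) * (slope_x a0 a1 (D' 0%N 0%N) c2 - D' 1%N 0%N (a1, c2)) =
    - (D' 0%N 0%N (a0, c2) - D' 0%N 0%N (a1, c2) - (a0 - a1) * D' 1%N 0%N (a1, c2)).
    by rewrite /slope_x; field; lra.
  by apply: le_trans h _; lra.
have e2 : `|slope_x x0 x1 (D 0%N 0%N) c.2 - D 1%N 0%N c| <= (x1 - x0) * Mxx.
  apply: (slope_one D _ _ y0 y1) => //; rewrite /= /edge; case: (s); by [left|right].
have e3 : `|slope_y y0 y1 (D 0%N 0%N) c.1 - D 0%N 1%N c| <= (y1 - y0) * Myy.
  have := @slope_one (fun i j p => D j i (p.2, p.1)) y0 y1 x0 x1 c.2 c.1 Myy hy hx hy0 hy1 (sm_swap hD).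
  apply => //; first exact: bounded_on_swap hMyy.
  rewrite /= /edge; case: (s); by [left|right].
have k1 : `|p.1 - c.1| <= x1 - x0 by apply: abs_sub_le.
have k2 : `|p.2 - c.2| <= y1 - y0 by apply: abs_sub_le.
have e4 : `|(p.1 - c.1) * (slope_x x0 x1 (D 0%N 0%N) c.2 - D 1%N 0%N c)| <= (x1 - x0) * ((x1 - x0) * Mxx).
  by rewrite normrM; apply: ler_pM.
have e5 : `|(p.2 - c.2) * (slope_y y0 y1 (D 0%N 0%N) c.1 - D 0%N 1%N c)| <= (y1 - y0) * ((y1 - y0) * Myy).
  by rewrite normrM; apply: ler_pM.
set T := D 0%N 0%N p - D 0%N 0%N c - _ - _ in e1.
set U := (p.1 - c.1) * _ in e4; set V := (p.2 - c.2) * _ in e5.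
have -> : D 0%N 0%N p - lin x0 x1 y0 y1 s (D 0%N 0%N) p = T - U - V.
  by rewrite /lin /T /U /V /=; ring.
have a1 := ler_normB (T - U) V; have a2 := ler_normB T U.
have : 0 <= (x1 - x0) * (y1 - y0) * Mxy by apply: mulr_ge0 => //; apply: mulr_ge0; lra.
lra.
Qed.

Lemma lin_le (x0 x1 y0 y1 : R) s f p M : x0 < x1 -> y0 < y1 -> bounded_on x0 x1 y0 y1 f M ->
  x0 <= p.1 <= x1 -> y0 <= p.2 <= y1 -> `|lin x0 x1 y0 y1 s f p| <= 5 * M.
Proof.
move=> hx hy hM hp1 hp2.
pose c := (edge x0 x1 s, edge y0 y1 s).
have hc1 : x0 <= c.1 <= x1 := edge_itv s (ltW hx).
have hc2 : y0 <= c.2 <= y1 := edge_itv s (ltW hy).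
have k1 : `|p.1 - c.1| <= x1 - x0 by apply: abs_sub_le.
have k2 : `|p.2 - c.2| <= y1 - y0 by apply: abs_sub_le.
have e1 : `|slope_x x0 x1 f c.2| * (x1 - x0) <= 2 * M.
  rewrite /slope_x normf_div (gtr0_norm (_ : 0 < x1 - x0)) ?subr_gt0 // divfK; last by lra.
  apply: le_trans (ler_normB _ _) _; rewrite mulr_natl mulr2n.
  by apply: lerD; apply: hM; rewrite //= lexx ltW.
have e2 : `|slope_y y0 y1 f c.1| * (y1 - y0) <= 2 * M.
  rewrite /slope_y normf_div (gtr0_norm (_ : 0 < y1 - y0)) ?subr_gt0 // divfK; last by lra.
  apply: le_trans (ler_normB _ _) _; rewrite mulr_natl mulr2n.
  by apply: lerD; apply: hM; rewrite //= lexx ltW.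
have e3 := hM c hc1 hc2.
rewrite /lin -/c.
have a1 := ler_normD (f c + (p.1 - c.1) * slope_x x0 x1 f c.2) ((p.2 - c.2) * slope_y y0 y1 f c.1).
have a2 := ler_normD (f c) ((p.1 - c.1) * slope_x x0 x1 f c.2).
have a3 : `|(p.1 - c.1) * slope_x x0 x1 f c.2| <= 2 * M.
  by rewrite normrM mulrC; apply: le_trans e1; apply: ler_wpM2l.
have a4 : `|(p.2 - c.2) * slope_y y0 y1 f c.1| <= 2 * M.
  by rewrite normrM mulrC; apply: le_trans e2; apply: ler_wpM2l.
lra.
Qed.

End ElementErrors.

(** * Explicit formulas for quadratic interpolation on a macrotriangle *)

Section QuadraticInterpolation.
Variable R : realType.
Implicit Types (f : R * R -> R) (D : nat -> nat -> R * R -> R).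

(* [X0], [Y0] are the coordinates of the right-angled corner of the triangle, so
   that the steps are negative on the upper right triangles. *)
Section Formulas.
Variables (X0 X1 X2 Y0 Y1 Y2 : R).

(** The x derivative of the quadratic interpolant, as a combination of the difference quotients
    along the three horizontal edges that join interpolation nodes; the weights sum to 1. Only
    slopes of the linear interpolant enter, whence the stability of the postprocessing on finite
    element functions. *)
Definition qgrad f (p : R * R) : R :=
  let s := (p.1 - X0) / (X1 - X0) in let t := (p.2 - Y0) / (Y1 - Y0) in
  (3 / 2 - s - t) * slope_x X0 X1 f Y0 + (s - 1 / 2) * slope_x X1 X2 f Y0 +
  t * slope_x X0 X1 f Y1.

(** Lagrange interpolation in local coordinates, in which the macrotriangle is the set of
    nonnegative [s], [t] with [s + t <= 2] and the nodes have integer coordinates. *)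
Definition qval f (p : R * R) : R :=
  let s := (p.1 - X0) / (X1 - X0) in let t := (p.2 - Y0) / (Y1 - Y0) in
  (2 - s - t) * (1 - s - t) / 2 * f (X0, Y0) + s * (s - 1) / 2 * f (X2, Y0) +
  t * (t - 1) / 2 * f (X0, Y2) + s * (2 - s - t) * f (X1, Y0) +
  t * (2 - s - t) * f (X0, Y1) + s * t * f (X1, Y1).

End Formulas.

Section Exactness.
Variables (a0 a1 a2 a3 a4 a5 : R) (q : R * R -> R).

Lemma qgrad_exact (X0 X1 X2 Y0 Y1 : R) p : X1 != X0 -> Y1 != Y0 -> X2 - X1 = X1 - X0 ->
  (forall p, q p = a0 + a1 * p.1 + a2 * p.2 + a3 * p.1 ^+ 2 + a4 * (p.1 * p.2) + a5 * p.2 ^+ 2) ->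
  qgrad X0 X1 X2 Y0 Y1 q p = a1 + 2 * a3 * p.1 + a4 * p.2.
Proof.
move=> hX hY e hq; rewrite /qgrad /slope_x e.
have -> : X2 = X0 + 2 * (X1 - X0) by lra.
have h1 : X1 - X0 != 0 by rewrite subr_eq0.
have h2 : Y1 - Y0 != 0 by rewrite subr_eq0.
by rewrite !hq /=; field; rewrite h2 h1.
Qed.

Lemma qval_exact (X0 X1 X2 Y0 Y1 Y2 : R) p : X1 != X0 -> Y1 != Y0 ->
  X2 - X1 = X1 - X0 -> Y2 - Y1 = Y1 - Y0 ->
  (forall p, q p = a0 + a1 * p.1 + a2 * p.2 + a3 * p.1 ^+ 2 + a4 * (p.1 * p.2) + a5 * p.2 ^+ 2) ->
  qval X0 X1 X2 Y0 Y1 Y2 q p = q p.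
Proof.
move=> hX hY e e' hq; have {e} -> : X2 = 2 * X1 - X0 by lra.
have {e'} -> : Y2 = 2 * Y1 - Y0 by lra.
have h1 : X1 - X0 != 0 by rewrite subr_eq0.
have h2 : Y1 - Y0 != 0 by rewrite subr_eq0.
by rewrite /qval !hq /=; field; rewrite h2 h1.
Qed.
End Exactness.

(** The upper right half uses the same formula with the nodes in reversed order, starting from its
    right-angled corner. *)
Definition mgrad (x0 x1 x2 y0 y1 y2 : R) (s : bool) f p : R :=
  if s then qgrad x2 x1 x0 y2 y1 f p else qgrad x0 x1 x2 y0 y1 f p.
Definition mval (x0 x1 x2 y0 y1 y2 : R) (s : bool) f p : R :=
  if s then qval x2 x1 x0 y2 y1 y0 f p else qval x0 x1 x2 y0 y1 y2 f p.

Lemma slope_xC (a b : R) f y : slope_x b a f y = slope_x a b f y.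
Proof.
by rewrite /slope_x -[f (a, y) - _]opprB -[a - b]opprB invrN mulrNN.
Qed.

Lemma tri_local (x0 x1 x2 y0 y1 y2 : R) s p : x0 < x1 -> y0 < y1 ->
  x2 - x1 = x1 - x0 -> y2 - y1 = y1 - y0 -> tri x0 x2 y0 y2 s p ->
  let X0 := if s then x2 else x0 in let Y0 := if s then y2 else y0 in
  let u := (p.1 - X0) / (x1 - X0) in let v := (p.2 - Y0) / (y1 - Y0) in
  [/\ 0 <= u, 0 <= v & u + v <= 2].
Proof.
move=> hx hy ex ey [/andP[h1 h2] /andP[h3 h4] h5] X0 Y0 u v.
have ex2 : x2 = 2 * x1 - x0 by lra.
have ey2 : y2 = 2 * y1 - y0 by lra.
have hX : x1 - X0 != 0 by rewrite /X0; case: (s); lra.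
have hY : y1 - Y0 != 0 by rewrite /Y0; case: (s); lra.
have eu : u * (x1 - X0) = p.1 - X0 by rewrite /u divfK.
have ev : v * (y1 - Y0) = p.2 - Y0 by rewrite /v divfK.
move: u v eu ev h5; rewrite /X0 /Y0 => u v; move: h1 h2 h3 h4; rewrite ex2 ey2.
case: (s) => h1 h2 h3 h4 eu ev h5.
  have u0 : 0 <= u by nra.
  have v0 : 0 <= v by nra.
  split => //.
  have k : 0 < (x1 - x0) * (y1 - y0) by apply: mulr_gt0; lra.
  rewrite -(ler_pM2r k).
  move: h5; have -> : p.1 = u * (x1 - (2 * x1 - x0)) + (2 * x1 - x0) by lra.
  have -> : p.2 = v * (y1 - (2 * y1 - y0)) + (2 * y1 - y0) by lra.
  lra.
have u0 : 0 <= u by nra.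
have v0 : 0 <= v by nra.
split => //.
have k : 0 < (x1 - x0) * (y1 - y0) by apply: mulr_gt0; lra.
rewrite -(ler_pM2r k).
move: h5; have -> : p.1 = u * (x1 - x0) + x0 by lra.
have -> : p.2 = v * (y1 - y0) + y0 by lra.
lra.
Qed.

Lemma weighted_sum_le n (c e : 'I_n -> R) (A M : R) :
  (forall k, `|c k| <= A) -> (forall k, `|e k| <= M) ->
  `|\sum_k c k * e k| <= n%:R * (A * M).
Proof.
move=> hc he; apply: le_trans (ler_norm_sum _ _ _) _.
have -> : n%:R * (A * M) = \sum_(k < n) A * M.
  by rewrite sumr_const card_ord mulr_natl.
by apply: ler_sum => k _; rewrite normrM; apply: ler_pM.
Qed.

Definition vec3 (T : Type) (a b c : T) (k : 'I_3) : T := nth a [:: a; b; c] k.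
Definition vec6 (T : Type) (a b c d e g : T) (k : 'I_6) : T := nth a [:: a; b; c; d; e; g] k.

Lemma all_vec3 (P : 'I_3 -> Prop) : P (inord 0) -> P (inord 1) -> P (inord 2) -> forall k, P k.
Proof.
move=> h0 h1 h2 [[|[|[|//]]] hk]; [move: h0|move: h1|move: h2];
  by congr (P _); apply: val_inj; rewrite /= inordK.
Qed.

Section Representation.
Variables (x0 x1 x2 y0 y1 y2 : R) (s : bool) (p : R * R).

(** All that the error estimates use: bounded weights summing to 1, and edge midpoints whose
    weighted mean is [p]. The second property makes the first order Taylor terms cancel, so that the
    recovered gradient is second order accurate. *)
Lemma mgrad_repr : x0 < x1 -> y0 < y1 ->
  x2 - x1 = x1 - x0 -> y2 - y1 = y1 - y0 -> tri x0 x2 y0 y2 s p ->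
  exists c a b z : 'I_3 -> R,
  [/\ forall k, `|c k| <= 2,
      forall k, [/\ x0 <= a k, b k - a k = x1 - x0, b k <= x2 & y0 <= z k <= y2],
      \sum_k c k = 1,
      \sum_k c k * ((a k + b k) / 2) = p.1 /\ \sum_k c k * z k = p.2
    & forall f, mgrad x0 x1 x2 y0 y1 y2 s f p = \sum_k c k * slope_x (a k) (b k) f (z k)].
Proof.
move=> hx hy ex ey hp; have := tri_local hx hy ex ey hp.
set X0 := if s then x2 else x0; set Y0 := if s then y2 else y0.
move=> /=; set u := _ / _; set v := _ / _; move=> [u0 v0 uv].
have hX : x1 - X0 != 0 by rewrite /X0; case: (s); lra.
have hY : y1 - Y0 != 0 by rewrite /Y0; case: (s); lra.
have eu : p.1 = u * (x1 - X0) + X0 by rewrite /u divfK // subrK.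
have ev : p.2 = v * (y1 - Y0) + Y0 by rewrite /v divfK // subrK.
exists (vec3 (3 / 2 - u - v) (u - 1 / 2) v),
  (vec3 (if s then x1 else x0) (if s then x0 else x1) (if s then x1 else x0)),
  (vec3 (if s then x2 else x1) (if s then x1 else x2) (if s then x2 else x1)),
  (vec3 Y0 Y0 y1).
split.
- apply: all_vec3; rewrite /vec3 inordK //= ler_norml; apply/andP; split; lra.
- by apply: all_vec3; rewrite /vec3 inordK //= /Y0; case: (s); split => /=;
    first [lra | apply/andP; split; lra].
- by rewrite !big_ord_recl big_ord0 /vec3 /=; lra.
- rewrite !big_ord_recl !big_ord0 /vec3 /= eu ev /X0 /Y0.
  have -> : x2 = 2 * x1 - x0 by lra.
  have -> : y2 = 2 * y1 - y0 by lra.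
  by case: (s) => /=; split; field.
- move=> f; rewrite !big_ord_recl big_ord0 /vec3 /= addr0 addrA /mgrad /qgrad.
  rewrite /u /v /X0 /Y0; case: (s) => //=.
  by rewrite (slope_xC x1 x2) (slope_xC x0 x1) (slope_xC x1 x2 f y1).
Qed.

Lemma all_vec6 (P : 'I_6 -> Prop) : P (inord 0) -> P (inord 1) -> P (inord 2) ->
  P (inord 3) -> P (inord 4) -> P (inord 5) -> forall k, P k.
Proof.
move=> h0 h1 h2 h3 h4 h5 [[|[|[|[|[|[|//]]]]]] hk];
  [move: h0|move: h1|move: h2|move: h3|move: h4|move: h5];
  by congr (P _); apply: val_inj; rewrite /= inordK.
Qed.

Lemma mval_repr : x0 < x1 -> y0 < y1 ->
  x2 - x1 = x1 - x0 -> y2 - y1 = y1 - y0 -> tri x0 x2 y0 y2 s p ->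
  let X0 := if s then x2 else x0 in let Y0 := if s then y2 else y0 in
  let X2 := if s then x0 else x2 in let Y2 := if s then y0 else y2 in
  let n := vec6 (X0, Y0) (X2, Y0) (X0, Y2) (x1, Y0) (X0, y1) (x1, y1) in
  exists c : 'I_6 -> R,
  [/\ forall k, `|c k| <= 1,
      forall k, x0 <= (n k).1 <= x2 /\ y0 <= (n k).2 <= y2,
      \sum_k c k = 1,
      \sum_k c k * (n k).1 = p.1 /\ \sum_k c k * (n k).2 = p.2
    & forall f, mval x0 x1 x2 y0 y1 y2 s f p = \sum_k c k * f (n k)].
Proof.
move=> hx hy ex ey hp; have := tri_local hx hy ex ey hp.
set X0 := if s then x2 else x0; set Y0 := if s then y2 else y0.
move=> /=; set u := _ / _; set v := _ / _; move=> [u0 v0 uv].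
have hX : x1 - X0 != 0 by rewrite /X0; case: (s); lra.
have hY : y1 - Y0 != 0 by rewrite /Y0; case: (s); lra.
have eu : p.1 = u * (x1 - X0) + X0 by rewrite /u divfK // subrK.
have ev : p.2 = v * (y1 - Y0) + Y0 by rewrite /v divfK // subrK.
set X2 := if s then x0 else x2; set Y2 := if s then y0 else y2.
exists (vec6 ((2 - u - v) * (1 - u - v) / 2) (u * (u - 1) / 2) (v * (v - 1) / 2)
  (u * (2 - u - v)) (v * (2 - u - v)) (u * v)).
split.
(* The bounds of the six basis functions are quadratic inequalities on the triangle; they follow
   linearly from the products and squares collected here. *)
- have p1 := mulr_ge0 u0 v0.
  have w0 : 0 <= 2 - u - v by lra.
  have p2 := mulr_ge0 u0 w0; have p3 := mulr_ge0 v0 w0.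
  have q1 := sqr_ge0 (u + v - 3 / 2); have q2 := sqr_ge0 (u - 1 / 2).
  have q3 := sqr_ge0 (v - 1 / 2); have q4 := sqr_ge0 (1 - u).
  have q5 := sqr_ge0 (1 - v); have q6 := sqr_ge0 (u - v).
  move: p1 p2 p3 q1 q2 q3 q4 q5 q6 u0 v0 uv w0.
  move: u v {eu ev} => u v.
  do 13?[move=> ?].
  by apply: all_vec6; rewrite /vec6 inordK //= ler_norml; apply/andP; split; lra.
- by apply: all_vec6; rewrite /vec6 inordK //= /X0 /Y0 /X2 /Y2; case: (s); split => /=;
    apply/andP; split; lra.
- by rewrite !big_ord_recl big_ord0 /vec6 /=; field.
- have hX2 : X2 = 2 * x1 - X0 by rewrite /X2 /X0; case: (s); lra.
  have hY2 : Y2 = 2 * y1 - Y0 by rewrite /Y2 /Y0; case: (s); lra.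
  rewrite !big_ord_recl !big_ord0 /vec6 /= eu ev hX2 hY2.
  by split; field.
- move=> f; rewrite !big_ord_recl big_ord0 /vec6 /= addr0 !addrA /mval /qval.
  by rewrite /u /v /X0 /Y0 /X2 /Y2; case: (s).
Qed.
End Representation.

End QuadraticInterpolation.

(** * Error bounds for quadratic interpolation of a smooth function *)

Section MacroErrors.
Variable R : realType.
Implicit Types (f : R * R -> R) (D : nat -> nat -> R * R -> R).

Definition macro_cell (x0 x1 x2 y0 y1 y2 : R) : Prop :=
  [/\ cell x0 x2 y0 y2, x2 - x1 = x1 - x0 & y2 - y1 = y1 - y0].

Lemma macro_cell_lt (x0 x1 x2 y0 y1 y2 : R) : macro_cell x0 x1 x2 y0 y1 y2 ->
  x0 < x1 /\ y0 < y1.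
Proof. by move=> [[hx hy _ _] ex ey]; split; lra. Qed.

Section Estimates.
Variables (x0 x1 x2 y0 y1 y2 : R) (s : bool) (p : R * R).
Variable D : nat -> nat -> R * R -> R.
Notation bd := (bounded_on x0 x2 y0 y2).
Notation mg := (mgrad x0 x1 x2 y0 y1 y2 s).
Notation mv := (mval x0 x1 x2 y0 y1 y2 s).

Lemma mgrad_le0 f M : macro_cell x0 x1 x2 y0 y1 y2 -> tri x0 x2 y0 y2 s p ->
  bd f M -> `|mg f p| <= 12 * M / (x1 - x0).
Proof.
move=> hm hp hM; have [hx hy] := macro_cell_lt hm.
case: hm => [[_ _ [hx0 hx2] [hy0 hy2]]] ex ey.
have [c [a [b [z [hc ha _ _ ->]]]]] := mgrad_repr hx hy ex ey hp.
have -> : 12 * M / (x1 - x0) = 3%:R * (2 * (2 * M / (x1 - x0))) by field; lra.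
apply: weighted_sum_le => // k; have [a0 ab b2 hz] := ha k.
rewrite /slope_x normf_div ab (gtr0_norm (_ : 0 < x1 - x0)) ?subr_gt0 //.
rewrite ler_pM2r ?invr_gt0 ?subr_gt0 //.
apply: le_trans (ler_normB _ _) _; rewrite mulr_natl mulr2n.
by apply: lerD; apply: hM => //=; apply/andP; split; lra.
Qed.

Lemma mgrad_le1 M : macro_cell x0 x1 x2 y0 y1 y2 -> tri x0 x2 y0 y2 s p -> sm 3 D ->
  bd (D 1%N 0%N) M -> `|mg (D 0%N 0%N) p| <= 6 * M.
Proof.
move=> hm hp hD hM; have [hx hy] := macro_cell_lt hm.
case: hm => [[_ _ [hx0 hx2] [hy0 hy2]]] ex ey.
have [c [a [b [z [hc ha _ _ ->]]]]] := mgrad_repr hx hy ex ey hp.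
have -> : 6 * M = 3%:R * (2 * M) by ring.
apply: weighted_sum_le => // k; have [a0 ab b2 hz] := ha k.
apply: (@slope_x_le _ 3 D (a k) (b k) y0 y2) => //; try lra.
by apply: bounded_on_sub hM => //; lra.
Qed.

Lemma mgrad_err1 Mx My : macro_cell x0 x1 x2 y0 y1 y2 -> tri x0 x2 y0 y2 s p -> sm 3 D ->
  bd (D 2 0%N) Mx -> bd (D 1%N 1%N) My ->
  `|mg (D 0%N 0%N) p - D 1%N 0%N p| <= 12 * ((x2 - x0) * Mx + (y2 - y0) * My).
Proof.
move=> hm hp hD hMx hMy; have [hx hy] := macro_cell_lt hm.
case: hm => [[hx02 hy02 [hx0 hx2] [hy0 hy2]]] ex ey.
have [c [a [b [z [hc ha c1 _ ->]]]]] := mgrad_repr hx hy ex ey hp.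
have [hp1 hp2] := tri_box hp.
have -> : \sum_k c k * slope_x (a k) (b k) (D 0%N 0%N) (z k) - D 1%N 0%N p =
   \sum_k c k * (slope_x (a k) (b k) (D 0%N 0%N) (z k) - D 1%N 0%N p).
  under [RHS]eq_bigr => k _ do rewrite mulrBr.
  by rewrite sumrB -mulr_suml c1 mul1r.
have Mx0 := bounded_on_ge0 (ltW hx02) (ltW hy02) hMx.
have My0 := bounded_on_ge0 (ltW hx02) (ltW hy02) hMy.
have -> : 12 * ((x2 - x0) * Mx + (y2 - y0) * My) = 3%:R * (2 * (2 * ((x2 - x0) * Mx + (y2 - y0) * My))) by ring.
apply: weighted_sum_le => // k; have [a0 ab b2 hz] := ha k.
have hak : x0 <= a k <= x2 by apply/andP; split; lra.
have e1 : `|D 1%N 0%N (a k, z k) - D 1%N 0%N p| <= (x2 - x0) * Mx + (y2 - y0) * My.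
  exact: (@lip_xy _ 3 D x0 x2 y0 y2).
have e2 : `|slope_x (a k) (b k) (D 0%N 0%N) (z k) - D 1%N 0%N (a k, z k)| <=
    (b k - a k) * Mx + (y2 - y0) * My.
  apply: (@slope_x_err _ 3 D (a k) (b k) y0 y2) => //=; first [lra | by apply: bounded_on_sub hMx => //; lra
    | by apply: bounded_on_sub hMy => //; lra | by apply/andP; split; lra].
have e3 : (b k - a k) * Mx <= (x2 - x0) * Mx by apply: ler_wpM2r => //; lra.
have := ler_distD (D 1%N 0%N (a k, z k)) (slope_x (a k) (b k) (D 0%N 0%N) (z k)) (D 1%N 0%N p).
lra.
Qed.

Lemma mgrad_err2 M30 M21 M12 : macro_cell x0 x1 x2 y0 y1 y2 -> tri x0 x2 y0 y2 s p -> sm 3 D ->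
  bd (D 3 0%N) M30 -> bd (D 2 1%N) M21 -> bd (D 1%N 2) M12 ->
  `|mg (D 0%N 0%N) p - D 1%N 0%N p| <=
  12 * ((x2 - x0) ^+ 2 * M30 + (x2 - x0) * (y2 - y0) * M21 + (y2 - y0) ^+ 2 * M12).
Proof.
move=> hm hp hD h30 h21 h12; have [hx hy] := macro_cell_lt hm.
case: hm => [[hx02 hy02 [hx0 hx2] [hy0 hy2]]] ex ey.
have [c [a [b [z [hc ha c1 [cm1 cm2] ->]]]]] := mgrad_repr hx hy ex ey hp.
have [hp1 hp2] := tri_box hp.
pose m k : R * R := ((a k + b k) / 2, z k).
(* The inserted first order terms have weighted sum zero by the two moment identities. *)
have -> : \sum_k c k * slope_x (a k) (b k) (D 0%N 0%N) (z k) - D 1%N 0%N p =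
   \sum_k c k * (slope_x (a k) (b k) (D 0%N 0%N) (z k) - D 1%N 0%N p -
     ((m k).1 - p.1) * D 2 0%N p - ((m k).2 - p.2) * D 1%N 1%N p).
  have e k : c k * (slope_x (a k) (b k) (D 0%N 0%N) (z k) - D 1%N 0%N p -
     ((m k).1 - p.1) * D 2 0%N p - ((m k).2 - p.2) * D 1%N 1%N p) =
     c k * slope_x (a k) (b k) (D 0%N 0%N) (z k) - (c k * D 1%N 0%N p +
     (c k * (m k).1 * D 2 0%N p - c k * (p.1 * D 2 0%N p)) +
     (c k * (m k).2 * D 1%N 1%N p - c k * (p.2 * D 1%N 1%N p))) by ring.
  under [RHS]eq_bigr => k _ do rewrite e.
  rewrite sumrB !big_split /= !sumrN -!mulr_suml c1 cm1 cm2; ring.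
set rho := (x2 - x0) ^+ 2 * M30 + (x2 - x0) * (y2 - y0) * M21 + (y2 - y0) ^+ 2 * M12.
have M0 := bounded_on_ge0 (ltW hx02) (ltW hy02) h30.
have M1 := bounded_on_ge0 (ltW hx02) (ltW hy02) h21.
have M2 := bounded_on_ge0 (ltW hx02) (ltW hy02) h12.
have -> : 12 * rho = 3%:R * (2 * (2 * rho)) by ring.
apply: weighted_sum_le => // k; have [a0 ab b2 hz] := ha k.
have hm1 : x0 <= (m k).1 <= x2 by rewrite /m /=; apply/andP; split; lra.
have e1 : `|D 1%N 0%N (m k) - D 1%N 0%N p - ((m k).1 - p.1) * D 2 0%N p - ((m k).2 - p.2) * D 1%N 1%N p| <= rho.
  exact: (@taylor_xy _ 3 D x0 x2 y0 y2).
have e2 : `|slope_x (a k) (b k) (D 0%N 0%N) (z k) - D 1%N 0%N (m k)| <= M30 * (b k - a k) ^+ 2.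
  apply: (@slope_x_mid _ 3 D (a k) (b k) y0 y2) => //=; try lra.
  by apply: bounded_on_sub h30 => //; lra.
have e3 : M30 * (b k - a k) ^+ 2 <= rho.
  have k1 : 0 <= (x2 - x0) * (y2 - y0) * M21 by apply: mulr_ge0 => //; apply: mulr_ge0; lra.
  have k2 : 0 <= (y2 - y0) ^+ 2 * M12 by apply: mulr_ge0 => //; apply: sqr_ge0.
  have k3 : M30 * (b k - a k) ^+ 2 <= M30 * (x2 - x0) ^+ 2.
    by apply: ler_wpM2l => //; rewrite ler_sqr ?nnegrE; lra.
  by rewrite /rho; lra.
set T := _ - _ - _ - _ in e1; set S := _ - _ in e2.
have -> : slope_x (a k) (b k) (D 0%N 0%N) (z k) - D 1%N 0%N p -
   ((m k).1 - p.1) * D 2 0%N p - ((m k).2 - p.2) * D 1%N 1%N p = S + T.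
  by rewrite /S /T; ring.
have := ler_normD S T; lra.
Qed.

Lemma mval_le f M : macro_cell x0 x1 x2 y0 y1 y2 -> tri x0 x2 y0 y2 s p ->
  bd f M -> `|mv f p| <= 6 * M.
Proof.
move=> hm hp hM; have [hx hy] := macro_cell_lt hm; case: hm => _ ex ey.
have [c [hc hn _ _ ->]] := mval_repr hx hy ex ey hp.
have -> : 6 * M = 6%:R * (1 * M) by ring.
by apply: weighted_sum_le => // k; have [h1 h2] := hn k; apply: hM.
Qed.

Lemma mval_err Mxx Mxy Myy : macro_cell x0 x1 x2 y0 y1 y2 -> tri x0 x2 y0 y2 s p -> sm 3 D ->
  bd (D 2 0%N) Mxx -> bd (D 1%N 1%N) Mxy -> bd (D 0%N 2) Myy ->
  `|mv (D 0%N 0%N) p - D 0%N 0%N p| <=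
  6 * ((x2 - x0) ^+ 2 * Mxx + (x2 - x0) * (y2 - y0) * Mxy + (y2 - y0) ^+ 2 * Myy).
Proof.
move=> hm hp hD hMxx hMxy hMyy; have [hx hy] := macro_cell_lt hm.
case: hm => [[hx02 hy02 [hx0 hx2] [hy0 hy2]]] ex ey.
have [c [hc hn c1 [cm1 cm2] ->]] := mval_repr hx hy ex ey hp.
have [hp1 hp2] := tri_box hp.
set n := vec6 _ _ _ _ _ _ in hn cm1 cm2 *.
have -> : \sum_k c k * D 0%N 0%N (n k) - D 0%N 0%N p =
   \sum_k c k * (D 0%N 0%N (n k) - D 0%N 0%N p - ((n k).1 - p.1) * D 1%N 0%N p - ((n k).2 - p.2) * D 0%N 1%N p).
  have e k : c k * (D 0%N 0%N (n k) - D 0%N 0%N p - ((n k).1 - p.1) * D 1%N 0%N p - ((n k).2 - p.2) * D 0%N 1%N p) =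
     c k * D 0%N 0%N (n k) - (c k * D 0%N 0%N p + (c k * (n k).1 * D 1%N 0%N p - c k * (p.1 * D 1%N 0%N p)) +
     (c k * (n k).2 * D 0%N 1%N p - c k * (p.2 * D 0%N 1%N p))) by ring.
  under [RHS]eq_bigr => k _ do rewrite e.
  rewrite sumrB !big_split /= !sumrN -!mulr_suml c1 cm1 cm2; ring.
set rho := _ + _; have -> : 6 * rho = 6%:R * (1 * rho) by ring.
apply: weighted_sum_le => // k; have [h1 h2] := hn k.
exact: (@taylor_xy _ 3 D x0 x2 y0 y2).
Qed.

End Estimates.
End MacroErrors.

(** * Sums over the triangulation *)

Section Sums.
Variable R : realType.

Definition S3 (N : nat) (F : nat -> nat -> bool -> R) : R :=
  \sum_(i < N) \sum_(j < N) \sum_(s : bool) F i j s.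

Lemma eq_S3 N F G : (forall i j s, (i < N)%N -> (j < N)%N -> F i j s = G i j s) -> S3 N F = S3 N G.
Proof. by move=> h; apply: eq_bigr => i _; apply: eq_bigr => j _; apply: eq_bigr => s _; exact: h. Qed.

Lemma S3_add N F G : S3 N (fun i j s => F i j s + G i j s) = S3 N F + S3 N G.
Proof.
rewrite /S3 -big_split; apply: eq_bigr => i _; rewrite -big_split; apply: eq_bigr => j _.
by rewrite -big_split.
Qed.

Lemma S3_scale N a F : S3 N (fun i j s => a * F i j s) = a * S3 N F.
Proof.
rewrite /S3 mulr_sumr; apply: eq_bigr => i _; rewrite mulr_sumr; apply: eq_bigr => j _.
by rewrite mulr_sumr.
Qed.

Lemma S3_sub N F G : S3 N (fun i j s => F i j s - G i j s) = S3 N F - S3 N G.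
Proof.
rewrite -mulN1r -S3_scale -S3_add; apply: eq_S3 => i j s _ _.
by rewrite mulN1r.
Qed.

Lemma S3_le N F G : (forall i j s, (i < N)%N -> (j < N)%N -> F i j s <= G i j s) -> S3 N F <= S3 N G.
Proof. by move=> h; apply: ler_sum => i _; apply: ler_sum => j _; apply: ler_sum => s _; exact: h. Qed.

Lemma S3_ge0 N F : (forall i j s, (i < N)%N -> (j < N)%N -> 0 <= F i j s) -> 0 <= S3 N F.
Proof. by move=> h; apply: sumr_ge0 => i _; apply: sumr_ge0 => j _; apply: sumr_ge0 => s _; exact: h. Qed.

Lemma S3_abs N F : `|S3 N F| <= S3 N (fun i j s => `|F i j s|).
Proof.
apply: le_trans (ler_norm_sum _ _ _) _; apply: ler_sum => i _.
apply: le_trans (ler_norm_sum _ _ _) _; apply: ler_sum => j _.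
exact: ler_norm_sum.
Qed.

Lemma S3_swap N F : S3 N F = S3 N (fun i j s => F j i s).
Proof. by rewrite /S3 exchange_big. Qed.

Lemma S3_factor N (a b : nat -> R) :
  S3 N (fun i j _ => a i * b j) = 2 * ((\sum_(i < N) a i) * \sum_(j < N) b j).
Proof.
rewrite /S3 big_distrlr /= mulr_sumr; apply: eq_bigr => i _; rewrite mulr_sumr.
by apply: eq_bigr => j _; rewrite sumr_const card_bool mulr2n mulr_natl mulr2n.
Qed.

Lemma S3_term_le N F i j s : (forall i j s, (i < N)%N -> (j < N)%N -> 0 <= F i j s) ->
  (i < N)%N -> (j < N)%N -> F i j s <= S3 N F.
Proof.
move=> F0 hi hj; rewrite /S3 (bigD1 (Ordinal hi)) //= (bigD1 (Ordinal hj)) //= (bigD1 s) //=.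
rewrite -!addrA lerDl; apply: addr_ge0; first by apply: sumr_ge0 => *; exact: F0.
apply: addr_ge0; first by apply: sumr_ge0 => *; apply: sumr_ge0 => *; exact: F0.
by apply: sumr_ge0 => *; apply: sumr_ge0 => *; apply: sumr_ge0 => *; exact: F0.
Qed.

Lemma discriminant (A B C : R) : 0 <= A -> (forall t, 0 <= A * t ^+ 2 - 2 * B * t + C) ->
  B ^+ 2 <= A * C.
Proof.
move=> A0 h; have [e|An0] := eqVneq A 0.
  have [->|B0] := eqVneq B 0; first by rewrite expr0n /= e mul0r.
  (* For [A = 0] the polynomial is affine in [t], and it takes the value -1 at this point. *)
  have := h ((C + 1) / (2 * B)); rewrite e.
  have -> : 0 * ((C + 1) / (2 * B)) ^+ 2 - 2 * B * ((C + 1) / (2 * B)) + C = -1 by field; exact: B0.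
  by lra.
have Ap : 0 < A by rewrite lt_neqAle eq_sym An0.
have := h (B / A); have -> : A * (B / A) ^+ 2 - 2 * B * (B / A) + C = (A * C - B ^+ 2) / A.
  by field; exact: An0.
by rewrite pmulr_lge0 ?invr_gt0 // subr_ge0.
Qed.

Lemma cauchy_schwarz N (w a b : nat -> nat -> bool -> R) :
  (forall i j s, (i < N)%N -> (j < N)%N -> 0 <= w i j s) ->
  S3 N (fun i j s => w i j s * (a i j s * b i j s)) ^+ 2 <=
  S3 N (fun i j s => w i j s * a i j s ^+ 2) * S3 N (fun i j s => w i j s * b i j s ^+ 2).
Proof.
move=> w0; apply: discriminant.
  by apply: S3_ge0 => i j s hi hj; apply: mulr_ge0; [exact: w0|exact: sqr_ge0].
move=> t.
rewrite [_ * t ^+ 2]mulrC -mulrA [S3 _ _ * t]mulrC mulrA -!S3_scale -S3_sub -S3_add.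
apply: S3_ge0 => i j s hi hj.
have -> : t ^+ 2 * (w i j s * a i j s ^+ 2) - 2 * t * (w i j s * (a i j s * b i j s)) + w i j s * b i j s ^+ 2
  = w i j s * (t * a i j s - b i j s) ^+ 2 by ring.
by apply: mulr_ge0; [exact: w0|exact: sqr_ge0].
Qed.

Lemma sqr_le_sqrt (x a b : R) : 0 <= a -> 0 <= b -> x ^+ 2 <= a * b ->
  x <= Num.sqrt a * Num.sqrt b.
Proof.
move=> a0 b0 h; rewrite -sqrtrM //; apply: le_trans (ler_norm x) _.
by rewrite -sqrtr_sqr ler_wsqrtr.
Qed.

End Sums.

(** * One-dimensional meshes of the unit interval *)

Section Mesh.
Variable R : realType.

Definition mesh (N : nat) (X : nat -> R) : Prop :=
  [/\ X 0%N = 0, X N = 1 & forall i, (i < N)%N -> X i < X i.+1].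

Section MeshTheory.
Variables (N : nat) (X : nat -> R).
Hypothesis hX : mesh N X.

Lemma mesh_le i j : (i <= j)%N -> (j <= N)%N -> X i <= X j.
Proof.
elim: j => [|j ih]; first by rewrite leqn0 => /eqP ->.
rewrite leq_eqVlt => /orP[/eqP -> //|]; rewrite ltnS => ij jN.
by apply: le_trans (ih ij (ltnW jN)) _; case: hX => _ _ h; rewrite ltW // h.
Qed.

Lemma mesh_itv i : (i <= N)%N -> 0 <= X i <= 1.
Proof.
move=> h; have [e0 e1 _] := hX.
have a := mesh_le (leq0n i) h; have b := mesh_le h (leqnn N).
by rewrite e0 in a; rewrite e1 in b; rewrite a b.
Qed.

Lemma mesh_inj i j x : (i < N)%N -> (j < N)%N ->
  X i < x < X i.+1 -> X j < x < X j.+1 -> i = j.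
Proof.
move=> hi hj /andP[a b] /andP[c d]; have [ij|ij|//] := ltngtP i j.
  have := mesh_le ij (ltnW hj); move=> h.
  by have := lt_trans c b; rewrite ltNge h.
have := mesh_le ij (ltnW hi); move=> h.
by have := lt_trans a d; rewrite ltNge h.
Qed.

Lemma mesh_locate x : 0 <= x < 1 -> exists2 i, (i < N)%N & X i <= x < X i.+1.
Proof.
have [e0 e1 _] := hX; rewrite -e0 -e1 => /andP[h0 h1].
elim: N h1 => [|n ih] h1; first by have := lt_le_trans h1 h0; rewrite ltxx.
have [h|h] := ltP x (X n).
  by have [i hi hx] := ih h; exists i => //; exact: ltnW.
by exists n => //; rewrite h.
Qed.

Lemma mesh_sum (n : nat) : \sum_(i < n) (X i.+1 - X i) = X n - X 0%N.
Proof.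
elim: n => [|n ih]; first by rewrite big_ord0 subrr.
by rewrite big_ord_recr /= ih; ring.
Qed.

End MeshTheory.

Lemma mesh_cell N X Y i j : mesh N X -> mesh N Y -> (i < N)%N -> (j < N)%N ->
  cell (X i) (X i.+1) (Y j) (Y j.+1).
Proof.
move=> hX hY hi hj; split; [by case: hX => _ _; exact|by case: hY => _ _; exact| |].
  by split; [have /andP[] := mesh_itv hX (ltnW hi)|have /andP[] := mesh_itv hX hi].
by split; [have /andP[] := mesh_itv hY (ltnW hj)|have /andP[] := mesh_itv hY hj].
Qed.

End Mesh.

(** * Lines of measure zero *)

Section Decomposition.
Variable R : realType.
Notation mu := (@lebesgue_measure R).
Notation mu2 := (@lebesgue_measure R \x @lebesgue_measure R)%E.

Lemma measurable_eq0 (g : R * R -> R) : continuous g -> measurable [set p | g p = 0].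
Proof.
move=> cg; have -> : [set p | g p = 0] = ~` [set p | 0 < g p] `&` ~` [set p | 0 < - g p].
  apply/seteqP; split => p /=.
    by move=> ->; rewrite oppr0 ltxx.
  by move=> [/negP h1 /negP h2]; apply/eqP; rewrite eq_le; move: h1 h2; rewrite oppr_gt0 -!leNgt => -> ->.
apply: measurableI; apply: measurableC; apply: open_measurable2; apply: open_pos => //.
by cont.
Qed.

(** The product measure is by definition the integral of the measures of the vertical sections,
    which are single points here. *)
Lemma negligible_graph (f : R -> R) : continuous f ->
  mu2.-negligible [set p : R * R | p.2 - f p.1 = 0].
Proof.
move=> cf; have cg : continuous (fun p : R * R => p.2 - f p.1).
  have c1 : continuous (fun p : R * R => f p.1).
    by move=> p; exact: (cvg_comp _ _ (@continuous_fst' R p) (cf _)).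
  by cont.
have mL := measurable_eq0 cg.
set L : set (R * R) := [set p | _] in mL *.
apply/negligibleP => //.
change ((\int[mu]_x (mu \o xsection L) x)%E = 0%E).
apply: integral0_eq => x _ /=.
have -> : xsection L x = [set f x].
  apply/seteqP; split => y; rewrite /xsection /= inE /L /=.
    by move/eqP; rewrite subr_eq0 => /eqP.
  by move=> ->; rewrite subrr.
exact: lebesgue_measure_set1.
Qed.

(** A vertical line is not a graph over the first coordinate; its measure is 0 times infinity, which
    is 0 by convention. *)
Lemma negligible_vertical (c : R) : mu2.-negligible [set p : R * R | p.1 - c = 0].
Proof.
have -> : [set p : R * R | p.1 - c = 0] = [set c] `*` setT.
  apply/seteqP; split => -[x y] /=; first by move/eqP; rewrite subr_eq0 => /eqP ->.
  by move=> [-> _]; rewrite subrr.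
apply/negligibleP; first by apply: measurableX.
have h := product_measure1E mu mu (measurable_set1 c) (@measurableT _ (measurableTypeR R)).
have e : ((@lebesgue_measure R) [set c] * (@lebesgue_measure R) setT = 0)%E.
  by rewrite lebesgue_measure_set1 mul0e.
exact: (etrans h e).
Qed.

Lemma off_tri (x0 x1 y0 y1 : R) (p : R * R) : x0 < x1 -> y0 < y1 ->
  x0 <= p.1 <= x1 -> y0 <= p.2 <= y1 ->
  p.1 - x0 <> 0 -> p.1 - x1 <> 0 -> p.2 - y0 <> 0 -> p.2 - y1 <> 0 ->
  p.2 - diag y0 y1 x0 x1 p.1 <> 0 ->
  (if 0 < p.2 - diag y0 y1 x0 x1 p.1 then tri x0 x1 y0 y1 true p else tri x0 x1 y0 y1 false p).
Proof.
move=> hx hy /andP[a b] /andP[c d] /eqP h1 /eqP h2 /eqP h3 /eqP h4 /eqP h5.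
have a' : x0 < p.1 by rewrite lt_neqAle a andbT eq_sym -subr_eq0.
have b' : p.1 < x1 by rewrite lt_neqAle b andbT -subr_eq0.
have c' : y0 < p.2 by rewrite lt_neqAle c andbT eq_sym -subr_eq0.
have d' : p.2 < y1 by rewrite lt_neqAle d andbT -subr_eq0.
have P0 : 0 < x1 - x0 by lra.
have e : (p.1 - x0) * (y1 - y0) + (p.2 - y0) * (x1 - x0) - (x1 - x0) * (y1 - y0) =
   (x1 - x0) * (p.2 - diag y0 y1 x0 x1 p.1) by rewrite /diag; field; lra.
case: ltP => h.
  split; rewrite ?a' ?b' ?c' ?d' //.
  by rewrite -subr_gt0 e; apply: mulr_gt0.
split; rewrite ?a' ?b' ?c' ?d' //.
by rewrite -subr_lt0 e pmulr_rlt0 // lt_neqAle h5.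
Qed.

End Decomposition.

(** * Integrals over the square as sums over the triangles *)

Section IntegralDecomposition.
Variable R : realType.
Notation mu := (@lebesgue_measure R).
Notation mu2 := (@lebesgue_measure R \x @lebesgue_measure R)%E.

Lemma Rintegral_off_negligible d (T : measurableType d)
    (m : {measure set T -> \bar R}) (D Z : set T) (F : T -> R) :
  m.-negligible Z -> \int[m]_(p in D) F p = \int[m]_(p in D `\` Z) F p.
Proof.
move=> [A [mA A0 ZA]].
rewrite (Rintegral_off_null D F mA A0) [RHS](Rintegral_off_null _ F mA A0).
congr Rintegral; apply/seteqP; split => p; first by move=> [h1 h2]; do !split => //; move/ZA.
by move=> [[h1 h2] h3].
Qed.

(** Whole lines instead of segments. The horizontal lines are written as graphs of constants to
    match [negligible_graph], and [diag] with exchanged arguments is the ordinate of the diagonal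
    above [p.1]. *)
Definition edges (x0 x1 y0 y1 : R) : set (R * R) :=
  [set p | p.1 - x0 = 0] `|` [set p | p.1 - x1 = 0] `|`
  ([set p | p.2 - (fun=> y0) p.1 = 0] `|` [set p | p.2 - (fun=> y1) p.1 = 0] `|`
   [set p | p.2 - diag y0 y1 x0 x1 p.1 = 0]).

Lemma negligible_edges x0 x1 y0 y1 : mu2.-negligible (edges x0 x1 y0 y1).
Proof.
have cc (c : R) : continuous (fun _ : R => c) by move=> x; exact: cvg_cst.
apply: negligibleU; first by apply: negligibleU; exact: negligible_vertical.
apply: negligibleU; last by apply: negligible_graph; exact: continuous_diag.
by apply: negligibleU; apply: negligible_graph; exact: cc.
Qed.

Lemma hull_half_rect (x0 x1 y0 y1 : R) s p : x0 < x1 -> y0 < y1 ->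
  hull (half_rect x0 x1 y0 y1 s) p <->
  [/\ x0 <= p.1 <= x1, y0 <= p.2 <= y1 &
    if s then (x1 - x0) * (y1 - y0) <= (p.1 - x0) * (y1 - y0) + (p.2 - y0) * (x1 - x0)
    else (p.1 - x0) * (y1 - y0) + (p.2 - y0) * (x1 - x0) <= (x1 - x0) * (y1 - y0)].
Proof.
move=> hx hy; have hx' : 0 < x1 - x0 by lra.
have hy' : 0 < y1 - y0 by lra.
have K : 0 < (x1 - x0) * (y1 - y0) by apply: mulr_gt0.
split.
  rewrite /hull /half_rect; case: s => /= -[t0 [t1 [t2 [[h0 h1 h2] e0 -> ->]]]].
    have -> : t2 = 1 - t0 - t1 by lra.
    have h3 : t0 + t1 <= 1 by lra.
    have q1 := mulr_ge0 h0 (ltW hx'); have q2 := mulr_ge0 h1 (ltW hx').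
    have q3 := mulr_ge0 h0 (ltW hy'); have q4 := mulr_ge0 h1 (ltW hy').
    have q5 := mulr_ge0 h2 (ltW hx'); have q6 := mulr_ge0 h2 (ltW hy').
    have e2 : t2 = 1 - t0 - t1 by lra.
    rewrite e2 in q5 q6; have q7 := mulr_ge0 h2 (ltW K); rewrite e2 in q7.
    by split; [apply/andP; split; lra|apply/andP; split; lra|lra].
  have -> : t0 = 1 - t1 - t2 by lra.
  have q1 := mulr_ge0 h1 (ltW hx'); have q2 := mulr_ge0 h2 (ltW hx').
  have q3 := mulr_ge0 h1 (ltW hy'); have q4 := mulr_ge0 h2 (ltW hy').
  have e2 : t0 = 1 - t1 - t2 by lra.
  have q5 := mulr_ge0 h0 (ltW hx'); have q6 := mulr_ge0 h0 (ltW hy').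
  rewrite e2 in q5 q6; have q7 := mulr_ge0 h0 (ltW K); rewrite e2 in q7.
  by split; [apply/andP; split; lra|apply/andP; split; lra|lra].
move=> [/andP[a b] /andP[c d] h]; rewrite /hull /half_rect.
have u0 : 0 <= (p.1 - x0) / (x1 - x0) by apply: divr_ge0; lra.
have v0 : 0 <= (p.2 - y0) / (y1 - y0) by apply: divr_ge0; lra.
have u1 : (p.1 - x0) / (x1 - x0) <= 1 by rewrite ler_pdivrMr; lra.
have v1 : (p.2 - y0) / (y1 - y0) <= 1 by rewrite ler_pdivrMr; lra.
have eu : p.1 = x0 + (p.1 - x0) / (x1 - x0) * (x1 - x0) by field; lra.
have ev : p.2 = y0 + (p.2 - y0) / (y1 - y0) * (y1 - y0) by field; lra.
move: (_ / (x1 - x0)) (_ / (y1 - y0)) u0 v0 u1 v1 eu ev => u v u0 v0 u1 v1 eu ev.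
case: s h => h.
  exists (1 - u), (1 - v), (u + v - 1); split; [split; try lra|ring| |].
  - rewrite -(ler_pM2r K); move: h; rewrite eu ev; lra.
  - by rewrite /= {1}eu; ring.
  - by rewrite /= {1}ev; ring.
exists (1 - u - v), u, v; split; [split; try lra|ring| |].
- rewrite -(ler_pM2r K); move: h; rewrite eu ev; lra.
- by rewrite /= {1}eu; ring.
- by rewrite /= {1}ev; ring.
Qed.

Lemma tri_hull (x0 x1 y0 y1 : R) s p : tri x0 x1 y0 y1 s p ->
  hull (half_rect x0 x1 y0 y1 s) p.
Proof.
move=> h; have [/andP[a b] /andP[c d] e] := h.
apply/hull_half_rect; [exact: lt_trans a b|exact: lt_trans c d|].
split; [by rewrite !ltW|by rewrite !ltW|].
by case: (s) e => /ltW.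
Qed.

Lemma hullD_edges (x0 x1 y0 y1 : R) s : x0 < x1 -> y0 < y1 ->
  hull (half_rect x0 x1 y0 y1 s) `\` edges x0 x1 y0 y1 = tri x0 x1 y0 y1 s.
Proof.
move=> hx hy; have P0 : 0 < x1 - x0 by lra.
have e (p : R * R) : (p.1 - x0) * (y1 - y0) + (p.2 - y0) * (x1 - x0) - (x1 - x0) * (y1 - y0) =
   (x1 - x0) * (p.2 - diag y0 y1 x0 x1 p.1) by rewrite /diag; field; lra.
apply/seteqP; split => p.
  move=> [/(hull_half_rect _ _ hx hy) [h1 h2 h3] hn].
  have hn' : [/\ p.1 - x0 <> 0, p.1 - x1 <> 0, p.2 - y0 <> 0, p.2 - y1 <> 0 &
     p.2 - diag y0 y1 x0 x1 p.1 <> 0].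
    by split=> k; apply: hn; rewrite /edges /=; tauto.
  case: hn' => k1 k2 k3 k4 k5.
  have := off_tri hx hy h1 h2 k1 k2 k3 k4 k5.
  case: ltP => hlt; case: s h3 => // h3 _; exfalso.
    by have := mulr_gt0 P0 hlt; rewrite -e subr_gt0 ltNge h3.
  by apply: k5; apply/eqP; rewrite eq_le hlt /= -(pmulr_rge0 _ P0) -e subr_ge0.
move=> h; split; first exact: tri_hull.
case: h => /andP[a b] /andP[c d] k; rewrite /edges /= => h.
have {h} : [\/ p.1 = x0, p.1 = x1, p.2 = y0 | p.2 = y1] \/ p.2 - diag y0 y1 x0 x1 p.1 = 0.
  case: h => [[h|h]|[[h|h]|h]]; [left; apply: Or41|left; apply: Or42|left; apply: Or43|left; apply: Or44|by right];
    by apply/eqP; rewrite -subr_eq0; apply/eqP.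
case=> [[]h|h]; move: a b c d k; rewrite ?h ?ltxx //.
move=> _ _ _ _; have := e p; rewrite h mulr0 => /eqP; rewrite subr_eq0 => /eqP ->.
by case: (s); rewrite ltxx.
Qed.

Lemma hull_integral (x0 x1 y0 y1 : R) s (F G : R * R -> R) : x0 < x1 -> y0 < y1 ->
  (forall p, tri x0 x1 y0 y1 s p -> F p = G p) ->
  \int[mu2]_(p in hull (half_rect x0 x1 y0 y1 s)) F p = J x0 x1 y0 y1 s G.
Proof.
move=> hx hy h; rewrite (Rintegral_off_negligible _ _ (negligible_edges x0 x1 y0 y1)) hullD_edges //.
by apply: eq_Rintegral => p; rewrite inE; exact: h.
Qed.

Section Global.
Variables (N : nat) (X Y : nat -> R).

Definition tri_of i j s := tri (X i) (X i.+1) (Y j) (Y j.+1) s.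
Definition JK i j s := J (X i) (X i.+1) (Y j) (Y j.+1) s.

Lemma tri_of_inj i j s i' j' s' p : mesh N X -> mesh N Y ->
  (i < N)%N -> (j < N)%N -> (i' < N)%N -> (j' < N)%N ->
  tri_of i j s p -> tri_of i' j' s' p -> [/\ i = i', j = j' & s = s'].
Proof.
move=> hX hY hi hj hi' hj' [a b c] [a' b' c'].
have ei := mesh_inj hX hi hi' a a'; have ej := mesh_inj hY hj hj' b b'.
split => //; move: c c'; rewrite ei ej; case: (s); case: (s') => // k1 k2;
  by have := lt_trans k1 k2; rewrite ltxx.
Qed.

Lemma tri_of_Omega i j s p : mesh N X -> mesh N Y -> (i < N)%N -> (j < N)%N ->
  tri_of i j s p -> Omega p.
Proof.
move=> hX hY hi hj [/andP[a b] /andP[c d] _].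
have [_ _ [k1 k2] [k3 k4]] := mesh_cell hX hY hi hj.
split; apply/andP; split; lra.
Qed.

(* The mesh skeleton is negligible: [F] may take junk values there, as the
   derivatives of piecewise linear functions do. *)
Lemma Omega_integral (F : R * R -> R) (G : nat -> nat -> bool -> R * R -> R) :
  mesh N X -> mesh N Y ->
  (forall i j s, (i < N)%N -> (j < N)%N -> continuous (G i j s)) ->
  (forall i j s p, (i < N)%N -> (j < N)%N -> tri_of i j s p -> F p = G i j s p) ->
  \int[mu2]_(p in Omega) F p = S3 N (fun i j s => JK i j s (G i j s)).
Proof.
move=> hX hY cG hF.
pose T (k : 'I_N * 'I_N * bool) := tri_of k.1.1 k.1.2 k.2.
pose U := \big[setU/set0]_(k <- enum {: 'I_N * 'I_N * bool}) T k.
have mT k : measurable (T k) by exact: measurable_tri.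
have mU (l : seq ('I_N * 'I_N * bool)) : measurable (\big[setU/set0]_(k <- l) T k).
  by apply: bigsetU_measurable.
have UE p : U p <-> exists i j s, [/\ (i < N)%N, (j < N)%N & tri_of i j s p].
  rewrite /U -bigcup_seq; split.
    by case=> -[[i j] s] _ h; exists i, j, s; split.
  case=> i [j [s [hi hj h]]]; exists (Ordinal hi, Ordinal hj, s) => //.
  by rewrite /= mem_enum.
(* The indices are left unbounded: a countable union of negligible sets is negligible. *)
pose E := \bigcup_i \bigcup_j edges (X i) (X i.+1) (Y j) (Y j.+1).
have nE : mu2.-negligible E.
  by apply: negligible_bigcup => i; apply: negligible_bigcup => j; exact: negligible_edges.
(* A point of the square lies in some half-open cell; if it is off all the lines of that cell, it
   lies in one of the two open halves. *)
have nZ : mu2.-negligible (Omega `\` U).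
  move: nE => [A [mA A0 EA]]; exists A; split => //; apply: subset_trans EA.
  move=> p [[/andP[a b] /andP[c d]] hU].
  have [i hi /andP[i1 i2]] := mesh_locate hX (introT andP (conj (ltW a) b)).
  have [j hj /andP[j1 j2]] := mesh_locate hY (introT andP (conj (ltW c) d)).
  exists i => //; exists j => //; apply: contrapT => hE; apply: hU; apply/UE.
  have [hx hy _ _] := mesh_cell hX hY hi hj.
  have hb1 : X i <= p.1 <= X i.+1 by rewrite i1 ltW.
  have hb2 : Y j <= p.2 <= Y j.+1 by rewrite j1 ltW.
  have hb (s : bool) : hull (half_rect (X i) (X i.+1) (Y j) (Y j.+1) s) p -> exists i j s, [/\ (i < N)%N, (j < N)%N & tri_of i j s p].
    by move=> hh; exists i, j, s; split => //; rewrite /tri_of -hullD_edges.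
  have [hs|hs] := leP ((X i.+1 - X i) * (Y j.+1 - Y j)) ((p.1 - X i) * (Y j.+1 - Y j) + (p.2 - Y j) * (X i.+1 - X i)).
    by apply: (hb true); apply/hull_half_rect.
  by apply: (hb false); apply/hull_half_rect => //; split => //; exact: ltW.
rewrite (Rintegral_off_negligible _ _ nZ).
have -> : Omega `\` (Omega `\` U) = U.
  apply/seteqP; split => p; first by move=> [h1 h2]; apply: contrapT => h3; exact: h2.
  move=> hU; split; last by move=> [].
  by have /UE [i [j [s [hi hj h]]]] := hU; exact: tri_of_Omega h.
have iG (k : 'I_N * 'I_N * bool) : mu2.-integrable (T k) (EFin \o F).
  have iT := @integrable_tri R (G k.1.1 k.1.2 k.2) (X k.1.1) (X k.1.1.+1) (Y k.1.2) (Y k.1.2.+1) k.2 (cG k.1.1 k.1.2 k.2 (ltn_ord _) (ltn_ord _)).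
  apply: (eq_integrable _ _ _ _ iT); first exact: measurable_tri.
  by move=> p; rewrite inE => h /=; rewrite (hF k.1.1 k.1.2 k.2).
rewrite /Rintegral integral_bigsetU_EFin //; last 3 first.
- exact: enum_uniq.
- apply/trivIsetP => -[[i j] s] [[i' j'] s'] _ _ hne; apply/seteqP; split => // p [/= h1 h2].
  have [e1 e2 e3] := tri_of_inj hX hY (ltn_ord i) (ltn_ord j) (ltn_ord i') (ltn_ord j') h1 h2.
  move/eqP: hne; apply; congr ((_, _), _) => //; exact: val_inj.
- elim: (enum _) => [|k l ih]; first by rewrite big_nil; exact: measurable_fun_set0.
  rewrite big_cons; apply/measurable_funU; [exact: mT|exact: mU|].
  by split => //; exact: measurable_int (iG k).
rewrite big_enum /= -sum_fine; last first.
  by move=> k _; apply: (integrable_fin_num _ (iG k)); exact: mT.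
rewrite /S3 pair_bigA /= pair_bigA /=; apply: eq_bigr => -[[i j] s] _ /=.
by rewrite /JK /J /Rintegral; congr fine; apply: eq_integral => p; rewrite inE => h; rewrite (hF i j s).
Qed.

End Global.
End IntegralDecomposition.

(** * The finite element space *)

Section IntegrationByParts.
Variable R : realType.
Notation mu := (@lebesgue_measure R).

(** [W] is continuous across the sides of the triangles: in each cell the contributions of the two
    halves on the diagonal cancel, those of the vertical sides telescope along a row, and the two
    ends vanish. *)
Lemma S3_ibp_x N (X Y : nat -> R) (W : R * R -> R) (Wx : nat -> nat -> bool -> R * R -> R) :
  mesh N X -> mesh N Y -> continuous W ->
  (forall i j s, (i < N)%N -> (j < N)%N -> continuous (Wx i j s)) ->
  (forall i j s p, (i < N)%N -> (j < N)%N -> tri_of X Y i j s p ->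
     is_derive p.1 1 (fun t => W (t, p.2)) (Wx i j s p)) ->
  (forall y : R, 0 <= y <= 1 -> W (0, y) = 0 /\ W (1, y) = 0) ->
  S3 N (fun i j s => JK X Y i j s (Wx i j s)) = 0.
Proof.
move=> hX hY cW cWx hd hb.
pose A j i := \int[mu]_(y in `[Y j, Y j.+1]) W (X i, y).
have cS i : continuous (fun y => W (X i, y)) by apply: (continuous_comp2 cW); cont.
rewrite S3_swap /S3; apply: big1 => j _.
have -> : \sum_(i < N) \sum_(s : bool) JK X Y i j s (Wx i j s) = \sum_(i < N) (A j i.+1 - A j i).
  apply: eq_bigr => i _; have [hx hy _ _] := mesh_cell hX hY (ltn_ord i) (ltn_ord j).
  have F s := @J_FTC_x R W (Wx i j s) (X i) (X i.+1) (Y j) (Y j.+1) s hx hy cW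
     (cWx i j s (ltn_ord i) (ltn_ord j)) (fun p => hd i j s p (ltn_ord i) (ltn_ord j)).
  rewrite big_bool /JK !F /lo /hi /A -!RintegralB //=.
    have cd : continuous (fun y => W (diag (X i) (X i.+1) (Y j) (Y j.+1) y, y)).
      by apply: (continuous_comp2 cW); [exact: continuous_diag|cont].
    rewrite -RintegralD //=.
    - by apply: eq_Rintegral => y _; ring.
    - by apply: integrable_segment; have := cS i.+1 => ?; cont.
    - by apply: integrable_segment; have := cS i => ?; cont.
  - exact: integrable_segment.
  - exact: integrable_segment.
rewrite mesh_sum /A; have [-> -> _] := hX.
have z c : c = 0 \/ c = 1 -> \int[mu]_(y in `[Y j, Y j.+1]) W (c, y) = 0.
  move=> hc; transitivity (\int[mu]_(y in `[Y j, Y j.+1]) (0 : R)).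
    apply: eq_Rintegral => y; rewrite inE /= in_itv /= => /andP[h1 h2].
    have /andP[k1 _] := mesh_itv hY (ltnW (ltn_ord j)); have /andP[_ k2] := mesh_itv hY (ltn_ord j).
    have [] := hb y; first by rewrite (le_trans k1 h1) (le_trans h2 k2).
    by case: hc => ->.
  by rewrite Rintegral_cst //= mul0r.
by rewrite !z ?subrr; auto.
Qed.

Lemma tri_of_swap (X Y : nat -> R) i j s p : tri_of X Y i j s p -> tri_of Y X j i s (p.2, p.1).
Proof. by case=> a b c; split => //=; case: s c => c; lra. Qed.

Lemma JK_swap (X Y : nat -> R) i j s G : continuous G ->
  JK X Y i j s G = JK Y X j i s (fun p => G (p.2, p.1)).
Proof. exact: J_swap. Qed.

Lemma S3_ibp_y N (X Y : nat -> R) (W : R * R -> R) (Wy : nat -> nat -> bool -> R * R -> R) :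
  mesh N X -> mesh N Y -> continuous W ->
  (forall i j s, (i < N)%N -> (j < N)%N -> continuous (Wy i j s)) ->
  (forall i j s p, (i < N)%N -> (j < N)%N -> tri_of X Y i j s p ->
     is_derive p.2 1 (fun t => W (p.1, t)) (Wy i j s p)) ->
  (forall x : R, 0 <= x <= 1 -> W (x, 0) = 0 /\ W (x, 1) = 0) ->
  S3 N (fun i j s => JK X Y i j s (Wy i j s)) = 0.
Proof.
move=> hX hY cW cWy hd hb; rewrite S3_swap.
rewrite (eq_S3 (G := fun i j s => JK Y X i j s (fun p => Wy j i s (p.2, p.1)))); last first.
  by move=> i j s hi hj; apply: JK_swap; exact: cWy.
apply: (@S3_ibp_x N Y X (fun p => W (p.2, p.1))) => //.
- exact: continuous_swap.
- by move=> i j s hi hj; apply: continuous_swap; exact: cWy.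
- by move=> i j s p hi hj /tri_of_swap h; exact: (hd j i s _ hj hi h).
Qed.

Lemma near_tri_x (x0 x1 y0 y1 : R) s p : tri x0 x1 y0 y1 s p ->
  \forall t \near p.1, tri x0 x1 y0 y1 s (t, p.2).
Proof.
case: p => x y h; have /= := @open_tri R x0 x1 y0 y1 s.
rewrite openE => /(_ _ h) hn.
have c : (fun t : R => (t, y)) @ x --> (x, y).
  exact: (@cvg_pair _ _ _ (nbhs x) (nbhs x) (nbhs y) _ _ _ _ _ (@continuous_idfun R x) (@continuous_const R _ y x)).
exact: (c _ hn).
Qed.

Lemma dx_tri (x0 x1 y0 y1 : R) s p (w W : R * R -> R) (d : R) : tri x0 x1 y0 y1 s p ->
  (forall q, tri x0 x1 y0 y1 s q -> w q = W q) ->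
  is_derive p.1 1 (fun t => W (t, p.2)) d ->
  is_derive p.1 1 (fun t => w (t, p.2)) d /\ dx w p = d.
Proof.
move=> hp hw hd.
have h : is_derive p.1 1 (fun t => w (t, p.2)) d.
  apply: near_eq_is_derive hd; apply: filterS (near_tri_x hp) => t ht.
  by rewrite hw.
by split => //; rewrite /dx derive1E derive_val.
Qed.

Lemma tri_swap (x0 x1 y0 y1 : R) s p : tri x0 x1 y0 y1 s p -> tri y0 y1 x0 x1 s (p.2, p.1).
Proof. by case=> a b c; split => //=; case: s c => c; lra. Qed.

Lemma dy_tri (x0 x1 y0 y1 : R) s p (w W : R * R -> R) (d : R) : tri x0 x1 y0 y1 s p ->
  (forall q, tri x0 x1 y0 y1 s q -> w q = W q) ->
  is_derive p.2 1 (fun t => W (p.1, t)) d ->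
  is_derive p.2 1 (fun t => w (p.1, t)) d /\ dy w p = d.
Proof.
move=> hp hw hd.
apply: (@dx_tri y0 y1 x0 x1 s (p.2, p.1) (fun q => w (q.2, q.1)) (fun q => W (q.2, q.1))) => //.
  exact: tri_swap.
by move=> q /tri_swap; exact: hw.
Qed.

End IntegrationByParts.

(** * A global formula for the nodal interpolant *)

Section Interpolant.
Variable R : realType.

Lemma clamp_ge1 (x : R) : 1 <= x -> clamp x = 1.
Proof. by move=> h; rewrite /clamp !ger0_norm; [field|lra|lra]. Qed.
Lemma clamp_le0 (x : R) : x <= 0 -> clamp x = 0.
Proof. by move=> h; rewrite /clamp !ler0_norm; [field|lra|lra]. Qed.

(** On the unit interval, the continuous piecewise linear map that sends the node [X i] to [i]. It
    turns the mesh into the integer grid, on which all nodal basis functions are translates of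
    [hat]. *)
Definition xi (N : nat) (X : nat -> R) (x : R) : R :=
  \sum_(i < N) clamp ((x - X i) / (X i.+1 - X i)).

Lemma continuous_sum (T : topologicalType) (I : Type) (r : seq I) (F : I -> T -> R) :
  (forall i, continuous (F i)) -> continuous (fun x => \sum_(i <- r) F i x).
Proof.
move=> cF; elim: r => [|i r ih].
  rewrite (_ : (fun x => _) = (fun=> 0)); first by cont.
  by apply/funext => x; rewrite big_nil.
rewrite (_ : (fun x => _) = (fun x => F i x + \sum_(j <- r) F j x)).
  by apply: (@continuous_add _ _ (F i)).
by apply/funext => x; rewrite big_cons.
Qed.

Lemma continuous_xi N X : continuous (xi N X).
Proof. by apply: continuous_sum => i; rewrite /clamp; cont. Qed.

Lemma xiE N X i x : mesh N X -> (i < N)%N -> X i <= x <= X i.+1 ->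
  xi N X x = i%:R + (x - X i) / (X i.+1 - X i).
Proof.
move=> hX hi /andP[h1 h2].
have pos k : (k < N)%N -> 0 < X k.+1 - X k by move=> hk; rewrite subr_gt0; case: hX => _ _; exact.
(* Summands of cells to the left of cell [i] equal 1 and those to the right equal 0; only cell [i]
   contributes a fraction. *)
have key n : (n <= N)%N -> \sum_(k < n) clamp ((x - X k) / (X k.+1 - X k)) =
   if (n <= i)%N then n%:R else i%:R + (x - X i) / (X i.+1 - X i).
  elim: n => [|n ih] hn; first by rewrite big_ord0.
  rewrite big_ord_recr /= (ih (ltnW hn)); have pn := pos n hn.
  case: (ltngtP n i) => [ni|ni|->].
  - rewrite clamp_ge1; first by rewrite -natr1.
    rewrite ler_pdivlMr // mul1r lerB //.
    by apply: le_trans h1; apply: (mesh_le hX) => //; exact: ltnW.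
  - rewrite clamp_le0 ?addr0 //.
    rewrite ler_pdivrMr // mul0r subr_le0.
    by apply: le_trans h2 _; apply: (mesh_le hX) => //; exact: ltnW.
  - rewrite clamp_id //; have pi := pos i hi.
    by apply/andP; split; [apply: divr_ge0; lra|rewrite ler_pdivrMr; lra].
by rewrite /xi key // leqNgt hi.
Qed.

Definition rmin (a b : R) : R := (a + b - `|a - b|) / 2.
Lemma rminE a b : a <= b -> rmin a b = a.
Proof. by move=> h; rewrite /rmin ler0_norm; [field|lra]. Qed.
Lemma rminC a b : rmin a b = rmin b a.
Proof. by rewrite /rmin distrC (addrC a). Qed.

Definition tent (s : R) : R := clamp (1 - `|s|).
(* The nodal basis function in index coordinates; the third factor cuts its
   support along the direction (1, -1) of the diagonals. *)
Definition hat (s t : R) : R := rmin (rmin (tent s) (tent t)) (tent (s + t)).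

Lemma tent_ge0 s : 0 <= tent s.
Proof. by have /andP[] := clamp_itv (1 - `|s|). Qed.
Lemma tent_pos s : 0 <= s <= 1 -> tent s = 1 - s.
Proof. by move=> /andP[a b]; rewrite /tent ger0_norm // clamp_id //; apply/andP; split; lra. Qed.
Lemma tent_neg s : -1 <= s <= 0 -> tent s = 1 + s.
Proof. by move=> /andP[a b]; rewrite /tent ler0_norm // clamp_id ?opprK //; apply/andP; split; lra. Qed.
Lemma tent_out s : 1 <= `|s| -> tent s = 0.
Proof. by move=> h; rewrite /tent clamp_le0 //; lra. Qed.

Lemma hat_out1 s t : 1 <= `|s| -> hat s t = 0.
Proof.
move=> h; rewrite /hat (tent_out h) (rminE (tent_ge0 t)).
by rewrite rminE //; exact: tent_ge0.
Qed.
Lemma hat_out2 s t : 1 <= `|t| -> hat s t = 0.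
Proof.
move=> h; rewrite /hat (tent_out h) (rminC (tent s)) (rminE (tent_ge0 s)).
by rewrite rminE //; exact: tent_ge0.
Qed.

Lemma hat_lower s t : 0 <= s -> 0 <= t -> s + t <= 1 ->
  [/\ hat s t = 1 - s - t, hat (s - 1) t = s, hat s (t - 1) = t & hat (s - 1) (t - 1) = 0].
Proof.
move=> s0 t0 st; rewrite /hat.
rewrite !(tent_pos (s := s)) ?(tent_pos (s := t)) ?(tent_neg (s := s - 1)) ?(tent_neg (s := t - 1));
  try (by apply/andP; split; lra).
rewrite (tent_pos (s := s + t)) ?(tent_neg (s := s - 1 + t)) ?(tent_neg (s := s + (t - 1))); try (by apply/andP; split; lra).
rewrite (tent_out (s := s - 1 + (t - 1))); last by rewrite ler0_norm; lra.
split.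
- rewrite rminC rminE; first by ring.
  by have [h|h] := leP s t; [rewrite rminC|]; rewrite rminE; lra.
- by rewrite (rminE (a := 1 + (s - 1))) ?rminE; lra.
- by rewrite (rminC (1 - s)) (rminE (a := 1 + (t - 1))) ?rminE; lra.
- rewrite rminC rminE //.
  by have [h|h] := leP s t; [|rewrite rminC]; rewrite rminE; lra.
Qed.

Lemma hat_upper s t : s <= 1 -> t <= 1 -> 1 <= s + t ->
  [/\ hat s t = 0, hat (s - 1) t = 1 - t, hat s (t - 1) = 1 - s & hat (s - 1) (t - 1) = s + t - 1].
Proof.
move=> s0 t0 st; rewrite /hat.
rewrite !(tent_pos (s := s)) ?(tent_pos (s := t)) ?(tent_neg (s := s - 1)) ?(tent_neg (s := t - 1));
  try (by apply/andP; split; lra).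
rewrite (tent_neg (s := s - 1 + (t - 1))) ?(tent_pos (s := s - 1 + t)) ?(tent_pos (s := s + (t - 1))); try (by apply/andP; split; lra).
rewrite (tent_out (s := s + t)); last by rewrite ger0_norm; lra.
split.
- rewrite rminC rminE //.
  by have [h|h] := leP s t; [rewrite rminC|]; rewrite rminE; lra.
- by rewrite (rminC (1 + (s - 1))) (rminE (a := 1 - t)) ?rminE; lra.
- by rewrite (rminE (a := 1 - s)) ?rminE; lra.
- rewrite rminC rminE; first by ring.
  by have [h|h] := leP s t; [|rewrite rminC]; rewrite rminE; lra.
Qed.

Lemma sum_two N i (f : nat -> R) : (i < N)%N -> (forall a, a != i -> a != i.+1 -> f a = 0) ->
  \sum_(a < N.+1) f a = f i + f i.+1.
Proof.
move=> hi h.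
have hi0 : (i < N.+1)%N by exact: ltnW.
have hi1 : (i.+1 < N.+1)%N by [].
rewrite (bigD1 (Ordinal hi0)) //= (bigD1 (Ordinal hi1)) /=; last first.
  by apply/eqP => /(congr1 val) /= /eqP; rewrite eqn_leq ltnn.
rewrite addrA big1 ?addr0 // => a /andP[h1 h2]; apply: h.
  by apply: contraNneq h1 => e; apply/eqP/val_inj.
by apply: contraNneq h2 => e; apply/eqP/val_inj.
Qed.

(** A single formula on the plane, so that continuity comes without gluing the elementwise linear
    functions. *)
Definition interp N (X Y : nat -> R) (u : R * R -> R) (p : R * R) : R :=
  \sum_(a < N.+1) \sum_(b < N.+1)
    u (X a, Y b) * hat (xi N X p.1 - a%:R) (xi N Y p.2 - b%:R).

Lemma continuous_interp N X Y u : continuous (interp N X Y u).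
Proof.
have c1 : continuous (fun p : R * R => xi N X p.1).
  by move=> p; exact: (cvg_comp _ _ (@continuous_fst' R p) (@continuous_xi N X _)).
have c2 : continuous (fun p : R * R => xi N Y p.2).
  by move=> p; exact: (cvg_comp _ _ (@continuous_snd' R p) (@continuous_xi N Y _)).
apply: continuous_sum => a; apply: continuous_sum => b.
by rewrite /hat /rmin /tent /clamp; cont.
Qed.

Lemma nat_dist (i a : nat) (x : R) : 0 <= x <= 1 -> a != i -> a != i.+1 ->
  1 <= `|i%:R + x - a%:R|.
Proof.
move=> /andP[x0 x1] h1 h2; have [h|h|h] := ltngtP a i; last by rewrite h eqxx in h1.
  have : (a%:R + 1 : R) <= i%:R by rewrite natr1 ler_nat.
  by move=> k; rewrite ger0_norm; lra.
have h' : (i.+2 <= a)%N by rewrite ltn_neqAle eq_sym h2.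
have : (i%:R + 1 + 1 : R) <= a%:R by rewrite !natr1 ler_nat.
by move=> k; rewrite ler0_norm; lra.
Qed.

Lemma interp_lin N X Y u i j s p : mesh N X -> mesh N Y -> (i < N)%N -> (j < N)%N ->
  hull (half_rect (X i) (X i.+1) (Y j) (Y j.+1) s) p ->
  interp N X Y u p = lin (X i) (X i.+1) (Y j) (Y j.+1) s u p.
Proof.
move=> hX hY hi hj; have [hx hy _ _] := mesh_cell hX hY hi hj.
move=> /(hull_half_rect _ _ hx hy) [hp1 hp2 hp3].
have /andP[a1 b1] := hp1; have /andP[a2 b2] := hp2.
rewrite /interp (xiE hX hi hp1) (xiE hY hj hp2).
have hX' : 0 < X i.+1 - X i by lra.
have hY' : 0 < Y j.+1 - Y j by lra.
have u0 : 0 <= (p.1 - X i) / (X i.+1 - X i) <= 1.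
  by apply/andP; split; [apply: divr_ge0; lra|rewrite ler_pdivrMr; lra].
have v0 : 0 <= (p.2 - Y j) / (Y j.+1 - Y j) <= 1.
  by apply/andP; split; [apply: divr_ge0; lra|rewrite ler_pdivrMr; lra].
have eu : p.1 - X i = (p.1 - X i) / (X i.+1 - X i) * (X i.+1 - X i) by rewrite divfK //; lra.
have ev : p.2 - Y j = (p.2 - Y j) / (Y j.+1 - Y j) * (Y j.+1 - Y j) by rewrite divfK //; lra.
move: (_ / (X i.+1 - X i)) (_ / (Y j.+1 - Y j)) u0 v0 eu ev => x y x01 y01 eu ev.
pose g a b := u (X a, Y b) * hat (i%:R + x - a%:R) (j%:R + y - b%:R).
(* A basis function vanishes as soon as one index coordinate is at distance at least 1 from its
   node; the four corners of the cell remain. *)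
rewrite (@sum_two N i (fun a => \sum_(b < N.+1) g a b) hi); last first.
  by move=> a h1 h2; rewrite big1 // => b _; rewrite /g hat_out1 ?mulr0 //; exact: nat_dist.
rewrite (@sum_two N j (g i) hj) ?(@sum_two N j (g i.+1) hj);
  try by move=> a h1 h2; rewrite /g hat_out2 ?mulr0 //; exact: nat_dist.
rewrite /g.
have e0 k (z : R) : k%:R + z - k%:R = z by ring.
have e1 k (z : R) : k%:R + z - k.+1%:R = z - 1 by rewrite -natr1; ring.
rewrite !e0 !e1.
have e3 : p.1 = X i + x * (X i.+1 - X i) by lra.
have e4 : p.2 = Y j + y * (Y j.+1 - Y j) by lra.
have K : 0 < (X i.+1 - X i) * (Y j.+1 - Y j) by apply: mulr_gt0.
have /andP[x0 x1] := x01; have /andP[y0 y1] := y01.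
rewrite /lin /edge /slope_x /slope_y; case: s hp3 => hp3 /=.
  have st : 1 <= x + y by rewrite -(ler_pM2r K); move: hp3; rewrite eu ev; lra.
  have [-> -> -> ->] := hat_upper x1 y1 st.
  by rewrite e3 e4; field; rewrite !gt_eqF.
have st : x + y <= 1 by rewrite -(ler_pM2r K); move: hp3; rewrite eu ev; lra.
have [-> -> -> ->] := hat_lower x0 y0 st.
by rewrite e3 e4; field; rewrite !gt_eqF.
Qed.

Lemma interp_boundary N X Y u : (0 < N)%N -> mesh N X -> mesh N Y ->
  (forall p, bOmega p -> u p = 0) -> forall p, bOmega p -> interp N X Y u p = 0.
Proof.
move=> N0 hX hY hu p hp.
have [eX0 eX1 mX] := hX; have [eY0 eY1 mY] := hY.
have hN : (N.-1 < N)%N by rewrite prednK.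
have xi0 Z : mesh N Z -> xi N Z 0 = 0.
  move=> hZ; have [z0 z1 mZ] := hZ; rewrite (@xiE N Z 0%N) // z0; first by rewrite subrr mul0r addr0.
  by rewrite lexx -z0 ltW // mZ.
have xi1 Z : mesh N Z -> xi N Z 1 = N%:R.
  move=> hZ; have [z0 z1 mZ] := hZ; have h := mZ _ hN.
  rewrite prednK // z1 in h.
  rewrite (@xiE N Z N.-1) // prednK // z1; last by rewrite lexx ltW.
  by rewrite divff; [rewrite natr1 prednK|rewrite subr_eq0 gt_eqF].
have far (a b : nat) : a != b -> 1 <= `|a%:R - b%:R : R|.
  move=> h; have [k|k|k] := ltngtP a b; last by rewrite k eqxx in h.
    have : (a%:R + 1 : R) <= b%:R by rewrite natr1 ler_nat.
    by move=> q; rewrite ler0_norm; lra.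
  have : (b%:R + 1 : R) <= a%:R by rewrite natr1 ler_nat.
  by move=> q; rewrite ger0_norm; lra.
have bd (x y : R) : 0 <= x <= 1 -> 0 <= y <= 1 -> [\/ x = 0, x = 1, y = 0 | y = 1] -> bOmega (x, y).
  move=> hx hy h; split; first by split.
  by move=> [/= /andP[a b] /andP[c d]]; case: h => e; move: a b c d; rewrite e ltxx.
have inX (a : 'I_N.+1) : 0 <= X a <= 1 by apply: (mesh_itv hX); rewrite -ltnS.
have inY (a : 'I_N.+1) : 0 <= Y a <= 1 by apply: (mesh_itv hY); rewrite -ltnS.
have hc : [\/ p.1 = 0, p.1 = 1, p.2 = 0 | p.2 = 1].
  case: hp => [[/andP[a b] /andP[c d]] hn].
  apply: contrapT => k; apply: hn.
  split; apply/andP; split; rewrite lt_neqAle ?a ?b ?c ?d andbT; apply/eqP => e; apply: k;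
    by [apply: Or41|apply: Or42|apply: Or43|apply: Or44].
rewrite /interp; apply: big1 => a _; apply: big1 => b _.
case: hc => e; rewrite e ?(xi0 X hX) ?(xi1 X hX) ?(xi0 Y hY) ?(xi1 Y hY).
- have [h|h] := eqVneq (a : nat) 0%N.
    by rewrite h eX0 hu ?mul0r //; apply: bd => //; [rewrite lexx ler01|apply: Or41].
  by rewrite hat_out1 ?mulr0 //; apply: (far 0%N); rewrite eq_sym.
- have [h|h] := eqVneq (a : nat) N.
    by rewrite h eX1 hu ?mul0r //; apply: bd => //; [rewrite lexx ler01|apply: Or42].
  by rewrite hat_out1 ?mulr0 //; apply: far; rewrite eq_sym.
- have [h|h] := eqVneq (b : nat) 0%N.
    by rewrite h eY0 hu ?mul0r //; apply: bd => //; [rewrite lexx ler01|apply: Or43].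
  by rewrite hat_out2 ?mulr0 //; apply: (far 0%N); rewrite eq_sym.
- have [h|h] := eqVneq (b : nat) N.
    by rewrite h eY1 hu ?mul0r //; apply: bd => //; [rewrite lexx ler01|apply: Or44].
  by rewrite hat_out2 ?mulr0 //; apply: far; rewrite eq_sym.
Qed.

End Interpolant.

(** * Linear algebra of elementwise integrals *)

Section PiecewiseIntegrals.
Variable R : realType.
Implicit Types F G : nat -> nat -> bool -> R * R -> R.

Definition cont3 F : Prop := forall i j s, continuous (F i j s).
Definition SJ (N : nat) (X Y : nat -> R) F : R :=
  S3 N (fun i j s => JK X Y i j s (F i j s)).

Section Algebra.
Variables (N : nat) (X Y : nat -> R).
Notation SJ := (SJ N X Y).

Lemma SJ_eq F G : (forall i j s p, (i < N)%N -> (j < N)%N -> tri_of X Y i j s p ->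
  F i j s p = G i j s p) -> SJ F = SJ G.
Proof. by move=> h; apply: eq_S3 => i j s hi hj; apply: J_eq => p hp; exact: h. Qed.

Lemma SJ_add F G : cont3 F -> cont3 G -> SJ (fun i j s p => F i j s p + G i j s p) = SJ F + SJ G.
Proof. by move=> cF cG; rewrite -S3_add; apply: eq_S3 => i j s _ _; apply: J_add. Qed.

Lemma SJ_sub F G : cont3 F -> cont3 G -> SJ (fun i j s p => F i j s p - G i j s p) = SJ F - SJ G.
Proof. by move=> cF cG; rewrite -S3_sub; apply: eq_S3 => i j s _ _; apply: J_sub. Qed.

Lemma SJ_scale a F : cont3 F -> SJ (fun i j s p => a * F i j s p) = a * SJ F.
Proof. by move=> cF; rewrite -S3_scale; apply: eq_S3 => i j s _ _; apply: J_scale. Qed.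

Lemma SJ_le F G : cont3 F -> cont3 G -> (forall i j s p, (i < N)%N -> (j < N)%N ->
  tri_of X Y i j s p -> F i j s p <= G i j s p) -> SJ F <= SJ G.
Proof. by move=> cF cG h; apply: S3_le => i j s hi hj; apply: J_le => // p; exact: h. Qed.

Lemma SJ_abs F G : cont3 F -> cont3 G -> (forall i j s p, (i < N)%N -> (j < N)%N ->
  tri_of X Y i j s p -> `|F i j s p| <= G i j s p) -> `|SJ F| <= SJ G.
Proof.
move=> cF cG h; apply: le_trans (S3_abs _ _) _; apply: S3_le => i j s hi hj.
by apply: J_abs => // p; exact: h.
Qed.

Lemma SJ_ge0 F : (forall i j s p, (i < N)%N -> (j < N)%N -> tri_of X Y i j s p ->
  0 <= F i j s p) -> 0 <= SJ F.
Proof. by move=> h; apply: S3_ge0 => i j s hi hj; apply: J_ge0 => p; exact: h. Qed.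

Lemma SJ_cauchy_schwarz (w : nat -> nat -> bool -> R) F G : cont3 F -> cont3 G ->
  (forall i j s, (i < N)%N -> (j < N)%N -> 0 <= w i j s) ->
  SJ (fun i j s p => w i j s * (F i j s p * G i j s p)) ^+ 2 <=
  SJ (fun i j s p => w i j s * F i j s p ^+ 2) * SJ (fun i j s p => w i j s * G i j s p ^+ 2).
Proof.
move=> cF cG w0; apply: discriminant.
  by apply: SJ_ge0 => i j s p hi hj _; apply: mulr_ge0; [exact: w0|exact: sqr_ge0].
move=> t.
have c1 : cont3 (fun i j s p => w i j s * F i j s p ^+ 2) by move=> i j s; have := cF i j s => c; cont.
have c2 : cont3 (fun i j s p => w i j s * G i j s p ^+ 2) by move=> i j s; have := cG i j s => c; cont.
have c3 : cont3 (fun i j s p => w i j s * (F i j s p * G i j s p)).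
  by move=> i j s; have := cF i j s => c; have := cG i j s => c'; cont.
rewrite [_ * t ^+ 2]mulrC -mulrA [SJ _ * t]mulrC mulrA -!SJ_scale // -SJ_sub; last 2 first.
- by move=> i j s; have := c1 i j s => c; cont.
- by move=> i j s; have := c3 i j s => c; cont.
rewrite -SJ_add //; last first.
  by move=> i j s; have := c1 i j s => c; have := c3 i j s => c'; cont.
apply: SJ_ge0 => i j s p hi hj _.
have -> : t ^+ 2 * (w i j s * F i j s p ^+ 2) - 2 * t * (w i j s * (F i j s p * G i j s p)) + w i j s * G i j s p ^+ 2
  = w i j s * (t * F i j s p - G i j s p) ^+ 2 by ring.
by apply: mulr_ge0; [exact: w0|exact: sqr_ge0].
Qed.

End Algebra.
End PiecewiseIntegrals.

(** * Finite element functions and inner products, element by element *)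

Section Forms.
Variable R : realType.
Notation mu := (@lebesgue_measure R).
Variables (P : problem R) (eps : R) (N : nat).
Notation X := (xpt P eps N).
Notation Y := (ypt P eps N).
Implicit Types v w : R * R -> R.

Definition gx v i j s := slope_x (X i) (X i.+1) v (edge (Y j) (Y j.+1) s).
Definition gy v i j s := slope_y (Y j) (Y j.+1) v (edge (X i) (X i.+1) s).
Definition vlin v i j s := lin (X i) (X i.+1) (Y j) (Y j.+1) s v.

Lemma vlinE v i j s p : vlin v i j s p =
  v (edge (X i) (X i.+1) s, edge (Y j) (Y j.+1) s) +
  (p.1 - edge (X i) (X i.+1) s) * gx v i j s + (p.2 - edge (Y j) (Y j.+1) s) * gy v i j s.
Proof. by []. Qed.

Lemma continuous_vlin v : cont3 (vlin v).
Proof. by move=> i j s; rewrite /vlin /lin; cont. Qed.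

Lemma vlin_dx v i j s (p : R * R) : is_derive p.1 1 (fun t => vlin v i j s (t, p.2)) (gx v i j s).
Proof.
rewrite /vlin /lin /gx /gy /=; apply: is_derive_eq.
by rewrite /GRing.scale /=; ring.
Qed.
Lemma vlin_dy v i j s (p : R * R) : is_derive p.2 1 (fun t => vlin v i j s (p.1, t)) (gy v i j s).
Proof.
rewrite /vlin /lin /gx /gy /=; apply: is_derive_eq.
by rewrite /GRing.scale /=; ring.
Qed.

Lemma vlin_sub v w i j s p : vlin (fun q => v q - w q) i j s p = vlin v i j s p - vlin w i j s p.
Proof. by rewrite /vlin /lin /slope_x /slope_y; ring. Qed.
Lemma gx_sub v w i j s : gx (fun q => v q - w q) i j s = gx v i j s - gx w i j s.
Proof. by rewrite /gx /slope_x; ring. Qed.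
Lemma gy_sub v w i j s : gy (fun q => v q - w q) i j s = gy v i j s - gy w i j s.
Proof. by rewrite /gy /slope_y; ring. Qed.

Hypotheses (hX : mesh N X) (hY : mesh N Y).

Lemma VN_sub v w : VN P eps N v -> VN P eps N w -> VN P eps N (fun p => v p - w p).
Proof.
move=> [cv pv bv] [cw pw bw]; split.
- by move=> p; apply: cvgB; [exact: cv|exact: cw].
- move=> i j s; have [a0 [a1 [a2 ha]]] := pv i j s; have [b0 [b1' [b2' hb]]] := pw i j s.
  exists (a0 - b0), (a1 - b1'), (a2 - b2') => p hp; rewrite ha // hb //; ring.
- by move=> p hp; rewrite bv // bw // subrr.
Qed.

Lemma VN_interp u : (0 < N)%N -> (forall p, bOmega p -> u p = 0) -> VN P eps N (interp N X Y u).
Proof.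
move=> N0 hu; split.
- exact: continuous_subspaceT (continuous_interp (N := N) (X := X) (Y := Y) (u := u)).
- move=> i j s; exists (vlin u i j s (0, 0)), (gx u i j s), (gy u i j s) => p hp.
  by rewrite (interp_lin u hX hY (ltn_ord i) (ltn_ord j) hp) -/(vlin u i j s p) !vlinE /=; ring.
- exact: interp_boundary.
Qed.

Lemma corner_hull i j s c d : (i < N)%N -> (j < N)%N -> c = X i \/ c = X i.+1 ->
  d = Y j \/ d = Y j.+1 -> (c, d) <> (if s then (X i, Y j) else (X i.+1, Y j.+1)) ->
  hull (elt P eps N i j s) (c, d).
Proof.
move=> hi hj hc hd hn; have [hx hy _ _] := mesh_cell hX hY hi hj.
have K : 0 <= (X i.+1 - X i) * (Y j.+1 - Y j) by apply: mulr_ge0; lra.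
apply/hull_half_rect => //=.
by case: hc hn => ->; case: hd => ->; case: (s) => /= hn;
  first [by case: hn | split; [by rewrite ?lexx ?ltW|by rewrite ?lexx ?ltW|lra]].
Qed.

Lemma VN_lin v i j s p : VN P eps N v -> (i < N)%N -> (j < N)%N ->
  hull (elt P eps N i j s) p -> v p = vlin v i j s p.
Proof.
move=> [_ pv _] hi hj hp; have [hx hy _ _] := mesh_cell hX hY hi hj.
have [a0 [a1 [a2 ha]]] := pv (Ordinal hi) (Ordinal hj) s.
have hne1 : X i <> X i.+1 by lra.
have hne2 : Y j <> Y j.+1 by lra.
have hc c d : c = X i \/ c = X i.+1 -> d = Y j \/ d = Y j.+1 ->
    (c, d) <> (if s then (X i, Y j) else (X i.+1, Y j.+1)) -> v (c, d) = a0 + a1 * c + a2 * d.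
  by move=> h1 h2 h3; apply: ha; exact: corner_hull.
rewrite ha // vlinE /gx /gy /slope_x /slope_y; move: hc; rewrite /edge; case: (s) => hc.
  by rewrite !hc; auto; [field; rewrite !gt_eqF ?subr_gt0|case..] => //; congruence.
by rewrite !hc; auto; [field; rewrite !gt_eqF ?subr_gt0|case..] => //; congruence.
Qed.

(** Continuous elementwise representatives of a function, its gradient and its Laplacian, valid in
    the open triangles. It treats finite element functions and the smooth solution in the same
    way. *)
Definition rep w (W Wx Wy Wl : nat -> nat -> bool -> R * R -> R) : Prop :=
  [/\ cont3 W, cont3 Wx, cont3 Wy, cont3 Wl &
    forall i j s p, (i < N)%N -> (j < N)%N -> tri_of X Y i j s p ->
    [/\ w p = W i j s p, dx w p = Wx i j s p, dy w p = Wy i j s p & lap w p = Wl i j s p]].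

Definition cst3 (g : nat -> nat -> bool -> R) i j s (p : R * R) := g i j s.
Lemma cont3_cst (g : nat -> nat -> bool -> R) : cont3 (cst3 g).
Proof. by move=> i j s; exact: continuous_const. Qed.

Lemma VN_rep v : VN P eps N v ->
  rep v (vlin v) (cst3 (gx v)) (cst3 (gy v)) (fun _ _ _ _ => 0 : R).
Proof.
move=> hv; split; [exact: continuous_vlin|exact: cont3_cst|exact: cont3_cst| |].
  by move=> i j s; exact: continuous_const.
move=> i j s p hi hj hp.
have hl q : tri_of X Y i j s q -> v q = vlin v i j s q.
  by move=> hq; apply: VN_lin => //; exact: tri_hull.
have hdx q : tri_of X Y i j s q -> dx v q = gx v i j s.
  by move=> hq; have [_ ->] := dx_tri hq hl (vlin_dx v i j s q).
have hdy q : tri_of X Y i j s q -> dy v q = gy v i j s.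
  by move=> hq; have [_ ->] := dy_tri hq hl (vlin_dy v i j s q).
split; [exact: hl|exact: hdx|exact: hdy|].
have dc1 (c : R) : is_derive p.1 1 (fun t : R => (fun=> c) (t, p.2)) 0 by exact: is_derive_cst.
have dc2 (c : R) : is_derive p.2 1 (fun t : R => (fun=> c) (p.1, t)) 0 by exact: is_derive_cst.
rewrite /lap; have [_ ->] := dx_tri (W := fun=> gx v i j s) hp hdx (dc1 _).
by have [_ ->] := dy_tri (W := fun=> gy v i j s) hp hdy (dc2 _); rewrite addr0.
Qed.

Lemma ip_Omega f g F G : cont3 F -> cont3 G ->
  (forall i j s p, (i < N)%N -> (j < N)%N -> tri_of X Y i j s p ->
    f p = F i j s p /\ g p = G i j s p) ->
  ip Omega f g = SJ N X Y (fun i j s p => F i j s p * G i j s p).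
Proof.
move=> cF cG h; rewrite /ip (Omega_integral (G := fun i j s p => F i j s p * G i j s p) hX hY) //.
  by move=> i j s _ _; have := cF i j s => c; have := cG i j s => c'; cont.
by move=> i j s p hi hj hp; have [-> ->] := h i j s p hi hj hp.
Qed.

Lemma ip_elt f g i j s F G : (i < N)%N -> (j < N)%N ->
  (forall p, tri_of X Y i j s p -> f p = F p /\ g p = G p) ->
  ip (hull (elt P eps N i j s)) f g = JK X Y i j s (fun p => F p * G p).
Proof.
move=> hi hj h; have [hx hy _ _] := mesh_cell hX hY hi hj.
rewrite /ip /elt (hull_integral (G := fun p => F p * G p)) //.
by move=> p hp; have [-> ->] := h p hp.
Qed.

Lemma ip_ge0 (D : set (R * R)) (f : R * R -> R) : 0 <= ip D f f.
Proof. by apply: Rintegral_ge0 => p _; rewrite -expr2 sqr_ge0. Qed.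

Lemma norm_eps_rep w W Wx Wy Wl : 0 <= eps -> 0 <= mu0 P -> rep w W Wx Wy Wl ->
  norm_eps P eps w ^+ 2 = eps * (SJ N X Y (fun i j s p => Wx i j s p ^+ 2) +
    SJ N X Y (fun i j s p => Wy i j s p ^+ 2)) + mu0 P * SJ N X Y (fun i j s p => W i j s p ^+ 2).
Proof.
move=> e0 m0 [c c1 c2 _ h]; rewrite /norm_eps.
rewrite sqr_sqrtr; last first.
  by apply: addr_ge0; apply: mulr_ge0 => //; exact: sqr_ge0.
have L2 (D : set (R * R)) (f : R * R -> R) : L2norm D f ^+ 2 = ip D f f by rewrite /L2norm; apply: sqr_sqrtr; exact: ip_ge0.
have -> : H1seminorm w ^+ 2 = ip Omega (dx w) (dx w) + ip Omega (dy w) (dy w).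
  rewrite /H1seminorm -!L2; apply: sqr_sqrtr.
  by apply: addr_ge0; exact: sqr_ge0.
rewrite L2.
rewrite (@ip_Omega w w _ _ c c); last first.
  by move=> i j s p hi hj /(h _ _ _ _ hi hj) [].
rewrite (@ip_Omega (dx w) (dx w) _ _ c1 c1); last first.
  by move=> i j s p hi hj /(h _ _ _ _ hi hj) [].
rewrite (@ip_Omega (dy w) (dy w) _ _ c2 c2); last first.
  by move=> i j s p hi hj /(h _ _ _ _ hi hj) [].
by congr (_ * (_ + _) + _ * _); apply: SJ_eq => i j s p _ _ _; rewrite expr2.
Qed.

End Forms.

(** * The bilinear form and the load as elementwise integrals *)

Section ErrorIdentity.
Variable R : realType.
Variables (P : problem R) (Cs eps : R) (N : nat) (dl : nat -> nat -> R).
Notation X := (xpt P eps N).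
Notation Y := (ypt P eps N).
Notation SJ := (SJ N X Y).
Notation B1 := (ext (b1 P)).
Notation B2 := (ext (b2 P)).
Notation Cc := (ext (creac P)).
Notation gx := (gx P eps N).
Notation gy := (gy P eps N).
Notation vlin := (vlin P eps N).
Implicit Types v w : R * R -> R.

Lemma tri_of_bar i j s p : mesh N X -> mesh N Y -> (i < N)%N -> (j < N)%N ->
  tri_of X Y i j s p -> Omega_bar p.
Proof.
move=> hX hY hi hj /(tri_of_Omega hX hY hi hj) [/andP[a b] /andP[c d]].
by split; rewrite !ltW.
Qed.

Definition bg (a b : R) (p : R * R) : R := B1 p * a + B2 p * b.

Lemma bgE a b p : bg a b p = B1 p * a + B2 p * b. Proof. by []. Qed.

Lemma bgradE w p : Omega_bar p -> bgrad P w p = bg (dx w p) (dy w p) p.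
Proof. by move=> h; rewrite /bgrad /bg !extE. Qed.

Lemma sum_eltsE (F : triangle R -> R) :
  sum_elts P eps N F = S3 N (fun i j s => F (elt P eps N i j s)).
Proof. by []. Qed.

(** The integrand of [aSD] on finite element functions: the Laplacian of [w] vanishes in each
    triangle, so diffusion is absent from the stabilization. *)
Definition sdform w v i j s p : R :=
  eps * (gx w i j s * gx v i j s + gy w i j s * gy v i j s) +
  (bg (gx w i j s) (gy w i j s) p + Cc p * vlin w i j s p) *
  (vlin v i j s p + dl i j * bg (gx v i j s) (gy v i j s) p).

Section Continuity.
Hypotheses (cB1 : continuous B1) (cB2 : continuous B2) (cC : continuous Cc).

Lemma continuous_bg_comp (a b : R * R -> R) : continuous a -> continuous b ->
  continuous (fun p => bg (a p) (b p) p).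
Proof. by move=> ca cb; rewrite /bg; have := cB1 => c1; have := cB2 => c2; cont. Qed.

Lemma continuous_bg a b : continuous (bg a b).
Proof. by rewrite /bg; have := cB1 => c1; have := cB2 => c2; cont. Qed.

Lemma cont3_sdform w v : cont3 (sdform w v).
Proof.
move=> i j s; rewrite /sdform; have c1 := @continuous_vlin R P eps N w i j s.
have c2 := @continuous_vlin R P eps N v i j s; have := cC => c3.
have c4 : continuous (bg (gx w i j s) (gy w i j s)) by exact: continuous_bg.
have c5 : continuous (bg (gx v i j s) (gy v i j s)) by exact: continuous_bg.
by cont.
Qed.
End Continuity.

Lemma aSD_VN w v : mesh N X -> mesh N Y -> continuous B1 -> continuous B2 -> continuous Cc ->
  (forall i j s, (i < N)%N -> (j < N)%N -> delta P Cs eps N (elt P eps N i j s) = dl i j) ->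
  VN P eps N w -> VN P eps N v -> aSD P Cs eps N w v = SJ (sdform w v).
Proof.
move=> hX hY cB1 cB2 cC hdl /(VN_rep hX hY) [c1 _ _ _ hw] /(VN_rep hX hY) [c1' _ _ _ hv].
have cb a b : continuous (bg a b) by exact: continuous_bg.
rewrite /aSD /aGal /astab sum_eltsE.
rewrite (ip_Omega (F := cst3 (gx w)) (G := cst3 (gx v)) hX hY); last 3 first.
- exact: cont3_cst.
- exact: cont3_cst.
- move=> i j s p hi hj hp; by have [_ -> _ _] := hw i j s p hi hj hp; have [_ -> _ _] := hv i j s p hi hj hp.
rewrite (ip_Omega (F := cst3 (gy w)) (G := cst3 (gy v)) hX hY); last 3 first.
- exact: cont3_cst.
- exact: cont3_cst.
- move=> i j s p hi hj hp; by have [_ _ -> _] := hw i j s p hi hj hp; have [_ _ -> _] := hv i j s p hi hj hp.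
pose L i j s p := bg (gx w i j s) (gy w i j s) p + Cc p * vlin w i j s p.
have cL : cont3 L.
  by move=> i j s; rewrite /L; have c2 := cb (gx w i j s) (gy w i j s); have c3 := c1 i j s; have := cC => c4; cont.
rewrite (ip_Omega (F := L) (G := vlin v) hX hY) //; last first.
  move=> i j s p hi hj hp; have hb := tri_of_bar hX hY hi hj hp.
  have [e0 e1 e2 _] := hw i j s p hi hj hp; have [e0' _ _ _] := hv i j s p hi hj hp.
  by rewrite (bgradE _ hb) e0 e1 e2 e0' /L !extE.
pose M i j s p := dl i j * bg (gx v i j s) (gy v i j s) p.
have cM : cont3 M.
  by move=> i j s; rewrite /M; have c2 := cb (gx v i j s) (gy v i j s); cont.
rewrite (eq_S3 (G := fun i j s => JK X Y i j s (fun p => L i j s p * M i j s p))); last first.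
  move=> i j s hi hj; apply: ip_elt => // p hp; have hb := tri_of_bar hX hY hi hj hp.
  have [e0 e1 e2 e3] := hw i j s p hi hj hp; have [_ e1' e2' _] := hv i j s p hi hj hp.
  by rewrite /Lop !(bgradE _ hb) e0 e1 e2 e3 e1' e2' hdl // /L /M !extE // mulr0 add0r.
rewrite -/(SJ _) -SJ_add; [|by move=> i j s; rewrite /cst3; cont|by move=> i j s; rewrite /cst3; cont].
rewrite -SJ_scale; last by move=> i j s; rewrite /cst3; cont.
have cLv : cont3 (fun i j s p => L i j s p * vlin v i j s p).
  by move=> i j s; have c2 := cL i j s; have c3 := c1' i j s; cont.
have cLM : cont3 (fun i j s p => L i j s p * M i j s p).
  by move=> i j s; have c2 := cL i j s; have c3 := cM i j s; cont.
rewrite -SJ_add //; last by move=> i j s; rewrite /cst3; cont.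
rewrite -SJ_add //; last by move=> i j s; rewrite /cst3; have c2 := cLv i j s; cont.
by apply: SJ_eq => i j s p _ _ _; rewrite /sdform /L /M /cst3; ring.
Qed.

Lemma norm_SD_VN v : mesh N X -> mesh N Y -> continuous B1 -> continuous B2 ->
  0 <= eps -> 0 <= mu0 P -> (forall i j, 0 <= dl i j) ->
  (forall i j s, (i < N)%N -> (j < N)%N -> delta P Cs eps N (elt P eps N i j s) = dl i j) ->
  VN P eps N v ->
  norm_SD P Cs eps N v ^+ 2 =
  eps * (SJ (fun i j s _ => gx v i j s ^+ 2) + SJ (fun i j s _ => gy v i j s ^+ 2)) +
  mu0 P * SJ (fun i j s p => vlin v i j s p ^+ 2) +
  SJ (fun i j s p => dl i j * bg (gx v i j s) (gy v i j s) p ^+ 2).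
Proof.
move=> hX hY cB1 cB2 e0 m0 dl0 hdl /(VN_rep hX hY) hr; have [_ _ _ _ hv] := hr.
have cb a b : continuous (bg a b) by exact: continuous_bg.
have e : sum_elts P eps N (fun K => delta P Cs eps N K * L2norm (hull K) (bgrad P v) ^+ 2) =
   SJ (fun i j s p => dl i j * bg (gx v i j s) (gy v i j s) p ^+ 2).
  rewrite sum_eltsE; apply: eq_S3 => i j s hi hj; rewrite hdl // /L2norm sqr_sqrtr ?ip_ge0 //.
  rewrite (@ip_elt R P eps N hX hY _ _ i j s (bg (gx v i j s) (gy v i j s)) (bg (gx v i j s) (gy v i j s)) hi hj).
    rewrite /JK J_scale; last by have c := cb (gx v i j s) (gy v i j s); cont.
    by congr (_ * _); apply: J_eq => p _; rewrite expr2.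
  move=> p hp; have hb := tri_of_bar hX hY hi hj hp.
  by have [_ e1 e2 _] := hv i j s p hi hj hp; rewrite (bgradE _ hb) e1 e2.
rewrite /norm_SD sqr_sqrtr.
  by rewrite (norm_eps_rep hX hY e0 m0 hr) e.
apply: addr_ge0; first exact: sqr_ge0.
rewrite e; apply: SJ_ge0 => i j s p _ _ _; apply: mulr_ge0 => //; exact: sqr_ge0.
Qed.

Lemma sm_rep u U : mesh N X -> mesh N Y -> sm 3 U ->
  (forall p, Omega_bar p -> u p = U 0%N 0%N p) ->
  rep P eps N u (fun _ _ _ => U 0%N 0%N) (fun _ _ _ => U 1%N 0%N) (fun _ _ _ => U 0%N 1%N)
    (fun _ _ _ p => U 2 0%N p + U 0%N 2 p).
Proof.
move=> hX hY hU hu; split.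
- by move=> i j s; exact: (sm_continuous hU).
- by move=> i j s; exact: (sm_continuous hU).
- by move=> i j s; exact: (sm_continuous hU).
- move=> i j s; have c1 := sm_continuous hU (isT : (2 + 0 <= 3)%N).
  by have c2 := sm_continuous hU (isT : (0 + 2 <= 3)%N); cont.
move=> i j s p hi hj hp.
have hl q : tri_of X Y i j s q -> u q = U 0%N 0%N q.
  by move=> hq; apply: hu; exact: tri_of_bar hq.
have [_ _ [x0 x1] [y0 y1]] := mesh_cell hX hY hi hj.
have Dx a b q : (a + b < 3)%N -> tri_of X Y i j s q -> is_derive q.1 1 (fun t => U a b (t, q.2)) (U a.+1 b q).
  by case: q => q1 q2 ab [/= h _ _]; exact: (sm_dx hU x0 x1).
have Dy a b q : (a + b < 3)%N -> tri_of X Y i j s q -> is_derive q.2 1 (fun t => U a b (q.1, t)) (U a b.+1 q).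
  by case: q => q1 q2 ab [/= _ h _]; exact: (sm_dy hU y0 y1).
have hdx q : tri_of X Y i j s q -> dx u q = U 1%N 0%N q.
  by move=> hq; have [_ ->] := dx_tri hq hl (Dx 0%N 0%N q isT hq).
have hdy q : tri_of X Y i j s q -> dy u q = U 0%N 1%N q.
  by move=> hq; have [_ ->] := dy_tri hq hl (Dy 0%N 0%N q isT hq).
split; [exact: hl|exact: hdx|exact: hdy|].
rewrite /lap; have [_ ->] := dx_tri hp hdx (Dx 1%N 0%N p isT hp).
by have [_ ->] := dy_tri hp hdy (Dy 0%N 1%N p isT hp).
Qed.

Definition source (U : nat -> nat -> R * R -> R) p : R :=
  - eps * (U 2 0%N p + U 0%N 2 p) + bg (U 1%N 0%N p) (U 0%N 1%N p) p + Cc p * U 0%N 0%N p.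

(** Consistency: the load is expressed through the exact solution, so that the discrete equation
    becomes an identity between two integrals over the same elements. *)
Lemma rhs_VN u U v : mesh N X -> mesh N Y -> continuous B1 -> continuous B2 -> continuous Cc ->
  (forall i j s, (i < N)%N -> (j < N)%N -> delta P Cs eps N (elt P eps N i j s) = dl i j) ->
  sm 3 U -> (forall p, Omega_bar p -> u p = U 0%N 0%N p) ->
  (forall p, Omega p -> Lop P eps u p = fsrc P p) ->
  VN P eps N v ->
  ip Omega (fsrc P) v + sum_elts P eps N (fun K =>
      ip (hull K) (fsrc P) (fun p => delta P Cs eps N K * bgrad P v p)) =
  SJ (fun i j s p => source U p * (vlin v i j s p + dl i j * bg (gx v i j s) (gy v i j s) p)).
Proof.
move=> hX hY cB1 cB2 cC hdl hU hu hf /(VN_rep hX hY) [c1 _ _ _ hv].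
have [_ _ _ _ hr] := sm_rep hX hY hU hu.
have cb a b : continuous (bg a b) by exact: continuous_bg.
have cS : continuous (source U).
  rewrite /source /bg; have k1 := sm_continuous hU (isT : (2 + 0 <= 3)%N).
  have k2 := sm_continuous hU (isT : (0 + 2 <= 3)%N); have k3 := sm_continuous hU (isT : (1 + 0 <= 3)%N).
  have k4 := sm_continuous hU (isT : (0 + 1 <= 3)%N); have k5 := sm_continuous hU (isT : (0 + 0 <= 3)%N).
  by cont.
have fE i j s p : (i < N)%N -> (j < N)%N -> tri_of X Y i j s p -> fsrc P p = source U p.
  move=> hi hj hp; have hb := tri_of_bar hX hY hi hj hp.
  rewrite -hf; last exact: (tri_of_Omega hX hY hi hj hp).
  by have [e0 e1 e2 e3] := hr i j s p hi hj hp; rewrite /Lop (bgradE _ hb) e0 e1 e2 e3 /source !extE.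
rewrite (ip_Omega (F := fun _ _ _ => source U) (G := vlin v) hX hY) //; last first.
  move=> i j s p hi hj hp; split; first exact: (fE i j s).
  by have [] := hv i j s p hi hj hp.
rewrite sum_eltsE.
rewrite (eq_S3 (G := fun i j s => JK X Y i j s (fun p => source U p * (dl i j * bg (gx v i j s) (gy v i j s) p)))); last first.
  move=> i j s hi hj; apply: ip_elt => // p hp; have hb := tri_of_bar hX hY hi hj hp.
  split; first exact: (fE i j s).
  by have [_ e1 e2 _] := hv i j s p hi hj hp; rewrite (bgradE _ hb) e1 e2 hdl.
rewrite -/(SJ _) -SJ_add.
- by apply: SJ_eq => i j s p _ _ _; ring.
- by move=> i j s; have c2 := c1 i j s; cont.
- by move=> i j s; have c2 := cb (gx v i j s) (gy v i j s); cont.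
Qed.

End ErrorIdentity.

(** * Galerkin orthogonality and the residual of the interpolation error *)

Section ErrorIdentity2.
Variable R : realType.
Variables (P : problem R) (Cs eps : R) (N : nat) (dl : nat -> nat -> R).
Notation X := (xpt P eps N).
Notation Y := (ypt P eps N).
Notation SJ := (SJ N X Y).
Notation B1 := (ext (b1 P)).
Notation B2 := (ext (b2 P)).
Notation Cc := (ext (creac P)).
Notation gx := (gx P eps N).
Notation gy := (gy P eps N).
Notation vlin := (vlin P eps N).
Notation bg := (bg P).
Implicit Types v w : R * R -> R.

Lemma eq_vlin v w i j s : (forall c d, c = X i \/ c = X i.+1 -> d = Y j \/ d = Y j.+1 ->
    (c, d) <> (if s then (X i, Y j) else (X i.+1, Y j.+1)) -> v (c, d) = w (c, d)) ->
  mesh N X -> mesh N Y -> (i < N)%N -> (j < N)%N ->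
  [/\ gx v i j s = gx w i j s, gy v i j s = gy w i j s & vlin v i j s = vlin w i j s].
Proof.
move=> h hX hY hi hj; have [hx hy _ _] := mesh_cell hX hY hi hj.
have hne1 : X i <> X i.+1 by lra.
have hne2 : Y j <> Y j.+1 by lra.
have e1 : gx v i j s = gx w i j s.
  by rewrite /gx /slope_x /edge; move: h; case: (s) => h; rewrite !h; auto; case; congruence.
have e2 : gy v i j s = gy w i j s.
  by rewrite /gy /slope_y /edge; move: h; case: (s) => h; rewrite !h; auto; case; congruence.
split => //; apply/funext => p; rewrite !vlinE e1 e2.
by rewrite /edge; move: h; case: (s) => h; rewrite !h; auto; case; congruence.
Qed.

Lemma vlin_vertex v i j s c d : mesh N X -> mesh N Y -> (i < N)%N -> (j < N)%N ->
  c = X i \/ c = X i.+1 -> d = Y j \/ d = Y j.+1 ->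
  (c, d) <> (if s then (X i, Y j) else (X i.+1, Y j.+1)) -> vlin v i j s (c, d) = v (c, d).
Proof.
move=> hX hY hi hj; have [hx hy _ _] := mesh_cell hX hY hi hj.
rewrite vlinE /gx /gy /slope_x /slope_y /edge; case=> ->; case=> ->; case: (s) => /= hn;
  by [case: hn | field; rewrite !gt_eqF ?subr_gt0].
Qed.

Lemma interp_vlin u i j s : mesh N X -> mesh N Y -> (i < N)%N -> (j < N)%N ->
  [/\ gx (interp N X Y u) i j s = gx u i j s, gy (interp N X Y u) i j s = gy u i j s &
   vlin (interp N X Y u) i j s = vlin u i j s].
Proof.
move=> hX hY hi hj; apply: eq_vlin => // c d hc hd hn.
rewrite (interp_lin u hX hY hi hj (s := s)); last exact: corner_hull hn.
exact: vlin_vertex.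
Qed.

Lemma bOmega_clamp_x (y : R) : bOmega (clamp 0, clamp y) /\ bOmega (clamp 1, clamp y).
Proof.
have h0 : clamp (0 : R) = 0 by rewrite clamp_id // lexx ler01.
have h1 : clamp (1 : R) = 1 by rewrite clamp_id // lexx ler01.
have hy := clamp_itv y.
by split; split; rewrite ?h0 ?h1; try (by split; rewrite //= lexx ler01); case=> /=; rewrite ltxx ?andbF.
Qed.
Lemma bOmega_clamp_y (x : R) : bOmega (clamp x, clamp 0) /\ bOmega (clamp x, clamp 1).
Proof.
have h0 : clamp (0 : R) = 0 by rewrite clamp_id // lexx ler01.
have h1 : clamp (1 : R) = 1 by rewrite clamp_id // lexx ler01.
have hy := clamp_itv x.
by split; split; rewrite ?h0 ?h1; try (by split; rewrite //= lexx ler01); case=> _ /=; rewrite ltxx ?andbF.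
Qed.

(** Integration by parts against [v], which vanishes on the boundary. It serves twice: with [A] a
    first derivative of the solution and [G = 1] for the diffusion, and with [A] a component of the
    convection field and [G] the interpolation error for the convection. *)
Lemma VN_ibp_x (A Ax G : R * R -> R) (Gx : nat -> nat -> bool -> R * R -> R)
    (g : nat -> nat -> bool -> R * R -> R) v :
  mesh N X -> mesh N Y -> continuous A -> continuous Ax -> continuous G -> cont3 Gx -> cont3 g ->
  (forall p : R * R, 0 < p.1 < 1 -> is_derive p.1 1 (fun t => A (t, p.2)) (Ax p)) ->
  (forall i j s p, (i < N)%N -> (j < N)%N -> tri_of X Y i j s p ->
     G p = g i j s p /\ is_derive p.1 1 (fun t => g i j s (t, p.2)) (Gx i j s p)) ->
  VN P eps N v ->
  SJ (fun i j s p => (Ax p * g i j s p + A p * Gx i j s p) * vlin v i j s p + A p * g i j s p * gx v i j s) = 0.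
Proof.
move=> hX hY cA cAx cG cGx cg hA hG hv; have [cv _ bv] := hv.
have cV := continuous_ext cv.
apply: (@S3_ibp_x R N X Y (fun p => A p * G p * ext v p)) => //.
- by cont.
- move=> i j s hi hj; have c1 := cGx i j s; have c2 := cg i j s; have c3 := @continuous_vlin R P eps N v i j s.
  by cont.
- move=> i j s p hi hj hp.
  have [_ dg] := hG i j s p hi hj hp.
  have hb : 0 < p.1 < 1 by have [] := tri_of_Omega hX hY hi hj hp.
  have dA := hA p hb; have dv := @vlin_dx R P eps N v i j s p.
  have dW : is_derive p.1 1 (fun t => A (t, p.2) * g i j s (t, p.2) * vlin v i j s (t, p.2))
    ((Ax p * g i j s p + A p * Gx i j s p) * vlin v i j s p + A p * g i j s p * gx v i j s).
    by case: p hp dg hb dA dv => x y hp dg hb dA dv; apply: is_derive_eq; rewrite /GRing.scale /=; ring.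
  have hW q : tri_of X Y i j s q -> A q * G q * ext v q = A q * g i j s q * vlin v i j s q.
    move=> hq; have [-> _] := hG i j s q hi hj hq.
    rewrite extE; last exact: (tri_of_bar hX hY hi hj hq).
    by rewrite (VN_lin hX hY hv hi hj (tri_hull hq)).
  by have [] := @dx_tri R _ _ _ _ s p (fun q => A q * G q * ext v q) (fun q => A q * g i j s q * vlin v i j s q) _ hp hW dW.
- move=> y _; have [h1 h2] := bOmega_clamp_x y.
  by rewrite /ext /= !bv // !mulr0.
Qed.

Lemma VN_ibp_y (A Ay G : R * R -> R) (Gy : nat -> nat -> bool -> R * R -> R)
    (g : nat -> nat -> bool -> R * R -> R) v :
  mesh N X -> mesh N Y -> continuous A -> continuous Ay -> continuous G -> cont3 Gy -> cont3 g ->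
  (forall p : R * R, 0 < p.2 < 1 -> is_derive p.2 1 (fun t => A (p.1, t)) (Ay p)) ->
  (forall i j s p, (i < N)%N -> (j < N)%N -> tri_of X Y i j s p ->
     G p = g i j s p /\ is_derive p.2 1 (fun t => g i j s (p.1, t)) (Gy i j s p)) ->
  VN P eps N v ->
  SJ (fun i j s p => (Ay p * g i j s p + A p * Gy i j s p) * vlin v i j s p + A p * g i j s p * gy v i j s) = 0.
Proof.
move=> hX hY cA cAy cG cGy cg hA hG hv; have [cv _ bv] := hv.
have cV := continuous_ext cv.
apply: (@S3_ibp_y R N X Y (fun p => A p * G p * ext v p)) => //.
- by cont.
- move=> i j s hi hj; have c1 := cGy i j s; have c2 := cg i j s; have c3 := @continuous_vlin R P eps N v i j s.
  by cont.
- move=> i j s p hi hj hp.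
  have [_ dg] := hG i j s p hi hj hp.
  have hb : 0 < p.2 < 1 by have [] := tri_of_Omega hX hY hi hj hp.
  have dA := hA p hb; have dv := @vlin_dy R P eps N v i j s p.
  have dW : is_derive p.2 1 (fun t => A (p.1, t) * g i j s (p.1, t) * vlin v i j s (p.1, t))
    ((Ay p * g i j s p + A p * Gy i j s p) * vlin v i j s p + A p * g i j s p * gy v i j s).
    by case: p hp dg hb dA dv => x y hp dg hb dA dv; apply: is_derive_eq; rewrite /GRing.scale /=; ring.
  have hW q : tri_of X Y i j s q -> A q * G q * ext v q = A q * g i j s q * vlin v i j s q.
    move=> hq; have [-> _] := hG i j s q hi hj hq.
    rewrite extE; last exact: (tri_of_bar hX hY hi hj hq).
    by rewrite (VN_lin hX hY hv hi hj (tri_hull hq)).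
  by have [] := @dy_tri R _ _ _ _ s p (fun q => A q * G q * ext v q) (fun q => A q * g i j s q * vlin v i j s q) _ hp hW dW.
- move=> y _; have [h1 h2] := bOmega_clamp_y y.
  by rewrite /ext /= !bv // !mulr0.
Qed.

(** The integrand of the form at [I u - u] and [v] after the convection has been integrated by
    parts: the reaction coefficient becomes c - div b. In the stabilization eps times the Laplacian
    of [u] has a plus sign, because the interpolant has no Laplacian inside the triangles. *)
Definition residual (U T1 T2 : nat -> nat -> R * R -> R) u v i j s p : R :=
  eps * ((gx u i j s - U 1%N 0%N p) * gx v i j s + (gy u i j s - U 0%N 1%N p) * gy v i j s) +
  (Cc p - T1 1%N 0%N p - T2 0%N 1%N p) * ((vlin u i j s p - U 0%N 0%N p) * vlin v i j s p) -
  (vlin u i j s p - U 0%N 0%N p) * bg (gx v i j s) (gy v i j s) p +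
  dl i j * ((eps * (U 2 0%N p + U 0%N 2 p) +
     bg (gx u i j s - U 1%N 0%N p) (gy u i j s - U 0%N 1%N p) p +
     Cc p * (vlin u i j s p - U 0%N 0%N p)) * bg (gx v i j s) (gy v i j s) p).

Lemma error_identity u U T1 T2 uN : (0 < N)%N -> mesh N X -> mesh N Y ->
  sm 1 T1 -> sm 1 T2 -> T1 0%N 0%N = B1 -> T2 0%N 0%N = B2 -> continuous Cc ->
  (forall i j s, (i < N)%N -> (j < N)%N -> delta P Cs eps N (elt P eps N i j s) = dl i j) ->
  sm 3 U -> (forall p, Omega_bar p -> u p = U 0%N 0%N p) ->
  (forall p, Omega p -> Lop P eps u p = fsrc P p) ->
  (forall p, bOmega p -> u p = 0) -> SDFEM_solution P Cs eps N uN ->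
  let chi := (fun p => interp N X Y u p - uN p) in
  VN P eps N chi /\ aSD P Cs eps N chi chi = SJ (residual U T1 T2 u chi).
Proof.
move=> N0 hX hY hT1 hT2 e1 e2 cC hdl hU hu hf hb [hN hsol] chi.
have cT1 := sm_continuous hT1 (isT : (0 + 0 <= 1)%N).
have cT2 := sm_continuous hT2 (isT : (0 + 0 <= 1)%N).
have cT1x := sm_continuous hT1 (isT : (1 + 0 <= 1)%N).
have cT2y := sm_continuous hT2 (isT : (0 + 1 <= 1)%N).
have cB1 : continuous B1 by rewrite -e1.
have cB2 : continuous B2 by rewrite -e2.
have hI : VN P eps N (interp N X Y u) := VN_interp hX hY N0 hb.
have hchi : VN P eps N chi := VN_sub hI hN.
split => //.
have k0 := sm_continuous hU (isT : (0 + 0 <= 3)%N).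
have k1 := sm_continuous hU (isT : (1 + 0 <= 3)%N).
have k2 := sm_continuous hU (isT : (0 + 1 <= 3)%N).
have k3 := sm_continuous hU (isT : (2 + 0 <= 3)%N).
have k4 := sm_continuous hU (isT : (0 + 2 <= 3)%N).
have [_ dUx dUy] := hU; have [_ dT1 _] := hT1; have [_ _ dT2] := hT2.
have cI := @continuous_interp R N X Y u.
have cl : cont3 (vlin u) by exact: continuous_vlin.
have clc : cont3 (vlin chi) by exact: continuous_vlin.
have cbg a b : continuous (bg a b) by exact: continuous_bg.
have c1 (c : R) : continuous (fun _ : R * R => c) by exact: continuous_const.
have dc (x : R) : is_derive x 1 (fun _ : R => (1 : R)) 0 by exact: is_derive_cst.
(* [Z1] and [Z2] put the diffusion of [u] in weak form. *)
have Z1 : SJ (fun i j s p => (U 2 0%N p * 1 + U 1%N 0%N p * 0) * vlin chi i j s p + U 1%N 0%N p * 1 * gx chi i j s) = 0.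
  apply: (@VN_ibp_x (U 1%N 0%N) (U 2 0%N) (fun=> 1) (fun _ _ _ _ => 0) (fun _ _ _ _ => 1)) => //.
  by move=> p; exact: dUx.
have Z2 : SJ (fun i j s p => (U 0%N 2 p * 1 + U 0%N 1%N p * 0) * vlin chi i j s p + U 0%N 1%N p * 1 * gy chi i j s) = 0.
  apply: (@VN_ibp_y (U 0%N 1%N) (U 0%N 2) (fun=> 1) (fun _ _ _ _ => 0) (fun _ _ _ _ => 1)) => //.
  by move=> p; exact: dUy.
pose g i j s p := vlin u i j s p - U 0%N 0%N p.
pose G p := interp N X Y u p - U 0%N 0%N p.
have cg : cont3 g by move=> i j s; rewrite /g; have c2 := cl i j s; cont.
have cG : continuous G by rewrite /G; cont.
have hGg i j s p : (i < N)%N -> (j < N)%N -> tri_of X Y i j s p -> G p = g i j s p.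
  by move=> hi hj hp; rewrite /G /g (interp_lin u hX hY hi hj (tri_hull hp)).
(* [Z3] and [Z4] move the derivative of the convection term from the interpolation error to
   [chi]. *)
have Z3 : SJ (fun i j s p => (T1 1%N 0%N p * g i j s p + T1 0%N 0%N p * (gx u i j s - U 1%N 0%N p)) * vlin chi i j s p + T1 0%N 0%N p * g i j s p * gx chi i j s) = 0.
  apply: (@VN_ibp_x (T1 0%N 0%N) (T1 1%N 0%N) G (fun i j s p => gx u i j s - U 1%N 0%N p) g _ hX hY _ _ cG _ cg _ _ hchi).
  - exact: sm_continuous hT1 (isT : (0 + 0 <= 1)%N).
  - exact: sm_continuous hT1 (isT : (1 + 0 <= 1)%N).
  - by move=> i j s; cont.
  - by move=> p hp; exact: dT1.
  - move=> i j s p hi hj hp; split; first exact: hGg.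
    have h : 0 < p.1 < 1 by have [] := tri_of_Omega hX hY hi hj hp.
    have d1 := @vlin_dx R P eps N u i j s p; have d2 := dUx 0%N 0%N p isT h.
    by rewrite /g; apply: is_derive_eq.
have Z4 : SJ (fun i j s p => (T2 0%N 1%N p * g i j s p + T2 0%N 0%N p * (gy u i j s - U 0%N 1%N p)) * vlin chi i j s p + T2 0%N 0%N p * g i j s p * gy chi i j s) = 0.
  apply: (@VN_ibp_y (T2 0%N 0%N) (T2 0%N 1%N) G (fun i j s p => gy u i j s - U 0%N 1%N p) g) => //.
  - by move=> i j s; cont.
  - by move=> p hp; exact: dT2.
  - move=> i j s p hi hj hp; split; first exact: hGg.
    have h : 0 < p.2 < 1 by have [] := tri_of_Omega hX hY hi hj hp.
    have d1 := @vlin_dy R P eps N u i j s p; have d2 := dUy 0%N 0%N p isT h.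
    by rewrite /g; apply: is_derive_eq.
have E1 := aSD_VN hX hY cB1 cB2 cC hdl hchi hchi.
have E2 := aSD_VN hX hY cB1 cB2 cC hdl hN hchi.
have E3 := rhs_VN hX hY cB1 cB2 cC hdl hU hu hf hchi.
have E4 := hsol _ hchi.
pose S1 i j s p := (U 2 0%N p * 1 + U 1%N 0%N p * 0) * vlin chi i j s p + U 1%N 0%N p * 1 * gx chi i j s.
pose S2 i j s p := (U 0%N 2 p * 1 + U 0%N 1%N p * 0) * vlin chi i j s p + U 0%N 1%N p * 1 * gy chi i j s.
pose S3' i j s p := (T1 1%N 0%N p * g i j s p + T1 0%N 0%N p * (gx u i j s - U 1%N 0%N p)) * vlin chi i j s p + T1 0%N 0%N p * g i j s p * gx chi i j s.
pose S4 i j s p := (T2 0%N 1%N p * g i j s p + T2 0%N 0%N p * (gy u i j s - U 0%N 1%N p)) * vlin chi i j s p + T2 0%N 0%N p * g i j s p * gy chi i j s.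
pose F i j s p := source P eps U p * (vlin chi i j s p + dl i j * bg (gx chi i j s) (gy chi i j s) p).
have {}Z1 : SJ S1 = 0 := Z1. have {}Z2 : SJ S2 = 0 := Z2.
have {}Z3 : SJ S3' = 0 := Z3. have {}Z4 : SJ S4 = 0 := Z4.
have cS1 : cont3 S1 by move=> i j s; rewrite /S1; have c2 := clc i j s; cont.
have cS2 : cont3 S2 by move=> i j s; rewrite /S2; have c2 := clc i j s; cont.
have cS3 : cont3 S3' by move=> i j s; rewrite /S3'; have c2 := clc i j s; have c3 := cg i j s; cont.
have cS4 : cont3 S4 by move=> i j s; rewrite /S4; have c2 := clc i j s; have c3 := cg i j s; cont.
have cform : cont3 (sdform P eps N dl uN chi) by apply: cont3_sdform.
have cform' : cont3 (sdform P eps N dl chi chi) by apply: cont3_sdform.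
have cF : cont3 F.
  move=> i j s; rewrite /F /source; have c2 := clc i j s; have c3 := cbg (gx chi i j s) (gy chi i j s).
  have c4 : continuous (fun p => bg (U 1%N 0%N p) (U 0%N 1%N p) p) by exact: continuous_bg_comp.
  by cont.
rewrite E1; have E5 : SJ F = SJ (sdform P eps N dl uN chi) by rewrite -E2 E4 E3.
(* The four vanishing integrals are subtracted with these coefficients; what remains is a pointwise
   polynomial identity between the integrands. *)
have comb (A B F0 A1 A2 A3 A4 : nat -> nat -> bool -> R * R -> R) : cont3 A -> cont3 B ->
    cont3 F0 -> cont3 A1 -> cont3 A2 -> cont3 A3 -> cont3 A4 ->
    SJ (fun i j s p => (((A i j s p + B i j s p - F0 i j s p) -
      eps * A1 i j s p) - eps * A2 i j s p - A3 i j s p) - A4 i j s p) =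
    SJ A + SJ B - SJ F0 - eps * SJ A1 - eps * SJ A2 - SJ A3 - SJ A4.
  move=> q1 q2 q3 q4 q5 q6 q7.
  by rewrite !SJ_sub ?SJ_add ?SJ_scale // => i j s; have := q1 i j s; have := q2 i j s;
    have := q3 i j s; have := q4 i j s; have := q5 i j s; have := q6 i j s => r1 r2 r3 r4 r5 r6; cont.
have E6 := comb _ _ _ _ _ _ _ cform' cform cF cS1 cS2 cS3 cS4.
rewrite Z1 Z2 Z3 Z4 E5 !mulr0 !subr0 addrK in E6.
rewrite -E6; apply: SJ_eq => i j s p hi hj hp.
have [i1 i2 i3] := interp_vlin u s hX hY hi hj.
have g1 : gx chi i j s = gx u i j s - gx uN i j s by rewrite /chi gx_sub i1.
have g2 : gy chi i j s = gy u i j s - gy uN i j s by rewrite /chi gy_sub i2.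
have g3 : vlin chi i j s p = vlin u i j s p - vlin uN i j s p by rewrite /chi vlin_sub i3.
rewrite /sdform /F /S1 /S2 /S3' /S4 /residual /source /g !bgE e1 e2.
have -> : gx uN i j s = gx u i j s - gx chi i j s by rewrite g1; ring.
have -> : gy uN i j s = gy u i j s - gy chi i j s by rewrite g2; ring.
have -> : vlin uN i j s p = vlin u i j s p - vlin chi i j s p by rewrite g3; ring.
ring.
Qed.

End ErrorIdentity2.

(** * Layer functions on a Shishkin mesh *)

Section Layers.
Variable R : realType.
Implicit Types (D : nat -> nat -> R * R -> R).

(* [r] is [1 / N] and [tau] is [N^(-5/2)], the size of the layer functions [E]
   outside of the layers; [M] bounds all the steps and, relative to [eps], also
   those inside of the layers. *)
Definition params (eps r M tau : R) : Prop :=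
  [/\ 0 < eps, eps <= r, 0 < r <= 1, r <= M & 0 <= tau <= r * r].

(** [n] is the index of the transition point, the only interior node at which neighbouring steps may
    differ. The description applies to either direction, so that x and y can be exchanged in all
    estimates. *)
Definition steps (N n : nat) (eps r M tau : R) (E : R -> R) (X : nat -> R) : Prop :=
  [/\ mesh N X,
      forall i, (i < N)%N -> X i.+1 - X i <= M /\ X i.+1 - X i <= 2 * r,
      forall i, (i < N)%N -> if (i < n)%N then r <= X i.+1 - X i else X i.+1 - X i <= eps * M,
      forall i, (i.+1 < N)%N -> i.+1 != n -> X i.+2 - X i.+1 = X i.+1 - X i
    & forall x, [/\ 0 <= E x, x <= 1 -> E x <= 1 & forall i, (i < n)%N -> x <= X i.+1 -> E x <= tau]].

Definition layers (C eps : R) (E1 E2 : R -> R) DS D1 D2 D12 : Prop :=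
  [/\ [/\ sm 3 DS, sm 3 D1, sm 3 D2 & sm 3 D12],
      forall i j p, (i + j <= 3)%N -> Omega_bar p -> `|DS i j p| <= C,
      forall i j p, (i + j <= 3)%N -> Omega_bar p -> `|D1 i j p| <= C * eps^-1 ^+ i * E1 p.1,
      forall i j p, (i + j <= 3)%N -> Omega_bar p -> `|D2 i j p| <= C * eps^-1 ^+ j * E2 p.2
    & forall i j p, (i + j <= 3)%N -> Omega_bar p -> `|D12 i j p| <= C * eps^-1 ^+ (i + j) * (E1 p.1 * E2 p.2)].

Definition transp D i j (p : R * R) : R := D j i (p.2, p.1).

(** The exchange of the variables exchanges the two one-dimensional layers and keeps the other two
    components. *)
Lemma layers_swap C eps E1 E2 DS D1 D2 D12 : layers C eps E1 E2 DS D1 D2 D12 ->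
  layers C eps E2 E1 (transp DS) (transp D2) (transp D1) (transp D12).
Proof.
case=> -[s0 s1 s2 s3] h0 h1 h2 h3.
have sw (p : R * R) : Omega_bar p -> Omega_bar (p.2, p.1) by case.
split; first by split; exact: sm_swap.
- by move=> i j p ij /sw hp; apply: h0 => //; rewrite addnC.
- by move=> i j p ij /sw hp; apply: h2 => //; rewrite addnC.
- by move=> i j p ij /sw hp; apply: h1 => //; rewrite addnC.
- by move=> i j p ij /sw hp; rewrite addnC mulrC (mulrC (E2 _)) -mulrC; apply: h3 => //; rewrite addnC.
Qed.

Lemma mesh_bar N X Y i j p : mesh N X -> mesh N Y -> (i < N)%N -> (j < N)%N ->
  X i <= p.1 <= X i.+1 -> Y j <= p.2 <= Y j.+1 -> Omega_bar (p : R * R).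
Proof.
move=> hX hY hi hj /andP[a b] /andP[c d].
have [_ _ [k1 k2] [k3 k4]] := mesh_cell hX hY hi hj.
by split; apply/andP; split; lra.
Qed.

Section CellBounds.
Variables (N n : nat) (C eps r M tau : R) (E1 E2 : R -> R) (X Y : nat -> R).
Variables (DS D1 D2 D12 : nat -> nat -> R * R -> R).
Hypothesis hp : params eps r M tau.
Hypothesis hX : steps N n eps r M tau E1 X.
Hypothesis hY : steps N n eps r M tau E2 Y.
Hypothesis hL : layers C eps E1 E2 DS D1 D2 D12.
Notation ie := (eps^-1).
Notation bd i j := (bounded_on (X i) (X i.+1) (Y j) (Y j.+1)).

(** A bound of the layer function on the cell [i], see [decay_le]. *)
Definition layer_cut (i : nat) : R := if (i < n)%N then tau else 1.

Lemma decay_le i x E Z : steps N n eps r M tau E Z -> (i < N)%N -> x <= Z i.+1 -> 0 <= E x <= layer_cut i.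
Proof.
move=> [hm _ _ _ hE] hi hx; have [e0 e1 e2] := hE x; rewrite e0 /layer_cut.
case: ltnP => h; first exact: e2 hx.
by apply: e1; apply: le_trans hx _; have /andP[] := mesh_itv hm hi.
Qed.

Lemma C_ge0 : 0 <= C.
Proof.
have [_ h _ _ _] := hL; apply: le_trans (h 0%N 0%N (0, 0) isT _); first exact: normr_ge0.
by split; rewrite /= lexx ler01.
Qed.

Lemma ie_ge0 : 0 <= ie.
Proof. by have [e _ _ _ _] := hp; rewrite invr_ge0 ltW. Qed.

Lemma bd_S i j a b : (i < N)%N -> (j < N)%N -> (a + b <= 3)%N -> bd i j (DS a b) C.
Proof.
move=> hi hj ab p h1 h2; have [_ h _ _ _] := hL; apply: h => //.
by case: hX => mX _ _ _ _; case: hY => mY _ _ _ _; exact: (mesh_bar mX mY hi hj).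
Qed.
Lemma bd_1 i j a b : (i < N)%N -> (j < N)%N -> (a + b <= 3)%N -> bd i j (D1 a b) (C * ie ^+ a * layer_cut i).
Proof.
move=> hi hj ab p h1 h2; have [_ _ h _ _] := hL.
have hb : Omega_bar p by case: hX => mX _ _ _ _; case: hY => mY _ _ _ _; exact: (mesh_bar mX mY hi hj).
apply: le_trans (h a b p ab hb) _; apply: ler_wpM2l.
  by apply: mulr_ge0; [exact: C_ge0|apply: exprn_ge0; exact: ie_ge0].
by have /andP[_ k] := h1; have /andP[] := decay_le hX hi k.
Qed.
Lemma bd_2 i j a b : (i < N)%N -> (j < N)%N -> (a + b <= 3)%N -> bd i j (D2 a b) (C * ie ^+ b * layer_cut j).
Proof.
move=> hi hj ab p h1 h2; have [_ _ _ h _] := hL.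
have hb : Omega_bar p by case: hX => mX _ _ _ _; case: hY => mY _ _ _ _; exact: (mesh_bar mX mY hi hj).
apply: le_trans (h a b p ab hb) _; apply: ler_wpM2l.
  by apply: mulr_ge0; [exact: C_ge0|apply: exprn_ge0; exact: ie_ge0].
by have /andP[_ k] := h2; have /andP[] := decay_le hY hj k.
Qed.
Lemma bd_12 i j a b : (i < N)%N -> (j < N)%N -> (a + b <= 3)%N ->
  bd i j (D12 a b) (C * ie ^+ (a + b) * (layer_cut i * layer_cut j)).
Proof.
move=> hi hj ab p h1 h2; have [_ _ _ _ h] := hL.
have hb : Omega_bar p by case: hX => mX _ _ _ _; case: hY => mY _ _ _ _; exact: (mesh_bar mX mY hi hj).
apply: le_trans (h a b p ab hb) _; apply: ler_wpM2l.
  by apply: mulr_ge0; [exact: C_ge0|apply: exprn_ge0; exact: ie_ge0].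
have /andP[_ k1] := h1; have /andP[_ k2] := h2.
have /andP[a0 a1] := decay_le hX hi k1; have /andP[b0 b1] := decay_le hY hj k2.
exact: ler_pM.
Qed.

End CellBounds.
End Layers.

(** * Gradient errors of the two triangles at a horizontal edge *)

Section EdgeEstimate.
Variable R : realType.
Implicit Types (D : nat -> nat -> R * R -> R).

Definition add4 DS D1 D2 D12 i j (p : R * R) : R :=
  DS i j p + D1 i j p + D2 i j p + D12 i j p.

Lemma sm_add4 k DS D1 D2 D12 : sm k DS -> sm k D1 -> sm k D2 -> sm k D12 ->
  sm k (add4 DS D1 D2 D12).
Proof. by move=> h0 h1 h2 h3; apply: sm_add => //; apply: sm_add => //; apply: sm_add. Qed.

Lemma Xerr_add4 (x0 x1 y0 y1 : R) s DS D1 D2 D12 : sm 3 DS -> sm 3 D1 -> sm 3 D2 -> sm 3 D12 ->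
  Xerr x0 x1 y0 y1 s (add4 DS D1 D2 D12) =
  Xerr x0 x1 y0 y1 s DS + Xerr x0 x1 y0 y1 s D1 + Xerr x0 x1 y0 y1 s D2 + Xerr x0 x1 y0 y1 s D12.
Proof.
move=> h0 h1 h2 h3.
have c0 := sm_continuous h0 (isT : (1 + 0 <= 3)%N).
have c1 := sm_continuous h1 (isT : (1 + 0 <= 3)%N).
have c2 := sm_continuous h2 (isT : (1 + 0 <= 3)%N).
have c3 := sm_continuous h3 (isT : (1 + 0 <= 3)%N).
rewrite /Xerr {1}/add4 !J_add; try by cont.
by rewrite /slope_x /add4; ring.
Qed.

Section CellFacts.
Variables (N n : nat) (eps r M tau : R) (E : R -> R) (X : nat -> R).

Lemma step_facts i : params eps r M tau -> steps N n eps r M tau E X -> (i < N)%N ->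
  [/\ 0 < X i.+1 - X i, X i.+1 - X i <= M, X i.+1 - X i <= 2 * r,
      (i < n)%N -> r <= X i.+1 - X i & (n <= i)%N -> (X i.+1 - X i) * eps^-1 <= M].
Proof.
move=> [e0 _ _ _ _] [[_ _ mX] h1 h2 _ _] hi; have [a b] := h1 i hi; split => //.
- by rewrite subr_gt0 mX.
- by move=> k; have := h2 i hi; rewrite k.
- by move=> k; have := h2 i hi; rewrite ltnNge k /= => h; rewrite ler_pdivrMr // mulrC.
Qed.

Lemma param_facts : params eps r M tau ->
  [/\ 0 < eps^-1, 0 < M, 0 <= tau, tau <= M & tau <= M ^+ 2].
Proof.
move=> [e0 er /andP[r0 r1] rM /andP[t0 t1]].
have rr : r * r <= r by rewrite ler_piMr // ltW.
have M0 : 0 < M by exact: lt_le_trans rM.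
have rM2 : r * r <= M ^+ 2 by rewrite expr2; apply: ler_pM => //; exact: ltW.
by split; rewrite ?invr_gt0 //; lra.
Qed.
End CellFacts.

Section Bounds.
Variables (N n : nat) (C eps r M tau : R) (E1 E2 : R -> R) (X Y : nat -> R).
Variables (DS D1 D2 D12 : nat -> nat -> R * R -> R).
Hypothesis hp : params eps r M tau.
Hypothesis hX : steps N n eps r M tau E1 X.
Hypothesis hY : steps N n eps r M tau E2 Y.
Hypothesis hL : layers C eps E1 E2 DS D1 D2 D12.
Notation ie := (eps^-1).
Notation XE i j s D := (Xerr (X i) (X i.+1) (Y j) (Y j.+1) s D).
Notation A i j := ((X i.+1 - X i) * (Y j.+1 - Y j) / 2).
Notation b1 := (bd_1 hp hX hY hL).
Notation b2 := (bd_2 hp hX hY hL).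
Notation b12 := (bd_12 hp hX hY hL).
Notation bS := (bd_S hX hY hL).

Lemma steps_cell i j : (i < N)%N -> (j < N)%N -> cell (X i) (X i.+1) (Y j) (Y j.+1).
Proof. by move: hX hY => [mX _ _ _ _] [mY _ _ _ _]; exact: mesh_cell. Qed.

Lemma area_ge0 i j : (i < N)%N -> (j < N)%N -> 0 <= A i j.
Proof.
move=> hi hj; have [h0 _ _ _ _] := step_facts hp hX hi; have [k0 _ _ _ _] := step_facts hp hY hj.
by apply: divr_ge0 => //; apply: mulr_ge0; exact: ltW.
Qed.

Lemma XE_S i j s : (i < N)%N -> (j < N)%N -> `|XE i j s DS| <= A i j * (2 * C * M).
Proof.
move=> hi hj; have [[s0 _ _ _] _ _ _ _] := hL.
apply: le_trans (Xerr_le1 s (steps_cell hi hj) s0 (bS hi hj (isT : (2 + 0 <= 3)%N)) (bS hi hj (isT : (1 + 1 <= 3)%N))) _.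
apply: ler_wpM2l; first exact: area_ge0.
have [h0 h1 _ _ _] := step_facts hp hX hi; have [k0 k1 _ _ _] := step_facts hp hY hj.
by rewrite -mulrDl mulrAC; apply: ler_wpM2r; [exact: (C_ge0 hL)|lra].
Qed.

Lemma XE_2 i j s : (i < N)%N -> (j < N)%N -> `|XE i j s D2| <= A i j * (2 * C * M).
Proof.
move=> hi hj; have [[_ _ s0 _] _ _ _ _] := hL; have C0 := C_ge0 hL.
have [h0 h1 _ _ _] := step_facts hp hX hi; have [k0 k1 _ _ k2] := step_facts hp hY hj.
have [ie0 M0 t0 tM tM2] := param_facts hp.
have c20 := b2 hi hj (isT : (2 + 0 <= 3)%N); have c11 := b2 hi hj (isT : (1 + 1 <= 3)%N).
have c10 := b2 hi hj (isT : (1 + 0 <= 3)%N).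
move: c20 c11 c10; rewrite /layer_cut; case: (ltnP j n) => hjn c20 c11 c10.
  apply: le_trans (Xerr_le0 s (steps_cell hi hj) s0 c10) _.
  apply: ler_wpM2l; first exact: area_ge0.
  by rewrite expr0 mulr1 mulrA; apply: ler_wpM2l => //; lra.
apply: le_trans (Xerr_le1 s (steps_cell hi hj) s0 c20 c11) _.
apply: ler_wpM2l; first exact: area_ge0.
rewrite expr0 expr1 !mulr1.
have -> : (X i.+1 - X i) * C + (Y j.+1 - Y j) * (C * ie) = C * ((X i.+1 - X i) + (Y j.+1 - Y j) * ie) by ring.
have -> : 2 * C * M = C * (2 * M) by ring.
by apply: ler_wpM2l => //; have := k2 hjn; lra.
Qed.

(** On coarse cells the derivatives of a layer function still carry 1/eps, so only its values, of
    size [tau], are used. The division by a step of length at least [r] is affordable because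
    [tau <= r * r]. *)
Lemma coarse_le i j : (i < N)%N -> (j < N)%N -> (i < n)%N ->
  6 * (C * tau) / (X i.+1 - X i) <= 6 * C * M.
Proof.
move=> hi hj hin; have C0 := C_ge0 hL.
have [h0 h1 _ h2 _] := step_facts hp hX hi.
have [e0 er /andP[r0 r1] rM /andP[t0 t1]] := hp.
rewrite ler_pdivrMr // -!mulrA; apply: ler_wpM2l => //; apply: ler_wpM2l => //.
apply: le_trans t1 _; apply: ler_pM; [exact: ltW|exact: ltW|exact: rM|exact: h2].
Qed.

Lemma XE_1c i j s : (i < N)%N -> (j < N)%N -> (i < n)%N -> `|XE i j s D1| <= A i j * (6 * C * M).
Proof.
move=> hi hj hin; have [[_ s0 _ _] _ _ _ _] := hL.
have c := b1 hi hj (isT : (0 + 0 <= 3)%N); rewrite /layer_cut hin expr0 mulr1 in c.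
apply: le_trans (Xerr_le2 s (steps_cell hi hj) s0 c) _.
by apply: ler_wpM2l; [exact: area_ge0|exact: (coarse_le hi hj)].
Qed.

Lemma layer_cut_le1 k : 0 <= layer_cut n tau k <= 1.
Proof.
have [e0 er /andP[r0 r1] rM /andP[t0 t1]] := hp.
rewrite /layer_cut; case: ifP => _; last by rewrite ler01 lexx.
by rewrite t0 /=; apply: le_trans t1 _; rewrite mulr_ile1 // ltW.
Qed.

Lemma XE_12c i j s : (i < N)%N -> (j < N)%N -> (i < n)%N -> `|XE i j s D12| <= A i j * (6 * C * M).
Proof.
move=> hi hj hin; have [[_ _ _ s0] _ _ _ _] := hL.
have c := b12 hi hj (isT : (0 + 0 <= 3)%N); rewrite /= expr0 mulr1 in c.
have {}c : bounded_on (X i) (X i.+1) (Y j) (Y j.+1) (D12 0%N 0%N) (C * tau).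
  move=> p p1 p2; apply: le_trans (c p p1 p2) _; apply: ler_wpM2l; first exact: (C_ge0 hL).
  rewrite {1}/layer_cut hin; have /andP[_ k] := layer_cut_le1 j.
  by rewrite ler_piMr //; have [] := param_facts hp.
apply: le_trans (Xerr_le2 s (steps_cell hi hj) s0 c) _.
by apply: ler_wpM2l; [exact: area_ge0|exact: (coarse_le hi hj)].
Qed.

Lemma XE_1f i j s : (i < N)%N -> (j < N)%N -> (n <= i)%N -> `|XE i j s D1| <= A i j * (2 * C * (ie * M)).
Proof.
move=> hi hj hin; have [[_ s0 _ _] _ _ _ _] := hL; have C0 := C_ge0 hL.
have [h0 h1 _ _ h2] := step_facts hp hX hi; have [k0 k1 _ _ k2] := step_facts hp hY hj.
have [ie0 M0 t0 tM tM2] := param_facts hp.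
have c20 := b1 hi hj (isT : (2 + 0 <= 3)%N); have c11 := b1 hi hj (isT : (1 + 1 <= 3)%N).
rewrite /layer_cut ltnNge hin /= !mulr1 in c20 c11.
apply: le_trans (Xerr_le1 s (steps_cell hi hj) s0 c20 c11) _.
apply: ler_wpM2l; first exact: area_ge0.
have -> : (X i.+1 - X i) * (C * ie ^+ 2) + (Y j.+1 - Y j) * (C * ie ^+ 1) =
   C * ie * ((X i.+1 - X i) * ie + (Y j.+1 - Y j)) by ring.
have -> : 2 * C * (ie * M) = C * ie * (2 * M) by ring.
apply: ler_wpM2l; first by apply: mulr_ge0 => //; exact: ltW.
by have := h2 hin; lra.
Qed.

Lemma XE_12fc i j s : (i < N)%N -> (j < N)%N -> (n <= i)%N -> (j < n)%N ->
  `|XE i j s D12| <= A i j * (2 * C * (ie * M ^+ 2)).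
Proof.
move=> hi hj hin hjn; have [[_ _ _ s0] _ _ _ _] := hL; have C0 := C_ge0 hL.
have [ie0 M0 t0 tM tM2] := param_facts hp.
have c := b12 hi hj (isT : (1 + 0 <= 3)%N); rewrite /layer_cut ltnNge hin hjn /= mul1r in c.
apply: le_trans (Xerr_le0 s (steps_cell hi hj) s0 c) _.
apply: ler_wpM2l; first exact: area_ge0.
have -> : 2 * (C * ie ^+ (1 + 0) * tau) = 2 * C * ie * tau by ring.
have -> : 2 * C * (ie * M ^+ 2) = 2 * C * ie * M ^+ 2 by ring.
apply: ler_wpM2l => //.
by apply: mulr_ge0; [apply: mulr_ge0|exact: ltW].
Qed.

Lemma XE_12ff i j s : (i < N)%N -> (j < N)%N -> (n <= i)%N -> (n <= j)%N ->
  `|XE i j s D12| <= A i j * (2 * C * (ie * M)).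
Proof.
move=> hi hj hin hjn; have [[_ _ _ s0] _ _ _ _] := hL; have C0 := C_ge0 hL.
have [h0 h1 _ _ h2] := step_facts hp hX hi; have [k0 k1 _ _ k2] := step_facts hp hY hj.
have [ie0 M0 t0 tM tM2] := param_facts hp.
have c20 := b12 hi hj (isT : (2 + 0 <= 3)%N); have c11 := b12 hi hj (isT : (1 + 1 <= 3)%N).
rewrite /layer_cut !ltnNge hin hjn /= !mulr1 in c20 c11.
apply: le_trans (Xerr_le1 s (steps_cell hi hj) s0 c20 c11) _.
apply: ler_wpM2l; first exact: area_ge0.
have -> : (X i.+1 - X i) * (C * ie ^+ 2) + (Y j.+1 - Y j) * (C * ie ^+ 2) =
   C * ie * ((X i.+1 - X i) * ie + (Y j.+1 - Y j) * ie) by ring.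
have -> : 2 * C * (ie * M) = C * ie * (2 * M) by ring.
apply: ler_wpM2l; first by apply: mulr_ge0 => //; exact: ltW.
by have := h2 hin; have := k2 hjn; lra.
Qed.

Lemma pair_scalar (h k c3 c2 c1 : R) : 0 <= h -> 0 <= k -> 
  c3 * h ^+ 2 <= C * (ie * M ^+ 2) -> c2 * (h * k) <= C * (ie * M ^+ 2) -> c1 * k ^+ 2 <= C * (ie * M ^+ 2) ->
  h * k * (2 * h ^+ 2 * c3 + 2 * (h * k) * c2 + 4 * k ^+ 2 * c1) <= (h * k / 2 + h * k / 2) * (8 * C * (ie * M ^+ 2)).
Proof.
move=> h0 k0 a b c; have -> : h * k / 2 + h * k / 2 = h * k by field.
by apply: ler_wpM2l; [exact: mulr_ge0|lra].
Qed.

Lemma cell_pair i j : (i < N)%N -> (j.+1 < N)%N -> cell (X i) (X i.+1) (Y j) (Y j.+2).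
Proof.
move=> hi hj; have [hx hy ha hb] := steps_cell hi (ltnW hj); have [_ hy' _ hb'] := steps_cell hi hj.
by split => //; [exact: lt_trans hy hy'|case: hb => ? _; case: hb'].
Qed.

Lemma bounded_on_pair i j f c : (j.+1 < N)%N ->
  bounded_on (X i) (X i.+1) (Y j) (Y j.+1) f c ->
  bounded_on (X i) (X i.+1) (Y j.+1) (Y j.+2) f c ->
  bounded_on (X i) (X i.+1) (Y j) (Y j.+2) f c.
Proof.
move=> hj a b p h1 /andP[h2 h3]; have [h|h] := leP p.2 (Y j.+1).
  by apply: a => //; rewrite h2.
by apply: b => //; rewrite h3 ltW.
Qed.

(** Each derivative in x costs 1/eps and is matched by a fine step, itself at most [eps * M]. Of the
    three derivatives of [D1 0 0] that enter, each step absorbs one, which leaves [ie * M ^+ 2]. *)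
Lemma XE_1pair i j : (i < N)%N -> (j.+1 < N)%N -> (n <= i)%N -> j.+1 != n ->
  `|XE i j true D1 + XE i j.+1 false D1| <= (A i j + A i j.+1) * (8 * C * (ie * M ^+ 2)).
Proof.
move=> hi hj hin hne; have [[_ s0 _ _] _ _ _ _] := hL; have C0 := C_ge0 hL.
have hj' := ltnW hj; have [_ _ _ he _] := hY.
have {}he : Y j.+1 - Y j = Y j.+2 - Y j.+1 by rewrite he.
have [h0 h1 _ _ h2] := step_facts hp hX hi; have [k0 k1 _ _ _] := step_facts hp hY hj'.
have [ie0 M0 t0 tM tM2] := param_facts hp.
have c a b (ab : (a + b <= 3)%N) : bounded_on (X i) (X i.+1) (Y j) (Y j.+2) (D1 a b) (C * ie ^+ a).
  apply: bounded_on_pair => //.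
    by have := b1 hi hj' ab; rewrite /layer_cut ltnNge hin /= mulr1.
  by have := b1 hi hj ab; rewrite /layer_cut ltnNge hin /= mulr1.
apply: le_trans (Xerr_pair (cell_pair hi hj) he s0 (c 3 0%N isT) (c 2 1%N isT) (c 1%N 2 isT)) _.
rewrite -he; apply: pair_scalar; try exact: ltW.
- have -> : C * ie ^+ 3 * (X i.+1 - X i) ^+ 2 = C * (ie * ((X i.+1 - X i) * ie) ^+ 2) by ring.
  apply: ler_wpM2l => //; apply: ler_wpM2l; first exact: ltW.
  by rewrite ler_sqr ?nnegrE ?h2 //; [apply: mulr_ge0; exact: ltW|exact: ltW].
- have -> : C * ie ^+ 2 * ((X i.+1 - X i) * (Y j.+1 - Y j)) = C * (ie * (((X i.+1 - X i) * ie) * (Y j.+1 - Y j))) by ring.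
  apply: ler_wpM2l => //; apply: ler_wpM2l; first exact: ltW.
  by rewrite expr2; apply: ler_pM => //; [apply: mulr_ge0; exact: ltW|exact: ltW|exact: h2].
- rewrite expr1 -mulrA; apply: ler_wpM2l => //; apply: ler_wpM2l; first exact: ltW.
  by rewrite ler_sqr ?nnegrE //; exact: ltW.
Qed.

Lemma XE_12pair i j : (i < N)%N -> (j.+1 < N)%N -> (n <= i)%N -> (n <= j)%N ->
  `|XE i j true D12 + XE i j.+1 false D12| <= (A i j + A i j.+1) * (8 * C * (ie * M ^+ 2)).
Proof.
move=> hi hj hin hjn; have [[_ _ _ s0] _ _ _ _] := hL; have C0 := C_ge0 hL.
have hj' := ltnW hj; have [_ _ _ he _] := hY.
have hne : j.+1 != n by rewrite neq_ltn ltnS hjn orbT.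
have {}he : Y j.+1 - Y j = Y j.+2 - Y j.+1 by rewrite he.
have [h0 h1 _ _ h2] := step_facts hp hX hi; have [k0 k1 _ _ k2] := step_facts hp hY hj'.
have [ie0 M0 t0 tM tM2] := param_facts hp.
have c a b (ab : (a + b <= 3)%N) : bounded_on (X i) (X i.+1) (Y j) (Y j.+2) (D12 a b) (C * ie ^+ (a + b)).
  apply: bounded_on_pair => //.
    by have := b12 hi hj' ab; rewrite /layer_cut !ltnNge hin hjn /= !mulr1.
  by have := b12 hi hj ab; rewrite /layer_cut !ltnNge hin (leq_trans hjn (leqnSn _)) /= !mulr1.
apply: le_trans (Xerr_pair (cell_pair hi hj) he s0 (c 3 0%N isT) (c 2 1%N isT) (c 1%N 2 isT)) _.
have hh : 0 <= (X i.+1 - X i) * ie by apply: mulr_ge0; exact: ltW.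
have kk : 0 <= (Y j.+1 - Y j) * ie by apply: mulr_ge0; exact: ltW.
rewrite -he; apply: pair_scalar; try exact: ltW.
- have -> : C * ie ^+ (3 + 0) * (X i.+1 - X i) ^+ 2 = C * (ie * ((X i.+1 - X i) * ie) ^+ 2) by ring.
  apply: ler_wpM2l => //; apply: ler_wpM2l; first exact: ltW.
  by rewrite ler_sqr ?nnegrE ?h2 //; exact: ltW.
- have -> : C * ie ^+ (2 + 1) * ((X i.+1 - X i) * (Y j.+1 - Y j)) = C * (ie * (((X i.+1 - X i) * ie) * ((Y j.+1 - Y j) * ie))) by ring.
  apply: ler_wpM2l => //; apply: ler_wpM2l; first exact: ltW.
  by rewrite expr2; apply: ler_pM => //; [exact: h2|exact: k2].
- have -> : C * ie ^+ (1 + 2) * (Y j.+1 - Y j) ^+ 2 = C * (ie * ((Y j.+1 - Y j) * ie) ^+ 2) by ring.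
  apply: ler_wpM2l => //; apply: ler_wpM2l; first exact: ltW.
  by rewrite ler_sqr ?nnegrE ?k2 //; exact: ltW.
Qed.

(** The first term collects what is first order without the factor 1/eps: the components smooth in x
    everywhere, and all components left of the x layer. Inside that layer the pairing gives the
    second term, except on the row of edges [j.+1 = n], where the heights of the two triangles
    differ and one power of [M] is lost. *)
Lemma edge_estimate i j : (i < N)%N -> (j.+1 < N)%N ->
  `|XE i j true (add4 DS D1 D2 D12) + XE i j.+1 false (add4 DS D1 D2 D12)| <=
  (A i j + A i j.+1) * (C * (16 * M + (if (i < n)%N then 0 else 16 * (ie * M ^+ 2) +
     (if j.+1 == n then 4 * (ie * M) else 0)))).
Proof.
move=> hi hj; have hj' := ltnW hj; have [[s0 s1 s2 s3] _ _ _ _] := hL; have C0 := C_ge0 hL.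
have [ie0 M0 t0 tM tM2] := param_facts hp.
have a0 := area_ge0 hi hj'; have a1 := area_ge0 hi hj.
have CM : 0 <= C * M by apply: mulr_ge0 => //; exact: ltW.
have CieM : 0 <= C * (ie * M) by apply: mulr_ge0 => //; apply: mulr_ge0; exact: ltW.
have CM2 : 0 <= C * (ie * M ^+ 2).
  by apply: mulr_ge0 => //; apply: mulr_ge0; [exact: ltW|exact: sqr_ge0].
have tri2 (x y B B' B'' : R) : `|x| <= A i j * B -> `|y| <= A i j.+1 * B' -> B <= B'' -> B' <= B'' ->
    `|x + y| <= (A i j + A i j.+1) * B''.
  move=> p q b b'; apply: le_trans (ler_normD _ _) _; rewrite mulrDl; apply: lerD.
    by apply: le_trans p _; exact: ler_wpM2l.
  by apply: le_trans q _; exact: ler_wpM2l.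
have eS := tri2 _ _ _ _ _ (XE_S true hi hj') (XE_S false hi hj) (lexx _) (lexx _).
have e2 := tri2 _ _ _ _ _ (XE_2 true hi hj') (XE_2 false hi hj) (lexx _) (lexx _).
have [B1 [B2 [e1 e12 hB]]] : exists B1 B2, [/\
    `|XE i j true D1 + XE i j.+1 false D1| <= (A i j + A i j.+1) * B1,
    `|XE i j true D12 + XE i j.+1 false D12| <= (A i j + A i j.+1) * B2 &
    B1 + B2 <= C * (12 * M + (if (i < n)%N then 0 else 16 * (ie * M ^+ 2) +
     (if j.+1 == n then 4 * (ie * M) else 0)))].
  case: (ltnP i n) => hin.
    exists (6 * C * M), (6 * C * M); split.
    - by apply: tri2 (XE_1c true hi hj' hin) (XE_1c false hi hj hin) (lexx _) (lexx _).
    - by apply: tri2 (XE_12c true hi hj' hin) (XE_12c false hi hj hin) (lexx _) (lexx _).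
    - lra.
  case: eqP => hjn.
    have hjc : (j < n)%N by rewrite -hjn.
    have hjf : (n <= j.+1)%N by rewrite hjn.
    exists (2 * C * (ie * M)), (2 * C * (ie * M ^+ 2) + 2 * C * (ie * M)); split.
    - by apply: tri2 (XE_1f true hi hj' hin) (XE_1f false hi hj hin) (lexx _) (lexx _).
    - by apply: tri2 (XE_12fc true hi hj' hin hjc) (XE_12ff false hi hj hin hjf) _ _; lra.
    - lra.
  have hne : j.+1 != n by apply/eqP.
  exists (8 * C * (ie * M ^+ 2)), (8 * C * (ie * M ^+ 2)); split.
  - exact: XE_1pair.
  (* Below the transition line [D12] already carries the factor [tau], which replaces the
     pairing. *)
  - have [hjn'|hjn'] := leqP n j; first exact: XE_12pair.
    have hj2 : (j.+1 < n)%N by rewrite ltn_neqAle hne.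
    by apply: tri2 (XE_12fc true hi hj' hin hjn') (XE_12fc false hi hj hin hj2) _ _; lra.
  - lra.
rewrite !Xerr_add4 //.
set a := A i j + A i j.+1 in eS e2 e1 e12 *.
have aa : 0 <= a by exact: addr_ge0.
have := ler_wpM2l aa hB.
move: eS e2 e1 e12.
move: (XE i j true DS) (XE i j.+1 false DS) (XE i j true D1) (XE i j.+1 false D1).
move: (XE i j true D2) (XE i j.+1 false D2) (XE i j true D12) (XE i j.+1 false D12).
move: (if (i < n)%N then 0 else _) => T.
move=> c c' d d' x x' b b' eS e2 e1 e12 h.
have -> : x + b + c + d + (x' + b' + c' + d') = (x + x') + (c + c') + (b + b') + (d + d') by ring.
have n1 := ler_normD ((x + x') + (c + c') + (b + b')) (d + d').
have n2 := ler_normD ((x + x') + (c + c')) (b + b').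
have n3 := ler_normD (x + x') (c + c').
have -> : a * (C * (16 * M + T)) = a * (C * (12 * M + T)) + a * (2 * C * M) + a * (2 * C * M) by ring.
rewrite mulrDr in h; lra.
Qed.

End Bounds.
End EdgeEstimate.

(** * Pointwise errors of the linear interpolant of the decomposed solution *)

Section LayerEstimates.
Variable R : realType.
Implicit Types (D : nat -> nat -> R * R -> R).

Lemma lin_add4 (x0 x1 y0 y1 : R) s DS D1 D2 D12 p :
  lin x0 x1 y0 y1 s (add4 DS D1 D2 D12 0%N 0%N) p =
  lin x0 x1 y0 y1 s (DS 0%N 0%N) p + lin x0 x1 y0 y1 s (D1 0%N 0%N) p +
  lin x0 x1 y0 y1 s (D2 0%N 0%N) p + lin x0 x1 y0 y1 s (D12 0%N 0%N) p.
Proof. by rewrite /lin /slope_x /slope_y /add4; ring. Qed.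

Lemma mgrad_add4 (x0 x1 x2 y0 y1 y2 : R) s DS D1 D2 D12 p :
  mgrad x0 x1 x2 y0 y1 y2 s (add4 DS D1 D2 D12 0%N 0%N) p =
  mgrad x0 x1 x2 y0 y1 y2 s (DS 0%N 0%N) p + mgrad x0 x1 x2 y0 y1 y2 s (D1 0%N 0%N) p +
  mgrad x0 x1 x2 y0 y1 y2 s (D2 0%N 0%N) p + mgrad x0 x1 x2 y0 y1 y2 s (D12 0%N 0%N) p.
Proof. by rewrite /mgrad /qgrad /slope_x /add4; case: s; ring. Qed.

Lemma mval_add4 (x0 x1 x2 y0 y1 y2 : R) s DS D1 D2 D12 p :
  mval x0 x1 x2 y0 y1 y2 s (add4 DS D1 D2 D12 0%N 0%N) p =
  mval x0 x1 x2 y0 y1 y2 s (DS 0%N 0%N) p + mval x0 x1 x2 y0 y1 y2 s (D1 0%N 0%N) p +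
  mval x0 x1 x2 y0 y1 y2 s (D2 0%N 0%N) p + mval x0 x1 x2 y0 y1 y2 s (D12 0%N 0%N) p.
Proof. by rewrite /mval /qval /add4; case: s; ring. Qed.

Lemma norm4 (a b c d a' b' c' d' A B C D : R) : `|a - a'| <= A -> `|b - b'| <= B ->
  `|c - c'| <= C -> `|d - d'| <= D -> `|a + b + c + d - (a' + b' + c' + d')| <= A + B + C + D.
Proof.
move=> h1 h2 h3 h4.
have -> : a + b + c + d - (a' + b' + c' + d') = (a - a') + (b - b') + (c - c') + (d - d') by ring.
have n1 := ler_normD ((a - a') + (b - b') + (c - c')) (d - d').
have n2 := ler_normD ((a - a') + (b - b')) (c - c').
have n3 := ler_normD (a - a') (b - b').
lra.
Qed.

Lemma quad_le (C K h k c1 c2 c3 : R) : 0 <= C ->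
  c1 * h ^+ 2 <= C * K -> c2 * (h * k) <= C * K -> c3 * k ^+ 2 <= C * K ->
  h ^+ 2 * c1 + h * k * c2 + k ^+ 2 * c3 <= 3 * C * K.
Proof. move=> *; lra. Qed.

Lemma mul2_le (C a b K L : R) : 0 <= C -> 0 <= a -> a <= K -> 0 <= b -> b <= L -> C * (a * b) <= C * (K * L).
Proof. by move=> C0 a0 aK b0 bL; apply: ler_wpM2l => //; apply: ler_pM. Qed.

(* [e1] and [e2] are [1] or [1 / eps], according to whether the function has a
   layer in the corresponding direction. *)
Lemma scaled_le (h k h1 k1 K C c1 c2 c3 : R) (e1 e2 : R) :
  0 <= C -> 0 <= h1 <= K -> 0 <= k1 <= K -> h1 = h * e1 -> k1 = k * e2 ->
  c1 = C * e1 ^+ 2 -> c2 = C * (e1 * e2) -> c3 = C * e2 ^+ 2 ->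
  h ^+ 2 * c1 + h * k * c2 + k ^+ 2 * c3 <= 3 * C * K ^+ 2.
Proof.
move=> C0 /andP[a b] /andP[c d] eh ek -> -> ->; apply: quad_le => //.
- have -> : C * e1 ^+ 2 * h ^+ 2 = C * (h1 * h1) by rewrite eh; ring.
  by rewrite expr2; apply: mul2_le.
- have -> : C * (e1 * e2) * (h * k) = C * (h1 * k1) by rewrite eh ek; ring.
  by rewrite expr2; apply: mul2_le.
- have -> : C * e2 ^+ 2 * k ^+ 2 = C * (k1 * k1) by rewrite ek; ring.
  by rewrite expr2; apply: mul2_le.
Qed.

Section Bounds.
Variables (N n : nat) (C eps r M tau : R) (E1 E2 : R -> R) (X Y : nat -> R).
Variables (DS D1 D2 D12 : nat -> nat -> R * R -> R).
Hypothesis hp : params eps r M tau.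
Hypothesis hX : steps N n eps r M tau E1 X.
Hypothesis hY : steps N n eps r M tau E2 Y.
Hypothesis hL : layers C eps E1 E2 DS D1 D2 D12.
Notation ie := (eps^-1).
Notation b1 := (bd_1 hp hX hY hL).
Notation b2 := (bd_2 hp hX hY hL).
Notation b12 := (bd_12 hp hX hY hL).
Notation bS := (bd_S hX hY hL).
Notation inc i j p := (X i <= p.1 <= X i.+1 /\ Y j <= p.2 <= Y j.+1).
Notation li i j s D p := (lin (X i) (X i.+1) (Y j) (Y j.+1) s (D 0%N 0%N) p).
Notation cut := (layer_cut n tau).

Lemma lin_err_crude i j s D p B : (i < N)%N -> (j < N)%N -> inc i j p ->
  bounded_on (X i) (X i.+1) (Y j) (Y j.+1) (D 0%N 0%N) B ->
  `|D 0%N 0%N p - li i j s D p| <= 6 * B.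
Proof.
move=> hi hj [h1 h2] hB; have [hx hy _ _] := steps_cell hX hY hi hj.
have := hB p h1 h2; have := lin_le s hx hy hB h1 h2.
have := ler_normB (D 0%N 0%N p) (li i j s D p); lra.
Qed.

Lemma err_S i j s p K : (i < N)%N -> (j < N)%N -> inc i j p ->
  X i.+1 - X i <= K -> Y j.+1 - Y j <= K ->
  `|DS 0%N 0%N p - li i j s DS p| <= 6 * C * K ^+ 2.
Proof.
move=> hi hj [h1 h2] hK kK; have [[s0 _ _ _] _ _ _ _] := hL; have C0 := C_ge0 hL.
have [h0 _ _ _ _] := step_facts hp hX hi; have [k0 _ _ _ _] := step_facts hp hY hj.
apply: le_trans (lin_err s (steps_cell hX hY hi hj) s0 (bS hi hj (isT : (2 + 0 <= 3)%N))
  (bS hi hj (isT : (1 + 1 <= 3)%N)) (bS hi hj (isT : (0 + 2 <= 3)%N)) h1 h2) _.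
have -> : 6 * C * K ^+ 2 = 2 * (3 * C * K ^+ 2) by ring.
apply: ler_wpM2l => //; apply: (scaled_le (h1 := X i.+1 - X i) (k1 := Y j.+1 - Y j) (e1 := 1) (e2 := 1)) => //;
  try ring; by rewrite ?hK ?kK ltW.
Qed.

Lemma err_1 i j s p : (i < N)%N -> (j < N)%N -> inc i j p ->
  `|D1 0%N 0%N p - li i j s D1 p| <= if (i < n)%N then 6 * C * tau else 6 * C * M ^+ 2.
Proof.
move=> hi hj h; have [h1 h2] := h; have [[_ s0 _ _] _ _ _ _] := hL; have C0 := C_ge0 hL.
have [ie0 M0 t0 tM tM2] := param_facts hp.
have [h0 _ _ _ hf] := step_facts hp hX hi; have [k0 kM _ _ _] := step_facts hp hY hj.
case: (ltnP i n) => hin.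
  have -> : 6 * C * tau = 6 * (C * tau) by ring.
  apply: lin_err_crude => //; have := b1 hi hj (isT : (0 + 0 <= 3)%N).
  by rewrite /layer_cut hin expr0 mulr1.
have := b1 hi hj (isT : (2 + 0 <= 3)%N); have := b1 hi hj (isT : (1 + 1 <= 3)%N).
have := b1 hi hj (isT : (0 + 2 <= 3)%N); rewrite /layer_cut ltnNge hin /= !mulr1 => c02 c11 c20.
apply: le_trans (lin_err s (steps_cell hX hY hi hj) s0 c20 c11 c02 h1 h2) _.
have -> : 6 * C * M ^+ 2 = 2 * (3 * C * M ^+ 2) by ring.
apply: ler_wpM2l => //; apply: (scaled_le (h1 := (X i.+1 - X i) * ie) (k1 := Y j.+1 - Y j) (e1 := ie) (e2 := 1)) => //;
  try ring.
  by rewrite hf // andbT; apply: mulr_ge0; exact: ltW.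
by rewrite kM ltW.
Qed.

Lemma err_2 i j s p : (i < N)%N -> (j < N)%N -> inc i j p ->
  `|D2 0%N 0%N p - li i j s D2 p| <= if (j < n)%N then 6 * C * tau else 6 * C * M ^+ 2.
Proof.
move=> hi hj h; have [h1 h2] := h; have [[_ _ s0 _] _ _ _ _] := hL; have C0 := C_ge0 hL.
have [ie0 M0 t0 tM tM2] := param_facts hp.
have [h0 hM _ _ _] := step_facts hp hX hi; have [k0 _ _ _ kf] := step_facts hp hY hj.
case: (ltnP j n) => hjn.
  have -> : 6 * C * tau = 6 * (C * tau) by ring.
  apply: lin_err_crude => //; have := b2 hi hj (isT : (0 + 0 <= 3)%N).
  by rewrite /layer_cut hjn expr0 mulr1.
have := b2 hi hj (isT : (2 + 0 <= 3)%N); have := b2 hi hj (isT : (1 + 1 <= 3)%N).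
have := b2 hi hj (isT : (0 + 2 <= 3)%N); rewrite /layer_cut ltnNge hjn /= !mulr1 => c02 c11 c20.
apply: le_trans (lin_err s (steps_cell hX hY hi hj) s0 c20 c11 c02 h1 h2) _.
have -> : 6 * C * M ^+ 2 = 2 * (3 * C * M ^+ 2) by ring.
apply: ler_wpM2l => //; apply: (scaled_le (h1 := X i.+1 - X i) (k1 := (Y j.+1 - Y j) * ie) (e1 := 1) (e2 := ie)) => //;
  try ring.
  by rewrite hM ltW.
by rewrite kf // andbT; apply: mulr_ge0; exact: ltW.
Qed.

Lemma cut_le1' k : 0 <= cut k <= 1.
Proof. exact: layer_cut_le1 hp k. Qed.

Lemma err_12 i j s p : (i < N)%N -> (j < N)%N -> inc i j p ->
  `|D12 0%N 0%N p - li i j s D12 p| <=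
  if (i < n)%N || (j < n)%N then 6 * C * tau else 6 * C * M ^+ 2.
Proof.
move=> hi hj h; have [h1 h2] := h; have [[_ _ _ s0] _ _ _ _] := hL; have C0 := C_ge0 hL.
have [ie0 M0 t0 tM tM2] := param_facts hp.
have [h0 hM _ _ hf] := step_facts hp hX hi; have [k0 _ _ _ kf] := step_facts hp hY hj.
case: ifP => hc.
  have -> : 6 * C * tau = 6 * (C * tau) by ring.
  apply: lin_err_crude => // q q1 q2; apply: le_trans (b12 hi hj (isT : (0 + 0 <= 3)%N) q1 q2) _.
  rewrite expr0 mulr1; apply: ler_wpM2l => //.
  have /andP[ci0 ci1] := cut_le1' i; have /andP[cj0 cj1] := cut_le1' j.
  case/orP: hc => hc; [rewrite {1}/layer_cut hc|rewrite mulrC {1}/layer_cut hc].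
    by rewrite ler_piMr.
  by rewrite ler_piMr.
move/negbT: hc; rewrite negb_or -!leqNgt => /andP[hin hjn].
have := b12 hi hj (isT : (2 + 0 <= 3)%N); have := b12 hi hj (isT : (1 + 1 <= 3)%N).
have := b12 hi hj (isT : (0 + 2 <= 3)%N); rewrite /layer_cut !ltnNge hin hjn /= !mulr1 => c02 c11 c20.
apply: le_trans (lin_err s (steps_cell hX hY hi hj) s0 c20 c11 c02 h1 h2) _.
have -> : 6 * C * M ^+ 2 = 2 * (3 * C * M ^+ 2) by ring.
apply: ler_wpM2l => //; apply: (scaled_le (h1 := (X i.+1 - X i) * ie) (k1 := (Y j.+1 - Y j) * ie) (e1 := ie) (e2 := ie)) => //;
  try ring.
  by rewrite hf // andbT; apply: mulr_ge0; exact: ltW.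
by rewrite kf // andbT; apply: mulr_ge0; exact: ltW.
Qed.

Lemma lin_estimate i j s p : (i < N)%N -> (j < N)%N -> inc i j p ->
  `|add4 DS D1 D2 D12 0%N 0%N p - lin (X i) (X i.+1) (Y j) (Y j.+1) s (add4 DS D1 D2 D12 0%N 0%N) p| <= 24 * C * M ^+ 2.
Proof.
move=> hi hj h; have C0 := C_ge0 hL; have [ie0 M0 t0 tM tM2] := param_facts hp.
have [h0 hM _ _ _] := step_facts hp hX hi; have [k0 kM _ _ _] := step_facts hp hY hj.
have := norm4 (err_S s hi hj h hM kM) (err_1 s hi hj h) (err_2 s hi hj h) (err_12 s hi hj h).
rewrite lin_add4; move/le_trans; apply.
have CT : 6 * C * tau <= 6 * C * M ^+ 2 by apply: ler_wpM2l => //; lra.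
by case: (i < n)%N; case: (j < n)%N => /=; lra.
Qed.

(** On coarse cells the steps are at most [2 * r], which saves the logarithms contained in [M]. The
    convection term relies on this: there the streamline derivative of [chi] costs N^(1/2), and the
    square of [M] would leave the factor ln^2 N. *)
Lemma lin_estimate_coarse i j s p : (i < N)%N -> (j < N)%N -> (i < n)%N -> (j < n)%N -> inc i j p ->
  `|add4 DS D1 D2 D12 0%N 0%N p - lin (X i) (X i.+1) (Y j) (Y j.+1) s (add4 DS D1 D2 D12 0%N 0%N) p| <= 42 * C * r ^+ 2.
Proof.
move=> hi hj hin hjn h; have C0 := C_ge0 hL.
have [e0 er /andP[r0 r1] rM /andP[t0 t1]] := hp.
have [h0 _ hM _ _] := step_facts hp hX hi; have [k0 _ kM _ _] := step_facts hp hY hj.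
have := norm4 (err_S s hi hj h hM kM) (err_1 s hi hj h) (err_2 s hi hj h) (err_12 s hi hj h).
rewrite lin_add4 hin hjn /=; move/le_trans; apply.
have CT : 6 * C * tau <= 6 * C * r ^+ 2 by apply: ler_wpM2l; [lra|rewrite expr2].
by lra.
Qed.

Notation sl i j s D := (slope_x (X i) (X i.+1) (D 0%N 0%N) (edge (Y j) (Y j.+1) s)).

Lemma cell_bar i j p : (i < N)%N -> (j < N)%N -> inc i j p -> Omega_bar p.
Proof.
move=> hi hj [h1 h2]; case: hX => mX _ _ _ _; case: hY => mY _ _ _ _.
exact: (mesh_bar mX mY hi hj h1 h2).
Qed.

Lemma slope_coarse i j s D : (i < N)%N -> (j < N)%N -> (i < n)%N ->
  bounded_on (X i) (X i.+1) (Y j) (Y j.+1) (D 0%N 0%N) (C * tau) -> `|sl i j s D| <= 2 * C * r.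
Proof.
move=> hi hj hin hB; have C0 := C_ge0 hL.
have [h0 _ _ hr _] := step_facts hp hX hi; have [k0 _ _ _ _] := step_facts hp hY hj.
have [e0 er /andP[r0 r1] rM /andP[t0 t1]] := hp.
have ky : Y j <= Y j.+1 by rewrite -subr_ge0 ltW.
have kx : X i <= X i.+1 by rewrite -subr_ge0 ltW.
rewrite /slope_x normf_div (gtr0_norm h0) ler_pdivrMr //.
apply: le_trans (ler_normB _ _) _.
have e1 : `|D 0%N 0%N (X i.+1, edge (Y j) (Y j.+1) s)| <= C * tau.
  by apply: hB; rewrite /= ?lexx ?kx //; exact: edge_itv.
have e2 : `|D 0%N 0%N (X i, edge (Y j) (Y j.+1) s)| <= C * tau.
  by apply: hB; rewrite /= ?lexx ?kx //; exact: edge_itv.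
apply: le_trans (lerD e1 e2) _.
have : C * tau <= C * (r * (X i.+1 - X i)).
  apply: ler_wpM2l => //; apply: le_trans t1 _; apply: ler_wpM2l; [exact: ltW|exact: hr].
move: (X i.+1 - X i) => h; lra.
Qed.

(** The quantity [ie * E1 p.1] has no bound uniform in eps by these hypotheses; it is therefore kept
    as a function of [p] and integrated later. The slopes, in contrast, only use values of the layer
    functions. *)
Lemma slope_estimate i j s p : (i < N)%N -> (j < N)%N -> (i < n)%N -> (j < n)%N -> inc i j p ->
  `|sl i j s (add4 DS D1 D2 D12) - add4 DS D1 D2 D12 1%N 0%N p| <= C * (10 * r + 2 * (ie * E1 p.1)).
Proof.
move=> hi hj hin hjn h; have [h1 h2] := h; have C0 := C_ge0 hL; have hb := cell_bar hi hj h.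
have [ie0 M0 t0 tM tM2] := param_facts hp.
have [e0 er /andP[r0 r1] rM /andP[_ t1]] := hp.
have tr : tau <= r by apply: le_trans t1 _; rewrite ler_piMr // ltW.
have [h0 _ hr _ _] := step_facts hp hX hi; have [k0 _ kr _ _] := step_facts hp hY hj.
have [[s0 s1 s2 s3] _ g1 g2 g12] := hL.
have [hx hy [hx0 hx1] [hy0 hy1]] := steps_cell hX hY hi hj.
have hed := edge_itv s (ltW hy).
have eS : `|sl i j s DS - DS 1%N 0%N p| <= C * (4 * r).
  apply: le_trans (slope_x_err s0 hx hy hx0 hx1 hy0 hy1 (isT : ((0 + 0).+1 < 3)%N)
    (bS hi hj (isT : (2 + 0 <= 3)%N)) (bS hi hj (isT : (1 + 1 <= 3)%N)) h1 h2 hed) _.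
  by rewrite -mulrDl mulrC; apply: ler_wpM2l => //; lra.
have /andP[E10 _] := decay_le hX hi (proj2 (andP h1)).
have /andP[E20 E21] := decay_le hY hj (proj2 (andP h2)).
have E21' : E2 p.2 <= 1 by apply: le_trans E21 _; have /andP[] := cut_le1' j.
have e1 : `|sl i j s D1 - D1 1%N 0%N p| <= C * (2 * r + ie * E1 p.1).
  apply: le_trans (ler_normB _ _) _; rewrite mulrDr; apply: lerD.
    rewrite [C * _]mulrA (mulrC C); apply: slope_coarse => //.
    by have := b1 hi hj (isT : (0 + 0 <= 3)%N); rewrite /layer_cut hin expr0 mulr1.
  by rewrite mulrA; have := g1 1%N 0%N p isT hb; rewrite expr1.
have e2 : `|sl i j s D2 - D2 1%N 0%N p| <= C * (2 * r).
  have := b2 hi hj (isT : (1 + 0 <= 3)%N); rewrite /layer_cut hjn expr0 mulr1 => c10.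
  have q1 := slope_x_le s2 hx hx0 hx1 (isT : (0 + 0 < 3)%N) c10 hed; have q2 := c10 p h1 h2.
  apply: le_trans (ler_normB _ _) _.
  have : C * tau <= C * r by apply: ler_wpM2l.
  by move: q1 q2; lra.
have e12 : `|sl i j s D12 - D12 1%N 0%N p| <= C * (2 * r + ie * E1 p.1).
  apply: le_trans (ler_normB _ _) _; rewrite mulrDr; apply: lerD.
    rewrite [C * _]mulrA (mulrC C); apply: slope_coarse => // q q1 q2.
    apply: le_trans (b12 hi hj (isT : (0 + 0 <= 3)%N) q1 q2) _.
    rewrite expr0 mulr1; apply: ler_wpM2l => //; have /andP[cj0 cj1] := cut_le1' j.
    by rewrite {1}/layer_cut hin ler_piMr.
  apply: le_trans (g12 1%N 0%N p isT hb) _; rewrite -mulrA; apply: ler_wpM2l => //.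
  apply: ler_wpM2l; first by rewrite expr1 ltW.
  by rewrite ler_piMr.
have -> : sl i j s (add4 DS D1 D2 D12) = sl i j s DS + sl i j s D1 + sl i j s D2 + sl i j s D12.
  by rewrite /slope_x /add4; ring.
have := norm4 eS e1 e2 e12; rewrite /add4; move/le_trans; apply.
by move: (ie * E1 p.1) => z; lra.
Qed.

Lemma laplacian_estimate i j p : (i < N)%N -> (j < N)%N -> inc i j p ->
  `|eps * (add4 DS D1 D2 D12 2 0%N p + add4 DS D1 D2 D12 0%N 2 p)| <=
  C * (2 * r + 4 * (ie * E1 p.1) + 4 * (ie * E2 p.2)).
Proof.
move=> hi hj h; have [h1 h2] := h; have C0 := C_ge0 hL; have hb := cell_bar hi hj h.
have [ie0 M0 t0 tM tM2] := param_facts hp.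
have [e0 er /andP[r0 r1] rM /andP[_ t1]] := hp.
have [_ g0 g1 g2 g12] := hL.
have /andP[E10 E11] := decay_le hX hi (proj2 (andP h1)).
have /andP[E20 E21] := decay_le hY hj (proj2 (andP h2)).
have E21' : E2 p.2 <= 1 by apply: le_trans E21 _; have /andP[] := cut_le1' j.
have e1 : eps <= 1 by exact: le_trans r1.
have ie1 : 1 <= ie by rewrite invf_ge1.
have a1 := g0 2 0%N p isT hb; have a2 := g0 0%N 2 p isT hb.
have c1 := g1 2 0%N p isT hb; have c2 := g1 0%N 2 p isT hb.
have d1 := g2 2 0%N p isT hb; have d2 := g2 0%N 2 p isT hb.
have f1 := g12 2 0%N p isT hb; have f2 := g12 0%N 2 p isT hb.
rewrite expr0 mulr1 in c2 d1.
have en := mulfV (lt0r_neq0 e0).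
have w1 : eps * (C * ie ^+ 2 * E1 p.1) = C * (ie * E1 p.1).
  have -> : eps * (C * ie ^+ 2 * E1 p.1) = (eps * ie) * (C * (ie * E1 p.1)) by ring.
  by rewrite en mul1r.
have w2 : eps * (C * ie ^+ 2 * E2 p.2) = C * (ie * E2 p.2).
  have -> : eps * (C * ie ^+ 2 * E2 p.2) = (eps * ie) * (C * (ie * E2 p.2)) by ring.
  by rewrite en mul1r.
have w3 : eps * (C * ie ^+ 2 * (E1 p.1 * E2 p.2)) <= C * (ie * E1 p.1).
  have -> : eps * (C * ie ^+ 2 * (E1 p.1 * E2 p.2)) = (eps * ie) * (C * (ie * (E1 p.1 * E2 p.2))) by ring.
  rewrite en mul1r; apply: ler_wpM2l => //; apply: ler_wpM2l; first exact: ltW.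
  by rewrite ler_piMr.
have w4 (E : R) : 0 <= E -> eps * (C * E) <= C * (ie * E).
  move=> E0; rewrite mulrCA; apply: ler_wpM2l => //; apply: ler_wpM2r => //.
  exact: le_trans e1 ie1.
have w5 : eps * C <= C * r by rewrite mulrC; apply: ler_wpM2l.
have w4a := w4 _ E10; have w4b := w4 _ E20.
rewrite normrM (gtr0_norm e0) /add4.
have tri4 (x y z w : R) : `|x + y + z + w| <= `|x| + `|y| + `|z| + `|w|.
  have n1 := ler_normD (x + y + z) w; have n2 := ler_normD (x + y) z; have n3 := ler_normD x y.
  by move: n1 n2 n3; lra.
apply: le_trans (ler_wpM2l (ltW e0) (le_trans (ler_normD _ _) (lerD (tri4 _ _ _ _) (tri4 _ _ _ _)))) _.
have bnd : `|DS 2 0%N p| + `|D1 2 0%N p| + `|D2 2 0%N p| + `|D12 2 0%N p| +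
   (`|DS 0%N 2 p| + `|D1 0%N 2 p| + `|D2 0%N 2 p| + `|D12 0%N 2 p|) <=
   2 * C + C * ie ^+ 2 * E1 p.1 + C * E1 p.1 + C * ie ^+ 2 * E2 p.2 + C * E2 p.2 +
   2 * (C * ie ^+ 2 * (E1 p.1 * E2 p.2)).
  by move: a1 a2 c1 c2 d1 d2 f1 f2; lra.
apply: le_trans (ler_wpM2l (ltW e0) bnd) _.
rewrite !mulrDr w1 w2 [C * (4 * (ie * E1 _))]mulrCA [C * (4 * (ie * E2 _))]mulrCA.
have p1 : 0 <= C * (ie * E2 p.2) by apply: mulr_ge0 => //; apply: mulr_ge0 => //; exact: ltW.
move: w3 w4a w4b w5 p1; clear w1 w2 w4; move: (C * (ie * E1 p.1)) (C * (ie * E2 p.2)) => z w.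
move: (eps * (C * E1 p.1)) (eps * (C * E2 p.2)) => z' w'.
have -> : eps * (2 * (C * ie ^+ 2 * (E1 p.1 * E2 p.2))) = 2 * (eps * (C * ie ^+ 2 * (E1 p.1 * E2 p.2))) by ring.
move: (eps * (C * ie ^+ 2 * (E1 p.1 * E2 p.2))) => v.
move=> *; lra.
Qed.

End Bounds.
End LayerEstimates.

(** * Pointwise errors of the quadratic interpolant of the decomposed solution *)

Section MacroEstimates.
Variable R : realType.
Implicit Types (D : nat -> nat -> R * R -> R).

Section Bounds.
Variables (N n : nat) (C eps r M tau : R) (E1 E2 : R -> R) (X Y : nat -> R).
Variables (DS D1 D2 D12 : nat -> nat -> R * R -> R).
Hypothesis hp : params eps r M tau.
Hypothesis hX : steps N n eps r M tau E1 X.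
Hypothesis hY : steps N n eps r M tau E2 Y.
Hypothesis hL : layers C eps E1 E2 DS D1 D2 D12.
Variables i j : nat.
(** The middle nodes are not on the transition lines, so the macro cell does not straddle them and
    consists of four equal cells. *)
Hypotheses (hi : (i.+1 < N)%N) (hin : i.+1 != n) (hj : (j.+1 < N)%N) (hjn : j.+1 != n).
Notation ie := (eps^-1).
Notation bd := (bounded_on (X i) (X i.+2) (Y j) (Y j.+2)).
Notation cut := (layer_cut n tau).
Notation mg s D p := (mgrad (X i) (X i.+1) (X i.+2) (Y j) (Y j.+1) (Y j.+2) s (D 0%N 0%N) p).
Notation mv s D p := (mval (X i) (X i.+1) (X i.+2) (Y j) (Y j.+1) (Y j.+2) s (D 0%N 0%N) p).
Notation tr s p := (tri (X i) (X i.+2) (Y j) (Y j.+2) s p).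

Lemma layer_cutS k : k.+1 != n -> layer_cut n tau k.+1 = layer_cut n tau k.
Proof. by move=> h; rewrite /layer_cut; have -> : (k.+1 < n)%N = (k < n)%N by rewrite ltn_neqAle h. Qed.

Lemma macro_steps k E Z : steps N n eps r M tau E Z -> (k.+1 < N)%N -> k.+1 != n ->
  [/\ 0 < Z k.+2 - Z k, Z k.+2 - Z k <= 2 * M, Z k.+2 - Z k.+1 = Z k.+1 - Z k,
      (k < n)%N -> r <= Z k.+1 - Z k & (n <= k)%N -> (Z k.+2 - Z k) * ie <= 2 * M].
Proof.
move=> hZ hk hkn; have [a1 a2 _ a4 a5] := step_facts hp hZ (ltnW hk).
have [c1 c2 _ c4 c5] := step_facts hp hZ hk; have [_ _ _ e _] := hZ.
have -> : Z k.+2 - Z k = (Z k.+2 - Z k.+1) + (Z k.+1 - Z k) by ring.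
split; [lra|lra|exact: e|exact: a4|].
by move=> h; rewrite mulrDl; have := a5 h; have := c5 (leq_trans h (leqnSn _)); lra.
Qed.

Lemma macro_cell_steps : macro_cell (X i) (X i.+1) (X i.+2) (Y j) (Y j.+1) (Y j.+2).
Proof.
have [a1 _ a3 _ _] := macro_steps hX hi hin; have [b1 _ b3 _ _] := macro_steps hY hj hjn.
have [mX _ _ _ _] := hX; have [mY _ _ _ _] := hY.
have [_ _ [x1 _] [y1 _]] := mesh_cell mX mY (ltnW hi) (ltnW hj).
have [_ _ [_ x2] [_ y2]] := mesh_cell mX mY hi hj.
by split => //; split; [rewrite -subr_gt0|rewrite -subr_gt0|split|split].
Qed.

Lemma macro_point p : X i <= p.1 <= X i.+2 -> Y j <= p.2 <= Y j.+2 ->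
  [/\ Omega_bar p, 0 <= E1 p.1 <= cut i & 0 <= E2 p.2 <= cut j].
Proof.
move=> /andP[a1 a2] /andP[b1 b2].
have [[_ _ [x1 x2] [y1 y2]] _ _] := macro_cell_steps.
split; first by split; apply/andP; split; lra.
  by rewrite -(layer_cutS hin); apply: (decay_le hX hi).
by rewrite -(layer_cutS hjn); apply: (decay_le hY hj).
Qed.

Lemma bdm_S a b : (a + b <= 3)%N -> bd (DS a b) C.
Proof. by move=> ab p h1 h2; have [_ h _ _ _] := hL; have [hb _ _] := macro_point h1 h2; exact: h. Qed.

Lemma bdm_1 a b : (a + b <= 3)%N -> bd (D1 a b) (C * ie ^+ a * cut i).
Proof.
move=> ab p h1 h2; have [_ _ h _ _] := hL; have [hb /andP[_ e] _] := macro_point h1 h2.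
apply: le_trans (h a b p ab hb) _; apply: ler_wpM2l => //.
by apply: mulr_ge0; [exact: (C_ge0 hL)|apply: exprn_ge0; exact: (ie_ge0 hp)].
Qed.

Lemma bdm_2 a b : (a + b <= 3)%N -> bd (D2 a b) (C * ie ^+ b * cut j).
Proof.
move=> ab p h1 h2; have [_ _ _ h _] := hL; have [hb _ /andP[_ e]] := macro_point h1 h2.
apply: le_trans (h a b p ab hb) _; apply: ler_wpM2l => //.
by apply: mulr_ge0; [exact: (C_ge0 hL)|apply: exprn_ge0; exact: (ie_ge0 hp)].
Qed.

Lemma bdm_12 a b : (a + b <= 3)%N -> bd (D12 a b) (C * ie ^+ (a + b) * (cut i * cut j)).
Proof.
move=> ab p h1 h2; have [_ _ _ _ h] := hL; have [hb /andP[e0 e] /andP[d0 d]] := macro_point h1 h2.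
apply: le_trans (h a b p ab hb) _; apply: ler_wpM2l.
  by apply: mulr_ge0; [exact: (C_ge0 hL)|apply: exprn_ge0; exact: (ie_ge0 hp)].
exact: ler_pM.
Qed.

Lemma scaled_step h : 0 < h -> h <= 2 * M -> 0 <= h <= 2 * M.
Proof. by move=> a b; rewrite b ltW. Qed.

Lemma scaled_step_ie h : 0 < h -> h * ie <= 2 * M -> 0 <= h * ie <= 2 * M.
Proof. by move=> a b; rewrite b andbT mulr_ge0 ?(ie_ge0 hp) // ltW. Qed.

Lemma mgrad_coarse s p D : (i < n)%N -> tr s p -> bd (D 0%N 0%N) (C * tau) -> `|mg s D p| <= C * (12 * M).
Proof.
move=> hc ht hB; have C0 := C_ge0 hL; have [_ _ _ hr _] := macro_steps hX hi hin.
have [h0 _] := macro_cell_lt macro_cell_steps.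
have [e0 er /andP[r0 r1] rM /andP[t0 t1]] := hp.
apply: le_trans (mgrad_le0 macro_cell_steps ht hB) _.
rewrite ler_pdivrMr ?subr_gt0 //.
have -> : 12 * (C * tau) = C * (12 * tau) by ring.
rewrite -mulrA; apply: ler_wpM2l => //; rewrite -mulrA; apply: ler_wpM2l => //.
apply: le_trans t1 _; apply: ler_pM => //; [exact: ltW|exact: ltW|exact: hr].
Qed.

Lemma bdm_12_crude a b : (a + b <= 3)%N -> bd (D12 a b) (C * ie ^+ (a + b) * cut i).
Proof.
move=> ab p h1 h2; apply: le_trans (bdm_12 ab h1 h2) _; apply: ler_wpM2l.
  by apply: mulr_ge0; [exact: (C_ge0 hL)|apply: exprn_ge0; exact: (ie_ge0 hp)].
by have /andP[c0 _] := layer_cut_le1 n hp i; have /andP[_ d1] := layer_cut_le1 n hp j; rewrite ler_piMr.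
Qed.

Lemma bdm_12_crude2 a b : (a + b <= 3)%N -> bd (D12 a b) (C * ie ^+ (a + b) * cut j).
Proof.
move=> ab p h1 h2; apply: le_trans (bdm_12 ab h1 h2) _; apply: ler_wpM2l.
  by apply: mulr_ge0; [exact: (C_ge0 hL)|apply: exprn_ge0; exact: (ie_ge0 hp)].
by have /andP[c0 _] := layer_cut_le1 n hp j; have /andP[_ d1] := layer_cut_le1 n hp i; rewrite ler_piMl.
Qed.

(** In contrast to [edge_estimate] there is no exceptional row: inside the layer the recovered
    gradient is second order accurate pointwise. On coarse cells the layer derivative is again kept
    as a function to be integrated. *)
Lemma mgrad_estimate s p : tr s p ->
  `|mg s (add4 DS D1 D2 D12) p - add4 DS D1 D2 D12 1%N 0%N p| <=
  C * (120 * M + (if (i < n)%N then 2 * (ie * E1 p.1) else 288 * (ie * M ^+ 2))).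
Proof.
move=> ht; have [p1 p2] := tri_box ht; have C0 := C_ge0 hL; have mc := macro_cell_steps.
have [ie0 M0 t0 tM tM2] := param_facts hp.
have [hb /andP[E10 E11] /andP[E20 E21]] := macro_point p1 p2.
have /andP[_ cj1] := layer_cut_le1 n hp j.
have E21' : E2 p.2 <= 1 by exact: le_trans cj1.
have [h0 hM _ hr hf] := macro_steps hX hi hin; have [k0 kM _ kr kf] := macro_steps hY hj hjn.
have [[s0 s1 s2 s3] _ g1 g2 g12] := hL.
rewrite mgrad_add4.
have CM : C * tau <= C * M by exact: ler_wpM2l.
have CieM : C * ie * tau <= C * ie * M ^+ 2.
  by apply: ler_wpM2l => //; apply: mulr_ge0 => //; exact: ltW.
have CieM0 : 0 <= C * ie * M ^+ 2.
  by apply: mulr_ge0; [apply: mulr_ge0 => //; exact: ltW|exact: sqr_ge0].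
have CM0 : 0 <= C * M by apply: mulr_ge0 => //; exact: ltW.
have eS : `|mg s DS p - DS 1%N 0%N p| <= 48 * (C * M).
  apply: le_trans (mgrad_err1 mc ht s0 (bdm_S (isT : (2 + 0 <= 3)%N)) (bdm_S (isT : (1 + 1 <= 3)%N))) _.
  have -> : 48 * (C * M) = 12 * ((2 * M) * C + (2 * M) * C) by ring.
  by apply: ler_wpM2l => //; apply: lerD; apply: ler_wpM2r.
have e2 : `|mg s D2 p - D2 1%N 0%N p| <= 48 * (C * M).
  have c10 := bdm_2 (isT : (1 + 0 <= 3)%N); have c20 := bdm_2 (isT : (2 + 0 <= 3)%N).
  have c11 := bdm_2 (isT : (1 + 1 <= 3)%N).
  have [hc|hc] := ltnP j n; rewrite /layer_cut ?hc in c10 c20 c11.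
    have q1 := mgrad_le1 mc ht s2 c10; have q2 := c10 p p1 p2; rewrite expr0 mulr1 in q1 q2.
    apply: le_trans (ler_normB _ _) _; lra.
  rewrite ltnNge hc /= !mulr1 in c20 c11.
  apply: le_trans (mgrad_err1 mc ht s2 c20 c11) _.
  have -> : 48 * (C * M) = 12 * (C * (2 * M) + C * (2 * M)) by ring.
  apply: ler_wpM2l => //; apply: lerD; first by rewrite mulrC; apply: ler_wpM2l.
  by rewrite expr1 mulrCA; apply: ler_wpM2l => //; exact: kf.
case: (ltnP i n) => hc.
  have e1 : `|mg s D1 p - D1 1%N 0%N p| <= C * (12 * M) + C * (ie * E1 p.1).
    apply: le_trans (ler_normB _ _) _; apply: lerD.
      by apply: mgrad_coarse => //; have := bdm_1 (isT : (0 + 0 <= 3)%N); rewrite /layer_cut hc expr0 mulr1.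
    by rewrite mulrA; have := g1 1%N 0%N p isT hb; rewrite expr1.
  have e12 : `|mg s D12 p - D12 1%N 0%N p| <= C * (12 * M) + C * (ie * E1 p.1).
    apply: le_trans (ler_normB _ _) _; apply: lerD.
      by apply: mgrad_coarse => //; have := bdm_12_crude (isT : (0 + 0 <= 3)%N); rewrite /layer_cut hc expr0 mulr1.
    apply: le_trans (g12 1%N 0%N p isT hb) _; rewrite -mulrA; apply: ler_wpM2l => //.
    apply: ler_wpM2l; first by rewrite expr1 ltW.
    by rewrite ler_piMr.
  by have := norm4 eS e1 e2 e12; rewrite /add4; move/le_trans; apply; lra.
have e1 : `|mg s D1 p - D1 1%N 0%N p| <= 144 * (C * ie * M ^+ 2).
  have := bdm_1 (isT : (3 + 0 <= 3)%N); have := bdm_1 (isT : (2 + 1 <= 3)%N).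
  have := bdm_1 (isT : (1 + 2 <= 3)%N); rewrite /layer_cut ltnNge hc /= !mulr1 => c12 c21 c30.
  apply: le_trans (mgrad_err2 mc ht s1 c30 c21 c12) _.
  have -> : 144 * (C * ie * M ^+ 2) = 12 * (3 * (C * ie) * (2 * M) ^+ 2) by ring.
  apply: ler_wpM2l => //.
  apply: (scaled_le (C := C * ie) (e1 := ie) (e2 := 1)
    (h1 := (X i.+2 - X i) * ie) (k1 := Y j.+2 - Y j)) => //; try ring.
  - by apply: mulr_ge0 => //; exact: ltW.
  - by apply: scaled_step_ie => //; exact: hf.
  - exact: scaled_step.
have e12 : `|mg s D12 p - D12 1%N 0%N p| <= 144 * (C * ie * M ^+ 2).
  case: (ltnP j n) => hc2.
    have c10 := bdm_12_crude2 (isT : (1 + 0 <= 3)%N); rewrite /layer_cut hc2 expr1 in c10.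
    have q1 := mgrad_le1 mc ht s3 c10; have q2 := c10 p p1 p2.
    by apply: le_trans (ler_normB _ _) _; lra.
  have := bdm_12 (isT : (3 + 0 <= 3)%N); have := bdm_12 (isT : (2 + 1 <= 3)%N).
  have := bdm_12 (isT : (1 + 2 <= 3)%N); rewrite /layer_cut !ltnNge hc hc2 /= !mulr1 => c12 c21 c30.
  apply: le_trans (mgrad_err2 mc ht s3 c30 c21 c12) _.
  have -> : 144 * (C * ie * M ^+ 2) = 12 * (3 * (C * ie) * (2 * M) ^+ 2) by ring.
  apply: ler_wpM2l => //.
  apply: (scaled_le (C := C * ie) (e1 := ie) (e2 := ie)
    (h1 := (X i.+2 - X i) * ie) (k1 := (Y j.+2 - Y j) * ie)) => //; try ring.
  - by apply: mulr_ge0 => //; exact: ltW.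
  - by apply: scaled_step_ie => //; exact: hf.
  - by apply: scaled_step_ie => //; exact: kf.
by have := norm4 eS e1 e2 e12; rewrite /add4; move/le_trans; apply; lra.
Qed.

Lemma mval_crude s p D : tr s p -> bd (D 0%N 0%N) (C * tau) -> `|mv s D p - D 0%N 0%N p| <= 72 * (C * M ^+ 2).
Proof.
move=> ht hB; have [p1 p2] := tri_box ht; have C0 := C_ge0 hL; have [ie0 M0 t0 tM tM2] := param_facts hp.
have q1 := mval_le macro_cell_steps ht hB; have q2 := hB p p1 p2.
have : C * tau <= C * M ^+ 2 by exact: ler_wpM2l.
have : 0 <= C * M ^+ 2 by apply: mulr_ge0 => //; exact: sqr_ge0.
by have := ler_normB (mv s D p) (D 0%N 0%N p); lra.
Qed.

Lemma mval_scaled s p D e1 e2 : tr s p -> sm 3 D ->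
  bd (D 2 0%N) (C * e1 ^+ 2) -> bd (D 1%N 1%N) (C * (e1 * e2)) -> bd (D 0%N 2) (C * e2 ^+ 2) ->
  0 <= (X i.+2 - X i) * e1 <= 2 * M -> 0 <= (Y j.+2 - Y j) * e2 <= 2 * M ->
  `|mv s D p - D 0%N 0%N p| <= 72 * (C * M ^+ 2).
Proof.
move=> ht hD c20 c11 c02 b1 b2; apply: le_trans (mval_err macro_cell_steps ht hD c20 c11 c02) _.
have -> : 72 * (C * M ^+ 2) = 6 * (3 * C * (2 * M) ^+ 2) by ring.
by apply: ler_wpM2l => //; apply: (scaled_le (e1 := e1) (e2 := e2) _ b1 b2) => //; exact: (C_ge0 hL).
Qed.

Lemma mval_estimate s p : tr s p ->
  `|mv s (add4 DS D1 D2 D12) p - add4 DS D1 D2 D12 0%N 0%N p| <= 288 * (C * M ^+ 2).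
Proof.
move=> ht.
have [h0 hM _ _ hf] := macro_steps hX hi hin; have [k0 kM _ _ kf] := macro_steps hY hj hjn.
have [[s0 s1 s2 s3] _ _ _ _] := hL.
have u1 : 0 <= (X i.+2 - X i) * 1 <= 2 * M by rewrite mulr1; exact: scaled_step.
have u2 : 0 <= (Y j.+2 - Y j) * 1 <= 2 * M by rewrite mulr1; exact: scaled_step.
have v1 (hc : (n <= i)%N) : 0 <= (X i.+2 - X i) * ie <= 2 * M by apply: scaled_step_ie => //; exact: hf.
have v2 (hc : (n <= j)%N) : 0 <= (Y j.+2 - Y j) * ie <= 2 * M by apply: scaled_step_ie => //; exact: kf.
rewrite mval_add4.
have eS : `|mv s DS p - DS 0%N 0%N p| <= 72 * (C * M ^+ 2).
  apply: (mval_scaled ht s0 _ _ _ u1 u2); rewrite ?expr1n ?mulr1;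
    [exact: (bdm_S (isT : (2 + 0 <= 3)%N))|exact: (bdm_S (isT : (1 + 1 <= 3)%N))|exact: (bdm_S (isT : (0 + 2 <= 3)%N))].
have e1 : `|mv s D1 p - D1 0%N 0%N p| <= 72 * (C * M ^+ 2).
  have [hc|hc] := ltnP i n.
    by apply: mval_crude => //; have := bdm_1 (isT : (0 + 0 <= 3)%N); rewrite /layer_cut hc expr0 mulr1.
  have := bdm_1 (isT : (2 + 0 <= 3)%N); have := bdm_1 (isT : (1 + 1 <= 3)%N).
  have := bdm_1 (isT : (0 + 2 <= 3)%N); rewrite /layer_cut ltnNge hc /= !mulr1 => c02 c11 c20.
  by apply: (mval_scaled ht s1 c20 _ _ (v1 hc) u2); rewrite ?expr1n mulr1 // in c02 *.
have e2 : `|mv s D2 p - D2 0%N 0%N p| <= 72 * (C * M ^+ 2).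
  have [hc|hc] := ltnP j n.
    by apply: mval_crude => //; have := bdm_2 (isT : (0 + 0 <= 3)%N); rewrite /layer_cut hc expr0 mulr1.
  have := bdm_2 (isT : (2 + 0 <= 3)%N); have := bdm_2 (isT : (1 + 1 <= 3)%N).
  have := bdm_2 (isT : (0 + 2 <= 3)%N); rewrite /layer_cut ltnNge hc /= !mulr1 => c02 c11 c20.
  by apply: (mval_scaled ht s2 _ _ c02 u1 (v2 hc)); rewrite ?expr1n ?mulr1 ?mul1r // in c20 *.
have e12 : `|mv s D12 p - D12 0%N 0%N p| <= 72 * (C * M ^+ 2).
  have [hc|hc] := ltnP i n.
    by apply: mval_crude => //; have := bdm_12_crude (isT : (0 + 0 <= 3)%N); rewrite /layer_cut hc expr0 mulr1.
  have [hc2|hc2] := ltnP j n.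
    by apply: mval_crude => //; have := bdm_12_crude2 (isT : (0 + 0 <= 3)%N); rewrite /layer_cut hc2 expr0 mulr1.
  have := bdm_12 (isT : (2 + 0 <= 3)%N); have := bdm_12 (isT : (1 + 1 <= 3)%N).
  have := bdm_12 (isT : (0 + 2 <= 3)%N); rewrite /layer_cut !ltnNge hc hc2 /= !mulr1 => c02 c11 c20.
  exact: (mval_scaled ht s3 c20 c11 c02 (v1 hc) (v2 hc2)).
by have := norm4 eS e1 e2 e12; rewrite /add4; move/le_trans; apply; lra.
Qed.

End Bounds.
End MacroEstimates.

(** * Summation by edges and weighted sums over the mesh *)

Section Regrouping.
Variable R : realType.

(* Over a family [g] attached to the horizontal edges, the errors of the two
   triangles sharing an edge only enter through their sum. *)
Lemma regroup N (A : nat -> nat -> R) (B : nat -> nat -> R) (g E : nat -> nat -> bool -> R) :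
  (forall i j, (i < N)%N -> (j.+1 < N)%N -> g i j true = g i j.+1 false) ->
  (forall i, (i < N)%N -> g i 0%N false = 0 /\ g i N.-1 true = 0) ->
  (forall i j, (i < N)%N -> (j < N)%N -> 0 <= A i j /\ 0 <= B i j) ->
  (forall i j, (i < N)%N -> (j.+1 < N)%N ->
     `|E i j true + E i j.+1 false| <= (A i j + A i j.+1) * B i j) ->
  `|S3 N (fun i j s => g i j s * E i j s)| <=
  S3 N (fun i j s => A i j * (`|g i j s| * (if s then B i j else B i j.-1))).
Proof.
case: N => [|m] hg h0 hA hE.
  by rewrite /S3 !big_ord0 normr0.
apply: le_trans (ler_norm_sum _ _ _) _; apply: ler_sum => i _.
have hi := ltn_ord i; have [gF gT] := h0 i hi; rewrite /= in gT.
(* The upper triangle of row [j] is joined with the lower triangle of row [j.+1]; the two triangles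
   left over have their horizontal leg on the boundary, where [g] vanishes. *)
have split2 (F : nat -> bool -> R) : \sum_(j < m.+1) \sum_(s : bool) F j s =
    F 0%N false + (\sum_(j < m) (F j true + F j.+1 false)) + F m true.
  rewrite (eq_bigr (fun j : 'I_m.+1 => F j true + F j false)); last by move=> j _; rewrite big_bool.
  by rewrite !big_split /= big_ord_recr /= [X in _ + X = _]big_ord_recl /=; ring.
rewrite (split2 (fun j s => g i j s * E i j s)).
rewrite (split2 (fun j s => A i j * (`|g i j s| * (if s then B i j else B i j.-1)))) /=.
rewrite gF gT normr0 !mul0r !mulr0 !add0r !addr0.
apply: le_trans (ler_norm_sum _ _ _) _; apply: ler_sum => j _.
have hj := ltn_ord j; rewrite -hg ?ltnS // -mulrDr normrM -mulrDl mulrCA.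
by apply: ler_wpM2l => //; apply: hE.
Qed.

Lemma S3_sqrt_le N (w a b : nat -> nat -> bool -> R) :
  (forall i j s, (i < N)%N -> (j < N)%N -> 0 <= w i j s) ->
  S3 N (fun i j s => w i j s * (a i j s * b i j s)) <=
  Num.sqrt (S3 N (fun i j s => w i j s * a i j s ^+ 2)) *
  Num.sqrt (S3 N (fun i j s => w i j s * b i j s ^+ 2)).
Proof.
move=> w0; apply: sqr_le_sqrt; last exact: cauchy_schwarz.
  by apply: S3_ge0 => i j s hi hj; apply: mulr_ge0; [exact: w0|exact: sqr_ge0].
by apply: S3_ge0 => i j s hi hj; apply: mulr_ge0; [exact: w0|exact: sqr_ge0].
Qed.

Lemma tail_sum N n (X : nat -> R) : (n <= N)%N ->
  \sum_(i < N) (if (i < n)%N then 0 else X i.+1 - X i) = X N - X n.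
Proof.
move=> nN; rewrite (eq_bigr (fun i : 'I_N => X (maxn i.+1 n) - X (maxn i n))).
  by rewrite (mesh_sum (fun k => X (maxn k n))) max0n (maxn_idPl nN).
move=> i _; case: ifP => h; first by rewrite (maxn_idPr h) (maxn_idPr (ltnW h)) subrr.
by move/negbT: h; rewrite -leqNgt => h; rewrite (maxn_idPl h) (maxn_idPl (leq_trans h (leqnSn _))).
Qed.

Lemma delta_sum_le N (a : nat -> R) k (c : R) : 0 <= c -> (forall j, (j < N)%N -> a j <= c) ->
  \sum_(j < N) (if (j : nat) == k then a j else 0) <= c.
Proof.
move=> c0 ha; have [kN|kN] := ltnP k N.
  rewrite (bigD1 (Ordinal kN)) //= eqxx big1 ?addr0; first exact: ha.
  by move=> j hj; rewrite ifN //; move: hj; rewrite -val_eqE.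
rewrite big1 // => j _; rewrite ifN //; apply/negP => /eqP h.
by move: (ltn_ord j); rewrite h ltnNge kN.
Qed.

End Regrouping.

(** * The diffusion term in the x direction *)

Section Diffusion.
Variable R : realType.
Implicit Types (D : nat -> nat -> R * R -> R) (v : R * R -> R).

Variables (N n : nat) (C eps r M tau : R) (E1 E2 : R -> R) (X Y : nat -> R).
Variables (DS D1 D2 D12 : nat -> nat -> R * R -> R).
Hypothesis hp : params eps r M tau.
Hypothesis hX : steps N n eps r M tau E1 X.
Hypothesis hY : steps N n eps r M tau E2 Y.
Hypothesis hL : layers C eps E1 E2 DS D1 D2 D12.
Hypothesis nN : (n <= N)%N.
Notation ie := (eps^-1).
Notation A i j := ((X i.+1 - X i) * (Y j.+1 - Y j) / 2).
Notation U := (add4 DS D1 D2 D12).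
Notation sl i j s v := (slope_x (X i) (X i.+1) v (edge (Y j) (Y j.+1) s)).
Notation lam := (1 - X n).

Definition edge_weight i j : R :=
  C * (16 * M + (if (i < n)%N then 0 else 16 * (ie * M ^+ 2) +
     (if j.+1 == n then 4 * (ie * M) else 0))).

Lemma area_sum (a b : nat -> R) :
  S3 N (fun i j _ => A i j * (a i * b j)) =
  (\sum_(i < N) (X i.+1 - X i) * a i) * (\sum_(j < N) (Y j.+1 - Y j) * b j).
Proof.
have -> : S3 N (fun i j _ => A i j * (a i * b j)) =
    2^-1 * S3 N (fun i j _ => ((X i.+1 - X i) * a i) * ((Y j.+1 - Y j) * b j)).
  by rewrite -S3_scale; apply: eq_S3 => i j s _ _; ring.
by rewrite (S3_factor N (fun i => (X i.+1 - X i) * a i) (fun j => (Y j.+1 - Y j) * b j)); field.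
Qed.

Lemma total_sum Z : mesh N Z -> \sum_(i < N) (Z i.+1 - Z i) * 1 = 1 :> R.
Proof.
move=> [z0 z1 _]; rewrite (eq_bigr (fun i : 'I_N => Z i.+1 - Z i)) ?mesh_sum ?z0 ?z1 ?subr0 //.
by move=> i _; rewrite mulr1.
Qed.

Lemma fine_sum Z : mesh N Z -> \sum_(i < N) (Z i.+1 - Z i) * (if (i < n)%N then 0 else 1) = 1 - Z n :> R.
Proof.
move=> [z0 z1 _]; rewrite -[X in X - _]z1 -tail_sum //; apply: eq_bigr => i _.
by case: (i < n)%N; rewrite ?mulr0 ?mulr1.
Qed.

(** The L2 norm of the x derivative of the linear interpolant of [v]. *)
Definition gradx v := Num.sqrt (S3 N (fun i j s => A i j * sl i j s v ^+ 2)).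

Lemma mesh_lam_ge0 Z E : steps N n eps r M tau E Z -> 0 <= 1 - Z n.
Proof. by move=> [mZ _ _ _ _]; rewrite subr_ge0; have /andP[] := mesh_itv mZ nN. Qed.

(** Three applications of Cauchy-Schwarz, one for each part of [edge_weight]: over the square, over
    the layer of width [lam], and over the two rows of the layer next to the transition line, of
    total height at most [4 * r]. *)
Lemma diffusion_x v : (forall x : R, 0 <= x <= 1 -> v (x, 0) = 0 /\ v (x, 1) = 0) ->
  `|S3 N (fun i j s => sl i j s v * Xerr (X i) (X i.+1) (Y j) (Y j.+1) s U)| <=
  gradx v * (C * (16 * M + 16 * (ie * M ^+ 2) * Num.sqrt lam + 8 * (ie * M) * (Num.sqrt lam * Num.sqrt (4 * r)))).
Proof.
move=> hv; have C0 := C_ge0 hL; have [ie0 M0 t0 tM tM2] := param_facts hp.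
have [mX _ _ _ _] := hX; have [mY kY _ _ _] := hY.
have [e0 er /andP[r0 r1] rM _] := hp.
have W i j : 0 <= edge_weight i j.
  apply: mulr_ge0 => //; apply: addr_ge0; first by apply: mulr_ge0 => //; exact: ltW.
  case: (i < n)%N => //; apply: addr_ge0; last case: (_ == _) => //.
    by apply: mulr_ge0 => //; apply: mulr_ge0; [exact: ltW|exact: sqr_ge0].
  by apply: mulr_ge0 => //; apply: mulr_ge0; exact: ltW.
have y0 : Y 0%N = 0 by case: mY.
have yN : Y N = 1 by case: mY.
have bdry i x y : (i < N)%N -> (forall x, 0 <= x <= 1 -> v (x, y) = 0) -> x = i ->
    slope_x (X i) (X i.+1) v y = 0.
  move=> hi hy _; rewrite /slope_x !hy ?subrr ?mul0r //; first [exact: (mesh_itv mX (ltnW hi))|exact: (mesh_itv mX hi)].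
have := @regroup R N (fun i j => A i j) edge_weight (fun i j s => sl i j s v)
  (fun i j s => Xerr (X i) (X i.+1) (Y j) (Y j.+1) s U).
move=> /(_ _ _ _ _)/le_trans; apply.
- by [].
- move=> i hi; rewrite /edge y0; split.
    by apply: (bdry i i) => // x hx; have [] := hv x hx.
  by rewrite prednK ?yN ?(leq_ltn_trans _ hi) //; apply: (bdry i i) => // x hx; have [] := hv x hx.
- by move=> i j hi hj; split; [exact: (area_ge0 hp hX hY)|].
- by move=> i j hi hj; exact: (edge_estimate hp hX hY hL).
have A0 i j (s : bool) : (i < N)%N -> (j < N)%N -> 0 <= A i j by move=> *; exact: (area_ge0 hp hX hY).
pose one i : R := if (i < n)%N then 0 else 1.
(* The weight of an edge is charged to the rows below and above it, so the edges on [Y n] concern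
   the rows [n.-1] and [n]. *)
pose col j : R := (if j == n.-1 then 1 else 0) + (if j == n then 1 else 0).
have colj i j (s : bool) : (if s then edge_weight i j else edge_weight i j.-1) <=
    C * (16 * M) + C * (16 * (ie * M ^+ 2)) * one i + C * (4 * (ie * M)) * (one i * col j).
  have p1 : 0 <= C * (4 * (ie * M)) by apply: mulr_ge0 => //; apply: mulr_ge0 => //; apply: mulr_ge0; exact: ltW.
  have c0 : 0 <= col j by rewrite /col; apply: addr_ge0; case: ifP.
  have key (b : bool) : (b -> 1 <= col j) -> (if b then 4 * (ie * M) else 0) * C <= C * (4 * (ie * M)) * col j.
    case: b => hb; last by rewrite mul0r; apply: mulr_ge0.
    by rewrite mulrC ler_peMr // hb.
  have h1 : (if j.+1 == n then 4 * (ie * M) else 0) * C <= C * (4 * (ie * M)) * col j.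
    by apply: key => /eqP h; rewrite /col -h /= eqxx lerDl; case: (_ == _).
  have h2 : (if j.-1.+1 == n then 4 * (ie * M) else 0) * C <= C * (4 * (ie * M)) * col j.
    apply: key => /eqP h; rewrite /col -h; case: (j) => [|j'] /=; first by rewrite ?eqxx lerDl ?ler01 ?lexx.
    by rewrite eqxx lerDr; case: (_ == _).
  rewrite /one /edge_weight; case: (i < n)%N; first by case: s; rewrite addr0 mulr0 mul0r mulr0 !addr0.
  rewrite mulr1 mul1r; case: s; move: h1 h2.
    by move: (if j.+1 == n then _ else _) => z h1 h2; lra.
  by move: (if j.-1.+1 == n then _ else _) => z h1 h2; lra.
have cs (a b : nat -> R) : S3 N (fun i j s => A i j * (`|sl i j s v| * (a i * b j))) <=
    gradx v * Num.sqrt ((\sum_(i < N) (X i.+1 - X i) * a i ^+ 2) * (\sum_(j < N) (Y j.+1 - Y j) * b j ^+ 2)).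
  apply: le_trans (S3_sqrt_le _ _ A0) _; rewrite /gradx.
  rewrite (eq_S3 (F := fun i j s => A i j * `|sl i j s v| ^+ 2) (G := fun i j s => A i j * sl i j s v ^+ 2)); last first.
    by move=> i j s _ _; rewrite real_normK ?num_real.
  apply: ler_wpM2l; first exact: sqrtr_ge0.
  rewrite -(area_sum (fun i => a i ^+ 2) (fun j => b j ^+ 2)) le_eqVlt; apply/orP; left; apply/eqP; congr (Num.sqrt _).
  by apply: eq_S3 => i j s _ _; rewrite exprMn.
pose u (k : nat) : R := 1.
have c1 := cs u u; have c2 := cs one u; have c3 := cs one col.
have G0 : 0 <= gradx v by exact: sqrtr_ge0.
have su Z : mesh N Z -> \sum_(i < N) (Z i.+1 - Z i) * u i ^+ 2 = 1.
  by move=> hZ; rewrite -[RHS](total_sum hZ); apply: eq_bigr => i _; rewrite expr1n.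
have so : \sum_(i < N) (X i.+1 - X i) * one i ^+ 2 = lam.
  by rewrite -fine_sum //; apply: eq_bigr => i _; rewrite /one; case: ifP; rewrite ?expr0n ?expr1n.
(* The two rows coincide for [n = 0], where [col] takes the value 2; hence the factor 4. *)
have sc : \sum_(j < N) (Y j.+1 - Y j) * col j ^+ 2 <= 4 * (4 * r).
  apply: (@le_trans _ _ (\sum_(j < N) ((if (j : nat) == n.-1 then 4 * (Y j.+1 - Y j) else 0) +
     (if (j : nat) == n then 4 * (Y j.+1 - Y j) else 0)))).
    apply: ler_sum => j _; have [k0 _ _ _ _] := step_facts hp hY (ltn_ord j); rewrite /col.
    by do 2 case: ifP => _; lra.
  rewrite big_split /=; have -> : 4 * (4 * r) = 4 * (2 * r) + 4 * (2 * r) by ring.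
  have e j : (j < N)%N -> 4 * (Y j.+1 - Y j) <= 4 * (2 * r) by move=> hj; have [_] := kY j hj; lra.
  by apply: lerD; apply: (@delta_sum_le R N (fun j => 4 * (Y j.+1 - Y j))) => //; lra.
rewrite su // su // mulr1 sqrtr1 mulr1 in c1.
rewrite so su // mulr1 in c2.
have {}c3 : S3 N (fun i j s => A i j * (`|sl i j s v| * (one i * col j))) <= gradx v * (Num.sqrt lam * (2 * Num.sqrt (4 * r))).
  apply: le_trans c3 _; apply: ler_wpM2l => //; rewrite so sqrtrM ?(mesh_lam_ge0 hX) //.
  apply: ler_wpM2l; first exact: sqrtr_ge0.
  have e4 : (4 : R) = 2 ^+ 2 by ring.
  have <- : Num.sqrt (4 : R) = 2 by rewrite e4 sqrtr_sqr ger0_norm.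
  by rewrite -sqrtrM // ler_wsqrtr.
apply: (@le_trans _ _ (S3 N (fun i j s => (C * (16 * M)) * (A i j * (`|sl i j s v| * 1)) +
   (C * (16 * (ie * M ^+ 2)) * (A i j * (`|sl i j s v| * (one i * u j))) +
    C * (4 * (ie * M)) * (A i j * (`|sl i j s v| * (one i * col j))))))).
  apply: S3_le => i j s hi hj; have := A0 i j s hi hj; have := colj i j s; have := normr_ge0 (sl i j s v).
  move: (if s then _ else _) => w; move: (`|_|) => g g0 hw a0.
  have := ler_wpM2l a0 (ler_wpM2l g0 hw); move/le_trans; apply; rewrite /u le_eqVlt; apply/orP; left; apply/eqP; ring.
rewrite !S3_add !S3_scale.
have C1 : 0 <= C * (16 * M) by apply: mulr_ge0 => //; apply: mulr_ge0 => //; exact: ltW.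
have C2 : 0 <= C * (16 * (ie * M ^+ 2)).
  by apply: mulr_ge0 => //; apply: mulr_ge0 => //; apply: mulr_ge0; [exact: ltW|exact: sqr_ge0].
have C3 : 0 <= C * (4 * (ie * M)) by apply: mulr_ge0 => //; apply: mulr_ge0 => //; apply: mulr_ge0; exact: ltW.
apply: le_trans (lerD (ler_wpM2l C1 c1) (lerD (ler_wpM2l C2 c2) (ler_wpM2l C3 c3))) _.
by rewrite le_eqVlt; apply/orP; left; apply/eqP; ring.
Qed.
End Diffusion.

(** * Elementary facts on N, its logarithm and its powers *)

Section Rates.
Variable R : realType.

(** The two bounds on [L] come from [expR x >= 1 + x]: at [- L] for the lower bound, with 1/N at
    most 1/4, and at [L / 2] for the upper bound, where [expR (L / 2) * h = 1]. *)
Lemma rate_facts (N : nat) : (4 <= N)%N ->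
  let r := N%:R^-1 : R in let h := Num.sqrt r in let L := ln (N%:R : R) in
  [/\ 0 < r <= 1, 0 < h <= 1, h ^+ 2 = r, 1 / 2 <= L /\ L * h <= 2 &
      expR (- (5 / 2 * L)) = h ^+ 5].
Proof.
move=> N4 r h L.
have N0 : 0 < N%:R :> R by rewrite ltr0n (leq_trans _ N4).
have N4' : (4%:R : R) <= N%:R by rewrite ler_nat.
have r0 : 0 < r by rewrite invr_gt0.
have r1 : r <= 1 / 4 by rewrite /r mul1r lef_pV2 ?posrE.
have h0 : 0 < h by rewrite sqrtr_gt0.
have h2 : h ^+ 2 = r by rewrite sqr_sqrtr // ltW.
have eL : expR L = N%:R by rewrite lnK // posrE.
have emL : expR (- L) = r by rewrite expRN eL.
have eh : expR (- (L / 2)) = h.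
  have q : expR (- (L / 2)) ^+ 2 = r by rewrite expr2 -expRD -emL; congr expR; field.
  by rewrite /h -q sqrtr_sqr ger0_norm // expR_ge0.
have Lhalf : 1 / 2 <= L by have := expR_ge1Dx (- L); rewrite emL; lra.
split.
- by rewrite r0 /=; lra.
- by rewrite h0 /= -(ler_pXn2r (isT : (0 < 2)%N)) ?nnegrE ?ler01 ?ltW // h2 expr1n; lra.
- exact: h2.
- split=> //; have := expR_ge1Dx (L / 2) => k.
  have ehi : expR (L / 2) * h = 1 by rewrite -eh expRN mulfV // lt0r_neq0 // expR_gt0.
  have : (1 + L / 2) * h <= 1 by have := ler_wpM2r (ltW h0) k; rewrite ehi.
  by move: h0; clear; nra.
- by rewrite -eh -expRM_natl; congr expR; field.
Qed.
End Rates.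

(** * The Shishkin mesh satisfies the abstract step conditions *)

Section ShishkinMesh.
Variable R : realType.

Section OneDimensional.
Variables (N : nat) (lam : R).
Hypotheses (N4 : (4 <= N)%N) (Neven : ~~ odd N) (l0 : 0 < lam) (l1 : lam <= 2^-1).
Notation Z := (mesh_point lam N).
Notation n := (N./2).
Notation r := (N%:R^-1 : R).

Let nN : N = n.*2. Proof. by rewrite -[LHS](odd_double_half N) (negbTE Neven). Qed.
Let n0 : 0 < n%:R :> R.
Proof. by rewrite ltr0n half_gt0 (leq_trans _ N4). Qed.
Let rE : n%:R^-1 = 2 * r :> R.
Proof. by rewrite [in RHS]nN -mul2n natrM invfM mulrA mulfV ?mul1r. Qed.

Lemma half_le : (n <= N)%N. Proof. by rewrite [X in (_ <= X)%N]nN -addnn leq_addr. Qed.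

Lemma mesh_half : Z n = 1 - lam.
Proof. by rewrite /mesh_point leqnn mulfK // lt0r_neq0. Qed.

Lemma mesh_step i : (i < N)%N ->
  Z i.+1 - Z i = if (i < n)%N then (1 - lam) * (2 * r) else lam * (2 * r).
Proof.
move=> hi; rewrite -rE; have hn : n%:R != 0 :> R by rewrite lt0r_neq0.
case: ifP => h; first by rewrite /mesh_point h (ltnW h) -natr1; field.
have {}h : (n <= i)%N by rewrite leqNgt h.
rewrite /mesh_point ltnNge h /=; move: h; rewrite leq_eqVlt => /orP[/eqP e|h].
  by rewrite -e leqnn subSnn; field.
by rewrite leqNgt h /= subSn ?(ltnW h) // -natr1; field.
Qed.

Lemma mesh_shishkin : mesh N Z.
Proof.
have r0 : 0 < r by rewrite invr_gt0 ltr0n (leq_trans _ N4).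
split.
- by rewrite /mesh_point /= mulr0 mul0r.
- rewrite /mesh_point; have -> : (N <= n)%N = false.
    by apply/negbTE; rewrite -ltnNge [X in (_ < X)%N]nN -addnn -[X in (X < _)%N]addn0 ltn_add2l half_gt0 (leq_trans _ N4).
  have -> : (N - n)%N = n by rewrite {1}nN -addnn addnK.
  by rewrite mulfK ?subrK // lt0r_neq0.
- move=> i hi; rewrite -subr_gt0 mesh_step //; have l0' := l0; have l1' := l1.
  by case: ifP => _; apply: mulr_gt0; try apply: mulr_gt0 => //; lra.
Qed.

(** Coarse steps are at most [2 * r], which [4 <= kappa] with [1 / 2 <= L] keeps below
    [kappa * L * r]. Fine steps equal 5 eps L r / beta, which is the origin of [5 <= kappa * beta].
    At the transition point the exponential is [expR (- (5 / 2 * L))], that is N^(-5/2). *)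
Lemma steps_shishkin (eps beta kappa L : R) : 0 < eps -> 0 < beta ->
  lam = 5 / 2 * eps * beta^-1 * L -> 4 <= kappa -> 5 <= kappa * beta -> 1 / 2 <= L ->
  expR (- (5 / 2 * L)) = Num.sqrt r ^+ 5 ->
  steps N n eps r (kappa * L * r) (Num.sqrt r ^+ 5) (fun x => expR (- (beta * (1 - x) / eps))) Z.
Proof.
move=> e0 b0 lE k4 k5 hL hE.
have r0 : 0 < r by rewrite invr_gt0 ltr0n (leq_trans _ N4).
have l0' := l0; have l1' := l1.
have kL : 2 <= kappa * L by nra.
have M2 : 2 * r <= kappa * L * r by apply: ler_wpM2r => //; exact: ltW.
have st i : (i < N)%N -> Z i.+1 - Z i <= 2 * r.
  by move=> hi; rewrite mesh_step //; case: ifP => _; rewrite ler_piMl //; lra.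
split; first exact: mesh_shishkin.
- by move=> i hi; split; [apply: le_trans M2|]; exact: st.
- move=> i hi; case: ifP => h; rewrite mesh_step // h; first by nra.
  rewrite lE; have -> : 5 / 2 * eps * beta^-1 * L * (2 * r) = eps * (5 * beta^-1 * L * r).
    by rewrite -[5 / 2 * eps]mulrA; move: (beta^-1) => z; field; rewrite pnatr_eq0 -lt0n (leq_trans _ N4).
  apply: ler_wpM2l; first exact: ltW.
  apply: ler_wpM2r; first exact: ltW.
  apply: ler_wpM2r; first lra.
  by rewrite ler_pdivrMr.
- move=> i hi hn; rewrite !mesh_step ?(ltnW hi) //.
  by rewrite [(i.+1 < n)%N]ltn_neqAle hn.
- move=> x; split; first exact: expR_ge0.
    move=> x1; rewrite -[leRHS]expR0 ler_expR oppr_le0; apply: divr_ge0; last exact: ltW.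
    by apply: mulr_ge0; [exact: ltW|lra].
  move=> i hi hx; rewrite -hE ler_expR lerN2.
  have hZ : x <= 1 - lam.
    rewrite -mesh_half; apply: le_trans hx _; apply: (mesh_le mesh_shishkin) => //; exact: half_le.
  rewrite ler_pdivlMr // (_ : 5 / 2 * L * eps = beta * lam); last by rewrite lE; field; exact: lt0r_neq0.
  by apply: ler_wpM2l; [exact: ltW|lra].
Qed.
End OneDimensional.

Section Problem.
Variables (P : problem R) (eps : R) (N : nat).
Hypothesis hm : mesh_parameters P eps N.
Hypotheses (be1 : 0 < beta1 P) (be2 : 0 < beta2 P).
Notation X := (xpt P eps N).
Notation Y := (ypt P eps N).
Notation n := (N./2).
Notation r := (N%:R^-1 : R).
Notation L := (ln (N%:R : R)).

Lemma lam_gt0 : 0 < lamx P eps N /\ 0 < lamy P eps N.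
Proof.
have [e0 _ [N4 _ _] _ _] := hm; have [_ _ _ [L0 _] _] := @rate_facts R N N4.
have L1 : 0 < L by lra.
by rewrite /lamx /lamy /rho; split; apply: mulr_gt0 => //; apply: mulr_gt0; rewrite ?invr_gt0 //;
  apply: mulr_gt0 => //; lra.
Qed.

(** Large enough for both directions of [steps_shishkin]; it depends on the problem but not on eps
    and N. *)
Definition kappa : R := 4 + 5 / beta1 P + 5 / beta2 P.

Lemma kappa_facts : [/\ 4 <= kappa, 5 <= kappa * beta1 P & 5 <= kappa * beta2 P].
Proof.
have u := divr_gt0 (ltr0n R 5) be1; have v := divr_gt0 (ltr0n R 5) be2.
rewrite /kappa; split.
- by move: (5 / beta1 P) (5 / beta2 P) u v => a b; lra.
- rewrite -ler_pdivrMr //; move: (5 / beta1 P) (5 / beta2 P) u v => a b; lra.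
- rewrite -ler_pdivrMr //; move: (5 / beta1 P) (5 / beta2 P) u v => a b; lra.
Qed.

Lemma steps_x : steps N n eps r (kappa * L * r) (Num.sqrt r ^+ 5)
  (fun x => expR (- (beta1 P * (1 - x) / eps))) X.
Proof.
have [e0 _ [N4 N2 _] lx ly] := hm; have [_ _ _ [L0 _] hE] := @rate_facts R N N4.
have [k4 k1 k2] := kappa_facts; have [l0 _] := lam_gt0.
exact: steps_shishkin.
Qed.

Lemma steps_y : steps N n eps r (kappa * L * r) (Num.sqrt r ^+ 5)
  (fun x => expR (- (beta2 P * (1 - x) / eps))) Y.
Proof.
have [e0 _ [N4 N2 _] lx ly] := hm; have [_ _ _ [L0 _] hE] := @rate_facts R N N4.
have [k4 k1 k2] := kappa_facts; have [_ l0] := lam_gt0.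
exact: steps_shishkin.
Qed.

Lemma params_shishkin : params eps r (kappa * L * r) (Num.sqrt r ^+ 5).
Proof.
have [e0 er [N4 _ _] _ _] := hm; have [r01 /andP[h0 h1] h2 [L0 _] _] := @rate_facts R N N4.
have [k4 _ _] := kappa_facts; have /andP[r0 r1] := r01.
split => //; first by rewrite ler_peMl ?ltW //; nra.
have -> : r * r = Num.sqrt r ^+ 4 by rewrite -[X in X * _]h2 -[X in _ * X]h2 -exprD.
apply/andP; split; first by rewrite exprn_ge0 // ltW.
by apply: ler_wiXn2l => //; exact: ltW.
Qed.

Lemma mesh_x : mesh N X. Proof. by have [] := steps_x. Qed.
Lemma mesh_y : mesh N Y. Proof. by have [] := steps_y. Qed.

Definition stabilization (Cs : R) (i j : nat) : R := if (i < n)%N && (j < n)%N then Cs * r else 0.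

Lemma delta_shishkin Cs i j s : (i < N)%N -> (j < N)%N ->
  delta P Cs eps N (elt P eps N i j s) = stabilization Cs i j.
Proof.
move=> hi hj; rewrite /delta /stabilization.
have [e0 _ [N4 N2 _] lx ly] := hm; have [l0 k0] := lam_gt0.
have mX := mesh_x; have mY := mesh_y.
have Xn : X n = 1 - lamx P eps N by exact: mesh_half.
have Yn : Y n = 1 - lamy P eps N by exact: mesh_half.
have hn := half_le N2.
have [_ _ sX] := mX; have [_ _ sY] := mY.
have [_ _ [x0 x1] [y0 y1]] := mesh_cell mX mY hi hj.
congr (if _ then _ else _); apply/asboolP/andP.
  (* The two ends of the diagonal belong to both halves, and each detects one coordinate. *)
  move=> hsub; have vx : hull (elt P eps N i j s) (X i.+1, Y j).
    rewrite hull_half_rect ?sX ?sY //=; split; rewrite ?lexx ?(ltW (sX _ hi)) ?(ltW (sY _ hj)) //.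
    by case: s {hsub}; lra.
  have vy : hull (elt P eps N i j s) (X i, Y j.+1).
    rewrite hull_half_rect ?sX ?sY //=; split; rewrite ?lexx ?(ltW (sX _ hi)) ?(ltW (sY _ hj)) //.
    by case: s {hsub vx}; lra.
  have [/= /andP[_ c1] _] := hsub _ vx; have [_ /= /andP[_ c2]] := hsub _ vy.
  rewrite -Xn in c1; rewrite -Yn in c2; split; rewrite ltnNge; apply/negP => h.
    have := lt_le_trans (sX i hi) c1; rewrite ltNge => /negP; apply.
    by apply: (mesh_le mX) => //; exact: ltnW.
  have := lt_le_trans (sY j hj) c2; rewrite ltNge => /negP; apply.
  by apply: (mesh_le mY) => //; exact: ltnW.
move=> [hin hjn] p; rewrite hull_half_rect ?sX ?sY // => -[/andP[a1 a2] /andP[b1 b2] _].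
have c1 : X i.+1 <= X n by exact: (mesh_le mX).
have c2 : Y j.+1 <= Y n by exact: (mesh_le mY).
by rewrite Xn in c1; rewrite Yn in c2; split; apply/andP; split; lra.
Qed.

End Problem.

Lemma decomposition_layers (P : problem R) (C0 eps : R) (u : R * R -> R) : 0 < eps ->
  decomposition P C0 eps u -> exists DS D1 D2 D12,
  layers C0 eps (fun x => expR (- (beta1 P * (1 - x) / eps))) (fun x => expR (- (beta2 P * (1 - x) / eps)))
    DS D1 D2 D12 /\ forall p, Omega_bar p -> u p = add4 DS D1 D2 D12 0%N 0%N p.
Proof.
move=> e0 [S [F1 [F2 [F12 [hu [GS jS bS] [G1 j1 b1] [G2 j2 b2] [G12 j12 b12]]]]]].
exists (fun i j => ext (GS i j)), (fun i j => ext (G1 i j)), (fun i j => ext (G2 i j)), (fun i j => ext (G12 i j)).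
split.
  split; first by split; [exact: jet_sm jS|exact: jet_sm j1|exact: jet_sm j2|exact: jet_sm j12].
  - by move=> i j p ij hp; rewrite extE //; exact: bS.
  - by move=> i j p ij hp; rewrite extE // exprVn; exact: b1.
  - by move=> i j p ij hp; rewrite extE // exprVn; exact: b2.
  - move=> i j p ij hp; rewrite extE // exprVn -expRD; apply: le_trans (b12 i j p ij hp) _.
    by rewrite mulrDl opprD.
move=> p hp; rewrite hu // /add4 !extE //.
case: jS => -> // _ _ _; case: j1 => -> // _ _ _; case: j2 => -> // _ _ _.
by case: j12 => -> // _ _ _.
Qed.

End ShishkinMesh.

(** * Superclose bounds for the interpolant *)

Section LayerIntegral.
Variable R : realType.

Lemma continuous_fst_comp (f : R -> R) : continuous f -> continuous (fun p : R * R => f p.1).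
Proof. by move=> cf p; apply: (@continuous_comp _ _ _ fst f); [exact: cvg_fst|exact: cf]. Qed.

Lemma continuous_snd_comp (f : R -> R) : continuous f -> continuous (fun p : R * R => f p.2).
Proof. by move=> cf p; apply: (@continuous_comp _ _ _ snd f); [exact: cvg_snd|exact: cf]. Qed.

Lemma J_monotone_le (E G : R -> R) (x0 x1 y0 y1 : R) s : x0 < x1 -> y0 < y1 ->
  continuous E -> continuous G -> (forall x : R, is_derive x 1 E (G x)) ->
  {homo E : x y / x <= y} ->
  J x0 x1 y0 y1 s (fun p => G p.1) <= (E x1 - E x0) * (y1 - y0).
Proof.
move=> hx hy cE cG hd hE.
have -> := @J_FTC_x R (fun p => E p.1) (fun p => G p.1) x0 x1 y0 y1 s hx hy
  (continuous_fst_comp cE) (continuous_fst_comp cG) (fun p _ => hd p.1).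
apply: le_trans (ler_norm _) _; apply: Rintegral_segment_bound; first exact: ltW.
  have cl : continuous (lo x0 x1 y0 y1 s) by exact: continuous_lo.
  have ch : continuous (hi x0 x1 y0 y1 s) by exact: continuous_hi.
  have k1 : continuous (fun y => E (hi x0 x1 y0 y1 s y)).
    by move=> y; apply: (@continuous_comp _ _ _ (hi x0 x1 y0 y1 s) E); [exact: ch|exact: cE].
  have k2 : continuous (fun y => E (lo x0 x1 y0 y1 s y)).
    by move=> y; apply: (@continuous_comp _ _ _ (lo x0 x1 y0 y1 s) E); [exact: cl|exact: cE].
  by cont.
move=> y hy' /=; have [l0 l1 l2] := lo_hi_le s hx hy' hy.
have e1 := hE _ _ l0; have e2 := hE _ _ l1; have e3 := hE _ _ l2.
by rewrite ger0_norm; lra.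
Qed.

Definition decay (beta eps x : R) : R := expR (- (beta * (1 - x) / eps)).

Lemma is_derive_decay (beta eps x : R) : beta != 0 ->
  is_derive x 1 (fun t => beta^-1 * decay beta eps t) (eps^-1 * decay beta eps x).
Proof.
move=> b0; rewrite /decay.
have d1 : is_derive x 1 (fun t : R => - (beta * (1 - t) / eps)) (beta / eps).
  by apply: is_derive_eq; rewrite /GRing.scale /=; ring.
have d2 := is_derive_expR (- (beta * (1 - x) / eps)).
have d3 := @is_derive1_comp R (@expR R) (fun t : R => - (beta * (1 - t) / eps)) x _ _ d2 d1.
have -> : (fun t => beta^-1 * expR (- (beta * (1 - t) / eps))) =
  beta^-1 *: (@expR R \o (fun t : R => - (beta * (1 - t) / eps))) by [].
by apply: is_derive_eq; rewrite /GRing.scale /= mulrCA (mulrA beta^-1) mulVf // mul1r mulrC.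
Qed.

Lemma continuous_decay beta eps : continuous (decay beta eps).
Proof.
move=> x; apply: (@continuous_comp _ _ _ (fun t : R => - (beta * (1 - t) / eps)) (@expR R)).
  have c : continuous (fun t : R => - (beta * (1 - t) / eps)) by cont.
  exact: c.
exact: continuous_expR.
Qed.

Lemma decay_mono beta eps : 0 < beta -> 0 < eps -> {homo decay beta eps : x y / x <= y}.
Proof.
move=> b0 e0 x y xy; rewrite /decay ler_expR lerN2 ler_pM2r ?invr_gt0 // ler_pM2l //; lra.
Qed.

(* The factor [eps^-1] is absorbed by integrating the exponential. *)
Lemma layer_integral N n X Y beta eps tau : mesh N X -> mesh N Y -> (n <= N)%N ->
  0 < beta -> 0 < eps -> decay beta eps (X n) <= tau ->
  S3 N (fun i j s => (if (i < n)%N then 1 else 0) *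
    JK X Y i j s (fun p => eps^-1 * decay beta eps p.1)) <= 2 * (beta^-1 * tau).
Proof.
move=> mX mY nN b0 e0 ht; have b1 : beta != 0 by rewrite lt0r_neq0.
have [x0 x1 sX] := mX; have [y0 y1 sY] := mY.
pose F x := beta^-1 * decay beta eps x.
have F0 x : 0 <= F x by apply: mulr_ge0; [rewrite invr_ge0 ltW|exact: expR_ge0].
have cF : continuous F by move=> x; apply: cvgM; [exact: cvg_cst|exact: continuous_decay].
have cG : continuous (fun x => eps^-1 * decay beta eps x).
  by move=> x; apply: cvgM; [exact: cvg_cst|exact: continuous_decay].
have mF : {homo F : x y / x <= y}.
  by move=> x y xy; apply: ler_wpM2l; [rewrite invr_ge0 ltW|exact: decay_mono].
apply: (@le_trans _ _ (S3 N (fun i j _ => (if (i < n)%N then F (X i.+1) - F (X i) else 0) * (Y j.+1 - Y j)))).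
  apply: S3_le => i j s hi hj; case: (i < n)%N; last by rewrite !mul0r.
  rewrite mul1r; apply: (J_monotone_le s (sX i hi) (sY j hj) cF cG) => //.
  by move=> x; exact: is_derive_decay.
rewrite (S3_factor N (fun i => if (i < n)%N then F (X i.+1) - F (X i) else 0) (fun j => Y j.+1 - Y j)).
rewrite mesh_sum y0 y1 subr0 mulr1; apply: ler_wpM2l => //.
have -> : \sum_(i < N) (if (i < n)%N then F (X i.+1) - F (X i) else 0) = F (X n) - F (X 0%N).
  have h1 := tail_sum (fun i => F (X i)) nN; have h2 := mesh_sum (fun i => F (X i)) N.
  have : \sum_(i < N) (if (i < n)%N then F (X i.+1) - F (X i) else 0) +
     \sum_(i < N) (if (i < n)%N then 0 else F (X i.+1) - F (X i)) = \sum_(i < N) (F (X i.+1) - F (X i)).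
    by rewrite -big_split; apply: eq_bigr => i _ /=; case: ifP; rewrite ?addr0 ?add0r.
  by rewrite h1 h2; lra.
have Fn : F (X n) <= beta^-1 * tau by apply: ler_wpM2l => //; rewrite invr_ge0 ltW.
by have := F0 (X 0%N); lra.
Qed.

End LayerIntegral.

Section InverseEstimate.
Variable R : realType.

(* The mass matrix of a triangle dominates the squared differences of the
   values at the edge midpoints. *)
Lemma inverse_estimate (x0 x1 y0 y1 : R) s v : x0 < x1 -> y0 < y1 ->
  slope_x x0 x1 v (edge y0 y1 s) ^+ 2 * ((x1 - x0) ^+ 3 * (y1 - y0)) <=
  48 * J x0 x1 y0 y1 s (fun p => lin x0 x1 y0 y1 s v p ^+ 2).
Proof.
move=> hx hy; set a := slope_x _ _ _ _.
pose b := slope_y y0 y1 v (edge x0 x1 s).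
pose c := v (edge x0 x1 s, edge y0 y1 s) - edge x0 x1 s * a - edge y0 y1 s * b.
have el p : lin x0 x1 y0 y1 s v p = c + a * p.1 + b * p.2.
  by rewrite /lin /= -/a -/b /c; ring.
rewrite (@J_quadratic R x0 x1 y0 y1 s _ (c ^+ 2) (2 * c * a) (2 * c * b) (a ^+ 2) (2 * a * b) (b ^+ 2)) //; last first.
  by move=> p; rewrite el; ring.
rewrite !el /=; set q := (X in _ / 6 * X).
have A0 : 0 < (x1 - x0) * (y1 - y0) by apply: mulr_gt0; rewrite subr_gt0.
have -> : a ^+ 2 * ((x1 - x0) ^+ 3 * (y1 - y0)) = ((x1 - x0) * (y1 - y0)) * (a * (x1 - x0)) ^+ 2 by ring.
have -> : 48 * ((x1 - x0) * (y1 - y0) / 6 * q) = ((x1 - x0) * (y1 - y0)) * (8 * q) by field.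
apply: ler_wpM2l; first exact: ltW.
rewrite /q; case: (s) => /=.
  set u := c + a * ((x0 + x1) / 2) + b * ((y0 + y1) / 2).
  set w := c + a * x1 + b * ((y0 + y1) / 2).
  have -> : a * (x1 - x0) = 2 * (w - u) by rewrite /w /u; field.
  by move: u w (c + _ + _) => u w z; have := sqr_ge0 (u + w); have := sqr_ge0 z; lra.
set u := c + a * ((x0 + x1) / 2) + b * ((y0 + y1) / 2).
set w := c + a * x0 + b * ((y0 + y1) / 2).
have -> : a * (x1 - x0) = 2 * (u - w) by rewrite /w /u; field.
by move: u w (c + _ + _) => u w z; have := sqr_ge0 (u + w); have := sqr_ge0 z; lra.
Qed.

End InverseEstimate.

(** * The diffusion term in both directions *)

Section DiffusionTerm.
Variable R : realType.
Implicit Types (D : nat -> nat -> R * R -> R) (v : R * R -> R).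

Lemma SJ_swap N (X Y : nat -> R) F : cont3 F ->
  SJ N X Y F = SJ N Y X (fun i j s p => F j i s (p.2, p.1)).
Proof.
by move=> cF; rewrite /SJ S3_swap; apply: eq_S3 => i j s _ _; rewrite JK_swap //; exact: cF.
Qed.

Lemma SJ_cst N (X Y : nat -> R) (g : nat -> nat -> bool -> R) : mesh N X -> mesh N Y ->
  SJ N X Y (fun i j s _ => g i j s) =
  S3 N (fun i j s => (X i.+1 - X i) * (Y j.+1 - Y j) / 2 * g i j s).
Proof.
move=> [_ _ sX] [_ _ sY]; apply: eq_S3 => i j s hi hj.
by rewrite /JK J_cst ?sX ?sY.
Qed.

Lemma gradxE N (X Y : nat -> R) v : mesh N X -> mesh N Y ->
  gradx N X Y v ^+ 2 = SJ N X Y (fun i j s _ => slope_x (X i) (X i.+1) v (edge (Y j) (Y j.+1) s) ^+ 2).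
Proof.
move=> mX mY; rewrite SJ_cst // /gradx sqr_sqrtr //.
have [_ _ sX] := mX; have [_ _ sY] := mY.
apply: S3_ge0 => i j s hi hj; apply: mulr_ge0; last exact: sqr_ge0.
by apply: divr_ge0 => //; apply: mulr_ge0; rewrite subr_ge0 ltW ?sX ?sY.
Qed.

Section Bounds.
Variables (N n : nat) (C eps r M tau : R) (E1 E2 : R -> R) (X Y : nat -> R).
Variables (DS D1 D2 D12 : nat -> nat -> R * R -> R).
Hypothesis hp : params eps r M tau.
Hypothesis hX : steps N n eps r M tau E1 X.
Hypothesis hY : steps N n eps r M tau E2 Y.
Hypothesis hL : layers C eps E1 E2 DS D1 D2 D12.
Hypothesis nN : (n <= N)%N.
Notation U := (add4 DS D1 D2 D12).
Notation slx i j s v := (slope_x (X i) (X i.+1) v (edge (Y j) (Y j.+1) s)).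
Notation sly i j s v := (slope_y (Y j) (Y j.+1) v (edge (X i) (X i.+1) s)).

Definition diffusion_rate lam :=
  C * (16 * M + 16 * (eps^-1 * M ^+ 2) * Num.sqrt lam +
       8 * (eps^-1 * M) * (Num.sqrt lam * Num.sqrt (4 * r))).

Lemma SJ_diffusion_x v : (forall x : R, 0 <= x <= 1 -> v (x, 0) = 0 /\ v (x, 1) = 0) ->
  `|SJ N X Y (fun i j s p => (slx i j s (U 0%N 0%N) - U 1%N 0%N p) * slx i j s v)| <=
  gradx N X Y v * diffusion_rate (1 - X n).
Proof.
move=> hv; have := diffusion_x hp hX hY hL nN hv; rewrite -/(diffusion_rate _).
have [mX _ _ _ _] := hX; have [mY _ _ _ _] := hY; have [_ _ sX] := mX; have [_ _ sY] := mY.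
have [[s0 s1 s2 s3] _ _ _ _] := hL.
have cU : continuous (U 1%N 0%N) by exact: sm_continuous (sm_add4 s0 s1 s2 s3) (isT : (1 + 0 <= 3)%N).
have -> : SJ N X Y (fun i j s p => (slx i j s (U 0%N 0%N) - U 1%N 0%N p) * slx i j s v) =
  - S3 N (fun i j s => slx i j s v * Xerr (X i) (X i.+1) (Y j) (Y j.+1) s U).
  rewrite -mulN1r -S3_scale; apply: eq_S3 => i j s hi hj.
  have -> : (fun p => (slx i j s (U 0%N 0%N) - U 1%N 0%N p) * slx i j s v) =
     (fun p => slx i j s v * (slx i j s (U 0%N 0%N) - U 1%N 0%N p)) by apply/funext => p; rewrite mulrC.
  rewrite /JK J_scale; last by cont.
  rewrite J_sub; [|by cont|exact: cU].
  by rewrite J_cst ?sX ?sY // /Xerr; ring.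
by rewrite normrN.
Qed.

End Bounds.

Lemma add4_transp DS D1 D2 D12 :
  add4 (transp DS) (transp D2) (transp D1) (transp D12) = transp (add4 DS D1 D2 D12) :> (nat -> nat -> R * R -> R).
Proof. by apply/funext => i; apply/funext => j; apply/funext => p; rewrite /transp /add4; ring. Qed.

Lemma SJ_diffusion_y N n C eps r M tau E1 E2 (X Y : nat -> R) DS D1 D2 D12 v :
  params eps r M tau -> steps N n eps r M tau E1 X -> steps N n eps r M tau E2 Y ->
  layers C eps E1 E2 DS D1 D2 D12 -> (n <= N)%N ->
  (forall y : R, 0 <= y <= 1 -> v (0, y) = 0 /\ v (1, y) = 0) ->
  `|SJ N X Y (fun i j s p =>
      (slope_y (Y j) (Y j.+1) (add4 DS D1 D2 D12 0%N 0%N) (edge (X i) (X i.+1) s) -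
       add4 DS D1 D2 D12 0%N 1%N p) * slope_y (Y j) (Y j.+1) v (edge (X i) (X i.+1) s))| <=
  gradx N Y X (fun p => v (p.2, p.1)) * diffusion_rate C eps r M (1 - Y n).
Proof.
move=> hp hX hY hL nN hv; have [[s0 s1 s2 s3] _ _ _ _] := hL.
have cU : continuous (add4 DS D1 D2 D12 0%N 1%N).
  exact: sm_continuous (sm_add4 s0 s1 s2 s3) (isT : (0 + 1 <= 3)%N).
rewrite SJ_swap; last by move=> i j s; cont.
have := SJ_diffusion_x hp hY hX (layers_swap hL) nN (v := fun p => v (p.2, p.1)) hv.
by rewrite add4_transp.
Qed.

End DiffusionTerm.

(** * Weighted Cauchy-Schwarz inequalities and the global inverse estimate *)

Section WeightedCauchySchwarz.
Variable R : realType.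
Variables (N : nat) (X Y : nat -> R).
Hypotheses (mX : mesh N X) (mY : mesh N Y).
Notation A i j := ((X i.+1 - X i) * (Y j.+1 - Y j) / 2).

Lemma SJ_abs_le K (w : nat -> nat -> bool -> R) G : 0 <= K -> cont3 G ->
  (forall i j s, (i < N)%N -> (j < N)%N -> 0 <= w i j s) ->
  SJ N X Y (fun i j s p => K * (w i j s * `|G i j s p|)) <=
  K * (Num.sqrt (S3 N (fun i j s => A i j * w i j s)) *
       Num.sqrt (SJ N X Y (fun i j s p => w i j s * G i j s p ^+ 2))).
Proof.
move=> K0 cG w0.
have cG' : cont3 (fun i j s p => `|G i j s p|) by move=> i j s; have := cG i j s => c; cont.
have c1 : cont3 (fun (i j : nat) (s : bool) (p : R * R) => 1 : R) by move=> i j s; cont.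
rewrite SJ_scale; last by move=> i j s; have := cG' i j s => c; cont.
apply: ler_wpM2l => //.
have -> : SJ N X Y (fun i j s p => w i j s * `|G i j s p|) = SJ N X Y (fun i j s p => w i j s * (1 * `|G i j s p|)).
  by apply: SJ_eq => i j s p _ _ _; rewrite mul1r.
have cs := SJ_cauchy_schwarz X Y c1 cG' w0.
have e1 : SJ N X Y (fun i j s p => w i j s * 1 ^+ 2) = S3 N (fun i j s => A i j * w i j s).
  by rewrite -SJ_cst //; apply: SJ_eq => i j s p _ _ _; rewrite expr1n mulr1.
have e2 : SJ N X Y (fun i j s p => w i j s * `|G i j s p| ^+ 2) = SJ N X Y (fun i j s p => w i j s * G i j s p ^+ 2).
  by apply: SJ_eq => i j s p _ _ _; rewrite real_normK ?num_real.
rewrite e1 e2 in cs; apply: sqr_le_sqrt cs.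
  rewrite -e1; apply: SJ_ge0 => i j s p hi hj _; apply: mulr_ge0; [exact: w0|exact: sqr_ge0].
by apply: SJ_ge0 => i j s p hi hj _; apply: mulr_ge0; [exact: w0|exact: sqr_ge0].
Qed.

Lemma area_total : S3 N (fun i j _ => A i j * 1) = 1 :> R.
Proof.
have := area_sum N X Y (fun=> 1) (fun=> 1); rewrite (total_sum mX) (total_sum mY) mulr1 => e.
by rewrite -[RHS]e; apply: eq_S3 => i j s _ _; rewrite !mulr1.
Qed.

Lemma area_ge i j : (i < N)%N -> (j < N)%N -> 0 <= A i j.
Proof.
move=> hi hj; have [_ _ sX] := mX; have [_ _ sY] := mY.
by apply: divr_ge0 => //; apply: mulr_ge0; rewrite subr_ge0 ltW ?sX ?sY.
Qed.

Lemma area_le1 (w : nat -> nat -> bool -> R) : (forall i j s, (i < N)%N -> (j < N)%N -> w i j s <= 1) ->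
  S3 N (fun i j s => A i j * w i j s) <= 1.
Proof.
move=> h; rewrite -[leRHS]area_total; apply: S3_le => i j s hi hj.
by apply: ler_wpM2l; [exact: area_ge|exact: h].
Qed.

Lemma area_layers n : (n <= N)%N ->
  S3 N (fun i j _ => A i j * (if (i < n)%N && (j < n)%N then 0 else 1)) <= (1 - X n) + (1 - Y n).
Proof.
move=> nN; pose f i : R := if (i < n)%N then 0 else 1.
have e1 := area_sum N X Y f (fun=> 1); have e2 := area_sum N X Y (fun=> 1) f.
rewrite /f fine_sum // total_sum // mulr1 in e1; rewrite /f fine_sum // total_sum // mul1r in e2.
rewrite -e1 -e2 -S3_add; apply: S3_le => i j s hi hj; have := area_ge hi hj.
move: (A i j) => a a0.
by case: (i < n)%N; case: (j < n)%N => /=; rewrite ?mulr0 ?mulr1 ?mul0r ?mul1r ?addr0 ?add0r //; lra.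
Qed.

(** A maximum norm bound of the gradient on coarse cells: the mass on one triangle is bounded by the
    total mass, and both steps are at least [r]. The constant is 7 because 48 is at most 49. *)
Lemma inverse_x r i j s v : 0 < r -> (i < N)%N -> (j < N)%N -> r <= X i.+1 - X i -> r <= Y j.+1 - Y j ->
  `|slope_x (X i) (X i.+1) v (edge (Y j) (Y j.+1) s)| * r ^+ 2 <=
  7 * Num.sqrt (SJ N X Y (fun i j s p => lin (X i) (X i.+1) (Y j) (Y j.+1) s v p ^+ 2)).
Proof.
move=> r0 hi hj hx hy; have [_ _ sX] := mX; have [_ _ sY] := mY.
set V := SJ _ _ _ _; set a := slope_x _ _ _ _.
have J0 i' j' s' : (i' < N)%N -> (j' < N)%N ->
    0 <= JK X Y i' j' s' (fun p => lin (X i') (X i'.+1) (Y j') (Y j'.+1) s' v p ^+ 2).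
  by move=> _ _; apply: J_ge0 => p _; exact: sqr_ge0.
have V0 : 0 <= V by exact: S3_ge0.
have k1 : a ^+ 2 * r ^+ 4 <= 48 * V.
  apply: le_trans (_ : 48 * JK X Y i j s (fun p => lin (X i) (X i.+1) (Y j) (Y j.+1) s v p ^+ 2) <= _).
    apply: le_trans (inverse_estimate s v (sX i hi) (sY j hj)).
    apply: ler_wpM2l; first exact: sqr_ge0.
    have -> : r ^+ 4 = r ^+ 3 * r by ring.
    apply: ler_pM => //; [exact: exprn_ge0 (ltW r0)|exact: ltW|].
    by apply: lerXn2r => //; rewrite nnegrE; lra.
  by apply: ler_wpM2l => //; exact: (S3_term_le _ J0).
rewrite -(ler_pXn2r (isT : (0 < 2)%N)) ?nnegrE; last 2 first.
- by apply: mulr_ge0 => //; apply: exprn_ge0; exact: ltW.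
- by apply: mulr_ge0 => //; exact: sqrtr_ge0.
have -> : (`|a| * r ^+ 2) ^+ 2 = a ^+ 2 * r ^+ 4 by rewrite -[a ^+ 2]real_normK ?num_real //; ring.
have -> : (7 * Num.sqrt V) ^+ 2 = 49 * V by rewrite -[in RHS](sqr_sqrtr V0); ring.
by apply: le_trans k1 _; apply: ler_wpM2r => //; lra.
Qed.

End WeightedCauchySchwarz.

Section Swap.
Variable R : realType.

Lemma lin_swap (x0 x1 y0 y1 : R) s v p :
  lin y0 y1 x0 x1 s (fun q => v (q.2, q.1)) (p.2, p.1) = lin x0 x1 y0 y1 s v p.
Proof. by rewrite /lin /slope_x /slope_y /=; ring. Qed.

Lemma SJ_lin_swap N (X Y : nat -> R) v :
  SJ N Y X (fun i j s p => lin (Y i) (Y i.+1) (X j) (X j.+1) s (fun q => v (q.2, q.1)) p ^+ 2) =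
  SJ N X Y (fun i j s p => lin (X i) (X i.+1) (Y j) (Y j.+1) s v p ^+ 2).
Proof.
rewrite SJ_swap; last by move=> i j s; rewrite /lin; cont.
by apply: SJ_eq => i j s p _ _ _; rewrite lin_swap.
Qed.

Lemma inverse_y N (X Y : nat -> R) r i j s v : mesh N X -> mesh N Y ->
  0 < r -> (i < N)%N -> (j < N)%N -> r <= X i.+1 - X i -> r <= Y j.+1 - Y j ->
  `|slope_y (Y j) (Y j.+1) v (edge (X i) (X i.+1) s)| * r ^+ 2 <=
  7 * Num.sqrt (SJ N X Y (fun i j s p => lin (X i) (X i.+1) (Y j) (Y j.+1) s v p ^+ 2)).
Proof.
move=> mX mY r0 hi hj hx hy; rewrite -SJ_lin_swap.
exact: (inverse_x mY mX s (fun q => v (q.2, q.1)) r0 hj hi hy hx).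
Qed.

End Swap.

Section ElementaryRates.
Variable R : realType.

(* [e], [h] and [l] stand for the square roots of [eps], [1 / N] and [ln N]. *)
Lemma rate_bounds (e h l : R) : 0 <= e -> 0 < h -> h <= 1 -> 0 < l -> 1 / 2 <= l ^+ 2 -> l ^+ 2 * h <= 2 ->
  let Q := (e * h ^+ 2 + h ^+ 3) * l ^+ 3 in
  [/\ h ^+ 3 <= 8 * Q, l ^+ 3 * h ^+ 3 <= Q, l ^+ 5 * h ^+ 4 <= 2 * Q,
      l ^+ 4 * h ^+ 4 <= 4 * Q & e * (l ^+ 2 * h ^+ 2) <= 2 * Q].
Proof.
move=> e0 h0 h1 l0 l2 lh Q.
have lhalf : 1 / 2 <= l by nra.
have l3 : 0 < l ^+ 3 by apply: exprn_gt0.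
have h3 : 0 < h ^+ 3 by apply: exprn_gt0.
have p1 : 0 <= e * h ^+ 2 * l ^+ 3.
  by apply: mulr_ge0; [apply: mulr_ge0 => //; exact: sqr_ge0|exact: ltW].
have eQ : Q = e * h ^+ 2 * l ^+ 3 + l ^+ 3 * h ^+ 3 by rewrite /Q; ring.
have p2 : 0 < l ^+ 3 * h ^+ 3 by exact: mulr_gt0.
have l38 : 1 <= 8 * l ^+ 3 by rewrite (_ : 8 * l ^+ 3 = (2 * l) ^+ 3); [apply: exprn_ege1; lra|ring].
split.
- have : 1 * h ^+ 3 <= 8 * l ^+ 3 * h ^+ 3 by apply: ler_wpM2r => //; exact: ltW.
  by rewrite eQ; lra.
- by rewrite eQ; lra.
- have -> : l ^+ 5 * h ^+ 4 = (l ^+ 3 * h ^+ 3) * (l ^+ 2 * h) by ring.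
  have : (l ^+ 3 * h ^+ 3) * (l ^+ 2 * h) <= (l ^+ 3 * h ^+ 3) * 2 by apply: ler_wpM2l => //; exact: ltW.
  by rewrite eQ; lra.
- have -> : l ^+ 4 * h ^+ 4 = (l ^+ 3 * h ^+ 3) * (l * h) by ring.
  have k : l * h <= 4.
    have : (1 / 2) * (l * h) <= l * (l * h) by apply: ler_wpM2r => //; apply: mulr_ge0; exact: ltW.
    by rewrite mulrA -expr2; lra.
  have : (l ^+ 3 * h ^+ 3) * (l * h) <= (l ^+ 3 * h ^+ 3) * 4 by apply: ler_wpM2l => //; exact: ltW.
  by rewrite eQ; lra.
- have : (1 / 2) * (e * (l ^+ 2 * h ^+ 2)) <= l * (e * (l ^+ 2 * h ^+ 2)).
    by apply: ler_wpM2r => //; apply: mulr_ge0 => //; apply: mulr_ge0; exact: sqr_ge0.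
  have -> : l * (e * (l ^+ 2 * h ^+ 2)) = e * h ^+ 2 * l ^+ 3 by ring.
  by rewrite eQ; lra.
Qed.

End ElementaryRates.

(** * The reaction and convection terms *)

Section InteriorTerms.
Variable R : realType.
Variables (P : problem R) (Cs eps : R) (N : nat).
Notation X := (xpt P eps N).
Notation Y := (ypt P eps N).
Notation SJ := (SJ N X Y).
Notation B1 := (ext (b1 P)).
Notation B2 := (ext (b2 P)).
Notation Cc := (ext (creac P)).
Notation gx := (gx P eps N).
Notation gy := (gy P eps N).
Notation vlin := (vlin P eps N).
Notation bg := (bg P).
Notation n := (N./2).
Notation r := (N%:R^-1 : R).
Notation L := (ln (N%:R : R)).
Notation kap := (kappa P).
Notation M := (kap * L * r).
Notation h := (Num.sqrt r).
Notation l := (Num.sqrt L).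
Notation e := (Num.sqrt eps).
Notation tau := (h ^+ 5).
Notation E1 := (decay (beta1 P) eps).
Notation E2 := (decay (beta2 P) eps).
Notation ie := (eps^-1).
Notation A i j := ((X i.+1 - X i) * (Y j.+1 - Y j) / 2).
Notation dl := (stabilization N Cs).
Hypothesis hm : mesh_parameters P eps N.
Hypotheses (be1 : 0 < beta1 P) (be2 : 0 < beta2 P) (cs0 : 0 < Cs).
Variables (C B : R) (DS D1 D2 D12 : nat -> nat -> R * R -> R).
Hypothesis hL : layers C eps E1 E2 DS D1 D2 D12.
Notation U := (add4 DS D1 D2 D12).
Notation U0 := (U 0%N 0%N).
Hypotheses (cB1 : continuous B1) (cB2 : continuous B2) (cC : continuous Cc).
Hypothesis hB : forall p, Omega_bar p -> [/\ `|B1 p| <= B, `|B2 p| <= B & `|Cc p| <= B].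
Variable v : R * R -> R.

Let sx := steps_x hm be1 be2.
Let sy := steps_y hm be1 be2.
Let hp := params_shishkin hm be1 be2.
Let mX := mesh_x hm be1 be2.
Let mY := mesh_y hm be1 be2.
Let nN : (n <= N)%N. Proof. by have [_ _ [_ N2 _] _ _] := hm; exact: half_le. Qed.
Let C0 : 0 <= C. Proof. exact: C_ge0 hL. Qed.
Let r0 : 0 < r. Proof. by have [_ _ /andP[]] := hp. Qed.
Let M0 : 0 < M. Proof. by have [_ ?] := param_facts hp. Qed.
Let B0 : 0 <= B.
Proof.
have hb : Omega_bar ((0, 0) : R * R) by split; rewrite /= lexx ler01.
by have [k _ _] := hB hb; exact: le_trans k.
Qed.

Lemma bg_le a b p : Omega_bar p -> `|bg a b p| <= B * (`|a| + `|b|).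
Proof.
move=> hb; have [k1 k2 _] := hB hb; rewrite bgE mulrDr.
by apply: le_trans (ler_normD _ _) _; rewrite !normrM; apply: lerD; exact: ler_wpM2r.
Qed.

Notation err i j s p := (vlin U0 i j s p - U0 p).
Definition on_coarse i j : R := if (i < n)%N && (j < n)%N then 1 else 0.
Definition on_fine i j : R := if (i < n)%N && (j < n)%N then 0 else 1.
Notation coarse := on_coarse.
Notation fine := on_fine.

Let cU0 : continuous U0.
Proof.
have [[s0 s1 s2 s3] _ _ _ _] := hL.
exact: sm_continuous (sm_add4 s0 s1 s2 s3) (isT : (0 + 0 <= 3)%N).
Qed.

Let cell_of i j s p : tri_of X Y i j s p -> X i <= p.1 <= X i.+1 /\ Y j <= p.2 <= Y j.+1.
Proof. exact: tri_box. Qed.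

Let err_le i j s p : (i < N)%N -> (j < N)%N -> tri_of X Y i j s p ->
  `|err i j s p| <= 24 * C * M ^+ 2 /\ `|err i j s p| * coarse i j <= 42 * C * r ^+ 2 * coarse i j.
Proof.
move=> hi hj ht; have hc := cell_of ht; split.
  by rewrite distrC; exact: (lin_estimate hp sx sy hL s hi hj hc).
rewrite /on_coarse; case: (ltnP i n) => hin; last by rewrite /= !mulr0.
case: (ltnP j n) => hjn; last by rewrite /= !mulr0.
by rewrite /= !mulr1 distrC; exact: (lin_estimate_coarse hp sx sy hL s hi hj hin hjn hc).
Qed.

Lemma reaction_term (c : R * R -> R) : continuous c -> (forall p, Omega_bar p -> `|c p| <= B) ->
  `|SJ (fun i j s p => c p * (err i j s p * vlin v i j s p))| <=
  24 * C * B * M ^+ 2 * Num.sqrt (SJ (fun i j s p => vlin v i j s p ^+ 2)).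
Proof.
move=> cc hc; have cv := @continuous_vlin R P eps N v; have cu := @continuous_vlin R P eps N U0.
have K0 : 0 <= 24 * C * B * M ^+ 2 by apply: mulr_ge0; [apply: mulr_ge0 => //; exact: mulr_ge0|exact: sqr_ge0].
have := SJ_abs_le mX mY (w := fun _ _ _ => 1) K0 cv (fun _ _ _ _ _ => ler01).
rewrite area_total // sqrtr1 mul1r.
have -> : SJ (fun i j s p => 1 * vlin v i j s p ^+ 2) = SJ (fun i j s p => vlin v i j s p ^+ 2).
  by apply: SJ_eq => i j s p _ _ _; rewrite mul1r.
apply: le_trans; apply: SJ_abs => [i j s|i j s|i j s p hi hj ht].
- by have := cv i j s => c1; have := cu i j s => c2; cont.
- by have := cv i j s => c1; cont.
have [k1 _] := err_le hi hj ht; have k2 := hc p (tri_of_bar mX mY hi hj ht).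
rewrite !normrM mulrA mul1r; apply: ler_wpM2r => //.
have -> : 24 * C * B * M ^+ 2 = B * (24 * C * M ^+ 2) by ring.
exact: ler_pM.
Qed.

(** On the coarse region the streamline derivative is controlled by the stabilized norm. On the
    layers only eps^(1/2) times the gradient is, but the area of the layers is at most
    [lamx + lamy], of order eps ln N, and its square root compensates. *)
Lemma convection_term :
  `|SJ (fun i j s p => err i j s p * bg (gx v i j s) (gy v i j s) p)| <=
  42 * C * r ^+ 2 * Num.sqrt (SJ (fun i j s p => coarse i j * bg (gx v i j s) (gy v i j s) p ^+ 2)) +
  24 * C * B * M ^+ 2 * (Num.sqrt (lamx P eps N + lamy P eps N) *
    (Num.sqrt (SJ (fun i j s p => gx v i j s ^+ 2)) + Num.sqrt (SJ (fun i j s p => gy v i j s ^+ 2)))).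
Proof.
have cu := @continuous_vlin R P eps N U0.
have cb (i j : nat) (s : bool) : continuous (bg (gx v i j s) (gy v i j s)) by exact: continuous_bg.
have cb3 : cont3 (fun i j s => bg (gx v i j s) (gy v i j s)) by move=> i j s; exact: cb.
have w0 (i j : nat) (s : bool) : (i < N)%N -> (j < N)%N -> 0 <= coarse i j by rewrite /on_coarse; case: ifP.
have f0 (i j : nat) (s : bool) : (i < N)%N -> (j < N)%N -> 0 <= fine i j by rewrite /on_fine; case: ifP.
have K1 : 0 <= 42 * C * r ^+ 2 by apply: mulr_ge0; [exact: mulr_ge0|exact: sqr_ge0].
have K2 : 0 <= 24 * C * B * M ^+ 2 by apply: mulr_ge0; [apply: mulr_ge0 => //; exact: mulr_ge0|exact: sqr_ge0].
have t1 := SJ_abs_le mX mY K1 cb3 w0.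
have t2 := SJ_abs_le mX mY K2 (@cont3_cst R (gx v)) f0.
have t3 := SJ_abs_le mX mY K2 (@cont3_cst R (gy v)) f0.
rewrite /cst3 in t2 t3.
have a1 : Num.sqrt (S3 N (fun i j s => A i j * coarse i j)) <= 1.
  rewrite -[leRHS]sqrtr1 ler_wsqrtr //.
  by apply: (@area_le1 _ _ _ _ mX mY (fun i j _ => coarse i j)) => i j s _ _; rewrite /on_coarse; case: ifP.
have a2 : Num.sqrt (S3 N (fun i j s => A i j * fine i j)) <= Num.sqrt (lamx P eps N + lamy P eps N).
  rewrite ler_wsqrtr //; apply: le_trans (area_layers mX mY nN) _.
  have [_ _ [N4 _ _] _ _] := hm.
  have Xn : X n = 1 - lamx P eps N by exact: mesh_half.
  have Yn : Y n = 1 - lamy P eps N by exact: mesh_half.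
  by rewrite Xn Yn; move: (lamx P eps N) (lamy P eps N) => a b; lra.
have g1 : Num.sqrt (SJ (fun i j s p => fine i j * gx v i j s ^+ 2)) <= Num.sqrt (SJ (fun i j s p => gx v i j s ^+ 2)).
  rewrite ler_wsqrtr //; apply: SJ_le => [i j s|i j s|i j s p _ _ _]; [by cont|by cont|].
  by rewrite /on_fine; case: ifP => _; rewrite ?mul0r ?mul1r // sqr_ge0.
have g2 : Num.sqrt (SJ (fun i j s p => fine i j * gy v i j s ^+ 2)) <= Num.sqrt (SJ (fun i j s p => gy v i j s ^+ 2)).
  rewrite ler_wsqrtr //; apply: SJ_le => [i j s|i j s|i j s p _ _ _]; [by cont|by cont|].
  by rewrite /on_fine; case: ifP => _; rewrite ?mul0r ?mul1r // sqr_ge0.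
have {}t1 := le_trans t1 (ler_wpM2l K1 (ler_wpM2r (sqrtr_ge0 _) a1)); rewrite mul1r in t1.
have {}t2 := le_trans t2 (ler_wpM2l K2 (ler_pM (sqrtr_ge0 _) (sqrtr_ge0 _) a2 g1)).
have {}t3 := le_trans t3 (ler_wpM2l K2 (ler_pM (sqrtr_ge0 _) (sqrtr_ge0 _) a2 g2)).
have := lerD t1 (lerD t2 t3); rewrite -mulrDr -mulrDr; apply: le_trans.
rewrite -!SJ_add; try (by move=> i j s; have := cb i j s => c; cont).
apply: SJ_abs => [i j s|i j s|i j s p hi hj ht].
- by have := cb i j s => c1; have := cu i j s => c2; cont.
- by have := cb i j s => c1; cont.
have [k1 k2] := err_le hi hj ht; have hb := tri_of_bar mX mY hi hj ht.
have k3 := bg_le (gx v i j s) (gy v i j s) hb.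
rewrite normrM; move: k2; rewrite /on_coarse /on_fine; case: ifP => _; rewrite ?mulr1 ?mul0r ?mul1r ?mulr0 ?addr0 ?add0r => k2.
  exact: ler_wpM2r.
rewrite -mulrDr; have -> : 24 * C * B * M ^+ 2 = 24 * C * M ^+ 2 * B by ring.
by rewrite -mulrA; apply: ler_pM.
Qed.

End InteriorTerms.

(** * The stabilization term *)

Section StabilizationTerm.
Variable R : realType.
Variables (P : problem R) (Cs eps : R) (N : nat).
Notation X := (xpt P eps N).
Notation Y := (ypt P eps N).
Notation SJ := (SJ N X Y).
Notation B1 := (ext (b1 P)).
Notation B2 := (ext (b2 P)).
Notation Cc := (ext (creac P)).
Notation gx := (gx P eps N).
Notation gy := (gy P eps N).
Notation vlin := (vlin P eps N).
Notation bg := (bg P).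
Notation n := (N./2).
Notation r := (N%:R^-1 : R).
Notation L := (ln (N%:R : R)).
Notation kap := (kappa P).
Notation M := (kap * L * r).
Notation h := (Num.sqrt r).
Notation l := (Num.sqrt L).
Notation e := (Num.sqrt eps).
Notation tau := (h ^+ 5).
Notation E1 := (decay (beta1 P) eps).
Notation E2 := (decay (beta2 P) eps).
Notation ie := (eps^-1).
Notation A i j := ((X i.+1 - X i) * (Y j.+1 - Y j) / 2).
Notation dl := (stabilization N Cs).
Hypothesis hm : mesh_parameters P eps N.
Hypotheses (be1 : 0 < beta1 P) (be2 : 0 < beta2 P) (cs0 : 0 < Cs).
Variables (C B : R) (DS D1 D2 D12 : nat -> nat -> R * R -> R).
Hypothesis hL : layers C eps E1 E2 DS D1 D2 D12.
Notation U := (add4 DS D1 D2 D12).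
Notation U0 := (U 0%N 0%N).
Hypotheses (cB1 : continuous B1) (cB2 : continuous B2) (cC : continuous Cc).
Hypothesis hB : forall p, Omega_bar p -> [/\ `|B1 p| <= B, `|B2 p| <= B & `|Cc p| <= B].
Variable v : R * R -> R.

Let sx := steps_x hm be1 be2.
Let sy := steps_y hm be1 be2.
Let hp := params_shishkin hm be1 be2.
Let mX := mesh_x hm be1 be2.
Let mY := mesh_y hm be1 be2.
Let nN : (n <= N)%N. Proof. by have [_ _ [_ N2 _] _ _] := hm; exact: half_le. Qed.
Let C0 : 0 <= C. Proof. exact: C_ge0 hL. Qed.
Let r0 : 0 < r. Proof. by have [_ _ /andP[]] := hp. Qed.
Let M0 : 0 < M. Proof. by have [_ ?] := param_facts hp. Qed.
Let B0 : 0 <= B.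
Proof.
have hb : Omega_bar ((0, 0) : R * R) by split; rewrite /= lexx ler01.
by have [k _ _] := hB hb; exact: le_trans k.
Qed.

Notation err i j s p := (vlin U0 i j s p - U0 p).
Notation coarse := (@on_coarse R N).
Notation K := (C * (4 + 62 * B)).
Notation V := (Num.sqrt (SJ (fun i j s p => vlin v i j s p ^+ 2))).

(** The differential operator applied to [I u - u] inside a triangle, where the Laplacian of [I u]
    is zero. *)
Definition strong_residual i j s p : R :=
  eps * (U 2 0%N p + U 0%N 2 p) +
  bg (gx U0 i j s - U 1%N 0%N p) (gy U0 i j s - U 0%N 1%N p) p + Cc p * err i j s p.

Let e0 : 0 < eps. Proof. by have [] := hm. Qed.

(** In the constant, 4 comes from the Laplacian and 62 = 10 + 10 + 42 from the two slopes and the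
    value of the interpolation error. *)
Lemma strong_residual_le i j s p : (i < n)%N -> (j < n)%N -> tri_of X Y i j s p ->
  `|strong_residual i j s p| <= K * (r + ie * E1 p.1 + ie * E2 p.2).
Proof.
move=> hin hjn ht; have hi := leq_trans hin nN; have hj := leq_trans hjn nN.
have hc : X i <= p.1 <= X i.+1 /\ Y j <= p.2 <= Y j.+1 by exact: (tri_box ht).
have hc' : Y j <= (p.2, p.1).1 <= Y j.+1 /\ X i <= (p.2, p.1).2 <= X i.+1 by case: hc.
have hb := tri_of_bar mX mY hi hj ht; have [_ _ hC] := hB hb.
have k1 := laplacian_estimate hp sx sy hL hi hj hc.
have k2 := slope_estimate hp sx sy hL s hi hj hin hjn hc.
have := slope_estimate hp sy sx (layers_swap hL) s hj hi hjn hin hc'.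
rewrite add4_transp {2}/transp /= -surjective_pairing => k3.
have k4 : `|err i j s p| <= 42 * C * r ^+ 2.
  by rewrite distrC; exact: (lin_estimate_coarse hp sx sy hL s hi hj hin hjn hc).
have [_ _ /andP[_ r1] _ _] := hp.
have k5 := bg_le hB (gx U0 i j s - U 1%N 0%N p) (gy U0 i j s - U 0%N 1%N p) hb.
have k6 : B * (`|gx U0 i j s - U 1%N 0%N p| + `|gy U0 i j s - U 0%N 1%N p|) <=
    B * (C * (10 * r + 2 * (ie * E1 p.1)) + C * (10 * r + 2 * (ie * E2 p.2))).
  by apply: ler_wpM2l => //; exact: lerD k2 k3.
have k7 : `|Cc p * err i j s p| <= B * (42 * C * r).
  rewrite normrM; apply: ler_pM => //; apply: le_trans k4 _.
  by apply: ler_wpM2l; [exact: mulr_ge0|rewrite expr2 ler_piMr // ltW].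
have ie0 : 0 <= ie by rewrite invr_ge0 ltW.
have p1 : 0 <= ie * E1 p.1 by apply: mulr_ge0 => //; exact: expR_ge0.
have p2 : 0 <= ie * E2 p.2 by apply: mulr_ge0 => //; exact: expR_ge0.
have n1 := ler_normD (eps * (U 2 0%N p + U 0%N 2 p) + bg (gx U0 i j s - U 1%N 0%N p) (gy U0 i j s - U 0%N 1%N p) p) (Cc p * err i j s p).
have n2 := ler_normD (eps * (U 2 0%N p + U 0%N 2 p)) (bg (gx U0 i j s - U 1%N 0%N p) (gy U0 i j s - U 0%N 1%N p) p).
apply: le_trans n1 _; apply: le_trans (lerD n2 k7) _.
apply: le_trans (lerD (lerD k1 (le_trans k5 k6)) (lexx _)) _.
change (C * (2 * r + 4 * (ie * E1 p.1) + 4 * (ie * E2 p.2)) +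
  B * (C * (10 * r + 2 * (ie * E1 p.1)) + C * (10 * r + 2 * (ie * E2 p.2))) + B * (42 * C * r) <=
  K * (r + ie * E1 p.1 + ie * E2 p.2)).
move: (ie * E1 p.1) (ie * E2 p.2) p1 p2 => z w z0 w0.
have BC : 0 <= B * C by exact: mulr_ge0.
have q1 := mulr_ge0 BC z0; have q2 := mulr_ge0 BC w0; have q3 := mulr_ge0 BC (ltW r0).
have q4 := mulr_ge0 C0 z0; have q5 := mulr_ge0 C0 w0; have q6 := mulr_ge0 C0 (ltW r0).
by move: q1 q2 q3 q4 q5 q6; move: r => rr; lra.
Qed.

Let V0 : 0 <= V. Proof. exact: sqrtr_ge0. Qed.

Lemma grad_coarse_le i j s : (i < n)%N -> (j < n)%N -> `|gx v i j s| + `|gy v i j s| <= 14 * V / r ^+ 2.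
Proof.
move=> hin hjn; have hi := leq_trans hin nN; have hj := leq_trans hjn nN.
have [_ _ _ hr _] := step_facts hp sx hi; have [_ _ _ kr _] := step_facts hp sy hj.
have q1 := inverse_x mX mY s v r0 hi hj (hr hin) (kr hjn).
have q2 := inverse_y s v mX mY r0 hi hj (hr hin) (kr hjn).
rewrite ler_pdivlMr ?exprn_gt0 //.
have -> : 14 * V = 7 * V + 7 * V by ring.
by rewrite mulrDl; apply: lerD.
Qed.

Lemma coarse_layer_integral :
  SJ (fun i j s p => coarse i j * (ie * E1 p.1 + ie * E2 p.2)) <=
  2 * ((beta1 P)^-1 * tau) + 2 * ((beta2 P)^-1 * tau).
Proof.
have [_ _ [N4 _ _] _ _] := hm.
have Xn : X n = 1 - lamx P eps N by exact: mesh_half.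
have Yn : Y n = 1 - lamy P eps N by exact: mesh_half.
have c1 : continuous (fun p : R * R => ie * E1 p.1).
  by have := continuous_fst_comp (@continuous_decay R (beta1 P) eps) => c; cont.
have c2 : continuous (fun p : R * R => ie * E2 p.2).
  by have := continuous_snd_comp (@continuous_decay R (beta2 P) eps) => c; cont.
have c2' : continuous (fun p : R * R => ie * E2 p.1).
  by have := continuous_fst_comp (@continuous_decay R (beta2 P) eps) => c; cont.
have n1 : (0 < n)%N by rewrite half_gt0 (leq_trans _ N4).
have tx : decay (beta1 P) eps (X n) <= tau.
  have [_ _ _ _ k] := sx; have [_ _ k'] := k (X n); apply: (k' n.-1); first by rewrite prednK.
  by rewrite prednK.
have ty : decay (beta2 P) eps (Y n) <= tau.
  have [_ _ _ _ k] := sy; have [_ _ k'] := k (Y n); apply: (k' n.-1); first by rewrite prednK.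
  by rewrite prednK.
have l1 := layer_integral mX mY nN be1 e0 tx.
have l2 := layer_integral mY mX nN be2 e0 ty.
apply: le_trans (lerD l1 l2); rewrite [X in _ <= _ + X]S3_swap -S3_add.
apply: S3_le => i j s hi hj; have [_ _ sX] := mX; have [_ _ sY] := mY.
rewrite /JK J_scale; last exact: continuous_add c1 c2.
rewrite J_add //.
have q1 : 0 <= J (X i) (X i.+1) (Y j) (Y j.+1) s (fun p => ie * E1 p.1).
  by apply: J_ge0 => p _; apply: mulr_ge0; [rewrite invr_ge0 ltW|exact: expR_ge0].
have -> : J (Y j) (Y j.+1) (X i) (X i.+1) s (fun p => ie * E2 p.1) =
    J (X i) (X i.+1) (Y j) (Y j.+1) s (fun p => ie * E2 p.2).
  by have := @JK_swap R X Y i j s _ c2; rewrite /JK => ->.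
have q2 : 0 <= J (X i) (X i.+1) (Y j) (Y j.+1) s (fun p => ie * E2 p.2).
  by apply: J_ge0 => p _; apply: mulr_ge0; [rewrite invr_ge0 ltW|exact: expR_ge0].
rewrite /on_coarse mulrDr; move: q1 q2; move: (J _ _ _ _ _ _) (J _ _ _ _ _ _) => z w z0 w0.
by case: (i < n)%N; case: (j < n)%N => /=; lra.
Qed.

(** The part [K * r] of the residual is paired with the streamline derivative by Cauchy-Schwarz. The
    layer part is small only in L1, so it is paired with the maximum norm of the gradient of [v], at
    most [14 * V / r ^+ 2] on coarse cells. *)
Lemma stabilization_term :
  `|SJ (fun i j s p => dl i j * (strong_residual i j s p * bg (gx v i j s) (gy v i j s) p))| <=
  K * r * (Num.sqrt (Cs * r) * Num.sqrt (SJ (fun i j s p => dl i j * bg (gx v i j s) (gy v i j s) p ^+ 2))) +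
  14 * Cs * K * B * V / r * (2 * ((beta1 P)^-1 * tau) + 2 * ((beta2 P)^-1 * tau)).
Proof.
have cb (i j : nat) (s : bool) : continuous (bg (gx v i j s) (gy v i j s)) by exact: continuous_bg.
have cb3 : cont3 (fun i j s => bg (gx v i j s) (gy v i j s)) by move=> i j s; exact: cb.
have [[s0 s1 s2 s3] _ _ _ _] := hL; have sU := sm_add4 s0 s1 s2 s3.
have u0 : continuous U0 by exact: sm_continuous sU (isT : (0 + 0 <= 3)%N).
have u1 : continuous (U 2 0%N) by exact: sm_continuous sU (isT : (2 + 0 <= 3)%N).
have u2 : continuous (U 0%N 2) by exact: sm_continuous sU (isT : (0 + 2 <= 3)%N).
have u3 : continuous (U 1%N 0%N) by exact: sm_continuous sU (isT : (1 + 0 <= 3)%N).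
have u4 : continuous (U 0%N 1%N) by exact: sm_continuous sU (isT : (0 + 1 <= 3)%N).
have cs : cont3 strong_residual.
  move=> i j s; have c := @continuous_vlin R P eps N U0 i j s.
  have c' : continuous (fun p => bg (gx U0 i j s - U 1%N 0%N p) (gy U0 i j s - U 0%N 1%N p) p).
    change (continuous (fun p => B1 p * (gx U0 i j s - U 1%N 0%N p) + B2 p * (gy U0 i j s - U 0%N 1%N p))).
    by cont.
  by rewrite /strong_residual; cont.
have c1 : continuous (fun p : R * R => E1 p.1) by exact: continuous_fst_comp (@continuous_decay R (beta1 P) eps).
have c2 : continuous (fun p : R * R => E2 p.2) by exact: continuous_snd_comp (@continuous_decay R (beta2 P) eps).
have d0 (i j : nat) (s : bool) : (i < N)%N -> (j < N)%N -> 0 <= dl i j.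
  by move=> _ _; rewrite /stabilization; case: ifP => // _; apply: mulr_ge0; exact: ltW.
have K0 : 0 <= K by apply: mulr_ge0 => //; apply: addr_ge0 => //; exact: mulr_ge0.
have Kr : 0 <= K * r by apply: mulr_ge0 => //; exact: ltW.
have KV : 0 <= 14 * Cs * K * B * V / r.
  by apply: divr_ge0; [repeat apply: mulr_ge0 => //; exact: ltW|exact: ltW].
have t1 := SJ_abs_le mX mY Kr cb3 d0.
have a1 : Num.sqrt (S3 N (fun i j s => A i j * dl i j)) <= Num.sqrt (Cs * r).
  rewrite ler_wsqrtr //.
  have -> : S3 N (fun i j s => A i j * dl i j) = Cs * r * S3 N (fun i j s => A i j * coarse i j).
    by rewrite -S3_scale; apply: eq_S3 => i j s _ _; rewrite /stabilization /on_coarse; case: ifP => _; ring.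
  rewrite ler_piMr //; first by apply: mulr_ge0; exact: ltW.
  by apply: (@area_le1 _ _ _ _ mX mY (fun i j _ => coarse i j)) => i j s _ _; rewrite /on_coarse; case: ifP.
have {}t1 := le_trans t1 (ler_wpM2l Kr (ler_wpM2r (sqrtr_ge0 _) a1)).
have t2 := ler_wpM2l KV coarse_layer_integral.
apply: le_trans (lerD t1 t2); rewrite -SJ_scale; last by move=> i j s; cont.
rewrite -SJ_add; try (by move=> i j s; have := cb i j s => c; cont).
apply: SJ_abs => [i j s|i j s|i j s p hi hj ht].
- by have := cb i j s => c; have := cs i j s => c'; cont.
- by have := cb i j s => c; cont.
rewrite /stabilization /on_coarse; case: ifP => [/andP[hin hjn]|_]; last first.
  by rewrite !mul0r !mulr0 normr0 addr0.
have hb := tri_of_bar mX mY hi hj ht.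
have k1 := strong_residual_le hin hjn ht; have k2 := grad_coarse_le s hin hjn.
have k3 := bg_le hB (gx v i j s) (gy v i j s) hb.
rewrite mul1r normrM (ger0_norm (_ : 0 <= Cs * r)); last by apply: mulr_ge0; exact: ltW.
rewrite normrM.
have ie0 : 0 <= ie by rewrite invr_ge0 ltW.
have p1 : 0 <= ie * E1 p.1 by apply: mulr_ge0 => //; exact: expR_ge0.
have p2 : 0 <= ie * E2 p.2 by apply: mulr_ge0 => //; exact: expR_ge0.
move: k1 k3; move: (strong_residual i j s p) (bg _ _ p) => a b k1 k3.
have k4 : `|b| <= B * (14 * V / r ^+ 2) by apply: le_trans k3 _; exact: ler_wpM2l.
pose q := ie * E1 p.1 + ie * E2 p.2.
have {}k1 : `|a| <= K * r + K * q.
  have -> : K * r + K * q = K * (r + ie * E1 p.1 + ie * E2 p.2) by rewrite /q; ring.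
  exact: k1.
have q0 : 0 <= q by exact: addr_ge0.
have k5 : `|a| * `|b| <= K * r * `|b| + K * q * (B * (14 * V / r ^+ 2)).
  apply: le_trans (ler_wpM2r (normr_ge0 b) k1) _; rewrite mulrDl; apply: lerD => //.
  by apply: ler_wpM2l => //; exact: mulr_ge0.
have Cr : 0 <= Cs * r by apply: mulr_ge0; exact: ltW.
apply: le_trans (ler_wpM2l Cr k5) _; rewrite le_eqVlt; apply/orP; left; apply/eqP.
rewrite -/q; have := r0; clear k5 k1 q0; move: q r V (`|b|) => q' r' V' b' r'0.
by field; exact: lt0r_neq0.
Qed.

End StabilizationTerm.

(** * Conversion of the diffusion bound into the final rate *)

Section RateAlgebra.
Variable R : realType.

(** Since the square root of [lam] is at most [kap * e * l], the negative powers of eps cancel, and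
    the three terms become multiples of e l^2 h^2, l^5 h^4 and l^3 h^3. With all powers of [kap]
    raised to the third by [4 <= kap], they contribute 2, 32 and 4 to the constant 38. *)
Lemma diffusion_rate_le (C eps r e h l kap lam : R) : 0 < e -> eps = e ^+ 2 -> 0 < h -> h <= 1 -> r = h ^+ 2 ->
  0 < l -> 1 / 2 <= l ^+ 2 -> l ^+ 2 * h <= 2 -> 4 <= kap -> 0 <= C -> Num.sqrt lam <= kap * e * l ->
  e * diffusion_rate C eps r (kap * l ^+ 2 * r) lam <= 38 * kap ^+ 3 * C * ((e * h ^+ 2 + h ^+ 3) * l ^+ 3).
Proof.
move=> e0 -> h0 h1 -> l0 l2 lh k4 C0 hs.
have [_ q2 q3 _ q5] := rate_bounds (ltW e0) h0 h1 l0 l2 lh; set Q := (_ + _) * _ in q2 q3 q5 *.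
rewrite /diffusion_rate.
have -> : Num.sqrt (4 * h ^+ 2) = 2 * h.
  by rewrite (_ : 4 * h ^+ 2 = (2 * h) ^+ 2); [rewrite sqrtr_sqr ger0_norm // mulr_ge0 // ltW|ring].
set s := Num.sqrt lam in hs *; have s0 : 0 <= s by exact: sqrtr_ge0.
have en : e != 0 by rewrite lt0r_neq0.
have k0 : 0 < kap by lra.
have Q0 : 0 <= Q by apply: le_trans q2; apply: mulr_ge0; apply: exprn_ge0; exact: ltW.
pose w := (e ^+ 2)^-1 * e * (16 * (kap * l ^+ 2 * h ^+ 2) ^+ 2 + 16 * (kap * l ^+ 2 * h ^+ 2) * h).
have w0 : 0 <= w.
  apply: mulr_ge0; first by apply: mulr_ge0; rewrite ?invr_ge0 ?sqr_ge0 // ltW.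
  apply: addr_ge0; first by apply: mulr_ge0 => //; exact: sqr_ge0.
  apply: mulr_ge0; last exact: ltW.
  by apply: mulr_ge0 => //; apply: mulr_ge0; [apply: mulr_ge0; [exact: ltW|exact: sqr_ge0]|exact: sqr_ge0].
have -> : e * (C * (16 * (kap * l ^+ 2 * h ^+ 2) + 16 * ((e ^+ 2)^-1 * (kap * l ^+ 2 * h ^+ 2) ^+ 2) * s +
    8 * ((e ^+ 2)^-1 * (kap * l ^+ 2 * h ^+ 2)) * (s * (2 * h)))) =
  C * (16 * kap * (e * (l ^+ 2 * h ^+ 2)) + w * s) by rewrite /w; move: (e ^+ 2)^-1 => z; ring.
have -> : 38 * kap ^+ 3 * C * Q = C * (38 * kap ^+ 3 * Q) by ring.
apply: ler_wpM2l => //.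
have t1 : w * s <= 16 * kap ^+ 3 * (l ^+ 5 * h ^+ 4) + 16 * kap ^+ 2 * (l ^+ 3 * h ^+ 3).
  apply: le_trans (ler_wpM2l w0 hs) _; rewrite le_eqVlt; apply/orP; left; apply/eqP.
  by rewrite /w; field.
have k3 : 16 * kap <= kap ^+ 3.
  have -> : kap ^+ 3 = kap ^+ 2 * kap by ring.
  apply: ler_wpM2r; first exact: ltW.
  by have -> : (16 : R) = 4 ^+ 2; [ring|apply: lerXn2r => //; rewrite nnegrE ltW].
have k2 : 4 * kap ^+ 2 <= kap ^+ 3.
  by have -> : kap ^+ 3 = kap * kap ^+ 2; [ring|apply: ler_wpM2r => //; exact: sqr_ge0].
have kk3 : 0 <= kap ^+ 3 by apply: exprn_ge0; exact: ltW.
have u1 : 16 * kap * (e * (l ^+ 2 * h ^+ 2)) <= 16 * kap * (2 * Q).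
  by apply: ler_wpM2l => //; apply: mulr_ge0 => //; exact: ltW.
have u2 : 16 * kap * (2 * Q) <= kap ^+ 3 * (2 * Q) by apply: ler_wpM2r => //; exact: mulr_ge0.
have u3 : 16 * kap ^+ 3 * (l ^+ 5 * h ^+ 4) <= 16 * kap ^+ 3 * (2 * Q).
  by apply: ler_wpM2l => //; exact: mulr_ge0.
have u4 : 16 * kap ^+ 2 * (l ^+ 3 * h ^+ 3) <= 16 * kap ^+ 2 * Q.
  by apply: ler_wpM2l => //; apply: mulr_ge0 => //; exact: sqr_ge0.
have u5 : 4 * kap ^+ 2 * Q <= kap ^+ 3 * Q by apply: ler_wpM2r.
by move: t1 u1 u2 u3 u4 u5; lra.
Qed.

Lemma sqrt_scaled_le (a x nu : R) : 0 <= a -> 0 <= nu -> a * x <= nu ^+ 2 -> Num.sqrt a * Num.sqrt x <= nu.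
Proof.
by move=> a0 n0 hx; rewrite -sqrtrM // -[leRHS](ger0_norm n0) -sqrtr_sqr ler_wsqrtr.
Qed.

End RateAlgebra.

(** * Supercloseness of the interpolant and the discrete solution *)

Section Supercloseness.
Variable R : realType.
Variables (P : problem R) (Cs eps : R) (N : nat).
Notation X := (xpt P eps N).
Notation Y := (ypt P eps N).
Notation SJ := (SJ N X Y).
Notation B1 := (ext (b1 P)).
Notation B2 := (ext (b2 P)).
Notation Cc := (ext (creac P)).
Notation gx := (gx P eps N).
Notation gy := (gy P eps N).
Notation vlin := (vlin P eps N).
Notation bg := (bg P).
Notation n := (N./2).
Notation r := (N%:R^-1 : R).
Notation L := (ln (N%:R : R)).
Notation kap := (kappa P).
Notation M := (kap * L * r).
Notation h := (Num.sqrt r).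
Notation l := (Num.sqrt L).
Notation e := (Num.sqrt eps).
Notation tau := (h ^+ 5).
Notation E1 := (decay (beta1 P) eps).
Notation E2 := (decay (beta2 P) eps).
Notation ie := (eps^-1).
Notation A i j := ((X i.+1 - X i) * (Y j.+1 - Y j) / 2).
Notation dl := (stabilization N Cs).
Hypothesis hm : mesh_parameters P eps N.
Hypotheses (be1 : 0 < beta1 P) (be2 : 0 < beta2 P) (cs0 : 0 < Cs).
Variables (C B : R) (DS D1 D2 D12 : nat -> nat -> R * R -> R).
Hypothesis hL : layers C eps E1 E2 DS D1 D2 D12.
Notation U := (add4 DS D1 D2 D12).
Notation U0 := (U 0%N 0%N).
Hypotheses (cB1 : continuous B1) (cB2 : continuous B2) (cC : continuous Cc).
Hypothesis hB : forall p, Omega_bar p -> [/\ `|B1 p| <= B, `|B2 p| <= B & `|Cc p| <= B].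

Let sx := steps_x hm be1 be2.
Let sy := steps_y hm be1 be2.
Let hp := params_shishkin hm be1 be2.
Let mX := mesh_x hm be1 be2.
Let mY := mesh_y hm be1 be2.
Let nN : (n <= N)%N. Proof. by have [_ _ [_ N2 _] _ _] := hm; exact: half_le. Qed.
Let C0 : 0 <= C. Proof. exact: C_ge0 hL. Qed.
Let r0 : 0 < r. Proof. by have [_ _ /andP[]] := hp. Qed.
Let M0 : 0 < M. Proof. by have [_ ?] := param_facts hp. Qed.
Let B0 : 0 <= B.
Proof.
have hb : Omega_bar ((0, 0) : R * R) by split; rewrite /= lexx ler01.
by have [k _ _] := hB hb; exact: le_trans k.
Qed.

Variables (T1 T2 : nat -> nat -> R * R -> R) (u uN : R * R -> R).
Hypotheses (mu_gt0 : 0 < mu0 P) (hT1 : sm 1 T1) (hT2 : sm 1 T2) (eT1 : T1 0%N 0%N = B1) (eT2 : T2 0%N 0%N = B2).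
Hypothesis hc : forall p, Omega_bar p -> `|Cc p - T1 1%N 0%N p - T2 0%N 1%N p| <= B.
Hypotheses (hu : forall p, Omega_bar p -> u p = U0 p) (hf : forall p, Omega p -> Lop P eps u p = fsrc P p).
Hypotheses (hbd : forall p, bOmega p -> u p = 0) (huN : SDFEM_solution P Cs eps N uN).
Hypothesis hcoer : forall v, VN P eps N v -> 2^-1 * norm_SD P Cs eps N v ^+ 2 <= aSD P Cs eps N v v.

(** The rate of the theorem in terms of the square roots of eps, 1/N and ln N, which makes all
    comparisons polynomial; [rateE] translates it back. *)
Definition rate : R := (e * h ^+ 2 + h ^+ 3) * l ^+ 3.
Definition stability_factor : R := C * (4 + 62 * B).
(** The constants of the five terms of [residual_split], the two diffusion terms counting 38 each;
    the factor 2 undoes the 1/2 of the coercivity. *)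
Definition closeness_constant : R :=
  2 * (76 * kap ^+ 3 * C + 96 * C * B * kap ^+ 2 * (Num.sqrt (mu0 P))^-1 + 336 * C * (Num.sqrt Cs)^-1 +
   192 * C * B * kap ^+ 3 + 8 * stability_factor * Num.sqrt Cs +
   224 * stability_factor * Cs * B * ((beta1 P)^-1 + (beta2 P)^-1) * (Num.sqrt (mu0 P))^-1).

Let N4 : (4 <= N)%N. Proof. by have [_ _ []] := hm. Qed.
Let e0 : 0 < eps. Proof. by have [] := hm. Qed.
Let se0 : 0 < e. Proof. by rewrite sqrtr_gt0. Qed.
Let e2 : eps = e ^+ 2. Proof. by rewrite sqr_sqrtr // ltW. Qed.
Let L0 : 0 < L. Proof. by have [_ _ _ [k _] _] := @rate_facts R N N4; lra. Qed.
Let l0 : 0 < l. Proof. by rewrite sqrtr_gt0. Qed.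
Let l2 : l ^+ 2 = L. Proof. by rewrite sqr_sqrtr // ltW. Qed.
Let h0 : 0 < h. Proof. by rewrite sqrtr_gt0. Qed.
Let h1 : h <= 1. Proof. by have [_ /andP[]] := @rate_facts R N N4. Qed.
Let h2 : r = h ^+ 2. Proof. by rewrite sqr_sqrtr // ltW. Qed.
Let l2half : 1 / 2 <= l ^+ 2. Proof. by rewrite l2; have [_ _ _ []] := @rate_facts R N N4. Qed.
Let lh : l ^+ 2 * h <= 2. Proof. by rewrite l2; have [_ _ _ []] := @rate_facts R N N4. Qed.
Let ME : M = kap * l ^+ 2 * r. Proof. by rewrite l2. Qed.
Let k4 : 4 <= kap. Proof. by have [] := kappa_facts be1 be2. Qed.
Let rates := rate_bounds (ltW se0) h0 h1 l0 l2half lh.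

Lemma sqrt_lam_le beta : 0 < beta -> 5 <= kap * beta ->
  Num.sqrt (rho R * eps * beta^-1 * ln N%:R) <= kap * e * l.
Proof.
move=> b0 hk; have K0 : 0 <= kap by move: k4; lra.
have K1 : 0 <= kap * e * l by apply: mulr_ge0; [apply: mulr_ge0 => //|]; exact: sqrtr_ge0.
rewrite -[leRHS](ger0_norm K1) -sqrtr_sqr ler_wsqrtr //.
have -> : (kap * e * l) ^+ 2 = kap ^+ 2 * (eps * L) by rewrite !exprMn -e2 l2 mulrA.
have -> : rho R * eps * beta^-1 * L = (5 / 2 / beta) * (eps * L) by rewrite /rho; ring.
apply: ler_wpM2r; first by apply: mulr_ge0; exact: ltW.
rewrite ler_pdivrMr //; move: hk; have : 1 <= kap by move: k4; lra.
move: kap => k k1 hk; have kb : 0 <= k * beta by apply: mulr_ge0; lra.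
have := ler_wpM2r kb k1; rewrite mul1r mulrA -expr2; lra.
Qed.

Let chi := (fun p => interp N X Y u p - uN p).
Let hchi : VN P eps N chi.
Proof.
have [[s0 s1 s2 s3] _ _ _ _] := hL; have sU := sm_add4 s0 s1 s2 s3.
by have [] := error_identity (leq_trans (isT : (0 < 4)%N) N4) mX mY hT1 hT2 eT1 eT2 cC
  (fun i j s => @delta_shishkin R P eps N hm be1 be2 Cs i j s) sU hu hf hbd huN.
Qed.

Notation v := chi.
Notation nu := (norm_SD P Cs eps N chi).
Notation GX := (Num.sqrt (SJ (fun i j s p => gx v i j s ^+ 2))).
Notation GY := (Num.sqrt (SJ (fun i j s p => gy v i j s ^+ 2))).
Notation V := (Num.sqrt (SJ (fun i j s p => vlin v i j s p ^+ 2))).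
Notation Dl := (Num.sqrt (SJ (fun i j s p => dl i j * bg (gx v i j s) (gy v i j s) p ^+ 2))).
Notation coarse := (@on_coarse R N).
Notation Sc := (Num.sqrt (SJ (fun i j s p => coarse i j * bg (gx v i j s) (gy v i j s) p ^+ 2))).

Let dl0 i j : 0 <= dl i j.
Proof. by rewrite /stabilization; case: ifP => // _; apply: mulr_ge0; exact: ltW. Qed.

Lemma norm_parts : [/\ e * GX <= nu, e * GY <= nu, Num.sqrt (mu0 P) * V <= nu, Dl <= nu &
  Num.sqrt Cs * h * Sc <= nu].
Proof.
have nE := norm_SD_VN mX mY cB1 cB2 (ltW e0) (ltW mu_gt0) dl0
  (fun i j s => @delta_shishkin R P eps N hm be1 be2 Cs i j s) hchi.
have n0 : 0 <= nu by exact: sqrtr_ge0.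
have cb (i j : nat) (s : bool) : continuous (bg (gx v i j s) (gy v i j s)) by exact: continuous_bg.
have p1 : 0 <= SJ (fun i j s p => gx v i j s ^+ 2) by apply: SJ_ge0 => *; exact: sqr_ge0.
have p2 : 0 <= SJ (fun i j s p => gy v i j s ^+ 2) by apply: SJ_ge0 => *; exact: sqr_ge0.
have p3 : 0 <= SJ (fun i j s p => vlin v i j s p ^+ 2) by apply: SJ_ge0 => *; exact: sqr_ge0.
have p4 : 0 <= SJ (fun i j s p => dl i j * bg (gx v i j s) (gy v i j s) p ^+ 2).
  by apply: SJ_ge0 => i j s p _ _ _; apply: mulr_ge0; [exact: dl0|exact: sqr_ge0].
have p5 : SJ (fun i j s p => dl i j * bg (gx v i j s) (gy v i j s) p ^+ 2) =
    (Cs * r) * SJ (fun i j s p => coarse i j * bg (gx v i j s) (gy v i j s) p ^+ 2).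
  rewrite -SJ_scale; last by move=> i j s; have := cb i j s => c; cont.
  by apply: SJ_eq => i j s p _ _ _; rewrite /stabilization /on_coarse; case: ifP => _; ring.
have m1 := mulr_ge0 (ltW e0) p1; have m2 := mulr_ge0 (ltW e0) p2; have m3 := mulr_ge0 (ltW mu_gt0) p3.
rewrite mulrDr in nE.
split.
- by apply: sqrt_scaled_le => //; [exact: ltW|rewrite nE; lra].
- by apply: sqrt_scaled_le => //; [exact: ltW|rewrite nE; lra].
- by apply: sqrt_scaled_le => //; [exact: ltW|rewrite nE; lra].
- by rewrite -[leLHS]mul1r -[X in X * _]sqrtr1; apply: sqrt_scaled_le => //; rewrite mul1r nE; lra.
- rewrite -sqrtrM ?(ltW cs0) //; apply: sqrt_scaled_le => //; last by rewrite -p5 nE; lra.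
  by apply: mulr_ge0; exact: ltW.
Qed.

Let nu0 : 0 <= nu. Proof. exact: sqrtr_ge0. Qed.

Lemma residual_split :
  aSD P Cs eps N chi chi =
  eps * SJ (fun i j s p => (gx U0 i j s - U 1%N 0%N p) * gx v i j s) +
  eps * SJ (fun i j s p => (gy U0 i j s - U 0%N 1%N p) * gy v i j s) +
  SJ (fun i j s p => (Cc p - T1 1%N 0%N p - T2 0%N 1%N p) * ((vlin U0 i j s p - U0 p) * vlin v i j s p)) -
  SJ (fun i j s p => (vlin U0 i j s p - U0 p) * bg (gx v i j s) (gy v i j s) p) +
  SJ (fun i j s p => dl i j * (strong_residual P eps N DS D1 D2 D12 i j s p * bg (gx v i j s) (gy v i j s) p)).
Proof.
have [[s0 s1 s2 s3] _ _ _ _] := hL; have sU := sm_add4 s0 s1 s2 s3.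
have [_ ->] := error_identity (leq_trans (isT : (0 < 4)%N) N4) mX mY hT1 hT2 eT1 eT2 cC
  (fun i j s => @delta_shishkin R P eps N hm be1 be2 Cs i j s) sU hu hf hbd huN.
have cb (i j : nat) (s : bool) : continuous (bg (gx v i j s) (gy v i j s)) by exact: continuous_bg.
have u0 : continuous U0 by exact: sm_continuous sU (isT : (0 + 0 <= 3)%N).
have u1 : continuous (U 2 0%N) by exact: sm_continuous sU (isT : (2 + 0 <= 3)%N).
have u2 : continuous (U 0%N 2) by exact: sm_continuous sU (isT : (0 + 2 <= 3)%N).
have u3 : continuous (U 1%N 0%N) by exact: sm_continuous sU (isT : (1 + 0 <= 3)%N).
have u4 : continuous (U 0%N 1%N) by exact: sm_continuous sU (isT : (0 + 1 <= 3)%N).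
have t1 : continuous (T1 1%N 0%N) by exact: sm_continuous hT1 (isT : (1 + 0 <= 1)%N).
have t2 : continuous (T2 0%N 1%N) by exact: sm_continuous hT2 (isT : (0 + 1 <= 1)%N).
have cl := @continuous_vlin R P eps N U0; have cv := @continuous_vlin R P eps N v.
have cx : cont3 (fun i j s p => (gx U0 i j s - U 1%N 0%N p) * gx v i j s) by move=> i j s; cont.
have cy : cont3 (fun i j s p => (gy U0 i j s - U 0%N 1%N p) * gy v i j s) by move=> i j s; cont.
have ca : cont3 (fun i j s p => (Cc p - T1 1%N 0%N p - T2 0%N 1%N p) * ((vlin U0 i j s p - U0 p) * vlin v i j s p)).
  by move=> i j s; have c := cl i j s; have c' := cv i j s; cont.
have ct : cont3 (fun i j s p => (vlin U0 i j s p - U0 p) * bg (gx v i j s) (gy v i j s) p).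
  by move=> i j s; have c := cl i j s; have c' := cb i j s; cont.
have cs : cont3 (fun i j s p => dl i j * (strong_residual P eps N DS D1 D2 D12 i j s p * bg (gx v i j s) (gy v i j s) p)).
  move=> i j s; have c := cl i j s; have c' := cb i j s.
  have c2 : continuous (fun p => bg (gx U0 i j s - U 1%N 0%N p) (gy U0 i j s - U 0%N 1%N p) p).
    change (continuous (fun p => B1 p * (gx U0 i j s - U 1%N 0%N p) + B2 p * (gy U0 i j s - U 0%N 1%N p))).
    by cont.
  have c3 : continuous (strong_residual P eps N DS D1 D2 D12 i j s) by rewrite /strong_residual; cont.
  by cont.
have cx' : cont3 (fun i j s p => eps * ((gx U0 i j s - U 1%N 0%N p) * gx v i j s)) by move=> i j s; have c := cx i j s; cont.
have cy' : cont3 (fun i j s p => eps * ((gy U0 i j s - U 0%N 1%N p) * gy v i j s)) by move=> i j s; have c := cy i j s; cont.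
have c12 : cont3 (fun i j s p => eps * ((gx U0 i j s - U 1%N 0%N p) * gx v i j s) +
    eps * ((gy U0 i j s - U 0%N 1%N p) * gy v i j s)).
  by move=> i j s; apply: continuous_add; [exact: cx'|exact: cy'].
have c123 := fun i j s => continuous_add (c12 i j s) (ca i j s).
have c1234 := fun i j s => continuous_add (c123 i j s) (continuous_opp (ct i j s)).
rewrite -(SJ_scale N X Y eps cx) -(SJ_scale N X Y eps cy) -(SJ_add N X Y cx' cy') -(SJ_add N X Y c12 ca) -(SJ_sub N X Y c123 ct).
rewrite -(SJ_add N X Y c1234 cs); apply: SJ_eq => i j s p hi hj ht.
have [e1 e3 e4] : [/\ gx u i j s = gx U0 i j s, gy u i j s = gy U0 i j s & vlin u i j s = vlin U0 i j s].
  apply: eq_vlin => // c d hc' hd _; apply: hu.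
  have [a1 a2] : 0 <= X i <= 1 /\ 0 <= X i.+1 <= 1 by split; [exact: (mesh_itv mX (ltnW hi))|exact: (mesh_itv mX hi)].
  have [b1 b2] : 0 <= Y j <= 1 /\ 0 <= Y j.+1 <= 1 by split; [exact: (mesh_itv mY (ltnW hj))|exact: (mesh_itv mY hj)].
  by split; [case: hc' => ->|case: hd => ->].
by rewrite /residual /strong_residual e1 e3 e4; ring.
Qed.

Lemma term_bound_diffusion :
  `|eps * SJ (fun i j s p => (gx U0 i j s - U 1%N 0%N p) * gx v i j s)| <= 38 * kap ^+ 3 * C * rate * nu /\
  `|eps * SJ (fun i j s p => (gy U0 i j s - U 0%N 1%N p) * gy v i j s)| <= 38 * kap ^+ 3 * C * rate * nu.
Proof.
have [_ _ hv] := hchi; have [n1 n2 _ _ _] := norm_parts.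
have bx (x : R) : 0 <= x <= 1 -> v (x, 0) = 0 /\ v (x, 1) = 0.
  move=> hx; split; apply: hv; split; rewrite /Omega_bar /= ?lexx ?ler01 //; first by case=> _ /=; rewrite ltxx.
  by case=> _ /= /andP[_]; rewrite ltxx.
have by' (y : R) : 0 <= y <= 1 -> v (0, y) = 0 /\ v (1, y) = 0.
  move=> hy; split; apply: hv; split; rewrite /Omega_bar /= ?lexx ?ler01 //; first by case=> /=; rewrite ltxx.
  by case=> /= /andP[_]; rewrite ltxx.
have [_ k1 k2] := kappa_facts be1 be2.
have Xn : 1 - X n = lamx P eps N by rewrite {1}/xpt mesh_half // opprB addrCA subrr addr0.
have Yn : 1 - Y n = lamy P eps N by rewrite {1}/ypt mesh_half // opprB addrCA subrr addr0.
have dx := SJ_diffusion_x hp sx sy hL nN bx; have dy := SJ_diffusion_y hp sx sy hL nN by'.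
have gX : gradx N X Y v = GX by rewrite -(gradxE v mX mY) sqrtr_sqr ger0_norm // sqrtr_ge0.
have gY : gradx N Y X (fun p => v (p.2, p.1)) = GY.
  have -> : GY = Num.sqrt (gradx N Y X (fun p => v (p.2, p.1)) ^+ 2).
    rewrite (gradxE _ mY mX) SJ_swap //; first by move=> i j s; cont.
  by rewrite sqrtr_sqr ger0_norm // sqrtr_ge0.
rewrite gX Xn in dx; rewrite gY Yn in dy.
have r1 := diffusion_rate_le se0 e2 h0 h1 h2 l0 l2half lh k4 C0 (sqrt_lam_le be1 k1).
have r2 := diffusion_rate_le se0 e2 h0 h1 h2 l0 l2half lh k4 C0 (sqrt_lam_le be2 k2).
rewrite -ME -/rate in r1; rewrite -ME -/rate in r2.
have comb (T G D : R) : `|T| <= G * D -> 0 <= G -> e * G <= nu -> e * D <= 38 * kap ^+ 3 * C * rate ->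
    0 <= e * D -> `|eps * T| <= 38 * kap ^+ 3 * C * rate * nu.
  move=> hT hG hG' hD hD'; rewrite normrM (gtr0_norm e0).
  apply: le_trans (ler_wpM2l (ltW e0) hT) _.
  have -> : eps * (G * D) = (e * D) * (e * G) by rewrite [in LHS]e2; ring.
  by apply: ler_pM => //; apply: mulr_ge0 => //; exact: ltW.
have dpos lam : 0 <= e * diffusion_rate C eps r M lam.
  have ie0 : 0 <= ie by rewrite invr_ge0 ltW.
  have M0' := ltW M0.
  apply: mulr_ge0; first exact: ltW.
  apply: mulr_ge0 => //; apply: addr_ge0; first apply: addr_ge0; first exact: mulr_ge0.
    by apply: mulr_ge0; [apply: mulr_ge0 => //; apply: mulr_ge0 => //; exact: sqr_ge0|exact: sqrtr_ge0].
  by apply: mulr_ge0; [apply: mulr_ge0 => //; exact: mulr_ge0|apply: mulr_ge0; exact: sqrtr_ge0].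
by split; [exact: comb dx (sqrtr_ge0 _) n1 r1 (dpos _)|exact: comb dy (sqrtr_ge0 _) n2 r2 (dpos _)].
Qed.

Let imu0 : 0 <= (Num.sqrt (mu0 P))^-1. Proof. by rewrite invr_ge0 sqrtr_ge0. Qed.
Let ics0 : 0 <= (Num.sqrt Cs)^-1. Proof. by rewrite invr_ge0 sqrtr_ge0. Qed.
Let kap0 : 0 <= kap. Proof. by apply: le_trans k4. Qed.
Let rate0 : 0 <= rate.
Proof.
by apply: mulr_ge0; [apply: addr_ge0; [apply: mulr_ge0|]|]; rewrite ?exprn_ge0 ?sqrtr_ge0.
Qed.

Let V_le : V <= (Num.sqrt (mu0 P))^-1 * nu.
Proof. by have [_ _ k _ _] := norm_parts; rewrite mulrC ler_pdivlMr ?sqrtr_gt0 // mulrC. Qed.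

Let M2E : M ^+ 2 = kap ^+ 2 * (l ^+ 4 * h ^+ 4).
Proof. by rewrite ME [in LHS]h2; ring. Qed.

Lemma term_bound_reaction :
  `|SJ (fun i j s p => (Cc p - T1 1%N 0%N p - T2 0%N 1%N p) * ((vlin U0 i j s p - U0 p) * vlin v i j s p))| <=
  96 * C * B * kap ^+ 2 * (Num.sqrt (mu0 P))^-1 * rate * nu.
Proof.
have t1 : continuous (T1 1%N 0%N) by exact: sm_continuous hT1 (isT : (1 + 0 <= 1)%N).
have t2 : continuous (T2 0%N 1%N) by exact: sm_continuous hT2 (isT : (0 + 1 <= 1)%N).
have cc : continuous (fun p => Cc p - T1 1%N 0%N p - T2 0%N 1%N p) by cont.
apply: le_trans (reaction_term hm be1 be2 hL hB v cc hc) _.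
have [_ _ _ q _] := rates; rewrite -/rate in q.
have CB : 0 <= 24 * C * B by apply: mulr_ge0 => //; exact: mulr_ge0.
have CBk : 0 <= 24 * C * B * kap ^+ 2 by apply: mulr_ge0 => //; exact: sqr_ge0.
rewrite M2E; have -> : 96 * C * B * kap ^+ 2 * (Num.sqrt (mu0 P))^-1 * rate * nu =
  (24 * C * B * kap ^+ 2 * (4 * rate)) * ((Num.sqrt (mu0 P))^-1 * nu) by ring.
rewrite [in leLHS]mulrA; apply: ler_pM => //.
- by apply: mulr_ge0 => //; apply: mulr_ge0; apply: exprn_ge0; exact: sqrtr_ge0.
- exact: ler_wpM2l.
Qed.

Lemma term_bound_convection :
  `|SJ (fun i j s p => (vlin U0 i j s p - U0 p) * bg (gx v i j s) (gy v i j s) p)| <=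
  (336 * C * (Num.sqrt Cs)^-1 + 192 * C * B * kap ^+ 3) * rate * nu.
Proof.
apply: le_trans (convection_term hm be1 be2 hL cB1 cB2 hB v) _.
have [n1 n2 _ _ n5] := norm_parts; have [q1 _ q3 _ _] := rates; rewrite -/rate in q1 q3.
have [_ k1 k2] := kappa_facts be1 be2; have [lx0 ly0] := lam_gt0 hm be1 be2.
have s1 : Num.sqrt (lamx P eps N) <= kap * e * l by exact: sqrt_lam_le.
have s2 : Num.sqrt (lamy P eps N) <= kap * e * l by exact: sqrt_lam_le.
have kel : 0 <= kap * e * l by apply: le_trans s1; exact: sqrtr_ge0.
have s12 : Num.sqrt (lamx P eps N + lamy P eps N) <= 2 * (kap * e * l).
  have K1 : 0 <= 2 * (kap * e * l) by exact: mulr_ge0.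
  rewrite -[leRHS](ger0_norm K1) -sqrtr_sqr ler_wsqrtr //.
  have sq lam : 0 < lam -> Num.sqrt lam <= kap * e * l -> lam <= (kap * e * l) ^+ 2.
    by move=> p0 ps; rewrite -(sqr_sqrtr (ltW p0)); apply: lerXn2r; rewrite ?nnegrE ?sqrtr_ge0.
  have := sq _ lx0 s1; have := sq _ ly0 s2; have := sqr_ge0 (kap * e * l).
  by move: (kap * e * l) (lamx P eps N) (lamy P eps N) => a b c; lra.
have CB : 0 <= 24 * C * B by apply: mulr_ge0 => //; exact: mulr_ge0.
have -> : (336 * C * (Num.sqrt Cs)^-1 + 192 * C * B * kap ^+ 3) * rate * nu =
  336 * C * (Num.sqrt Cs)^-1 * rate * nu + 192 * C * B * kap ^+ 3 * rate * nu by ring.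
apply: lerD.
  have a1 : h * Sc <= (Num.sqrt Cs)^-1 * nu by rewrite ler_pdivlMl ?sqrtr_gt0 // mulrA.
  have -> : 42 * C * r ^+ 2 * Sc = (42 * C * h ^+ 3) * (h * Sc) by rewrite [in LHS]h2; ring.
  have -> : 336 * C * (Num.sqrt Cs)^-1 * rate * nu = (42 * C * (8 * rate)) * ((Num.sqrt Cs)^-1 * nu) by ring.
  have C42 : 0 <= 42 * C by exact: mulr_ge0.
  have p1 : 0 <= 42 * C * h ^+ 3 by apply: mulr_ge0 => //; apply: exprn_ge0; exact: sqrtr_ge0.
  have p2 : 0 <= h * Sc by apply: mulr_ge0; exact: sqrtr_ge0.
  exact: ler_pM p1 p2 (ler_wpM2l C42 q1) a1.
have a2 : Num.sqrt (lamx P eps N + lamy P eps N) * (GX + GY) <= kap * l * (4 * nu).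
  have g : 0 <= GX + GY by apply: addr_ge0; exact: sqrtr_ge0.
  apply: le_trans (ler_wpM2r g s12) _.
  have -> : 2 * (kap * e * l) * (GX + GY) = (kap * l) * (2 * (e * GX + e * GY)) by ring.
  apply: ler_wpM2l; first by apply: mulr_ge0 => //; exact: sqrtr_ge0.
  by lra.
have CBM : 0 <= 24 * C * B * M ^+ 2 by apply: mulr_ge0 => //; exact: sqr_ge0.
apply: le_trans (ler_wpM2l CBM a2) _; rewrite M2E.
have -> : 24 * C * B * (kap ^+ 2 * (l ^+ 4 * h ^+ 4)) * (kap * l * (4 * nu)) =
  (96 * C * B * kap ^+ 3 * nu) * (l ^+ 5 * h ^+ 4) by ring.
have -> : 192 * C * B * kap ^+ 3 * rate * nu = (96 * C * B * kap ^+ 3 * nu) * (2 * rate) by ring.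
apply: ler_wpM2l => //; apply: mulr_ge0 => //; apply: mulr_ge0; last exact: exprn_ge0.
by apply: mulr_ge0 => //; exact: mulr_ge0.
Qed.

Lemma term_bound_stabilization :
  `|SJ (fun i j s p => dl i j * (strong_residual P eps N DS D1 D2 D12 i j s p * bg (gx v i j s) (gy v i j s) p))| <=
  (8 * stability_factor * Num.sqrt Cs +
   224 * stability_factor * Cs * B * ((beta1 P)^-1 + (beta2 P)^-1) * (Num.sqrt (mu0 P))^-1) * rate * nu.
Proof.
apply: le_trans (stabilization_term hm be1 be2 cs0 hL cB1 cB2 cC hB v) _.
have [_ _ _ n4 _] := norm_parts; have [q1 _ _ _ _] := rates; rewrite -/rate in q1.
rewrite -/stability_factor; have K0 : 0 <= stability_factor.
  by apply: mulr_ge0 => //; apply: addr_ge0 => //; exact: mulr_ge0.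
have ib : 0 <= (beta1 P)^-1 + (beta2 P)^-1 by apply: addr_ge0; rewrite invr_ge0 ltW.
have -> : (8 * stability_factor * Num.sqrt Cs +
   224 * stability_factor * Cs * B * ((beta1 P)^-1 + (beta2 P)^-1) * (Num.sqrt (mu0 P))^-1) * rate * nu =
  8 * stability_factor * Num.sqrt Cs * rate * nu +
   224 * stability_factor * Cs * B * ((beta1 P)^-1 + (beta2 P)^-1) * (Num.sqrt (mu0 P))^-1 * rate * nu by ring.
apply: lerD.
  have -> : Num.sqrt (Cs * r) = Num.sqrt Cs * h by rewrite sqrtrM // ltW.
  have -> : stability_factor * r * (Num.sqrt Cs * h * Dl) = (stability_factor * Num.sqrt Cs) * (h ^+ 3 * Dl).
    by have := h2; move: h => hh ->; ring.
  have -> : 8 * stability_factor * Num.sqrt Cs * rate * nu =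
    (stability_factor * Num.sqrt Cs) * (8 * rate * nu) by ring.
  apply: ler_wpM2l; first by apply: mulr_ge0 => //; exact: sqrtr_ge0.
  exact: ler_pM (exprn_ge0 _ (sqrtr_ge0 _)) (sqrtr_ge0 _) q1 n4.
have -> : 14 * Cs * stability_factor * B * V / r * (2 * ((beta1 P)^-1 * tau) + 2 * ((beta2 P)^-1 * tau)) =
  (28 * stability_factor * Cs * B * ((beta1 P)^-1 + (beta2 P)^-1)) * (h ^+ 3 * V).
  have hn : h != 0 by rewrite lt0r_neq0.
  have := h2; move: V (beta1 P)^-1 (beta2 P)^-1 stability_factor => V' b1 b2 K.
  by move: hn; move: h => hh hn ->; field.
have -> : 224 * stability_factor * Cs * B * ((beta1 P)^-1 + (beta2 P)^-1) * (Num.sqrt (mu0 P))^-1 * rate * nu =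
  (28 * stability_factor * Cs * B * ((beta1 P)^-1 + (beta2 P)^-1)) * (8 * rate * ((Num.sqrt (mu0 P))^-1 * nu)) by ring.
apply: ler_wpM2l.
  by apply: mulr_ge0 => //; apply: mulr_ge0 => //; apply: mulr_ge0; [exact: mulr_ge0|exact: ltW].
exact: ler_pM (exprn_ge0 _ (sqrtr_ge0 _)) (sqrtr_ge0 _) q1 V_le.
Qed.

Lemma supercloseness : VN P eps N chi /\ nu <= closeness_constant * rate.
Proof.
split; first exact: hchi.
have := hcoer hchi; rewrite residual_split => hco.
have [b1 b2] := term_bound_diffusion; have b3 := term_bound_reaction.
have b4 := term_bound_convection; have b5 := term_bound_stabilization.
set x1 := eps * _ in b1 hco; set x2 := eps * _ in b2 hco; set x3 := SJ _ in b3 hco.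
set x4 := SJ _ in b4 hco; set x5 := SJ _ in b5 hco.
have key : 2^-1 * nu ^+ 2 <= 2^-1 * (closeness_constant * rate * nu).
  have -> : 2^-1 * (closeness_constant * rate * nu) = 38 * kap ^+ 3 * C * rate * nu + 38 * kap ^+ 3 * C * rate * nu +
     96 * C * B * kap ^+ 2 * (Num.sqrt (mu0 P))^-1 * rate * nu +
     (336 * C * (Num.sqrt Cs)^-1 + 192 * C * B * kap ^+ 3) * rate * nu +
     (8 * stability_factor * Num.sqrt Cs +
      224 * stability_factor * Cs * B * ((beta1 P)^-1 + (beta2 P)^-1) * (Num.sqrt (mu0 P))^-1) * rate * nu.
    by rewrite /closeness_constant; move: (Num.sqrt (mu0 P))^-1 (Num.sqrt Cs)^-1 => m c;
      move: (beta1 P)^-1 (beta2 P)^-1 => z w; field.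
  apply: le_trans hco _.
  have a1 := ler_norm x1; have a2 := ler_norm x2; have a3 := ler_norm x3; have a5 := ler_norm x5.
  have a4 : - x4 <= `|x4| by rewrite -normrN ler_norm.
  apply: lerD; last exact: le_trans a5 b5.
  apply: lerD; last exact: le_trans a4 b4.
  apply: lerD; last exact: le_trans a3 b3.
  by apply: lerD; [exact: le_trans a1 b1|exact: le_trans a2 b2].
(* The quadratic inequality is divided by [nu]; for [nu = 0] the claim is the nonnegativity of the
   constant. *)
have [->|nn] := eqVneq nu 0.
  apply: mulr_ge0 => //.
  have K0 : 0 <= stability_factor by apply: mulr_ge0 => //; apply: addr_ge0 => //; exact: mulr_ge0.
  have ib : 0 <= (beta1 P)^-1 + (beta2 P)^-1 by apply: addr_ge0; rewrite invr_ge0 ltW.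
  have kk2 : 0 <= kap ^+ 2 by exact: sqr_ge0.
  have kk3 : 0 <= kap ^+ 3 by exact: exprn_ge0.
  have cs0' := ltW cs0; have scs : 0 <= Num.sqrt Cs by exact: sqrtr_ge0.
  by rewrite /closeness_constant; apply: mulr_ge0; [exact: ler0n|]; do 5?apply: addr_ge0; do ?[assumption | exact: ler0n | apply: mulr_ge0].
have np : 0 < nu by rewrite lt_neqAle eq_sym nn.
move: key; rewrite ler_pM2l ?invr_gt0 // expr2 ler_pM2r //.
Qed.

End Supercloseness.

(** * Postprocessing *)

Section MacroStability.
Variable R : realType.
Implicit Types v : R * R -> R.

Lemma sum_double m (f : nat -> R) : \sum_(i < m.*2) f i = \sum_(k < m) (f k.*2 + f k.*2.+1).
Proof.
elim: m => [|m ih]; first by rewrite !big_ord0.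
by rewrite doubleS !big_ord_recr /= ih addrA.
Qed.

Lemma S3_double m (F : nat -> nat -> bool -> R) : S3 m.*2 F =
  S3 m (fun k l s => F k.*2 l.*2 s + F k.*2.+1 l.*2 s + F k.*2 l.*2.+1 s + F k.*2.+1 l.*2.+1 s).
Proof.
rewrite /S3 (sum_double m (fun i => \sum_(j < m.*2) \sum_(s : bool) F i j s)); apply: eq_bigr => k _.
rewrite (sum_double m (fun j => \sum_(s : bool) F k.*2 j s)) (sum_double m (fun j => \sum_(s : bool) F k.*2.+1 j s)).
rewrite -big_split; apply: eq_bigr => l _ /=.
by rewrite -!big_split; apply: eq_bigr => s _ /=; ring.
Qed.

Lemma sqr_sum3 (a b c : R) : (a + b + c) ^+ 2 <= 3 * (a ^+ 2 + b ^+ 2 + c ^+ 2).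
Proof.
have := sqr_ge0 (a - b); have := sqr_ge0 (a - c); have := sqr_ge0 (b - c); lra.
Qed.

Lemma sqr_mul_le (c f k : R) : - k <= c -> c <= k -> (c * f) ^+ 2 <= k ^+ 2 * f ^+ 2.
Proof.
move=> h1 h2; rewrite exprMn; apply: ler_wpM2r; first exact: sqr_ge0.
by have := mulr_ge0 (_ : 0 <= k - c) (_ : 0 <= k + c); rewrite !subr_ge0 => /(_ h2); lra.
Qed.

Section Cell.
Variables (x0 x1 x2 y0 y1 y2 : R) (s : bool) (p : R * R) (v : R * R -> R).
Hypotheses (hx : x0 < x1) (hy : y0 < y1) (ex : x2 - x1 = x1 - x0) (ey : y2 - y1 = y1 - y0).
Hypothesis hp : tri x0 x2 y0 y2 s p.

(** The formula involves three of these slopes; the fourth completes the sum over the small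
    triangles of orientation [s] in the macro rectangle. The weights are at most 2 in absolute value
    and there are three of them, whence 12. *)
Lemma mgrad_stable : mgrad x0 x1 x2 y0 y1 y2 s v p ^+ 2 <=
  12 * (slope_x x0 x1 v (edge y0 y1 s) ^+ 2 + slope_x x1 x2 v (edge y0 y1 s) ^+ 2 +
        slope_x x0 x1 v (edge y1 y2 s) ^+ 2 + slope_x x1 x2 v (edge y1 y2 s) ^+ 2).
Proof.
have := tri_local hx hy ex ey hp; rewrite /mgrad /qgrad /edge; case: (s) => /=;
  move: ((p.1 - _) / _) ((p.2 - _) / _) => c d [c0 d0 cd].
  rewrite (slope_xC x1 x2) (slope_xC x0 x1) (slope_xC x1 x2 v y1).
  move: (slope_x x1 x2 v y2) (slope_x x0 x1 v y2) (slope_x x1 x2 v y1) (slope_x x0 x1 v y1) => a b g z.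
  apply: le_trans (sqr_sum3 _ _ _) _.
  have q1 : ((3 / 2 - c - d) * a) ^+ 2 <= 2 ^+ 2 * a ^+ 2 by apply: (@sqr_mul_le _ _ 2); lra.
  have q2 : ((c - 1 / 2) * b) ^+ 2 <= 2 ^+ 2 * b ^+ 2 by apply: (@sqr_mul_le _ _ 2); lra.
  have q3 : (d * g) ^+ 2 <= 2 ^+ 2 * g ^+ 2 by apply: (@sqr_mul_le _ _ 2); lra.
  by have := sqr_ge0 z; lra.
move: (slope_x x1 x2 v y1) (slope_x x0 x1 v y0) (slope_x x1 x2 v y0) (slope_x x0 x1 v y1) => z a b g.
apply: le_trans (sqr_sum3 _ _ _) _.
have q1 : ((3 / 2 - c - d) * a) ^+ 2 <= 2 ^+ 2 * a ^+ 2 by apply: (@sqr_mul_le _ _ 2); lra.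
have q2 : ((c - 1 / 2) * b) ^+ 2 <= 2 ^+ 2 * b ^+ 2 by apply: (@sqr_mul_le _ _ 2); lra.
have q3 : (d * g) ^+ 2 <= 2 ^+ 2 * g ^+ 2 by apply: (@sqr_mul_le _ _ 2); lra.
by have := sqr_ge0 z; lra.
Qed.

End Cell.

Definition vertex_squares (x0 x1 y0 y1 : R) s v : R :=
  v (edge x0 x1 s, edge y0 y1 s) ^+ 2 + v (edge x0 x1 (~~ s), edge y0 y1 s) ^+ 2 +
  v (edge x0 x1 s, edge y0 y1 (~~ s)) ^+ 2.

(** The vertices of the four small triangles of orientation [s] in the macro rectangle include all
    six interpolation nodes, and the weights are at most 1 in absolute value. *)
Lemma mval_stable (x0 x1 x2 y0 y1 y2 : R) s p v : x0 < x1 -> y0 < y1 ->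
  x2 - x1 = x1 - x0 -> y2 - y1 = y1 - y0 -> tri x0 x2 y0 y2 s p ->
  mval x0 x1 x2 y0 y1 y2 s v p ^+ 2 <=
  6 * (vertex_squares x0 x1 y0 y1 s v + vertex_squares x1 x2 y0 y1 s v +
       vertex_squares x0 x1 y1 y2 s v + vertex_squares x1 x2 y1 y2 s v).
Proof.
move=> hx hy ex ey hp; have := mval_repr hx hy ex ey hp.
move=> /= -[c [hc _ _ _ ->]].
have cl k : - 1 <= c k <= 1 by rewrite -ler_norml.
have sq k z : (c k * z) ^+ 2 <= z ^+ 2.
  by have /andP[a b] := cl k; have := @sqr_mul_le (c k) z 1 a b; rewrite expr1n mul1r.
rewrite !big_ord_recl big_ord0 /vec6 /= addr0 /vertex_squares /edge.
set k0 := ord0; set k1 := lift _ _; set k2 := lift _ _; set k3 := lift _ _; set k4 := lift _ _; set k5 := lift _ _.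
case: (s) => /=.
  move: (v (x2, y2)) (v (x0, y2)) (v (x2, y0)) (v (x1, y2)) (v (x2, y1)) (v (x1, y1)) => a0 a1 a2 a3 a4 a5.
  move: (v (x0, y1)) (v (x1, y0)) => w w'.
  have n1 := sqr_sum3 (c k0 * a0 + c k1 * a1) (c k2 * a2 + c k3 * a3) (c k4 * a4 + c k5 * a5).
  have n2 := sqr_ge0 (c k0 * a0 - c k1 * a1); have n3 := sqr_ge0 (c k2 * a2 - c k3 * a3).
  have n4 := sqr_ge0 (c k4 * a4 - c k5 * a5).
  have := sq k0 a0; have := sq k1 a1; have := sq k2 a2; have := sq k3 a3; have := sq k4 a4; have := sq k5 a5.
  have := sqr_ge0 w; have := sqr_ge0 w'; have := sqr_ge0 a5; have := sqr_ge0 a4; have := sqr_ge0 a3.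
  have := sqr_ge0 a0; have := sqr_ge0 a1; have := sqr_ge0 a2.
  move: (c k0 * a0) (c k1 * a1) (c k2 * a2) (c k3 * a3) (c k4 * a4) (c k5 * a5) n1 n2 n3 n4 => *; lra.
move: (v (x0, y0)) (v (x2, y0)) (v (x0, y2)) (v (x1, y0)) (v (x0, y1)) (v (x1, y1)) => a0 a1 a2 a3 a4 a5.
move: (v (x2, y1)) (v (x1, y2)) => w w'.
have n1 := sqr_sum3 (c k0 * a0 + c k1 * a1) (c k2 * a2 + c k3 * a3) (c k4 * a4 + c k5 * a5).
have n2 := sqr_ge0 (c k0 * a0 - c k1 * a1); have n3 := sqr_ge0 (c k2 * a2 - c k3 * a3).
have n4 := sqr_ge0 (c k4 * a4 - c k5 * a5).
have := sq k0 a0; have := sq k1 a1; have := sq k2 a2; have := sq k3 a3; have := sq k4 a4; have := sq k5 a5.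
have := sqr_ge0 w; have := sqr_ge0 w'; have := sqr_ge0 a5; have := sqr_ge0 a4; have := sqr_ge0 a3.
have := sqr_ge0 a0; have := sqr_ge0 a1; have := sqr_ge0 a2.
move: (c k0 * a0) (c k1 * a1) (c k2 * a2) (c k3 * a3) (c k4 * a4) (c k5 * a5) n1 n2 n3 n4 => *; lra.
Qed.

(** The mass matrix of a linear element is the area over 12 times the sum of the identity and the
    all-ones matrix, so its smallest eigenvalue is the area over 12. *)
Lemma vertex_mass (x0 x1 y0 y1 : R) s v : x0 < x1 -> y0 < y1 ->
  (x1 - x0) * (y1 - y0) / 2 * vertex_squares x0 x1 y0 y1 s v <=
  12 * J x0 x1 y0 y1 s (fun p => lin x0 x1 y0 y1 s v p ^+ 2).
Proof.
move=> hx hy.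
pose a := slope_x x0 x1 v (edge y0 y1 s); pose b := slope_y y0 y1 v (edge x0 x1 s).
pose c := v (edge x0 x1 s, edge y0 y1 s) - edge x0 x1 s * a - edge y0 y1 s * b.
have el p : lin x0 x1 y0 y1 s v p = c + a * p.1 + b * p.2.
  by rewrite /lin /= -/a -/b /c; ring.
have ea : a * (x1 - x0) = v (x1, edge y0 y1 s) - v (x0, edge y0 y1 s).
  by rewrite /a /slope_x divfK // lt0r_neq0 // subr_gt0.
have eb : b * (y1 - y0) = v (edge x0 x1 s, y1) - v (edge x0 x1 s, y0).
  by rewrite /b /slope_y divfK // lt0r_neq0 // subr_gt0.
have ec : c = v (edge x0 x1 s, edge y0 y1 s) - edge x0 x1 s * a - edge y0 y1 s * b by [].
rewrite (@J_quadratic R x0 x1 y0 y1 s _ (c ^+ 2) (2 * c * a) (2 * c * b) (a ^+ 2) (2 * a * b) (b ^+ 2)) //; last first.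
  by move=> p; rewrite el; ring.
rewrite !el /=; set q := (X in _ / 6 * X).
have A0 : 0 < (x1 - x0) * (y1 - y0) by apply: mulr_gt0; rewrite subr_gt0.
have -> : 12 * ((x1 - x0) * (y1 - y0) / 6 * q) = ((x1 - x0) * (y1 - y0)) / 2 * (4 * q) by field.
apply: ler_wpM2l; first by rewrite divr_ge0 // ltW.
move: ea eb ec; rewrite /q /vertex_squares /edge; case: (s) => /= ea eb ec.
  set f0 := v (x1, y1) in ea eb ec *; set f1 := v (x0, y1) in ea *; set f2 := v (x1, y0) in eb *.
  have m1 : c + a * ((x0 + x1) / 2) + b * ((y0 + y1) / 2) = (f1 + f2) / 2 by lra.
  have m2 : c + a * x1 + b * ((y0 + y1) / 2) = (f0 + f2) / 2 by lra.
  have m3 : c + a * ((x0 + x1) / 2) + b * y1 = (f0 + f1) / 2 by lra.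
  by rewrite m1 m2 m3; clear; move: f0 f1 f2 => f0 f1 f2; have := sqr_ge0 (f0 + f1 + f2); lra.
set f0 := v (x0, y0) in ea eb ec *; set f1 := v (x1, y0) in ea *; set f2 := v (x0, y1) in eb *.
have m1 : c + a * ((x0 + x1) / 2) + b * ((y0 + y1) / 2) = (f1 + f2) / 2 by lra.
have m2 : c + a * x0 + b * ((y0 + y1) / 2) = (f0 + f2) / 2 by lra.
have m3 : c + a * ((x0 + x1) / 2) + b * y0 = (f0 + f1) / 2 by lra.
by rewrite m1 m2 m3; clear; move: f0 f1 f2 => f0 f1 f2; have := sqr_ge0 (f0 + f1 + f2); lra.
Qed.

Section Global.
Variables (m : nat) (X Y : nat -> R).
Hypotheses (mX : mesh m.*2 X) (mY : mesh m.*2 Y).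
Hypothesis eX : forall k, (k < m)%N -> X k.*2.+2 - X k.*2.+1 = X k.*2.+1 - X k.*2.
Hypothesis eY : forall k, (k < m)%N -> Y k.*2.+2 - Y k.*2.+1 = Y k.*2.+1 - Y k.*2.
Notation XX := (fun k => X k.*2).
Notation YY := (fun k => Y k.*2).
Notation mg k l s v p := (mgrad (X k.*2) (X k.*2.+1) (X k.*2.+2) (Y l.*2) (Y l.*2.+1) (Y l.*2.+2) s v p).
Notation mv k l s v p := (mval (X k.*2) (X k.*2.+1) (X k.*2.+2) (Y l.*2) (Y l.*2.+1) (Y l.*2.+2) s v p).

Lemma lt_doubleS k : (k < m)%N -> (k.*2 < m.*2)%N /\ (k.*2.+1 < m.*2)%N.
Proof. by rewrite -leq_double doubleS => h; split; [exact: leq_trans h|exact: h]. Qed.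

Lemma macro_mesh (Z : nat -> R) : mesh m.*2 Z -> mesh m (fun k => Z k.*2).
Proof.
move=> [z0 z1 sZ]; split => // k hk; have [a b] := lt_doubleS hk.
by rewrite doubleS; apply: lt_trans (sZ _ a) (sZ _ b).
Qed.

Lemma continuous_mgrad k l s v : continuous (fun p => mg k l s v p).
Proof. by rewrite /mgrad /qgrad; case: s; cont. Qed.

Lemma continuous_mval k l s v : continuous (fun p => mv k l s v p).
Proof. by rewrite /mval /qval; case: s; cont. Qed.

Let quarter k l : (k < m)%N -> (l < m)%N ->
  let a := (X k.*2.+1 - X k.*2) * (Y l.*2.+1 - Y l.*2) / 2 in
  [/\ [/\ X k.*2 < X k.*2.+1, X k.*2.+1 < X k.*2.+2, Y l.*2 < Y l.*2.+1 & Y l.*2.+1 < Y l.*2.+2],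
   (X k.*2.+2 - X k.*2) * (Y l.*2.+2 - Y l.*2) / 2 = 4 * a,
   (X k.*2.+2 - X k.*2.+1) * (Y l.*2.+1 - Y l.*2) / 2 = a,
   (X k.*2.+1 - X k.*2) * (Y l.*2.+2 - Y l.*2.+1) / 2 = a &
   (X k.*2.+2 - X k.*2.+1) * (Y l.*2.+2 - Y l.*2.+1) / 2 = a].
Proof.
move=> hk hl a; have [k1 k2] := lt_doubleS hk; have [l1 l2] := lt_doubleS hl.
have [_ _ sX] := mX; have [_ _ sY] := mY; rewrite (eX hk) (eY hl).
have -> : X k.*2.+2 - X k.*2 = 2 * (X k.*2.+1 - X k.*2) by have := eX hk; lra.
have -> : Y l.*2.+2 - Y l.*2 = 2 * (Y l.*2.+1 - Y l.*2) by have := eY hl; lra.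
by split => //; [split; [exact: sX|exact: sX|exact: sY|exact: sY]|rewrite /a; ring].
Qed.

(** 48 is 12 from [mgrad_stable] times the ratio 4 of the areas of a macrotriangle and an
    element. *)
Lemma macro_gradient_stability v :
  SJ m XX YY (fun k l s p => mg k l s v p ^+ 2) <=
  48 * SJ m.*2 X Y (fun i j s p => slope_x (X i) (X i.+1) v (edge (Y j) (Y j.+1) s) ^+ 2).
Proof.
rewrite SJ_cst // S3_double -S3_scale; apply: S3_le => k l s hk hl.
have [[x01 x12 y01 y12] a1 a2 a3 a4] := quarter hk hl; rewrite a2 a3 a4.
have x02 := lt_trans x01 x12; have y02 := lt_trans y01 y12.
have cm := @continuous_mgrad k l s v.
have st p : tri (X k.*2) (X k.*2.+2) (Y l.*2) (Y l.*2.+2) s p -> `|mg k l s v p ^+ 2| <=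
   12 * (slope_x (X k.*2) (X k.*2.+1) v (edge (Y l.*2) (Y l.*2.+1) s) ^+ 2 + slope_x (X k.*2.+1) (X k.*2.+2) v (edge (Y l.*2) (Y l.*2.+1) s) ^+ 2 +
        slope_x (X k.*2) (X k.*2.+1) v (edge (Y l.*2.+1) (Y l.*2.+2) s) ^+ 2 + slope_x (X k.*2.+1) (X k.*2.+2) v (edge (Y l.*2.+1) (Y l.*2.+2) s) ^+ 2).
  by move=> hp; rewrite ger0_norm ?sqr_ge0 //; apply: mgrad_stable => //; [exact: eX|exact: eY].
have cm2 : continuous (fun p => mg k l s v p ^+ 2) by cont.
have := J_abs_cst x02 y02 cm2 st; rewrite a1 /JK !doubleS.
move/(le_trans (ler_norm _))/le_trans; apply; rewrite le_eqVlt; apply/orP; left; apply/eqP; ring.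
Qed.

(** 288 = 6 * 4 * 12, from [mval_stable], the ratio of the areas and [vertex_mass]. *)
Lemma macro_value_stability v :
  SJ m XX YY (fun k l s p => mv k l s v p ^+ 2) <=
  288 * SJ m.*2 X Y (fun i j s p => lin (X i) (X i.+1) (Y j) (Y j.+1) s v p ^+ 2).
Proof.
rewrite [in leRHS]/SJ S3_double -S3_scale; apply: S3_le => k l s hk hl.
have [[x01 x12 y01 y12] a1 a2 a3 a4] := quarter hk hl.
have x02 := lt_trans x01 x12; have y02 := lt_trans y01 y12.
have cm := @continuous_mval k l s v.
have st p : tri (X k.*2) (X k.*2.+2) (Y l.*2) (Y l.*2.+2) s p -> `|mv k l s v p ^+ 2| <=
   6 * (vertex_squares (X k.*2) (X k.*2.+1) (Y l.*2) (Y l.*2.+1) s v + vertex_squares (X k.*2.+1) (X k.*2.+2) (Y l.*2) (Y l.*2.+1) s v +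
       vertex_squares (X k.*2) (X k.*2.+1) (Y l.*2.+1) (Y l.*2.+2) s v + vertex_squares (X k.*2.+1) (X k.*2.+2) (Y l.*2.+1) (Y l.*2.+2) s v).
  by move=> hp; rewrite ger0_norm ?sqr_ge0 //; apply: mval_stable => //; [exact: eX|exact: eY].
have cm2 : continuous (fun p => mv k l s v p ^+ 2) by cont.
have := J_abs_cst x02 y02 cm2 st; rewrite a1 /JK !doubleS.
move/(le_trans (ler_norm _))/le_trans; apply.
have := vertex_mass s v x01 y01; have := vertex_mass s v x12 y01; have := vertex_mass s v x01 y12.
have := vertex_mass s v x12 y12; rewrite a2 a3 a4.
move: (J _ _ _ _ _ _) (J _ _ _ _ _ _) (J _ _ _ _ _ _) (J _ _ _ _ _ _) (_ / 2) => j1 j2 j3 j4 a.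
move: (vertex_squares _ _ _ _ _ _) (vertex_squares _ _ _ _ _ _) (vertex_squares _ _ _ _ _ _) (vertex_squares _ _ _ _ _ _) => *; lra.
Qed.

End Global.
End MacroStability.

(** * Quadratic interpolation errors of the solution in L2 *)

Section MacroErrorIntegrals.
Variable R : realType.
Variables (m n' : nat) (C eps r M tau beta : R) (E2 : R -> R) (X Y : nat -> R).
Variables (DS D1 D2 D12 : nat -> nat -> R * R -> R).
(** The transition index is even, so the transition lines are lines of the macro mesh. *)
Notation n := n'.*2.
Notation E1 := (decay beta eps).
Hypothesis hp : params eps r M tau.
Hypothesis hX : steps m.*2 n eps r M tau E1 X.
Hypothesis hY : steps m.*2 n eps r M tau E2 Y.
Hypothesis hL : layers C eps E1 E2 DS D1 D2 D12.
Hypotheses (nm : (n' <= m)%N) (n0 : (0 < n')%N) (b0 : 0 < beta).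
Notation ie := (eps^-1).
Notation U := (add4 DS D1 D2 D12).
Notation XX := (fun k => X k.*2).
Notation YY := (fun k => Y k.*2).
Notation mg k l s v p := (mgrad (X k.*2) (X k.*2.+1) (X k.*2.+2) (Y l.*2) (Y l.*2.+1) (Y l.*2.+2) s v p).
Notation mv k l s v p := (mval (X k.*2) (X k.*2.+1) (X k.*2.+2) (Y l.*2) (Y l.*2.+1) (Y l.*2.+2) s v p).

Let mX : mesh m.*2 X. Proof. by case: hX. Qed.
Let mY : mesh m.*2 Y. Proof. by case: hY. Qed.
Let mXX : mesh m XX. Proof. exact: macro_mesh. Qed.
Let mYY : mesh m YY. Proof. exact: macro_mesh. Qed.
Let odd_neq k : k.*2.+1 != n.
Proof. by apply/eqP => /(congr1 odd); rewrite /= !odd_double. Qed.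
Let sU : sm 3 U. Proof. by have [[s0 s1 s2 s3] _ _ _ _] := hL; exact: sm_add4. Qed.
Let C0 : 0 <= C. Proof. exact: C_ge0 hL. Qed.

(** Of the square of [ie * E1] on the coarse cells one factor is bounded by [ie * tau] and the other
    is integrated, so that a single factor 1/eps is left; it is cancelled by the eps of the energy
    norm. *)
Lemma macro_gradient_error :
  SJ m XX YY (fun k l s p => (mg k l s (U 0%N 0%N) p - U 1%N 0%N p) ^+ 2) <=
  (2 * 120 ^+ 2) * C ^+ 2 * M ^+ 2 + 16 * C ^+ 2 * (ie * beta^-1 * tau ^+ 2) +
  (2 * 288 ^+ 2) * C ^+ 2 * ((ie * M ^+ 2) ^+ 2 * (1 - X n)).
Proof.
have [e0 _ _ _ _] := hp; have [ie0 M0 t0 tM tM2] := param_facts hp.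
have cU : continuous (U 1%N 0%N) by exact: sm_continuous sU (isT : (1 + 0 <= 3)%N).
have cE : continuous (fun p : R * R => E1 p.1) by exact: continuous_fst_comp (@continuous_decay R beta eps).
pose w1 k : R := if (k < n')%N then 1 else 0; pose w2 k : R := if (k < n')%N then 0 else 1.
pose G1 (k l : nat) (s : bool) (p : R * R) : R := (2 * 120 ^+ 2) * C ^+ 2 * M ^+ 2 + (2 * 288 ^+ 2) * C ^+ 2 * (ie * M ^+ 2) ^+ 2 * w2 k.
pose G2 (k l : nat) (s : bool) (p : R * R) : R := w1 k * (ie * E1 p.1).
have cG2 : cont3 G2 by move=> k l s; rewrite /G2; cont.
have cG1 : cont3 G1 by move=> k l s; rewrite /G1; cont.
have K0 : 0 <= 8 * C ^+ 2 * (ie * tau).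
  by apply: mulr_ge0; [apply: mulr_ge0 => //; exact: sqr_ge0|apply: mulr_ge0 => //; exact: ltW].
have tX : E1 (X n) <= tau.
  have [_ _ _ _ k] := hX; have [_ _ k'] := k (X n).
  have nn : n.-1.+1 = n by rewrite prednK // double_gt0.
  by apply: (k' n.-1); rewrite nn.
apply: (@le_trans _ _ (SJ m XX YY G1 + 8 * C ^+ 2 * (ie * tau) * SJ m XX YY G2)).
  rewrite -SJ_scale // -SJ_add //; last by move=> k l s; have c := cG2 k l s; cont.
  apply: SJ_le => [k l s|k l s|k l s p hk hl ht].
  - by have c := @continuous_mgrad R X Y k l s (U 0%N 0%N); cont.
  - by have c := cG2 k l s; have c' := cG1 k l s; cont.
  have [k1 k2] := lt_doubleS hk; have [l1 l2] := lt_doubleS hl.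
  rewrite /tri_of !doubleS in ht; have [/andP[p0 p1] _] := tri_box ht.
  have := mgrad_estimate hp hX hY hL k2 (odd_neq k) l2 (odd_neq l) ht.
  rewrite ltn_double => est; rewrite -[leLHS]real_normK ?num_real //.
  apply: le_trans (_ : (C * (120 * M + (if (k < n')%N then 2 * (ie * E1 p.1) else 288 * (ie * M ^+ 2)))) ^+ 2 <= _).
    by apply: lerXn2r; rewrite ?nnegrE //; apply: le_trans est.
  have C2 : 0 <= C ^+ 2 by exact: sqr_ge0.
  rewrite /G1 /G2 /w1 /w2; case: ifP => hkn.
    have hE : E1 p.1 <= tau.
      have [_ _ _ _ q] := hX; have [_ _ q'] := q p.1; apply: (q' k.*2.+1) => //.
      by rewrite -doubleS leq_double.
    have E0 : 0 <= E1 p.1 by exact: expR_ge0.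
    have ieE : 0 <= ie * E1 p.1 by apply: mulr_ge0 => //; exact: ltW.
    have ieE2 : ie * E1 p.1 <= ie * tau by apply: ler_wpM2l => //; exact: ltW.
    rewrite exprMn mul1r mulr0 addr0.
    have -> : (2 * 120 ^+ 2) * C ^+ 2 * M ^+ 2 + 8 * C ^+ 2 * (ie * tau) * (ie * E1 p.1) =
      C ^+ 2 * ((2 * 120 ^+ 2) * M ^+ 2 + 8 * ((ie * tau) * (ie * E1 p.1))) by ring.
    apply: ler_wpM2l => //.
    have := ler_wpM2r ieE ieE2; have := sqr_ge0 (120 * M - 2 * (ie * E1 p.1)).
    by move: (ie * E1 p.1) (ie * tau) => a b; lra.
  rewrite mul0r mulr0 addr0 mulr1 exprMn.
  have -> : (2 * 120 ^+ 2) * C ^+ 2 * M ^+ 2 + (2 * 288 ^+ 2) * C ^+ 2 * (ie * M ^+ 2) ^+ 2 =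
      C ^+ 2 * ((2 * 120 ^+ 2) * M ^+ 2 + (2 * 288 ^+ 2) * (ie * M ^+ 2) ^+ 2) by ring.
  apply: ler_wpM2l => //; have := sqr_ge0 (120 * M - 288 * (ie * M ^+ 2)).
  by move: (ie * M ^+ 2) => a; lra.
have s2 : SJ m XX YY G2 <= 2 * (beta^-1 * tau).
  have := layer_integral mXX mYY nm b0 e0 tX; apply: le_trans; rewrite le_eqVlt; apply/orP; left; apply/eqP.
  by apply: eq_S3 => k l s _ _; rewrite /G2 /JK J_scale //; cont.
have s1 : SJ m XX YY G1 = (2 * 120 ^+ 2) * C ^+ 2 * M ^+ 2 + (2 * 288 ^+ 2) * C ^+ 2 * ((ie * M ^+ 2) ^+ 2 * (1 - X n)).
  rewrite /G1 (SJ_cst (fun k l s => (2 * 120 ^+ 2) * C ^+ 2 * M ^+ 2 + (2 * 288 ^+ 2) * C ^+ 2 * (ie * M ^+ 2) ^+ 2 * w2 k) mXX mYY).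
  have := area_sum m XX YY w2 (fun=> 1); rewrite (total_sum mYY) /w2 (fine_sum nm mXX) mulr1 => f.
  have t := area_total mXX mYY.
  rewrite (eq_S3 (G := fun k l s => ((2 * 120 ^+ 2) * C ^+ 2 * M ^+ 2) * ((XX k.+1 - XX k) * (YY l.+1 - YY l) / 2 * 1) +
     ((2 * 288 ^+ 2) * C ^+ 2 * (ie * M ^+ 2) ^+ 2) * ((XX k.+1 - XX k) * (YY l.+1 - YY l) / 2 * (w2 k * 1)))); last first.
    by move=> k l s _ _ /=; rewrite /w2; move: (if _ then _ else _ : R) => z; ring.
  by rewrite S3_add !S3_scale t f mulr1; ring.
rewrite s1; have := ler_wpM2l K0 s2.
have -> : 8 * C ^+ 2 * (ie * tau) * (2 * (beta^-1 * tau)) = 16 * C ^+ 2 * (ie * beta^-1 * tau ^+ 2) by ring.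
by move: (SJ _ _ _ _) (16 * _ * _) => a b; move: ((2 * 120 ^+ 2) * _ * _) ((2 * 288 ^+ 2) * _ * _) => c d; lra.
Qed.

Lemma macro_value_error :
  SJ m XX YY (fun k l s p => (mv k l s (U 0%N 0%N) p - U 0%N 0%N p) ^+ 2) <= (288 * (C * M ^+ 2)) ^+ 2.
Proof.
have cU : continuous (U 0%N 0%N) by exact: sm_continuous sU (isT : (0 + 0 <= 3)%N).
have -> : (288 * (C * M ^+ 2)) ^+ 2 = SJ m XX YY (fun _ _ _ _ => (288 * (C * M ^+ 2)) ^+ 2).
  rewrite (SJ_cst (fun _ _ _ => (288 * (C * M ^+ 2)) ^+ 2) mXX mYY).
  have t := area_total mXX mYY.
  rewrite (eq_S3 (G := fun k l s => (288 * (C * M ^+ 2)) ^+ 2 * ((XX k.+1 - XX k) * (YY l.+1 - YY l) / 2 * 1))); last first.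
    by move=> k l s _ _; rewrite mulr1 mulrC.
  by rewrite S3_scale t mulr1.
apply: SJ_le => [k l s|k l s|k l s p hk hl ht].
- by have c := @continuous_mval R X Y k l s (U 0%N 0%N); cont.
- by cont.
have [k1 k2] := lt_doubleS hk; have [l1 l2] := lt_doubleS hl.
rewrite /tri_of !doubleS in ht.
have est := mval_estimate hp hX hY hL k2 (odd_neq k) l2 (odd_neq l) ht.
have B0 := le_trans (normr_ge0 _) est.
by rewrite -[leLHS]real_normK ?num_real //; apply: lerXn2r est; rewrite nnegrE.
Qed.

End MacroErrorIntegrals.

(** * The postprocessed function on one macrotriangle *)

Section LocalPostprocessing.
Variable R : realType.
Variables (x0 x1 x2 y0 y1 y2 : R) (s : bool) (v q : R * R -> R).
Hypotheses (hx : x0 < x1) (hy : y0 < y1) (ex : x2 - x1 = x1 - x0) (ey : y2 - y1 = y1 - y0).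
Hypothesis hq : quadratic_interpolant (half_rect x0 x2 y0 y2 s) v q.

Lemma interpolation_nodes :
  let X0 := if s then x2 else x0 in let Y0 := if s then y2 else y0 in
  let X2 := if s then x0 else x2 in let Y2 := if s then y0 else y2 in
  [/\ [/\ v (X0, Y0) = q (X0, Y0), v (X2, Y0) = q (X2, Y0) & v (X0, Y2) = q (X0, Y2)],
      v (x1, Y0) = q (x1, Y0), v (X0, y1) = q (X0, y1) & v (x1, y1) = q (x1, y1)].
Proof.
have [_ hn] := hq; move: (ex) (ey) => xe ye.
have mx : (x0 + x2) / 2 = x1 by lra.
have mx' : (x2 + x0) / 2 = x1 by lra.
have my : (y0 + y2) / 2 = y1 by lra.
have my' : (y2 + y0) / 2 = y1 by lra.
have dd (z : R) : (z + z) / 2 = z by lra.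
move: hn; rewrite /interp_nodes /half_rect /midpoint; case: (s) => /=;
  rewrite ?mx ?mx' ?my ?my' ?dd => hn.
  by split; [split|..]; symmetry; apply: hn; rewrite !inE eqxx ?orbT.
by split; [split|..]; symmetry; apply: hn; rewrite !inE eqxx ?orbT.
Qed.

(** The interpolation formulas are exact on quadratics, so they reproduce [q] from its own nodal
    values, which are those of [v]. *)
Lemma postprocessing_local : exists qx qy : R * R -> R,
  [/\ forall p : R * R, is_derive p.1 1 (fun t => q (t, p.2)) (qx p),
      forall p : R * R, is_derive p.2 1 (fun t => q (p.1, t)) (qy p),
      forall p, q p = mval x0 x1 x2 y0 y1 y2 s v p,
      forall p, qx p = mgrad x0 x1 x2 y0 y1 y2 s v p
    & forall p, qy p = mgrad y0 y1 y2 x0 x1 x2 s (fun a => v (a.2, a.1)) (p.2, p.1)].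
Proof.
have [[a0 [a1 [a2 [a3 [a4 [a5 qE]]]]]] _] := hq.
have := interpolation_nodes => /= -[[n1 n2 n3] n4 n5 n6].
exists (fun p => a1 + 2 * a3 * p.1 + a4 * p.2), (fun p => a2 + 2 * a5 * p.2 + a4 * p.1).
have fx p : (fun t => q (t, p.2)) = (fun t : R => a0 + a1 * t + a2 * p.2 + a3 * t ^+ 2 + a4 * (t * p.2) + a5 * p.2 ^+ 2).
  by apply/funext => t; rewrite qE.
have fy p : (fun t => q (p.1, t)) = (fun t : R => a0 + a1 * p.1 + a2 * t + a3 * p.1 ^+ 2 + a4 * (p.1 * t) + a5 * t ^+ 2).
  by apply/funext => t; rewrite qE.
have qE' (p : R * R) : q (p.2, p.1) = a0 + a2 * p.1 + a1 * p.2 + a5 * p.1 ^+ 2 + a4 * (p.1 * p.2) + a3 * p.2 ^+ 2.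
  by rewrite qE /=; ring.
move: (hx) (hy) (ex) (ey) => xh yh xe ye.
have x12 : x1 < x2 by lra.
have y12 : y1 < y2 by lra.
have e1 := lt_eqF hx; have e2 := gt_eqF hx; have e3 := lt_eqF hy; have e4 := gt_eqF hy.
have e5 := lt_eqF x12; have e6 := lt_eqF y12.
have ex' : x0 - x1 = x1 - x2 by lra.
have ey' : y0 - y1 = y1 - y2 by lra.
split.
- by move=> p; rewrite fx; apply: is_derive_eq; rewrite /GRing.scale /=; ring.
- by move=> p; rewrite fy; apply: is_derive_eq; rewrite /GRing.scale /=; ring.
- move=> p; rewrite /mval; move: n1 n2 n3 n4 n5 n6; case: (s) => n1 n2 n3 n4 n5 n6.
    rewrite -(@qval_exact R a0 a1 a2 a3 a4 a5 q x2 x1 x0 y2 y1 y0 p) ?e5 ?e6 //.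
    by rewrite /qval n1 n2 n3 n4 n5 n6.
  rewrite -(@qval_exact R a0 a1 a2 a3 a4 a5 q x0 x1 x2 y0 y1 y2 p) ?e2 ?e4 //.
  by rewrite /qval n1 n2 n3 n4 n5 n6.
- move=> p; rewrite /mgrad; move: n1 n2 n3 n4 n5 n6; case: (s) => n1 n2 n3 n4 n5 n6.
    rewrite -(@qgrad_exact R a0 a1 a2 a3 a4 a5 q x2 x1 x0 y2 y1 p) ?e5 ?e6 //.
    by rewrite /qgrad /slope_x n1 n2 n4 n5 n6.
  rewrite -(@qgrad_exact R a0 a1 a2 a3 a4 a5 q x0 x1 x2 y0 y1 p) ?e2 ?e4 //.
  by rewrite /qgrad /slope_x n1 n2 n4 n5 n6.
- move=> p; rewrite /mgrad; move: n1 n2 n3 n4 n5 n6; case: (s) => n1 n2 n3 n4 n5 n6.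
    rewrite -[LHS](@qgrad_exact R a0 a2 a1 a5 a4 a3 (fun a => q (a.2, a.1)) y2 y1 y0 x2 x1 (p.2, p.1)) ?e5 ?e6 //.
    by rewrite /qgrad /slope_x /= n1 n3 n4 n5 n6.
  rewrite -[LHS](@qgrad_exact R a0 a2 a1 a5 a4 a3 (fun a => q (a.2, a.1)) y0 y1 y2 x0 x1 (p.2, p.1)) ?e2 ?e4 //.
  by rewrite /qgrad /slope_x /= n1 n3 n4 n5 n6.
Qed.

End LocalPostprocessing.

(** * Error of the postprocessing for a general nodal function *)

Section PostprocessedError.
Variable R : realType.

Lemma mgrad_sub (x0 x1 x2 y0 y1 y2 : R) s f g p :
  mgrad x0 x1 x2 y0 y1 y2 s (fun q => f q - g q) p =
  mgrad x0 x1 x2 y0 y1 y2 s f p - mgrad x0 x1 x2 y0 y1 y2 s g p.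
Proof. by rewrite /mgrad /qgrad /slope_x; case: s; ring. Qed.

Lemma mval_sub (x0 x1 x2 y0 y1 y2 : R) s f g p :
  mval x0 x1 x2 y0 y1 y2 s (fun q => f q - g q) p =
  mval x0 x1 x2 y0 y1 y2 s f p - mval x0 x1 x2 y0 y1 y2 s g p.
Proof. by rewrite /mval /qval; case: s; ring. Qed.

Section Abstract.
Variables (m n' : nat) (C eps r M tau beta : R) (E2 : R -> R) (X Y : nat -> R).
Variables (DS D1 D2 D12 : nat -> nat -> R * R -> R).
Notation n := n'.*2.
Notation E1 := (decay beta eps).
Hypothesis hp : params eps r M tau.
Hypothesis hX : steps m.*2 n eps r M tau E1 X.
Hypothesis hY : steps m.*2 n eps r M tau E2 Y.
Hypothesis hL : layers C eps E1 E2 DS D1 D2 D12.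
Hypotheses (nm : (n' <= m)%N) (n0 : (0 < n')%N) (b0 : 0 < beta).
Notation ie := (eps^-1).
Notation U := (add4 DS D1 D2 D12).
Notation XX := (fun k => X k.*2).
Notation YY := (fun k => Y k.*2).
Notation mg k l s v p := (mgrad (X k.*2) (X k.*2.+1) (X k.*2.+2) (Y l.*2) (Y l.*2.+1) (Y l.*2.+2) s v p).
Notation mv k l s v p := (mval (X k.*2) (X k.*2.+1) (X k.*2.+2) (Y l.*2) (Y l.*2.+1) (Y l.*2.+2) s v p).

Let mX : mesh m.*2 X. Proof. by case: hX. Qed.
Let mY : mesh m.*2 Y. Proof. by case: hY. Qed.
Let sU : sm 3 U. Proof. by have [[s0 s1 s2 s3] _ _ _ _] := hL; exact: sm_add4. Qed.

Lemma double_steps E Z : steps m.*2 n eps r M tau E Z ->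
  forall k, (k < m)%N -> Z k.*2.+2 - Z k.*2.+1 = Z k.*2.+1 - Z k.*2.
Proof.
move=> [_ _ _ q _] k hk; have [_ k2] := lt_doubleS hk; apply: q => //.
by apply/eqP => /(congr1 odd); rewrite /= !odd_double.
Qed.

(** The quadratic interpolant of the solution is inserted: one part is its interpolation error, the
    other the interpolant of the nodal difference, to which the stability bound applies. *)
Lemma postprocessed_gradient w :
  SJ m XX YY (fun k l s p => (U 1%N 0%N p - mg k l s w p) ^+ 2) <=
  2 * (2 * 120 ^+ 2 * C ^+ 2 * M ^+ 2 + 16 * C ^+ 2 * (ie * beta^-1 * tau ^+ 2) +
       2 * 288 ^+ 2 * C ^+ 2 * ((ie * M ^+ 2) ^+ 2 * (1 - X n))) +
  96 * SJ m.*2 X Y (fun i j s p => slope_x (X i) (X i.+1) (fun q => U 0%N 0%N q - w q) (edge (Y j) (Y j.+1) s) ^+ 2).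
Proof.
have cU : continuous (U 1%N 0%N) by exact: sm_continuous sU (isT : (1 + 0 <= 3)%N).
have c1 k l s : continuous (fun p => mg k l s w p) := @continuous_mgrad R X Y k l s w.
have c2 k l s : continuous (fun p => mg k l s (U 0%N 0%N) p) := @continuous_mgrad R X Y k l s (U 0%N 0%N).
have c3 k l s : continuous (fun p => mg k l s (fun q => U 0%N 0%N q - w q) p).
  exact: @continuous_mgrad R X Y k l s (fun q => U 0%N 0%N q - w q).
have t1 := macro_gradient_error hp hX hY hL nm n0 b0.
have t2 := macro_gradient_stability mX mY (double_steps hX) (double_steps hY) (fun q => U 0%N 0%N q - w q).
apply: (@le_trans _ _ (2 * SJ m XX YY (fun k l s p => (mg k l s (U 0%N 0%N) p - U 1%N 0%N p) ^+ 2) +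
  2 * SJ m XX YY (fun k l s p => mg k l s (fun q => U 0%N 0%N q - w q) p ^+ 2))).
  have d1 : cont3 (fun k l s p => (mg k l s (U 0%N 0%N) p - U 1%N 0%N p) ^+ 2).
    by move=> k l s; have c := c2 k l s; cont.
  have d2 : cont3 (fun k l s p => mg k l s (fun q => U 0%N 0%N q - w q) p ^+ 2).
    by move=> k l s; have c := c3 k l s; cont.
  have d3 : cont3 (fun k l s p => 2 * (mg k l s (U 0%N 0%N) p - U 1%N 0%N p) ^+ 2).
    by move=> k l s; have c := d1 k l s; cont.
  have d4 : cont3 (fun k l s p => 2 * mg k l s (fun q => U 0%N 0%N q - w q) p ^+ 2).
    by move=> k l s; have c := d2 k l s; cont.
  rewrite -(SJ_scale m XX YY 2 d1) -(SJ_scale m XX YY 2 d2) -(SJ_add m XX YY d3 d4).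
  apply: SJ_le => [k l s|k l s|k l s p hk hl ht].
  - by have c := c1 k l s; cont.
  - by apply: continuous_add; [exact: d3|exact: d4].
  rewrite mgrad_sub; move: (mgrad _ _ _ _ _ _ _ (U 0%N 0%N) p) (mgrad _ _ _ _ _ _ _ w p) (U 1%N 0%N p) => a b c.
  by have := sqr_ge0 (a - c + (a - b)); lra.
apply: le_trans (lerD (ler_wpM2l (ler0n R 2) t1) (ler_wpM2l (ler0n R 2) t2)) _.
by rewrite lerD2l mulrA -natrM.
Qed.

Lemma postprocessed_value w :
  SJ m XX YY (fun k l s p => (U 0%N 0%N p - mv k l s w p) ^+ 2) <=
  2 * (288 * (C * M ^+ 2)) ^+ 2 +
  576 * SJ m.*2 X Y (fun i j s p => lin (X i) (X i.+1) (Y j) (Y j.+1) s (fun q => U 0%N 0%N q - w q) p ^+ 2).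
Proof.
have cU : continuous (U 0%N 0%N) by exact: sm_continuous sU (isT : (0 + 0 <= 3)%N).
have c1 k l s : continuous (fun p => mv k l s w p) := @continuous_mval R X Y k l s w.
have c2 k l s : continuous (fun p => mv k l s (U 0%N 0%N) p) := @continuous_mval R X Y k l s (U 0%N 0%N).
have c3 k l s : continuous (fun p => mv k l s (fun q => U 0%N 0%N q - w q) p).
  exact: @continuous_mval R X Y k l s (fun q => U 0%N 0%N q - w q).
have t1 := macro_value_error hp hX hY hL.
have t2 := macro_value_stability mX mY (double_steps hX) (double_steps hY) (fun q => U 0%N 0%N q - w q).
apply: (@le_trans _ _ (2 * SJ m XX YY (fun k l s p => (mv k l s (U 0%N 0%N) p - U 0%N 0%N p) ^+ 2) +
  2 * SJ m XX YY (fun k l s p => mv k l s (fun q => U 0%N 0%N q - w q) p ^+ 2))).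
  have d1 : cont3 (fun k l s p => (mv k l s (U 0%N 0%N) p - U 0%N 0%N p) ^+ 2).
    by move=> k l s; have c := c2 k l s; cont.
  have d2 : cont3 (fun k l s p => mv k l s (fun q => U 0%N 0%N q - w q) p ^+ 2).
    by move=> k l s; have c := c3 k l s; cont.
  have d3 : cont3 (fun k l s p => 2 * (mv k l s (U 0%N 0%N) p - U 0%N 0%N p) ^+ 2).
    by move=> k l s; have c := d1 k l s; cont.
  have d4 : cont3 (fun k l s p => 2 * mv k l s (fun q => U 0%N 0%N q - w q) p ^+ 2).
    by move=> k l s; have c := d2 k l s; cont.
  rewrite -(SJ_scale m XX YY 2 d1) -(SJ_scale m XX YY 2 d2) -(SJ_add m XX YY d3 d4).
  apply: SJ_le => [k l s|k l s|k l s p hk hl ht].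
  - by have c := c1 k l s; cont.
  - by apply: continuous_add; [exact: d3|exact: d4].
  rewrite mval_sub; move: (mval _ _ _ _ _ _ _ (U 0%N 0%N) p) (mval _ _ _ _ _ _ _ w p) (U 0%N 0%N p) => a b c.
  by have := sqr_ge0 (a - c + (a - b)); lra.
apply: le_trans (lerD (ler_wpM2l (ler0n R 2) t1) (ler_wpM2l (ler0n R 2) t2)) _.
by rewrite lerD2l mulrA -natrM.
Qed.

End Abstract.
End PostprocessedError.

(** * The energy norm of the error on the macro mesh *)

Section PostprocessedNorm.
Variable R : realType.
Variables (P : problem R) (eps : R) (N : nat).
Notation X := (xpt P eps N).
Notation Y := (ypt P eps N).
Notation m := (N./2).
Notation XX := (fun k => X k.*2).
Notation YY := (fun k => Y k.*2).
Notation mg k l s v p := (mgrad (X k.*2) (X k.*2.+1) (X k.*2.+2) (Y l.*2) (Y l.*2.+1) (Y l.*2.+2) s v p).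
Notation mv k l s v p := (mval (X k.*2) (X k.*2.+1) (X k.*2.+2) (Y l.*2) (Y l.*2.+1) (Y l.*2.+2) s v p).
Notation mgy k l s v p := (mgrad (Y l.*2) (Y l.*2.+1) (Y l.*2.+2) (X k.*2) (X k.*2.+1) (X k.*2.+2) s (fun a => v (a.2, a.1)) (p.2, p.1)).

(* On the macro mesh the postprocessed function only involves nodal values of
   the finite element function, which gives continuous integrands. *)
Lemma norm_postprocessed U u uN ut : mesh m XX -> mesh m YY ->
  (forall k, (k < m)%N -> X k.*2 < X k.*2.+1) -> (forall k, (k < m)%N -> Y k.*2 < Y k.*2.+1) ->
  (forall k, (k < m)%N -> X k.*2.+2 - X k.*2.+1 = X k.*2.+1 - X k.*2) ->
  (forall k, (k < m)%N -> Y k.*2.+2 - Y k.*2.+1 = Y k.*2.+1 - Y k.*2) ->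
  0 <= eps -> 0 <= mu0 P -> sm 3 U -> (forall p, Omega_bar p -> u p = U 0%N 0%N p) ->
  postprocessing P eps N uN ut ->
  norm_eps P eps (fun p => u p - ut p) ^+ 2 =
  eps * (SJ m XX YY (fun k l s p => (U 1%N 0%N p - mg k l s uN p) ^+ 2) +
         SJ m XX YY (fun k l s p => (U 0%N 1%N p - mgy k l s uN p) ^+ 2)) +
  mu0 P * SJ m XX YY (fun k l s p => (U 0%N 0%N p - mv k l s uN p) ^+ 2).
Proof.
move=> mXX mYY sX sY eX eY e0 m0 sU hu [_ hpost]; set w := fun p => _.
have c0 := sm_continuous sU (isT : (0 + 0 <= 3)%N).
have c1 := sm_continuous sU (isT : (1 + 0 <= 3)%N).
have c2 := sm_continuous sU (isT : (0 + 1 <= 3)%N).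
have loc k l s p : (k < m)%N -> (l < m)%N -> tri_of XX YY k l s p ->
    [/\ w p = U 0%N 0%N p - mv k l s uN p, dx w p = U 1%N 0%N p - mg k l s uN p &
        dy w p = U 0%N 1%N p - mgy k l s uN p].
  move=> hk hl ht; have [q hq qE] := hpost (Ordinal hk) (Ordinal hl) s.
  have [qx [qy [d1 d2 v0 vx vy]]] := postprocessing_local (sX k hk) (sY l hl) (eX k hk) (eY l hl) hq.
  have wE p' : tri_of XX YY k l s p' -> w p' = U 0%N 0%N p' - q p'.
    move=> ht'; rewrite /w hu; last by have [a b] := tri_of_Omega mXX mYY hk hl ht'; split; apply/andP; split;
      [have /andP[] := a|have /andP[] := a|have /andP[] := b|have /andP[] := b] => *; exact: ltW.
    by rewrite qE //; exact: tri_hull.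
  have hO := tri_of_Omega mXX mYY hk hl ht; have [_ dUx dUy] := sU.
  have u1 := dUx 0%N 0%N p isT (proj1 hO); have u2 := dUy 0%N 0%N p isT (proj2 hO).
  have q1 := d1 p; have q2 := d2 p.
  split.
  - by rewrite wE // v0.
  - have dd : is_derive p.1 1 (fun t => U 0%N 0%N (t, p.2) - q (t, p.2)) (U 1%N 0%N p - qx p) by apply: is_derive_eq.
    by have [_ ->] := dx_tri (W := fun a => U 0%N 0%N a - q a) ht wE dd; rewrite vx.
  - have dd : is_derive p.2 1 (fun t => U 0%N 0%N (p.1, t) - q (p.1, t)) (U 0%N 1%N p - qy p) by apply: is_derive_eq.
    by have [_ ->] := dy_tri (W := fun a => U 0%N 0%N a - q a) ht wE dd; rewrite vy.
have ipE f (F : nat -> nat -> bool -> R * R -> R) : cont3 F ->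
    (forall k l s p, (k < m)%N -> (l < m)%N -> tri_of XX YY k l s p -> f p = F k l s p) ->
    L2norm Omega f ^+ 2 = SJ m XX YY (fun k l s p => F k l s p ^+ 2).
  move=> cF hF; rewrite /L2norm sqr_sqrtr ?ip_ge0 // /ip.
  apply: Omega_integral => // [k l s _ _|k l s p hk hl ht]; first by have c := cF k l s; cont.
  by rewrite (hF k l s p hk hl ht) -expr2.
have cm k l s : continuous (fun p => mg k l s uN p) := @continuous_mgrad R X Y k l s uN.
have cv k l s : continuous (fun p => mv k l s uN p) := @continuous_mval R X Y k l s uN.
have cy k l s : continuous (fun p => mgy k l s uN p).
  exact: continuous_swap (@continuous_mgrad R Y X l k s (fun a => uN (a.2, a.1))).
have n2 : norm_eps P eps w ^+ 2 = eps * (L2norm Omega (dx w) ^+ 2 + L2norm Omega (dy w) ^+ 2) + mu0 P * L2norm Omega w ^+ 2.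
  have h1 : H1seminorm w ^+ 2 = L2norm Omega (dx w) ^+ 2 + L2norm Omega (dy w) ^+ 2.
    by rewrite /H1seminorm sqr_sqrtr // addr_ge0 ?sqr_ge0.
  rewrite /norm_eps sqr_sqrtr h1 //; apply: addr_ge0; first by apply: mulr_ge0 => //; rewrite addr_ge0 ?sqr_ge0.
  by apply: mulr_ge0 => //; exact: sqr_ge0.
rewrite n2; congr (_ * (_ + _) + _ * _); apply: ipE => [k l s|k l s p hk hl ht].
- by have c := cm k l s; cont.
- by have [] := loc k l s p hk hl ht.
- by have c := cy k l s; cont.
- by have [] := loc k l s p hk hl ht.
- by have c := cv k l s; cont.
- by have [] := loc k l s p hk hl ht.
Qed.

End PostprocessedNorm.

(** * The postprocessing error in terms of the superclose difference *)

Section PostprocessingError.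
Variable R : realType.
Variables (P : problem R) (Cs eps : R) (N : nat).
Notation X := (xpt P eps N).
Notation Y := (ypt P eps N).
Notation SN := (SJ N X Y).
Notation gx := (gx P eps N).
Notation gy := (gy P eps N).
Notation vlin := (vlin P eps N).
Notation n := (N./2).
Notation r := (N%:R^-1 : R).
Notation L := (ln (N%:R : R)).
Notation kap := (kappa P).
Notation M := (kap * L * r).
Notation h := (Num.sqrt r).
Notation l := (Num.sqrt L).
Notation e := (Num.sqrt eps).
Notation tau := (h ^+ 5).
Notation ie := (eps^-1).
Notation Q := (rate eps N).
Hypothesis hm : mesh_parameters P eps N.
Hypotheses (be1 : 0 < beta1 P) (be2 : 0 < beta2 P) (mu_gt0 : 0 < mu0 P) (cs0 : 0 < Cs).
Variables (C : R) (DS D1 D2 D12 : nat -> nat -> R * R -> R) (u uN ut : R * R -> R).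
Hypothesis hL : layers C eps (decay (beta1 P) eps) (decay (beta2 P) eps) DS D1 D2 D12.
Notation U := (add4 DS D1 D2 D12).
Notation U0 := (U 0%N 0%N).
Hypothesis hu : forall p, Omega_bar p -> u p = U0 p.
Hypothesis hpost : postprocessing P eps N uN ut.
Notation v := (fun p => U0 p - uN p).
Notation chi := (fun p => interp N X Y u p - uN p).

Let sx := steps_x hm be1 be2.
Let sy := steps_y hm be1 be2.
Let hp := params_shishkin hm be1 be2.
Let mX := mesh_x hm be1 be2.
Let mY := mesh_y hm be1 be2.
Let N4 : (4 <= N)%N. Proof. by have [_ _ []] := hm. Qed.
Let eN : n.*2 = N.
Proof. by have [_ _ [_ k _] _ _] := hm; rewrite -[RHS](odd_double_half N) (negbTE k). Qed.
Let en : n./2.*2 = n.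
Proof. by have [_ _ [_ _ k] _ _] := hm; rewrite -[RHS](odd_double_half n) (negbTE k). Qed.
Let n2 : (0 < n./2)%N.
Proof. by rewrite -double_gt0 en half_gt0 (leq_trans _ N4). Qed.
Let n2n : (n./2 <= n)%N. Proof. by rewrite -[X in (_ <= X)%N]en -addnn leq_addr. Qed.
Let e0 : 0 < eps. Proof. by have [] := hm. Qed.
Let C0 : 0 <= C. Proof. exact: C_ge0 hL. Qed.
Let sU : sm 3 U. Proof. by have [[s0 s1 s2 s3] _ _ _ _] := hL; exact: sm_add4. Qed.

(** All three quantities only involve nodal values, and [interp] reproduces those of the solution.
    Hence the stability bounds apply to [chi], which the supercloseness estimate controls. *)
Lemma nodal_error i j s : (i < N)%N -> (j < N)%N ->
  [/\ gx v i j s = gx chi i j s, gy v i j s = gy chi i j s & forall p, vlin v i j s p = vlin chi i j s p].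
Proof.
move=> hi hj; have [i1 i2 i3] := interp_vlin u s mX mY hi hj.
have [e1 e2 e3] : [/\ gx u i j s = gx U0 i j s, gy u i j s = gy U0 i j s & vlin u i j s = vlin U0 i j s].
  apply: eq_vlin => // c d hc' hd _; apply: hu.
  have [a1 a2] : 0 <= X i <= 1 /\ 0 <= X i.+1 <= 1 by split; [exact: (mesh_itv mX (ltnW hi))|exact: (mesh_itv mX hi)].
  have [b1 b2] : 0 <= Y j <= 1 /\ 0 <= Y j.+1 <= 1 by split; [exact: (mesh_itv mY (ltnW hj))|exact: (mesh_itv mY hj)].
  by split; [case: hc' => ->|case: hd => ->].
split; first by rewrite !gx_sub i1 e1.
  by rewrite !gy_sub i2 e2.
by move=> p; rewrite !vlin_sub i3 e3.
Qed.

Definition gradient_factor (beta : R) : R :=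
  2 * (2 * 120 ^+ 2 * (2 * kap) ^+ 2 + 16 * beta^-1 * 8 ^+ 2 + 2 * 288 ^+ 2 * (2 * kap ^+ 3) ^+ 2) * C ^+ 2.

(** The three parts are compared separately with the square of the rate. In the last one the two
    factors 1/eps are cancelled by the energy weight eps and by [lam], which is of order eps ln
    N. *)
Lemma gradient_rate beta lam : 0 < beta -> 0 < lam -> Num.sqrt lam <= kap * e * l ->
  eps * (2 * (2 * 120 ^+ 2 * C ^+ 2 * M ^+ 2 + 16 * C ^+ 2 * (ie * beta^-1 * tau ^+ 2) +
       2 * 288 ^+ 2 * C ^+ 2 * ((ie * M ^+ 2) ^+ 2 * lam))) <= gradient_factor beta * Q ^+ 2.
Proof.
move=> b0 lam0 hs; have [r01 /andP[h0 h1] h2 [L0 lh'] _] := @rate_facts R N N4.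
have Lp : 0 < L by lra.
have l0 : 0 < l by rewrite sqrtr_gt0.
have l2 : l ^+ 2 = L by rewrite sqr_sqrtr // ltW.
have se0 : 0 < e by rewrite sqrtr_gt0.
have e2 : e ^+ 2 = eps by rewrite sqr_sqrtr // ltW.
have lh2 : 1 / 2 <= l ^+ 2 by rewrite l2.
have lhh : l ^+ 2 * h <= 2 by rewrite l2.
have [q1 _ q3 _ q5] := rate_bounds (ltW se0) h0 h1 l0 lh2 lhh; rewrite -/(rate eps N) in q1 q3 q5.
have [k4 _ _] := kappa_facts be1 be2; have k0 : 0 < kap by apply: lt_le_trans k4.
have ME : M = kap * l ^+ 2 * h ^+ 2 by rewrite l2 h2.
have Q0 : 0 <= Q by have := exprn_gt0 3 h0; move: q1; lra.
have z1 : eps * M ^+ 2 <= (2 * kap) ^+ 2 * Q ^+ 2.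
  have -> : eps * M ^+ 2 = (kap * (e * (l ^+ 2 * h ^+ 2))) ^+ 2 by rewrite ME -[in LHS]e2; ring.
  have -> : (2 * kap) ^+ 2 * Q ^+ 2 = (kap * (2 * Q)) ^+ 2 by ring.
  have p1 : 0 <= e * (l ^+ 2 * h ^+ 2) by apply: mulr_ge0; [exact: ltW|apply: mulr_ge0; exact: sqr_ge0].
  have kk := ltW k0; apply: lerXn2r; rewrite ?nnegrE; [exact: mulr_ge0|by apply: mulr_ge0 => //; exact: mulr_ge0|].
  exact: ler_wpM2l.
have z2 : tau ^+ 2 <= 8 ^+ 2 * Q ^+ 2.
  have -> : 8 ^+ 2 * Q ^+ 2 = (8 * Q) ^+ 2 by ring.
  have p1 : 0 <= tau by apply: exprn_ge0; exact: ltW.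
  have p2 : tau <= h ^+ 3 by apply: ler_wiXn2l => //; exact: ltW.
  apply: lerXn2r; rewrite ?nnegrE //; first exact: mulr_ge0.
  exact: le_trans p2 q1.
have z3 : eps * ((ie * M ^+ 2) ^+ 2 * lam) <= (2 * kap ^+ 3) ^+ 2 * Q ^+ 2.
  have hl : lam <= (kap * e * l) ^+ 2.
    rewrite -(sqr_sqrtr (ltW lam0)); apply: lerXn2r => //; rewrite nnegrE; first exact: sqrtr_ge0.
    by apply: le_trans hs; exact: sqrtr_ge0.
  apply: (@le_trans _ _ (eps * ((ie * M ^+ 2) ^+ 2 * (kap * e * l) ^+ 2))).
    by apply: ler_wpM2l; [exact: ltW|apply: ler_wpM2l => //; exact: sqr_ge0].
  have -> : eps * ((ie * M ^+ 2) ^+ 2 * (kap * e * l) ^+ 2) = (kap ^+ 3 * (l ^+ 5 * h ^+ 4)) ^+ 2.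
    rewrite ME; have -> : (kap * e * l) ^+ 2 = kap ^+ 2 * eps * l ^+ 2 by rewrite !exprMn e2.
    have en0 : eps != 0 by rewrite lt0r_neq0.
    by move: h l => hh ll; field.
  have -> : (2 * kap ^+ 3) ^+ 2 * Q ^+ 2 = (kap ^+ 3 * (2 * Q)) ^+ 2 by ring.
  have kk : 0 <= kap ^+ 3 by apply: exprn_ge0; exact: ltW.
  have p1 : 0 <= l ^+ 5 * h ^+ 4 by apply: mulr_ge0; apply: exprn_ge0; exact: ltW.
  apply: lerXn2r; rewrite ?nnegrE; [exact: mulr_ge0|by apply: mulr_ge0 => //; exact: mulr_ge0|].
  exact: ler_wpM2l.
have C2 : 0 <= C ^+ 2 by exact: sqr_ge0.
have ib : 0 <= beta^-1 by rewrite invr_ge0 ltW.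
have -> : eps * (2 * (2 * 120 ^+ 2 * C ^+ 2 * M ^+ 2 + 16 * C ^+ 2 * (ie * beta^-1 * tau ^+ 2) +
       2 * 288 ^+ 2 * C ^+ 2 * ((ie * M ^+ 2) ^+ 2 * lam))) =
  (2 * C ^+ 2) * (2 * 120 ^+ 2 * (eps * M ^+ 2) + 16 * beta^-1 * tau ^+ 2 * (eps * ie) +
   2 * 288 ^+ 2 * (eps * ((ie * M ^+ 2) ^+ 2 * lam))) by move: ie tau M => x y z; ring.
have -> : gradient_factor beta * Q ^+ 2 = (2 * C ^+ 2) * (2 * 120 ^+ 2 * ((2 * kap) ^+ 2 * Q ^+ 2) +
   16 * beta^-1 * (8 ^+ 2 * Q ^+ 2) + 2 * 288 ^+ 2 * ((2 * kap ^+ 3) ^+ 2 * Q ^+ 2)).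
  by rewrite /gradient_factor; move: Q => q; ring.
rewrite mulfV ?lt0r_neq0 // mulr1.
apply: ler_wpM2l; first exact: mulr_ge0.
apply: lerD; first apply: lerD.
- exact: ler_wpM2l (mulr_ge0 (ler0n R 2) (sqr_ge0 _)) _ _ z1.
- exact: ler_wpM2l (mulr_ge0 (ler0n R 16) ib) _ _ z2.
- exact: ler_wpM2l (mulr_ge0 (ler0n R 2) (sqr_ge0 _)) _ _ z3.
Qed.

Lemma value_rate : M ^+ 2 <= 4 * kap ^+ 2 * Q.
Proof.
have [r01 /andP[h0 h1] h2 [L0 lh'] _] := @rate_facts R N N4.
have Lp : 0 < L by lra.
have l0 : 0 < l by rewrite sqrtr_gt0.
have l2 : l ^+ 2 = L by rewrite sqr_sqrtr // ltW.
have lh2 : 1 / 2 <= l ^+ 2 by rewrite l2.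
have lhh : l ^+ 2 * h <= 2 by rewrite l2.
have [_ _ _ q4 _] := rate_bounds (sqrtr_ge0 eps) h0 h1 l0 lh2 lhh; rewrite -/(rate eps N) in q4.
have ME : M = kap * l ^+ 2 * h ^+ 2 by rewrite l2 h2.
have -> : M ^+ 2 = kap ^+ 2 * (l ^+ 4 * h ^+ 4) by rewrite ME; ring.
have -> : 4 * kap ^+ 2 * Q = kap ^+ 2 * (4 * Q) by ring.
by apply: ler_wpM2l => //; exact: sqr_ge0.
Qed.

Definition interpolation_constant : R :=
  gradient_factor (beta1 P) + gradient_factor (beta2 P) + 2 * mu0 P * (288 * (C * (4 * kap ^+ 2))) ^+ 2.

Lemma postprocessing_error :
  norm_eps P eps (fun p => u p - ut p) ^+ 2 <= interpolation_constant * Q ^+ 2 +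
  576 * (eps * (SN (fun i j s _ => gx chi i j s ^+ 2) + SN (fun i j s _ => gy chi i j s ^+ 2)) +
    mu0 P * SN (fun i j s p => vlin chi i j s p ^+ 2)).
Proof.
have sx' : steps n.*2 n./2.*2 eps r M tau (decay (beta1 P) eps) X by rewrite eN en; exact: sx.
have sy' : steps n.*2 n./2.*2 eps r M tau (decay (beta2 P) eps) Y by rewrite eN en; exact: sy.
have mX' : mesh n.*2 X by rewrite eN.
have mY' : mesh n.*2 Y by rewrite eN.
have [_ _ lX] := mX'; have [_ _ lY] := mY'.
have hX k : (k < n)%N -> X k.*2 < X k.*2.+1 by move=> hk; have [k1 _] := lt_doubleS hk; exact: lX.
have hY k : (k < n)%N -> Y k.*2 < Y k.*2.+1 by move=> hk; have [k1 _] := lt_doubleS hk; exact: lY.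
rewrite (norm_postprocessed (macro_mesh mX') (macro_mesh mY') hX hY (double_steps sx') (double_steps sy')
  (ltW e0) (ltW mu_gt0) sU hu hpost).
have tx := postprocessed_gradient hp sx' sy' hL n2n n2 be1 uN.
have ty := postprocessed_gradient hp sy' sx' (layers_swap hL) n2n n2 be2 (fun a => uN (a.2, a.1)).
have tv := postprocessed_value hp sx' sy' hL uN.
rewrite add4_transp in ty.
have [_ _ _ lamx1 lamy1] := hm; have [lx0 ly0] := lam_gt0 hm be1 be2.
have Xn : 1 - X n./2.*2 = lamx P eps N by rewrite en /xpt mesh_half // opprB addrCA subrr addr0.
have Yn : 1 - Y n./2.*2 = lamy P eps N by rewrite en /ypt mesh_half // opprB addrCA subrr addr0.
rewrite Xn in tx; rewrite Yn in ty; rewrite eN in tx ty tv.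
have [_ k1 k2] := kappa_facts be1 be2.
have gx0 := gradient_rate be1 lx0 (sqrt_lam_le hm be1 be2 be1 k1).
have gy0 := gradient_rate be2 ly0 (sqrt_lam_le hm be1 be2 be2 k2).
have gX : SN (fun i j s _ => gx v i j s ^+ 2) = SN (fun i j s _ => gx chi i j s ^+ 2).
  by apply: SJ_eq => i j s p hi hj _; have [-> _ _] := nodal_error s hi hj.
have gY : SN (fun i j s _ => gy v i j s ^+ 2) = SN (fun i j s _ => gy chi i j s ^+ 2).
  by apply: SJ_eq => i j s p hi hj _; have [_ -> _] := nodal_error s hi hj.
have gV : SN (fun i j s p => vlin v i j s p ^+ 2) = SN (fun i j s p => vlin chi i j s p ^+ 2).
  by apply: SJ_eq => i j s p hi hj _; have [_ _ ->] := nodal_error s hi hj.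
have c2 := sm_continuous sU (isT : (0 + 1 <= 3)%N).
(* The y derivatives are brought to the form of the x estimate with the two meshes exchanged. *)
have tyE : SN (fun i j s _ => gy v i j s ^+ 2) = SJ N Y X (fun i j s _ =>
    slope_x (Y i) (Y i.+1) (fun q => transp U 0%N 0%N q - uN (q.2, q.1)) (edge (X j) (X j.+1) s) ^+ 2).
  by rewrite SJ_swap // => i j s; cont.
rewrite -tyE gY in ty.
have yE : SJ n (fun k => X k.*2) (fun k => Y k.*2) (fun (k l : nat) (s : bool) (p : R * R) =>
   (U 0%N 1%N p - mgrad (Y l.*2) (Y l.*2.+1) (Y l.*2.+2) (X k.*2) (X k.*2.+1) (X k.*2.+2) s
     (fun a => uN (a.2, a.1)) (p.2, p.1)) ^+ 2) =
  SJ n (fun k => Y k.*2) (fun k => X k.*2) (fun (k l : nat) (s : bool) (p : R * R) =>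
   (transp U 1%N 0%N p - mgrad (Y k.*2) (Y k.*2.+1) (Y k.*2.+2) (X l.*2) (X l.*2.+1) (X l.*2.+2) s
     (fun a => uN (a.2, a.1)) p) ^+ 2).
  rewrite SJ_swap; first by apply: SJ_eq => k l s [a b].
  move=> k l s.
  have c3 : continuous (fun p : R * R => mgrad (Y l.*2) (Y l.*2.+1) (Y l.*2.+2) (X k.*2) (X k.*2.+1) (X k.*2.+2) s
     (fun a => uN (a.2, a.1)) (p.2, p.1)).
    exact: continuous_swap (@continuous_mgrad R Y X l k s (fun a => uN (a.2, a.1))).
  by cont.
rewrite yE.
have gXle : SN (fun i j s _ => gx v i j s ^+ 2) <= SN (fun i j s _ => gx chi i j s ^+ 2) by rewrite gX.
have gVle : SN (fun i j s p => vlin v i j s p ^+ 2) <= SN (fun i j s p => vlin chi i j s p ^+ 2) by rewrite gV.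
have {}tx := le_trans tx (lerD (lexx _) (ler_wpM2l (ler0n R 96) gXle)).
have {}tv := le_trans tv (lerD (lexx _) (ler_wpM2l (ler0n R 576) gVle)).
have ve : 2 * (288 * (C * M ^+ 2)) ^+ 2 <= 2 * (288 * (C * (4 * kap ^+ 2))) ^+ 2 * Q ^+ 2.
  have -> : 2 * (288 * (C * (4 * kap ^+ 2))) ^+ 2 * Q ^+ 2 = 2 * (288 * (C * (4 * kap ^+ 2 * Q))) ^+ 2.
    by move: Q kap => q k; ring.
  have M2 : 0 <= M ^+ 2 by exact: sqr_ge0.
  have w0 : 0 <= 4 * kap ^+ 2 * Q by exact: le_trans M2 value_rate.
  have p0 x : 0 <= x -> 0 <= 288 * (C * x) by move=> x0; exact: mulr_ge0 (ler0n R 288) (mulr_ge0 C0 x0).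
  apply: (ler_wpM2l (ler0n R 2)); apply: lerXn2r; [exact: p0|exact: p0|].
  exact: ler_wpM2l (ler0n R 288) _ _ (ler_wpM2l C0 value_rate).
have p1 : 0 <= SN (fun i j s _ => gx chi i j s ^+ 2) by apply: SJ_ge0 => *; exact: sqr_ge0.
have p2 : 0 <= SN (fun i j s _ => gy chi i j s ^+ 2) by apply: SJ_ge0 => *; exact: sqr_ge0.
have {tx} := ler_wpM2l (ltW e0) tx; have {ty} := ler_wpM2l (ltW e0) ty.
have {tv} := ler_wpM2l (ltW mu_gt0) tv; have {ve} := ler_wpM2l (ltW mu_gt0) ve.
have := mulr_ge0 (ltW e0) p1; have := mulr_ge0 (ltW e0) p2.
move: gx0 gy0; rewrite /interpolation_constant.
rewrite [eps * (_ + 96 * SN _)]mulrDr [eps * (_ + 96 * SN _)]mulrDr [mu0 P * (_ + 576 * _)]mulrDr.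
rewrite [eps * (96 * _)]mulrCA [eps * (96 * SN _)]mulrCA [mu0 P * (576 * _)]mulrCA.
rewrite [eps * (SJ _ _ _ _ + _)]mulrDr.
move=> t1 t2 w2 w1 t3 tv ty tx; apply: le_trans (lerD (lerD tx ty) tv) _.
move: t1 t2 t3 w1 w2; move: (eps * (2 * _)) (eps * (2 * _)) (mu0 P * (2 * (288 * (C * M ^+ 2)) ^+ 2)) => a1 a2 a3.
move: (SN (fun i j s p => vlin chi i j s p ^+ 2)) => sv.
move: (SN (fun i j s _ => gx chi i j s ^+ 2)) (SN (fun i j s _ => gy chi i j s ^+ 2)) => sa sb.
move: (288 * (C * (4 * kap ^+ 2))) (gradient_factor (beta1 P)) (gradient_factor (beta2 P)) (Q ^+ 2) => k g1 g2 q t1 t2 t3 w1 w2.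
have -> : (g1 + g2 + 2 * mu0 P * k ^+ 2) * q + 576 * (eps * (sa + sb) + mu0 P * sv) =
  g1 * q + g2 * q + mu0 P * (2 * k ^+ 2 * q) + 576 * (eps * sa) + 576 * (eps * sb) + 576 * (mu0 P * sv) by ring.
move: t1 t2 t3 w1 w2; move: (eps * sa) (eps * sb) (mu0 P * sv) (mu0 P * (2 * k ^+ 2 * q)) (g1 * q) (g2 * q) => *.
lra.
Qed.

End PostprocessingError.

(** * The rate in terms of real powers, and bounds of the coefficients *)

Section Constants.
Variable R : realType.

Lemma rateE (eps : R) (N : nat) : (4 <= N)%N -> 0 < eps ->
  rate eps N = (eps `^ (1 / 2) * N%:R^-1 + N%:R `^ (- (3 / 2))) * (ln N%:R) `^ (3 / 2).
Proof.
move=> N4 e0; have [_ /andP[h0 _] h2 [L0 _] _] := @rate_facts R N N4.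
have N0 : 0 <= N%:R :> R by exact: ler0n.
have L1 : 0 <= ln (N%:R : R) by lra.
have p32 (x : R) : 0 <= x -> x `^ (3 / 2) = Num.sqrt x ^+ 3.
  move=> x0; have -> : 3 / 2 = 2^-1 * 3%:R :> R by field.
  by rewrite powRrM powR12_sqrt // powR_mulrn // sqrtr_ge0.
rewrite powRN !p32 // div1r powR12_sqrt ?(ltW e0) // /rate h2.
by rewrite sqrtrV // exprVn.
Qed.

Lemma bounded_coefficients (f1 f2 f3 f4 : R * R -> R) :
  continuous f1 -> continuous f2 -> continuous f3 -> continuous f4 ->
  exists B, forall p, Omega_bar p -> [/\ `|f1 p| <= B, `|f2 p| <= B, `|f3 p| <= B & `|f4 p| <= B].
Proof.
move=> c1 c2 c3 c4.
have [M1 h1] := continuous_bounded_box 0 1 0 1 c1; have [M2 h2] := continuous_bounded_box 0 1 0 1 c2.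
have [M3 h3] := continuous_bounded_box 0 1 0 1 c3; have [M4 h4] := continuous_bounded_box 0 1 0 1 c4.
exists (`|M1| + `|M2| + `|M3| + `|M4|) => p [p1 p2].
have := h1 p p1 p2; have := h2 p p1 p2; have := h3 p p1 p2; have := h4 p p1 p2.
have := ler_norm M1; have := ler_norm M2; have := ler_norm M3; have := ler_norm M4.
have := normr_ge0 M1; have := normr_ge0 M2; have := normr_ge0 M3; have := normr_ge0 M4.
by split; lra.
Qed.

End Constants.

Theorem theorem4p1 (R : realType) (P : problem R) (hP : admissible P)
    (Cs : R) (hCs : coercivity_constant P Cs) (C0 : R) :
  exists C : R, forall (eps : R) (N : nat) (u uN ut : R * R -> R),
    mesh_parameters P eps N ->
    solution P eps u ->
    decomposition P C0 eps u ->
    SDFEM_solution P Cs eps N uN ->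
    postprocessing P eps N uN ut ->
    norm_eps P eps (fun p => u p - ut p) <=
      C * (eps `^ (1 / 2) * N%:R^-1 + N%:R `^ (- (3 / 2))) *
      (ln N%:R) `^ (3 / 2).
Proof.
have [[be1 be2 mu_gt0] [cc cf] _ [D1 [D2 [j1 j2 _]]]] := hP; have [cs0 hcoer] := hCs.
have hT1 := jet_sm j1; have hT2 := jet_sm j2.
have extD (b : R * R -> R) D : jet 1 b D -> ext (D 0%N 0%N) = ext b.
  by move=> [q _ _ _]; apply/funext => p; rewrite /ext q //; exact: Omega_bar_clamp.
have e1 := extD _ _ j1; have e2 := extD _ _ j2.
have cB1 : continuous (ext (b1 P)) by rewrite -e1; exact: sm_continuous hT1 (isT : (0 + 0 <= 1)%N).
have cB2 : continuous (ext (b2 P)) by rewrite -e2; exact: sm_continuous hT2 (isT : (0 + 0 <= 1)%N).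
have cC : continuous (ext (creac P)) by exact: continuous_ext.
have t1 : continuous (ext (D1 1%N 0%N)) by exact: sm_continuous hT1 (isT : (1 + 0 <= 1)%N).
have t2 : continuous (ext (D2 0%N 1%N)) by exact: sm_continuous hT2 (isT : (0 + 1 <= 1)%N).
(* The coefficient c - div b of the integrated convection term is bounded together with the data, by
   a constant fixed before eps and N. *)
have cdiv : continuous (fun p => ext (creac P) p - ext (D1 1%N 0%N) p - ext (D2 0%N 1%N) p) by cont.
have [B hB] := bounded_coefficients cB1 cB2 cC cdiv.
pose K := interpolation_constant P C0 + 576 * closeness_constant P Cs C0 B ^+ 2.
exists (Num.sqrt K) => eps N u uN ut hm [_ hf hbd] hdec huN hpost.
have [e0 _ [N4 _ _] _ _] := hm.
have [DS [F1 [F2 [F12 [hL hu]]]]] := decomposition_layers e0 hdec.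
have hB3 p : Omega_bar p -> [/\ `|ext (b1 P) p| <= B, `|ext (b2 P) p| <= B & `|ext (creac P) p| <= B].
  by move=> /hB[].
have hB1 p : Omega_bar p -> `|ext (creac P) p - ext (D1 1%N 0%N) p - ext (D2 0%N 1%N) p| <= B.
  by move=> /hB[].
have [hchi hclose] := supercloseness hm be1 be2 cs0 hL cB1 cB2 cC hB3 mu_gt0 hT1 hT2 e1 e2 hB1
  hu hf hbd huN (hcoer eps N hm).
have herr := postprocessing_error hm be1 be2 mu_gt0 hL hu hpost.
have dl0 i j : 0 <= stabilization N Cs i j.
  by rewrite /stabilization; case: ifP => // _; apply: mulr_ge0; rewrite ?invr_ge0 ?ler0n // ltW.
have nE := norm_SD_VN (mesh_x hm be1 be2) (mesh_y hm be1 be2) cB1 cB2 (ltW e0) (ltW mu_gt0) dl0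
  (fun i j s => @delta_shishkin R P eps N hm be1 be2 Cs i j s) hchi.
rewrite -mulrA -rateE //; set Q := rate eps N in hclose herr *.
have Q0 : 0 <= Q by rewrite /Q /rate; apply: mulr_ge0; [apply: addr_ge0; [apply: mulr_ge0|]|];
  rewrite ?exprn_ge0 ?sqrtr_ge0.
set nu := norm_SD _ _ _ _ _ in hclose nE.
have nu0 : 0 <= nu by exact: sqrtr_ge0.
have nu2 : nu ^+ 2 <= closeness_constant P Cs C0 B ^+ 2 * Q ^+ 2.
  rewrite -exprMn; apply: lerXn2r => //; rewrite nnegrE //.
  exact: le_trans hclose.
have nsq : norm_eps P eps (fun p => u p - ut p) ^+ 2 <= K * Q ^+ 2.
  apply: le_trans herr _.
  have -> : K * Q ^+ 2 = interpolation_constant P C0 * Q ^+ 2 + 576 * (closeness_constant P Cs C0 B ^+ 2 * Q ^+ 2).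
    by rewrite /K; move: (interpolation_constant _ _) (closeness_constant _ _ _ _) (Q ^+ 2) => a b q; ring.
  (* The energy part of [chi] is at most its full stabilized norm: the streamline part of [nE] is
     nonnegative. *)
  rewrite lerD2l; apply: (ler_wpM2l (ler0n R 576)).
  apply: le_trans nu2; rewrite nE lerDl.
  by apply: SJ_ge0 => i j s p _ _ _; apply: mulr_ge0; [exact: dl0|exact: sqr_ge0].
have n0 : 0 <= norm_eps P eps (fun p => u p - ut p) by exact: sqrtr_ge0.
rewrite -[leLHS](ger0_norm n0) -sqrtr_sqr -[Q](ger0_norm Q0) -sqrtr_sqr.
(* For negative [K] the squared error is at most 0, so the error vanishes and the bound holds
   trivially. *)
have [K0|K0] := leP 0 K; first by rewrite -sqrtrM // ler_wsqrtr.
have : norm_eps P eps (fun p => u p - ut p) ^+ 2 <= 0.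
  by apply: le_trans nsq _; apply: mulr_le0_ge0; [exact: ltW|exact: sqr_ge0].
move=> z; rewrite (_ : norm_eps P eps (fun p => u p - ut p) ^+ 2 = 0) ?sqrtr0.
  by apply: mulr_ge0; exact: sqrtr_ge0.
by apply/eqP; rewrite eq_le z sqr_ge0.
Qed.
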